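(* Consider either Case 1: $n=1$, $q>1$, $\Omega=(-1,1)$; or Case 2: $n>1$, $q=2$, $\Omega\subset\mathbb R^n$ a bounded convex open set with boundary of class $C^3$. Let $T>0$, $\Xi=\overline\Omega\times\mathbb R^n$, $n(x)$ the outward unit normal at $x\in\partial\Omega$, and $\Xi^{\rm ad}=\{(x,v)\in\Xi:\ v\cdot n(x)\le0\text{ if }x\in\partial\Omega\}$. Let $\mathcal P(\Xi)$ be the set of Borel probability measures on $\Xi$, let $F,G:\mathcal P(\Xi)\to C^0_b(\Xi;\mathbb R)$ be bounded and continuous maps (continuity with respect to narrow convergence in $\mathcal P(\Xi)$), and let $L:\Xi\times[0,T]\to\mathbb R$ be continuous and bounded. Let $\Gamma$ be the set of $\xi\in C^1([0,T];\mathbb R^n)$ with $\xi'$ absolutely continuous and $\xi(s)\in\overline\Omega$ for all $s$, a metric space with distance $\|\xi-\tilde\xi\|_{C^1([0,T];\mathbb R^n)}$; for $(x,v)\in\Xi$ let $\Gamma[x,v]=\{\xi\in\Gamma:\xi(0)=x,\xi'(0)=v\}$. Let $\mathcal P(\Gamma)$ be the set of Borel probability measures on $\Gamma$, $e_t(\xi)=(\xi(t),\xi'(t))$, $m^\mu(t)=e_t\sharp\mu$ for $\mu\in\mathcal P(\Gamma)$, and for $m_0\in\mathcal P(\Xi)$, $\mathcal P_{m_0}(\Gamma)=\{\mu\in\mathcal P(\Gamma):e_0\sharp\mu=m_0\}$. For $\mu\in\mathcal P(\Gamma)$ and $\xi\in\Gamma$ let $$J^\mu(\xi)=\int_0^T\Big(F[m^\mu(s)](\xi(s),\xi'(s))+L(\xi(s),\xi'(s),s)+\frac1q|\xi''(s)|^q\Big)ds+G[m^\mu(T)](\xi(T),\xi'(T))$$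 if $\xi\in W^{2,q}(0,T;\mathbb R^n)$ and $J^\mu(\xi)=+\infty$ otherwise, and let $\Gamma^{\mu,\rm opt}[x,v]$ be the set of $\xi\in\Gamma[x,v]\cap W^{2,q}(0,T;\mathbb R^n)$ achieving the minimum of $J^\mu$ on $\Gamma[x,v]$. Let $m_0\in\mathcal P(\Xi)$ with $m_0(\Xi\setminus\Xi^{\rm ad})=0$. Then there exists $\mu\in\mathcal P_{m_0}(\Gamma)$ such that $$\operatorname{supp}(\mu)\subset\bigcup_{(x,v)\in\operatorname{supp}(m_0)}\Gamma^{\mu,\rm opt}[x,v],$$ i.e. a relaxed constrained mean field equilibrium associated with $m_0$ exists. *)

(* Defs.v *)
From HB Require Import structures.
From mathcomp Require Import all_boot all_order all_algebra.
From mathcomp Require Import all_classical all_reals all_analysis.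
Unset Printing Implicit Defensive.
Import Order.TTheory GRing.Theory Num.Theory.
Import numFieldNormedType.Exports.
Local Open Scope classical_set_scope.
Local Open Scope ring_scope.

Section Defs.
Variables (R : realType) (n : nat).

Definition dotv (u v : 'rV[R]_n) : R := \sum_(i < n) u ord0 i * v ord0 i.
Definition enorm (u : 'rV[R]_n) : R := Num.sqrt (dotv u u).
Definition unitv (i : 'I_n) : 'rV[R]_n := delta_mx ord0 i.
Definition grad (f : 'rV[R]_n -> R) (x : 'rV[R]_n) : 'rV[R]_n :=
  \row_i ('D_(unitv i) f x).

Fixpoint Ck (k : nat) (U : set 'rV[R]_n) (f : 'rV[R]_n -> R) : Prop :=
  (forall x, U x -> {for x, continuous f}) /\
  match k with
  | 0 => True
  | k'.+1 => forall i, (forall x, U x -> derivable f x (unitv i)) /\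
                       Ck k' U (fun x => 'D_(unitv i) f x)
  end.

Definition bdry (A : set 'rV[R]_n) : set 'rV[R]_n := closure A `\` interior A.

Definition bounded_dom (A : set 'rV[R]_n) : Prop :=
  exists M : R, forall x, A x -> enorm x <= M.

Definition convex_dom (A : set 'rV[R]_n) : Prop :=
  forall x y, A x -> A y -> forall t : R, 0 <= t <= 1 -> A ((1 - t) *: x + t *: y).

Definition local_defining_fun (k : nat) (Om : set 'rV[R]_n) (x0 : 'rV[R]_n)
  (U : set 'rV[R]_n) (rho : 'rV[R]_n -> R) : Prop :=
  [/\ open U, U x0, Ck k U rho, (forall x, U x -> grad rho x != 0) &
      (forall x, U x -> (Om x <-> rho x < 0))].

Definition C3_boundary (Om : set 'rV[R]_n) : Prop :=
  forall x0, bdry Om x0 -> exists U rho, local_defining_fun 3 Om x0 U rho.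

Definition outward_unit_normal (Om : set 'rV[R]_n) (x0 nu : 'rV[R]_n) : Prop :=
  exists U rho, local_defining_fun 1 Om x0 U rho /\
    nu = (enorm (grad rho x0))^-1 *: grad rho x0.

Definition phase := ('rV[R]_n * 'rV[R]_n)%type.
Definition pdist (z w : phase) : R := enorm (z.1 - w.1) + enorm (z.2 - w.2).
Definition pball (z : phase) (e : R) : set phase := [set w | pdist z w < e].

Definition open_wrt {T : Type} (B : T -> R -> set T) : set (set T) :=
  [set A | forall x, A x -> exists2 e, 0 < e & B x e `<=` A].

Definition phaseB := g_sigma_algebraType (open_wrt pball).

Definition Xi (Om : set 'rV[R]_n) : set phaseB := [set z | closure Om z.1].
Definition Xiad (Om : set 'rV[R]_n) : set phaseB :=
  [set z | closure Om z.1 /\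
     (bdry Om z.1 -> forall nu, outward_unit_normal Om z.1 nu -> dotv z.2 nu <= 0)].

Definition I0T (T : R) : set R := `[0, T].

Definition path := R -> 'rV[R]_n.
Definition dquot (xi : path) (s : R) : R -> 'rV[R]_n :=
  fun h => h^-1 *: (xi (s + h) - xi s).
Definition Dp (T : R) (xi : path) (s : R) : 'rV[R]_n :=
  lim (dquot xi s @ within [set h | 0 <= s + h <= T] 0^').

Definition abs_cont_on (T : R) (f : R -> 'rV[R]_n) : Prop :=
  forall e : R, 0 < e -> exists2 d : R, 0 < d &
    forall s : seq (R * R),
      (forall p, p \in s -> 0 <= p.1 <= p.2 /\ p.2 <= T) ->
      (forall i j, (i < j < size s)%N ->
         (nth (0,0) s i).2 <= (nth (0,0) s j).1 \/
         (nth (0,0) s j).2 <= (nth (0,0) s i).1) ->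
      \sum_(p <- s) (p.2 - p.1) < d ->
      \sum_(p <- s) enorm (f p.2 - f p.1) < e.

Definition Gam (Om : set 'rV[R]_n) (T : R) : set path :=
  [set xi | [/\ (forall s, 0 <= s <= T ->
                  dquot xi s @ within [set h | 0 <= s + h <= T] 0^' --> Dp T xi s),
            {within `[0, T], continuous (Dp T xi)},
            abs_cont_on T (Dp T xi) &
            (forall s, 0 <= s <= T -> closure Om (xi s))]].

Definition pathball (T : R) (xi : path) (e : R) : set path :=
  [set eta | exists2 c, c < e & forall s, 0 <= s <= T ->
     enorm (xi s - eta s) + enorm (Dp T xi s - Dp T eta s) <= c].

Definition pathB (T : R) := g_sigma_algebraType (open_wrt (pathball T)).

Definition et (T t : R) (xi : path) : phaseB := (xi t, Dp T xi t).
Definition D2 (T : R) (xi : path) (s : R) : 'rV[R]_n := derive1 (Dp T xi) s.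

(* W^{2,q}(0,T) membership for an element of Gamma: xi'' in L^q(0,T) *)
Definition W2q (q T : R) (xi : path) : Prop :=
  measurable_fun (I0T T) (fun s => enorm (D2 T xi s) `^ q) /\
  (\int[lebesgue_measure]_(s in I0T T) (enorm (D2 T xi s) `^ q)%:E < +oo)%E.

Definition push (T : R) (mu : set (pathB T) -> \bar R) (t : R) : set phaseB -> \bar R :=
  fun A => mu (et T t @^-1` A).

Definition prob_Xi (Om : set 'rV[R]_n) (p : probability phaseB R) : Prop :=
  p (~` Xi Om) = 0%E.

Definition narrow_cvg (Om : set 'rV[R]_n) (ps : nat -> probability phaseB R)
  (p : probability phaseB R) : Prop :=
  forall phi : phaseB -> R,
    {within Xi Om, continuous phi} ->
    (exists C : R, forall z, Xi Om z -> `|phi z| <= C) ->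
    (fun k => (\int[ps k]_(z in Xi Om) (phi z)%:E)%E) @ \oo -->
      (\int[p]_(z in Xi Om) (phi z)%:E)%E.

(* F : P(Xi) -> C^0_b(Xi) bounded and continuous (narrow convergence on P(Xi),
   sup norm on C^0_b(Xi)); F is given on set functions, only its values on
   elements of P(Xi) matter *)
Definition bounded_continuous_map (Om : set 'rV[R]_n)
  (F : (set phaseB -> \bar R) -> phaseB -> R) : Prop :=
  [/\ exists C : R, forall p : probability phaseB R, prob_Xi Om p ->
         forall z, Xi Om z -> `|F p z| <= C,
      forall p : probability phaseB R, prob_Xi Om p -> {within Xi Om, continuous (F p)} &
      forall (ps : nat -> probability phaseB R) (p : probability phaseB R),
        (forall k, prob_Xi Om (ps k)) -> prob_Xi Om p -> narrow_cvg Om ps p ->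
        forall e : R, 0 < e -> \forall k \near \oo,
          forall z, Xi Om z -> `|F (ps k) z - F p z| < e].

Definition Jcost (q T : R) (F G : (set phaseB -> \bar R) -> phaseB -> R)
  (L : 'rV[R]_n -> 'rV[R]_n -> R -> R) (mu : set (pathB T) -> \bar R)
  (xi : path) : \bar R :=
  if `[< W2q q T xi >] then
    (\int[lebesgue_measure]_(s in I0T T)
        (F (push T mu s) (xi s, Dp T xi s) + L (xi s) (Dp T xi s) s
         + q^-1 * enorm (D2 T xi s) `^ q)%:E
     + (G (push T mu T) (xi T, Dp T xi T))%:E)%E
  else +oo%E.

Definition Gam_opt (Om : set 'rV[R]_n) (q T : R)
  (F G : (set phaseB -> \bar R) -> phaseB -> R) (L : 'rV[R]_n -> 'rV[R]_n -> R -> R)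
  (mu : set (pathB T) -> \bar R) (x v : 'rV[R]_n) : set path :=
  [set xi | [/\ Gam Om T xi, xi 0 = x, Dp T xi 0 = v, W2q q T xi &
     forall eta, Gam Om T eta -> eta 0 = x -> Dp T eta 0 = v ->
       (Jcost q T F G L mu xi <= Jcost q T F G L mu eta)%E]].

Definition supp_phase (Om : set 'rV[R]_n) (m : set phaseB -> \bar R) : set phaseB :=
  [set z | Xi Om z /\ forall e : R, 0 < e -> (0 < m (pball z e))%E].
Definition supp_path (Om : set 'rV[R]_n) (T : R) (mu : set (pathB T) -> \bar R)
  : set path :=
  [set xi | Gam Om T xi /\ forall e : R, 0 < e -> (0 < mu (pathball T xi e))%E].

End Defs.

Arguments dotv {R n}. Arguments enorm {R n}. Arguments unitv {R n}.
Arguments grad {R n}. Arguments Ck {R n}. Arguments bdry {R n}.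
Arguments bounded_dom {R n}. Arguments convex_dom {R n}.
Arguments local_defining_fun {R n}. Arguments C3_boundary {R n}.
Arguments outward_unit_normal {R n}. Arguments pdist {R n}. Arguments pball {R n}.
Arguments open_wrt {R T}. Arguments Xi {R n}. Arguments Xiad {R n}.
Arguments I0T {R}. Arguments dquot {R n}. Arguments Dp {R n}.
Arguments abs_cont_on {R n}. Arguments Gam {R n}. Arguments pathball {R n}.
Arguments et {R n}. Arguments D2 {R n}. Arguments W2q {R n}. Arguments push {R n}.
Arguments prob_Xi {R n}. Arguments narrow_cvg {R n}.
Arguments bounded_continuous_map {R n}. Arguments Jcost {R n}.
Arguments Gam_opt {R n}. Arguments supp_phase {R n}. Arguments supp_path {R n}.

(* Main.v *)
Require Import Defs.
From HB Require Import structures.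
From mathcomp Require Import all_boot all_order all_algebra.
From mathcomp Require Import all_classical all_reals all_analysis.
From mathcomp Require Import measurable_realfun.
From mathcomp Require Import ring lra.
Import Order.TTheory GRing.Theory Num.Theory.
Import numFieldNormedType.Exports.
(** A path of finite energy is a [C^1] path whose derivative has finite q-variation energy; the
   paths of energy at most [r] form a [C^1]-compact set [P_r], and an initial condition is
   admissible exactly when some [P_r] contains a path starting from it.

   Step [k]: discretise [m0] into finitely many atoms carrying finite energy paths and offer to the
   players of each atom a fine finite net of paths.  The resulting finite game has a mixed Nash
   equilibrium (Sperner, Knaster-Kuratowski-Mazurkiewicz), which is the law of a step map
   [Y_k : ]0, 1] -> Gamma].

   Compactness is obtained without Prokhorov's theorem.  The steps of [Y_k] are ordered by a real
   code of paths whose convergence forces [C^1] convergence, so that [code o Y_k] is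
   nondecreasing; minimality bounds the energy of [Y_k t] in terms of [t] alone.  Helly's
   selection theorem then makes a subsequence of [Y_k] converge outside a countable set, and [mu]
   is the law of its limit [Y].

   A path [xi] in the support of [mu] is a [C^1] limit of equilibrium paths [xi_k].  A competitor
   [eta] with the same initial condition is compared with [xi] through the recovery construction:
   follow [xi_k] up to a small good time at which it does not point outwards too much, move on a
   parabola bent inwards, and merge smoothly into [eta], all at a cost that tends to that of [eta]. *)

(** The obstacle is the lack of energy bounds. The least energy of a path starting from an
    admissible [(x, v)] is finite but not locally bounded: it blows up at interior points
    approaching the boundary with an outward velocity. The times [t] at which [Y_k t] approaches a
    path [xi] of the support may tend to 1, where the bound in terms of [t] degenerates, so [xi] is
    not known in advance to have finite energy.

    Keeping [xi_k] itself on a short interval [[0, s]] is what resolves this: the energy spent there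
    occurs on both sides of the comparison and cancels. There remains a bound of the energy of [xi]
    on [[a, T]] for every [a > 0], hence on [[0, T]]; finiteness of the energy is a conclusion,
    drawn from any competitor of finite energy.

    The energy is handled as a supremum over partitions, a form that is superadditive and
    subadditive in the interval, passes to pointwise limits and makes sense before differentiability
    is known. It is identified with the integral of [|xi''|^q] only where the cost is evaluated. *)

Set Implicit Arguments.
Unset Strict Implicit.
Local Open Scope classical_set_scope.
Local Open Scope ring_scope.

(** * Sperner's lemma and finite games *)

Section chains.
Context {V : Type}.
Implicit Types (s t : seq V) (phi : seq V -> bool) (c : seq (seq V)).

(* A sequence of vertices stands for an ordered simplex and a sequence of simplices for a chain
   modulo 2; [bdc] is the boundary and [ev phi c] the parity of the number of simplices of [c]
   satisfying [phi]. *)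
Fixpoint bdc s : seq (seq V) :=
  if s is x :: s' then s' :: map (cons x) (bdc s') else [::].

Definition ev phi c : bool := \big[addb/false]_(s <- c) phi s.

Lemma ev_cons phi s c : ev phi (s :: c) = phi s (+) ev phi c.
Proof. by rewrite /ev big_cons. Qed.

Lemma ev_nil phi : ev phi [::] = false. Proof. by rewrite /ev big_nil. Qed.

Lemma ev_map {U : Type} phi (f : seq U -> seq V) (c : seq (seq U)) :
  ev phi (map f c) = \big[addb/false]_(s <- c) phi (f s).
Proof. by rewrite /ev big_map. Qed.

Lemma ev_flatten phi (f : seq V -> seq (seq V)) c :
  ev phi (flatten (map f c)) = ev (fun s => ev phi (f s)) c.
Proof.
elim: c => [|s c IH] /=; first by rewrite !ev_nil.
by rewrite ev_cons -IH /ev big_cat.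
Qed.

Lemma ev_add phi psi c : ev (fun s => phi s (+) psi s) c = ev phi c (+) ev psi c.
Proof. by rewrite /ev big_split. Qed.

(** The coboundary of the cochain [phi] modulo 2; [evd_evd] is the relation dd = 0. *)
Definition evd phi s := ev phi (bdc s).

Lemma evd_cons phi x s : evd phi (x :: s) = phi s (+) evd (phi \o cons x) s.
Proof. by rewrite /evd /= ev_cons ev_map. Qed.

Lemma evd_evd phi s : evd (evd phi) s = false.
Proof.
elim: s phi => [|x s IH] phi; first by rewrite /evd /= ev_nil.
rewrite evd_cons /comp /=.
have -> : evd (fun t => evd phi (x :: t)) s = evd (fun t => phi t (+) evd (phi \o cons x) t) s.
  by congr (evd _ s); apply/funext => t; rewrite evd_cons.
by rewrite {2}/evd ev_add -!/(evd _ s) addbA addbb IH.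
Qed.

Lemma size_bdc s t : t \in [set u | List.In u (bdc s)] -> size t = (size s).-1.
Proof.
rewrite inE /=; elim: s t => //= x s IH t [<-//|].
move=> /(List.in_map_iff (cons x)) [u [<- us]] /=.
by rewrite (IH _ us); case: s us {IH} .
Qed.

End chains.

(** * Parity of the rainbow faces of a simplex *)

Section rainbow.

Lemma perm_iotaS k : perm_eq (k :: iota 0 k) (iota 0 k.+1).
Proof. by rewrite -[k.+1]addn1 iotaD add0n -cat1s perm_catC. Qed.


(** Deleting the entry [c] of [s] leaves a permutation of [X] exactly when [p ++ s] is one of
    [c :: X]; the prefix [p] holds the entries that the induction has already passed. *)
Lemma evd_perm_eq (p s X : seq nat) :
  evd (fun t => perm_eq (p ++ t) X) s =
  odd (count (fun c => perm_eq (p ++ s) (c :: X)) s).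
Proof.
elim: s p => [|x s IH] p; first by rewrite /evd /= ev_nil.
rewrite evd_cons /comp /=.
have -> : (fun t => perm_eq (p ++ x :: t) X) = (fun t => perm_eq (rcons p x ++ t) X).
  by apply/funext => t; rewrite cat_rcons.
rewrite IH cat_rcons oddD; congr (_ (+) _).
have -> : perm_eq (p ++ x :: s) (x :: X) = perm_eq (p ++ s) X.
  by rewrite -[x :: s]cat1s perm_catCA /= perm_cons.
by case: perm_eq.
Qed.

(** The parity count behind Sperner's lemma. If a face carries the labels [0..k-1] and the opposite
    vertex the label [c], then either [c = k] and this face is the only one of its kind, or [c < k]
    is repeated and deleting either of its two occurrences gives such a face. *)
Lemma evd_rainbow (s : seq nat) k : size s = k.+1 -> {in s, forall c, (c < k.+1)%N} ->
  evd (fun t => perm_eq t (iota 0 k)) s = perm_eq s (iota 0 k.+1).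
Proof.
move=> ss sk; have E := evd_perm_eq [::] s (iota 0 k); rewrite /= in E; rewrite {}E.
case: (boolP (has (fun c => perm_eq s (c :: iota 0 k)) s)) => [/hasP[c cs pc]|hn]; last first.
  rewrite (eqP (_ : count _ _ == 0%N)); last by rewrite eqn0Ngt -has_count.
  apply/esym/negbTE/negP => p.
  move/negP: hn; apply; apply/hasP; exists k.
    by rewrite (perm_mem p) mem_iota /= add0n.
  by rewrite (permPl p) perm_sym perm_iotaS.
have -> : count (fun c0 => perm_eq s (c0 :: iota 0 k)) s = count_mem c s.
  apply: eq_in_count => d ds /=; apply/idP/eqP => [pd|->//].
  have := perm_trans _ pc; move/(_ (d :: iota 0 k)); rewrite perm_sym => /(_ pd).
  move=> /permP /(_ (pred1 d)) /=; rewrite eqxx => /eqP.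
  by rewrite eqn_add2r; case: (c =P d) => // ->.
move/permP: (pc) => /(_ (pred1 c)) /= ->; rewrite eqxx.
rewrite count_uniq_mem ?iota_uniq// mem_iota /= add0n.
have ck := sk _ cs.
case: ltnP => kc.
  rewrite [LHS]/=; apply/esym/negbTE/negP => p.
  have h1 : count_mem c s = 2%N.
    move/permP: pc => -> /=; rewrite eqxx count_uniq_mem ?iota_uniq//.
    by rewrite mem_iota leq0n kc.
  have h2 := count_uniq_mem c (iota_uniq 0 k.+1).
  have : 2%N = (c \in iota 0 k.+1) :> nat.
    by rewrite -h1 -h2; move/permP: p => /(_ (pred1 c)).
  by case: (_ \in _).
rewrite [LHS]/=.
have ek : c = k by apply/eqP; rewrite eqn_leq -ltnS ck.
by rewrite (permPl pc) ek; apply/esym; exact: perm_iotaS.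
Qed.

End rainbow.

Lemma ler_sum_in {R : numDomainType} {I : eqType} (s : seq I) (P : pred I) (F G : I -> R) :
  (forall x, x \in s -> P x -> F x <= G x) -> \sum_(x <- s | P x) F x <= \sum_(x <- s | P x) G x.
Proof.
move=> h; rewrite big_seq_cond [leRHS]big_seq_cond; apply: ler_sum => x /andP[].
exact: h.
Qed.

(** * Iterated barycentric subdivision *)

Section subdivision.
Context {R : realType} {N : nat}.
Local Notation V := 'rV[R]_N.
Implicit Types (s t u : seq V) (phi : seq V -> bool).

Definition bary s : V := (size s)%:R^-1 *: \sum_(x <- s) x.

(* Barycentric subdivision as a cone: [Sd s = bary s * Sd (bdc s)]. *)
Fixpoint sd k s : seq (seq V) :=
  if k is k'.+1 then map (cons (bary s)) (flatten (map (sd k') (bdc s)))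
  else [:: [::]].

Definition evs k phi s := ev phi (sd k s).

Lemma evsS k phi s : evs k.+1 phi s = evd (fun t => evs k (phi \o cons (bary s)) t) s.
Proof.
rewrite /evs /= ev_map -[LHS]/(ev (phi \o cons (bary s)) _).
by rewrite ev_flatten.
Qed.

Lemma ev_ext phi psi c : (forall s, List.In s c -> phi s = psi s) -> ev phi c = ev psi c.
Proof.
elim: c => [|s c IH] h; first by rewrite !ev_nil.
rewrite !ev_cons h; last by left.
by rewrite IH// => t tc; apply: h; right.
Qed.

(** Subdivision is a chain map. The boundary of a cone is its base plus the cone over the boundary
    of the base; by induction the latter comes from a double boundary, which vanishes. *)
Lemma evs_evd k phi s : size s = k -> evs k (evd phi) s = evd (evs k.-1 phi) s.
Proof.
elim: k phi s => [|k IH] phi s ss.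
  by rewrite (size0nil ss) /evs /evd /ev /= !big_cons !big_nil.
rewrite evsS /=.
have -> : evd (fun t => evs k (evd phi \o cons (bary s)) t) s =
    evd (fun t => evs k phi t (+) evd (evs k.-1 (phi \o cons (bary s))) t) s.
  apply: ev_ext => t ts.
  rewrite -IH; last by rewrite (@size_bdc _ s) ?inE// ss.
  rewrite /evs -ev_add; apply: ev_ext => u _.
  by rewrite /comp evd_cons.
by rewrite {1}/evd ev_add -!/(evd _ s) evd_evd addbF.
Qed.

Lemma sd_size k s u : size s = k -> List.In u (sd k s) -> size u = k.
Proof.
elim: k s u => [|k IH] s u ss /=; first by case => // <-.
move=> /(List.in_map_iff (cons (bary s))) [v [<- vs]] /=; congr S.
move/List.in_concat: (vs) => _.
suff: exists2 t, List.In t (bdc s) & List.In v (sd k t).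
  by move=> [t ts]; apply: IH; rewrite (@size_bdc _ s) ?inE// ss.
elim: (bdc s) vs => //= t c IHc /(List.in_app_or _ _ _)[]; first by exists t => //; left.
by move=> /IHc[t' t'c h]; exists t' => //; right.
Qed.

Lemma in_sdS k s u : List.In u (sd k.+1 s) ->
  exists t v, [/\ List.In t (bdc s), List.In v (sd k t) & u = bary s :: v].
Proof.
move=> /(List.in_map_iff (cons (bary s))) [v [<- vs]].
suff [t ts vt] : exists2 t, List.In t (bdc s) & List.In v (sd k t) by exists t, v.
elim: (bdc s) vs => //= t c IHc /(List.in_app_or _ _ _)[]; first by exists t => //; left.
by move=> /IHc[t' t'c h]; exists t' => //; right.
Qed.

Lemma bdc_sub s t : List.In t (bdc s) -> {subset t <= s}.
Proof.
elim: s t => //= x s IH t [<- y ys|]; first by rewrite inE ys orbT.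
move=> /(List.in_map_iff (cons x)) [u [<- us]] y; rewrite !inE => /orP[->//|yu].
by rewrite (IH _ us _ yu) orbT.
Qed.

(** Vertices of a subdivision are iterated barycenters, so they inherit every property stable under
    barycenters: lying in the simplex, in a ball, or on a coordinate hyperplane. *)
Lemma sd_pred k s u (P : V -> Prop) : size s = k ->
  (forall t, t != [::] -> (forall x, x \in t -> P x) -> P (bary t)) ->
  (forall x, x \in s -> P x) -> List.In u (sd k s) -> forall x, x \in u -> P x.
Proof.
move=> + Pb; elim: k s u => [|k IH] s u ss Ps /=; first by case => // <-.
move=> /in_sdS[t [v [ts vt ->]]] x; rewrite inE => /orP[/eqP ->|].
  by apply: Pb => //; case: (s) ss.
apply: IH vt x; first by rewrite (@size_bdc _ s) ?inE// ss.
by move=> y yt; apply: Ps; exact: bdc_sub yt.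
Qed.

Definition diam_le s d := forall x y, x \in s -> y \in s -> `|x - y| <= d.

Lemma bary_sub s (y : V) : s != [::] -> bary s - y = (size s)%:R^-1 *: \sum_(x <- s) (x - y).
Proof.
move=> s0; rewrite sumrB big_const_seq count_predT iter_addr addr0 scalerBr.
rewrite -[y *+ _]scaler_nat scalerA mulVf ?scale1r//.
by rewrite pnatr_eq0 size_eq0.
Qed.

Lemma bary_ball s (y : V) r : s != [::] -> (forall x, x \in s -> `|x - y| <= r) ->
  `|bary s - y| <= r.
Proof.
move=> s0 h; rewrite bary_sub// normrZ normfV normr_nat.
have sp : (0 : R) < (size s)%:R by rewrite ltr0n lt0n size_eq0.
rewrite ler_pdivrMl//; apply: (le_trans (ler_norm_sum _ _ _)).
rewrite mulr_natl -iter_addr_0 -(count_predT s) -big_const_seq.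
by apply: ler_sum_in => x xs _; apply: h.
Qed.

(** The distance from a vertex to the barycenter averages the distances to all vertices, one of
    which is zero; this gives a factor of the form [k / (k + 1)]. [K] stays fixed while the
    induction descends to faces, whose factors are smaller. *)
Lemma sd_diam K k s u d : size s = k -> (k <= K.+1)%N -> 0 <= d -> diam_le s d ->
  List.In u (sd k s) -> diam_le u (d * (K%:R / K.+1%:R)).
Proof.
elim: k s u => [|k IH] s u ss kK d0 sD.
  by case => // <- x y.
move=> /in_sdS[t [v [ts vt ->]]].
have s0 : s != [::] by case: (s) ss.
have st : size t = k by rewrite (@size_bdc _ s) ?inE// ss.
have dt : diam_le t d by move=> x y xt yt; apply: sD; exact: (bdc_sub ts).
have h1 x : x \in s -> `|x - bary s| <= d * (K%:R / K.+1%:R).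
  move=> xs; rewrite distrC bary_sub// normrZ normfV normr_nat ss.
  rewrite ler_pdivrMl ?ltr0n//.
  have -> : \sum_(x0 <- s) (x0 - x) = \sum_(x0 <- s | x0 != x) (x0 - x).
    rewrite (bigID (fun z => z == x)) /= big1 ?add0r// => z /eqP ->.
    by rewrite subrr.
  apply: (le_trans (ler_norm_sum _ _ _)).
  apply: (@le_trans _ _ (\sum_(x0 <- s | x0 != x) d)).
    by apply: ler_sum_in => z zs _; apply: sD.
  rewrite big_const_seq iter_addr_0 -[d *+ _]mulr_natl.
  rewrite [X in _ <= X](_ : _ = (k.+1%:R * (K%:R / K.+1%:R)) * d); last by ring.
  apply: ler_wpM2r => //.
  have ck : (count (fun z => z != x) s <= k)%N.
    have := count_predC (pred1 x) s; rewrite ss => /eqP.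
    have : (0 < count (pred1 x) s)%N by rewrite -has_count has_pred1.
    rewrite (@eq_count _ (predC (pred1 x)) (fun z => z != x))//.
    by case: (count (pred1 x) s) => // c _; rewrite addSn eqSS => /eqP <-; rewrite leq_addl.
  apply: (@le_trans _ _ k%:R); first by rewrite ler_nat.
  rewrite mulrA ler_pdivlMr ?ltr0n// -!natrM ler_nat.
  by rewrite mulnS mulSn leq_add2r.
have h2 x : x \in v -> `|x - bary s| <= d * (K%:R / K.+1%:R).
  apply: (@sd_pred k t v (fun x => `|x - bary s| <= d * (K%:R / K.+1%:R))) => //.
  - by move=> t' t'0 h; apply: bary_ball.
  - by move=> z zt; apply: h1; apply: (bdc_sub ts).
move=> x y; rewrite !inE => /orP[/eqP ->|xv] /orP[/eqP ->|yv].
- by rewrite subrr normr0 !mulr_ge0// invr_ge0.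
- by rewrite distrC; apply: h2.
- exact: h2.
- by apply: (IH t v) => //; exact: ltnW.
Qed.

Fixpoint evsn m k phi : seq V -> bool := if m is m'.+1 then evs k (evsn m' k phi) else phi.

Lemma evsn_evd m k phi s : size s = k -> evsn m k (evd phi) s = evd (evsn m k.-1 phi) s.
Proof.
elim: m s => //= m IH s ss; rewrite -evs_evd//.
by apply: ev_ext => u us; apply: IH; apply: sd_size us.
Qed.

Lemma ev_true phi c : ev phi c -> exists2 u, List.In u c & phi u.
Proof.
elim: c => [|s c IH]; first by rewrite ev_nil.
rewrite ev_cons; case E : (phi s) => /=; first by exists s => //; left.
by move=> /IH[u uc pu]; exists u => //; right.
Qed.

(* [insd k m s u]: [u] is a cell, with [k] vertices, of the [m]-th subdivision of [s]. *)
Inductive insd (k : nat) : nat -> seq V -> seq V -> Prop :=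
| insd0 s : insd k 0 s s
| insdS m s t u : List.In t (sd k s) -> insd k m t u -> insd k m.+1 s u.

Lemma evsn_true m k phi s : evsn m k phi s -> exists2 u, insd k m s u & phi u.
Proof.
elim: m s => /= [|m IH] s; first by exists s => //; constructor.
by move=> /ev_true[t ts /IH[u tu pu]]; exists u => //; apply: insdS tu.
Qed.

Lemma evsn_ext m k phi psi s : (forall u, insd k m s u -> phi u = psi u) ->
  evsn m k phi s = evsn m k psi s.
Proof.
elim: m s => /= [|m IH] s h; first by apply: h; constructor.
by apply: ev_ext => t ts; apply: IH => u tu; apply: h; apply: insdS tu.
Qed.

Lemma insd_size m k s u : size s = k -> insd k m s u -> size u = k.
Proof.
move=> + H; elim: H => // {}m {}s t {}u ts _ IH ss; apply: IH; exact: sd_size ts.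
Qed.

Lemma insd_pred m k s u (P : V -> Prop) : size s = k ->
  (forall t, t != [::] -> (forall x, x \in t -> P x) -> P (bary t)) ->
  (forall x, x \in s -> P x) -> insd k m s u -> forall x, x \in u -> P x.
Proof.
move=> + Pb + H; elim: H => // {}m {}s t {}u ts _ IH ss Ps; apply: IH.
- exact: sd_size ts.
- exact: sd_pred ts.
Qed.

Lemma insd_diam m K k s u d : size s = k -> (k <= K.+1)%N -> 0 <= d -> diam_le s d ->
  insd k m s u -> diam_le u (d * (K%:R / K.+1%:R) ^+ m).
Proof.
move=> + kK + + H; elim: H d => [s0|{}m {}s t {}u ts _ IH] d ss d0 sD.
  by rewrite expr0 mulr1.
rewrite exprS mulrA; apply: IH.
- exact: sd_size ts.
- by rewrite !mulr_ge0// invr_ge0.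
- exact: sd_diam ts.
Qed.

End subdivision.

(** * Sperner's lemma *)

Section sperner.
Context {R : realType} {K : nat}.
Local Notation N := K.+1.
Local Notation V := 'rV[R]_N.

(** The flag of faces spanned by the first basis vectors, on which the induction of [sperner_odd]
    runs. *)
Definition vertices (k : nat) : seq V := [seq 'e_i | i <- take k (enum 'I_N)].

Variable (l : V -> 'I_N).
Definition rb (s : seq V) := perm_eq [seq (l x : nat) | x <- s] (iota 0 (size s)).

Definition simplex : set V := [set x | (forall i, 0 <= x ord0 i) /\ \sum_i x ord0 i = 1].

Hypothesis lsupp : forall x, simplex x -> 0 < x ord0 (l x).

Lemma bdc_map {A B : Type} (f : A -> B) s : bdc (map f s) = map (map f) (bdc s).
Proof. by elim: s => //= x s IH; rewrite IH -!map_comp. Qed.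

Lemma evd_rb s : (forall x, x \in s -> (l x < size s)%N) -> s != [::] ->
  evd rb s = rb s.
Proof.
move=> h s0; have ss : size [seq (l x : nat) | x <- s] = (size s).-1.+1.
  by rewrite size_map prednK// lt0n size_eq0.
have := evd_rainbow ss; rewrite prednK ?lt0n ?size_eq0//.
rewrite /rb => <-; last by move=> _ /mapP[x xs ->]; exact: h.
rewrite /evd bdc_map ev_map; apply: ev_ext => t ts /=.
by rewrite (@size_bdc _ s) ?inE.
Qed.

Lemma bary_coord (s : seq V) i : bary s ord0 i = (size s)%:R^-1 * \sum_(x <- s) x ord0 i.
Proof. by rewrite /bary mxE summxE. Qed.

Lemma bary_simplex (s : seq V) : s != [::] -> (forall x, x \in s -> simplex x) -> simplex (bary s).
Proof.
move=> s0 h; split=> [i|].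
  rewrite bary_coord mulr_ge0 ?invr_ge0// big_seq sumr_ge0// => x /h[+ _]; exact.
rewrite (eq_bigr (fun i => (size s)%:R^-1 * \sum_(x <- s) x ord0 i)); last first.
  by move=> i _; rewrite bary_coord.
rewrite -mulr_sumr exchange_big /= big_seq (eq_bigr (fun _ => 1)); last by move=> x /h[].
rewrite -big_seq big_const_seq count_predT iter_addr_0 mulVf//.
by rewrite pnatr_eq0 size_eq0.
Qed.

Lemma bary_zero (s : seq V) i : (forall x, x \in s -> x ord0 i = 0) -> bary s ord0 i = 0.
Proof. by move=> h; rewrite bary_coord big_seq big1 ?mulr0// => x /h. Qed.

Lemma e_simplex i : simplex ('e_i : V).
Proof.
split=> [j|]; first by rewrite mxE; case: (_ && _).
rewrite (bigD1 i)//= mxE !eqxx big1 ?addr0// => j ji.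
by rewrite mxE eqxx (negbTE ji).
Qed.

Lemma size_vertices k : (k <= N)%N -> size (vertices k) = k.
Proof. by move=> kN; rewrite size_map size_takel// size_enum_ord. Qed.

Lemma vertices_simplex k x : x \in vertices k -> simplex x.
Proof. by move=> /mapP[i _ ->]; exact: e_simplex. Qed.

Lemma take_enum_ord k (i : 'I_N) : (i \in take k (enum 'I_N)) = (i < k)%N.
Proof.
by rewrite in_take ?mem_enum// index_enum_ord.
Qed.

Lemma vertices_zero k x (i : 'I_N) : x \in vertices k -> (k <= i)%N -> x ord0 i = 0.
Proof.
move=> /mapP[j]; rewrite take_enum_ord => jk -> ki.
rewrite mxE eqxx /=; case: eqP => // ij.
by move: jk; rewrite -ij ltnNge ki.
Qed.

Lemma insd_zero m k s u i : size s = k -> (forall x, x \in s -> simplex x) ->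
  (forall x, x \in s -> x ord0 i = 0) -> insd k m s u ->
  forall x, x \in u -> simplex x /\ x ord0 i = 0.
Proof.
move=> ss h1 h2 su x xu; split.
  by move: x xu; apply: (insd_pred ss) su => //; exact: bary_simplex.
move: x xu; apply: (insd_pred (P := fun x => x ord0 i = 0) ss) su => //.
by move=> t _; exact: bary_zero.
Qed.

Lemma ev_map_rcons_false {A : Type} (phi : seq A -> bool) (c : seq (seq A)) :
  (forall t, List.In t c -> phi t = false) -> ev phi c = false.
Proof.
elim: c => [|s c IH] h; first by rewrite ev_nil.
by rewrite ev_cons h ?IH//; [move=> t tc; apply: h; right | left].
Qed.

Lemma evd_rcons {A : Type} (phi : seq A -> bool) s x :
  evd phi (rcons s x) = evd (fun t => phi (rcons t x)) s (+) phi s.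
Proof.
elim: s phi => [|y s IH] phi /=.
  by rewrite evd_cons /evd /ev /= !big_nil addbF.
by rewrite !evd_cons IH /comp /= addbA.
Qed.

(** Induction along the flag of faces. By [lsupp] the labels of a cell are below its size, so [rb]
    equals its own coboundary there and the count moves to the boundary of the face. One boundary
    face is the previous one of the flag, odd by induction; every other one lacks some [e_i] with
    [i < k], hence the label [i] that a rainbow cell would need. *)
Lemma sperner_odd m k : (k <= N)%N -> evsn m k rb (vertices k).
Proof.
elim: k => [|k IH] kN.
  have -> : vertices 0 = [::] by rewrite /vertices take0.
  by elim: m => //= m IHm; rewrite /evs /= ev_cons ev_nil IHm.
have sv := size_vertices kN.
rewrite (@evsn_ext _ _ m k.+1 rb (evd rb)); last first.
  move=> u su; have us := insd_size sv su.
  rewrite evd_rb//; last by rewrite -size_eq0 us.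
  move=> x xu; rewrite us ltnNge; apply/negP => lk.
  have [xs x0] : simplex x /\ x ord0 (l x) = 0.
    move: x xu lk => x xu lk.
    apply: (insd_zero sv _ _ su xu); first by move=> z; exact: vertices_simplex.
    by move=> z /vertices_zero; exact.
  by have := lsupp xs; rewrite x0 ltxx.
rewrite evsn_evd//=.
have kN' : (k < size (enum 'I_N))%N by rewrite size_enum_ord.
have -> : vertices k.+1 = rcons (vertices k) ('e_(Ordinal kN)).
  rewrite /vertices (take_nth ord0)// map_rcons; congr (rcons _ ('e_ _)).
  by apply: val_inj => /=; rewrite nth_enum_ord.
rewrite evd_rcons (IH (ltnW kN)) addbT.
apply/negbT/ev_map_rcons_false => t tk.
apply/negbTE/negP => /evsn_true[u tu ru].
have szt : size (rcons t 'e_(Ordinal kN)) = k.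
  rewrite size_rcons (@size_bdc _ (vertices k) t) ?inE// size_vertices ?(ltnW kN)//.
  by case: k tk {IH kN sv kN' tu ru} => //; rewrite /vertices take0.
(* some index below k is missing in t *)
have [i ik it] : exists2 i : 'I_N, (i < k)%N & forall x, x \in t -> x ord0 i = 0.
  have : List.In t (map (map (fun i => 'e_i : V)) (bdc (take k (enum 'I_N)))).
    by rewrite -bdc_map.
  move=> /List.in_map_iff[q [<- qk]].
  have sq : size q = k.-1.
    by rewrite (@size_bdc _ (take k (enum 'I_N))) ?inE// size_takel// size_enum_ord ltnW.
  have k0 : (0 < k)%N by move: szt; rewrite size_rcons => <-.
  have : ~~ all (fun i => i \in q) (take k (enum 'I_N)).
    apply/negP => /allP qa.
    have := uniq_leq_size (take_uniq k (enum_uniq 'I_N)) qa.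
    by rewrite sq size_takel ?size_enum_ord ?(ltnW kN)// -{1}(prednK k0) ltnn.
  rewrite -has_predC => /hasP[i]; rewrite take_enum_ord /= => ik iq.
  exists i => // x /mapP[j jq ->]; rewrite mxE eqxx /=; case: eqP => // ij.
  by move: iq; rewrite ij jq.
have := ru; rewrite /rb (insd_size szt tu) => pu.
have /mapP[x xu lx] : (i : nat) \in [seq (l x : nat) | x <- u].
  by rewrite (perm_mem pu) mem_iota add0n leq0n.
have [xs x0] : simplex x /\ x ord0 i = 0.
  apply: (insd_zero szt _ _ tu xu) => z; rewrite mem_rcons inE => /orP[/eqP ->|zt].
  - exact: e_simplex.
  - by apply: (@vertices_simplex k); exact: (bdc_sub tk).
  - rewrite mxE eqxx /=; case: eqP => // ij.
    by move: ik; rewrite ij /= ltnn.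
  - exact: it.
have := lsupp xs; have -> : l x = i by apply: val_inj.
by rewrite x0 ltxx.
Qed.

Lemma sperner (e : R) : 0 < e -> exists x : 'I_N -> V,
  (forall i, simplex (x i) /\ l (x i) = i) /\ forall i j, `|x i - x j| <= e.
Proof.
move=> e0.
(* The simplex has diameter at most 1 for the max norm, and each subdivision multiplies diameters by
   at most [K / K.+1]. *)
have [m hm] : exists m, 1 * (K%:R / K.+1%:R : R) ^+ m <= e.
  have : (K%:R / K.+1%:R : R) ^+ n @[n --> \oo] --> 0.
    apply: cvg_expr; rewrite ger0_norm ?divr_ge0//.
    by rewrite ltr_pdivrMr ?ltr0n// mul1r ltr_nat.
  move=> /cvgrPdist_le /(_ _ e0) [m _ /(_ m (leqnn m))].
  rewrite /= sub0r normrN => h; exists m; rewrite mul1r.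
  by apply: le_trans h; exact: ler_norm.
have /evsn_true[u su ru] := sperner_odd m (leqnn N).
have sv := size_vertices (leqnn N).
have us := insd_size sv su.
have ux i : exists2 x, x \in u & l x = i.
  have /mapP[x xu lx] : (i : nat) \in [seq (l x : nat) | x <- u].
    by rewrite (perm_mem ru) mem_iota add0n us /= ltn_ord.
  by exists x => //; apply: val_inj.
exists (fun i => sval (cid2 (ux i))); split.
  move=> i; case: cid2 => x xu lx /=; split=> //.
  move: x xu {lx}; apply: (insd_pred sv) su => //; first exact: bary_simplex.
  by move=> x; exact: vertices_simplex.
move=> i j; apply: le_trans hm.
case: cid2 => x xu _ /=; case: cid2 => y yu _ /=.
apply: (insd_diam sv _ _ _ su) => //.
move=> a b av bv; rewrite /Num.norm /= mx_normrE.
apply: bigmax_le => // -[p q] _ /=; rewrite ord1.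
have [a0 a1] := vertices_simplex av; have [b0 b1] := vertices_simplex bv.
have le1 (c : V) : simplex c -> c ord0 q <= 1.
  move=> [c0 <-]; rewrite (bigD1 q)//= lerDl sumr_ge0// => z _; exact: c0.
have := le1 a (vertices_simplex av); have := le1 b (vertices_simplex bv).
rewrite !mxE ler_norml => bq aq; have := a0 q; have := b0 q; lra.
Qed.

End sperner.

Lemma ltr_sum_strict {R : numDomainType} {I : finType} (F G : I -> R) :
  (forall i, true -> F i <= G i) -> (exists2 i, true & F i < G i) ->
  \sum_i F i < \sum_i G i.
Proof.
move=> h [i _ hi]; rewrite (bigD1 i)//= [ltRHS](bigD1 i)//= ltr_leD//.
by apply: ler_sum => j _; exact: h.
Qed.

(** * Equilibria on one simplex *)

Section nash.
Context {R : realType} {K : nat}.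
Local Notation N := K.+1.
Local Notation V := 'rV[R]_N.
Local Notation simplex := (@simplex R K).

Variable c : 'I_N -> V -> R.
Hypothesis cc : forall i x, simplex x -> forall e, 0 < e -> exists2 d, 0 < d &
  forall y, simplex y -> `|x - y| < d -> `|c i x - c i y| < e.

Let cbar (x : V) := \sum_j x ord0 j * c j x.

(** The Knaster-Kuratowski-Mazurkiewicz labelling: a strategy in use that costs at least the
    average. One exists at every point of the simplex, where the default [ord0] is therefore never
    taken. *)
Let lab (x : V) : 'I_N :=
  if [pick i | (0 < x ord0 i) && (cbar x <= c i x)] is Some i then i else ord0.

Let labP x : simplex x -> 0 < x ord0 (lab x) /\ cbar x <= c (lab x) x.
Proof.
move=> [x0 x1]; rewrite /lab; case: pickP => [i /andP[]//|h]; exfalso.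
have h' i : 0 < x ord0 i -> c i x < cbar x.
  by move=> xi; rewrite ltNge; apply/negP => hc; have := h i; rewrite xi hc.
have : cbar x < \sum_j x ord0 j * cbar x.
  have [i xi] : exists i, 0 < x ord0 i.
    apply: contrapT => /forallNP hn.
    have : \sum_i x ord0 i <= 0.
      by apply: sumr_le0 => i _; rewrite leNgt; apply/negP; exact: hn.
    by rewrite x1 leNgt ltr01.
  rewrite {1}/cbar; apply: ltr_sum_strict => [j _|].
    have := x0 j; rewrite le_eqVlt => /orP[/eqP <-|xj]; first by rewrite !mul0r.
    by rewrite ler_pM2l// ltW// h'.
  by exists i => //; rewrite ltr_pM2l// h'.
by rewrite -mulr_suml x1 mul1r ltxx.
Qed.

(** Cells carrying all labels shrink to a point [x] at which every strategy costs at least [cbar x].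
    Since [cbar x] averages the costs with the weights [x], the strategies in use cost exactly
    [cbar x]. *)
Lemma nash_simplex : exists2 x, simplex x & forall i j, 0 < x ord0 i -> c i x <= c j x.
Proof.
have /choice[X HX] : forall m : nat, exists X : 'I_N -> V,
    (forall i, simplex (X i) /\ lab (X i) = i) /\
    forall i j, `|X i - X j| <= m.+1%:R^-1.
  move=> m.
  apply: (@sperner R K lab) => //; by move=> x /labP[].
have cB : compact [set v : V | forall i, `[0 : R, 1]%classic (v ord0 i)].
  by apply: (@rV_compact _ _ (fun=> `[0 : R, 1]%classic)) => i; exact: segment_compact.
have sB x : simplex x -> forall i, `[0 : R, 1]%classic (x ord0 i).
  move=> [x0 x1] i; rewrite /= in_itv /= x0 /= -x1 (bigD1 i)//= lerDl.
  by rewrite sumr_ge0// => j _; exact: x0.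
have [x [Bx clx]] := cB ((fun m => X m ord0) @ \oo) _ (filterS (fun m _ => sB _ (proj1 ((HX m).1 ord0))) (@filterT _ (\oo)%classic _)).
have near d M : 0 < d -> exists2 m, (M <= m)%N & `|x - X m ord0| < d.
  move=> d0.
  have [||y []] := clx [set y | exists2 m, (M <= m)%N & y = X m ord0] (ball x d).
  - by exists M => // m /= Mm; exists m.
  - exact: nbhsx_ballx.
  - by move=> [m Mm ->]; rewrite -ball_normE /= => h; exists m.
have coord (v : V) i : `|v ord0 i| <= `|v|.
  by rewrite [leRHS]mx_normrE; apply: (le_bigmax _ (fun ij => `|v ij.1 ij.2|) (ord0, i)).
have sx : simplex x.
  split=> [i|]; first by have := Bx i; rewrite /= in_itv => /andP[].
  apply/eqP; rewrite -subr_eq0 -normr_le0; apply/ler_addgt0Pl => e e0; rewrite addr0.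
  have [|m _ hm] := near (e / N%:R) 0%N; first by rewrite divr_gt0.
  have [[_ s1] _] := (HX m).1 ord0.
  rewrite -s1 -sumrB; apply: le_trans (ler_norm_sum _ _ _) _.
  apply: (@le_trans _ _ (\sum_(i < N) (e / N%:R))).
    apply: ler_sum => i _; apply: le_trans (ltW hm).
    by have := coord (x - X m ord0) i; rewrite !mxE.
  by rewrite sumr_const card_ord -[_ *+ N]mulr_natr divfK// pnatr_eq0.
exists x => // i j xi.
have key k : cbar x <= c k x.
  rewrite leNgt; apply/negP => lk.
  pose e := (cbar x - c k x) / 4; have e0 : 0 < e by rewrite divr_gt0// subr_gt0.
  pose S := \sum_j `|c j x|.
  have S0 : 0 <= S by exact: sumr_ge0.
  pose e1 := Num.min 1 (e / (N%:R * (S + 2))).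
  have e10 : 0 < e1 by rewrite lt_min ltr01 divr_gt0// mulr_gt0// ltr_wpDl.
  have /choice[d dP] : forall j, exists d, 0 < d /\
      forall y, simplex y -> `|x - y| < d -> `|c j x - c j y| < e1.
    move=> j0; by have [d0 d00 h] := cc j0 sx e10; exists d0.
  pose D := \big[Num.min/e1]_j d j.
  have D0 : 0 < D by apply: lt_bigmin => // j0 _; have [] := dP j0.
  have Dd j0 : D <= d j0 by exact: bigmin_le.
  have De : D <= e1 by exact: bigmin_le_id.
  (* [m] is so large that [m.+1%:R^-1 <= D / 2], which puts the vertex labelled [k] within [D] of
     [x]. *)
  have [|m hm hx] := near (D / 2) (Num.bound (2 / D)); first by rewrite divr_gt0.
  have [[sy ly] hy] := ((HX m).1 k, (HX m).2 ord0 k).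
  set y := X m k in sy ly hy.
  have xy : `|x - y| < D.
    rewrite -(subrKA (X m ord0)); apply: le_lt_trans (ler_normD _ _) _.
    rewrite (splitr D) ltr_leD//; apply: le_trans hy _.
    rewrite -[leRHS]invrK invf_div lef_pV2 ?posrE ?divr_gt0//.
    apply/ltW/(lt_le_trans (archi_boundP _)); first by rewrite divr_ge0// ltW.
    by rewrite ler_nat; apply: leq_trans hm _.
  have [_] := labP sy; rewrite ly.
  have ck : c k y < c k x + e.
    have := (dP k).2 y sy (lt_le_trans xy (Dd k)).
    rewrite ltr_distlC => /andP[_ h]; apply: (lt_le_trans h); rewrite lerD2l.
    rewrite ge_min; apply/orP; right.
    rewrite ler_pdivrMr; last by rewrite mulr_gt0// ltr_wpDl.
    rewrite ler_peMr ?(ltW e0)//.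
    have : (1 : R) <= N%:R by rewrite ler1n.
    nra.
  have cb : `|cbar x - cbar y| <= e.
    rewrite /cbar -sumrB; apply: le_trans (ler_norm_sum _ _ _) _.
    apply: (@le_trans _ _ (\sum_(j0 < N) (e / N%:R))); last first.
      by rewrite sumr_const card_ord -[_ *+ N]mulr_natr divfK// pnatr_eq0.
    apply: ler_sum => j0 _.
    have h1 : `|x ord0 j0 - y ord0 j0| <= e1.
      apply: le_trans De; apply: le_trans (ltW xy).
      by have := coord (x - y) j0; rewrite !mxE.
    have h2 := (dP j0).2 y sy (lt_le_trans xy (Dd j0)).
    have h3 : `|c j0 x| <= S by rewrite /S (bigD1 j0)//= lerDl sumr_ge0.
    have y1 : `|y ord0 j0| <= 1.
      by have := sB _ sy j0; rewrite /= in_itv /= => /andP[? ?]; rewrite ger0_norm.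
    have -> : x ord0 j0 * c j0 x - y ord0 j0 * c j0 y =
      (x ord0 j0 - y ord0 j0) * c j0 x + y ord0 j0 * (c j0 x - c j0 y) by ring.
    apply: le_trans (ler_normD _ _) _; rewrite !normrM.
    apply: (@le_trans _ _ (e1 * S + 1 * e1)).
      by apply: lerD; apply: ler_pM => //; exact: ltW.
    have h4 : e1 * (N%:R * (S + 2)) <= e.
      by rewrite -ler_pdivlMr ?mulr_gt0 ?ltr_wpDl// ge_min lexx orbT.
    rewrite ler_pdivlMr ?ltr0n//; apply: le_trans h4.
    have : 0 <= e1 * N%:R by rewrite mulr_ge0// ltW.
    lra.
  move: cb; rewrite ler_distl => /andP[h1 h2].
  have : cbar x - c k x = 4 * e by rewrite /e mulrC divfK// pnatr_eq0.
  have := e0; lra.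
suff -> : c i x = cbar x by exact: key.
apply/eqP; rewrite eq_le key andbT leNgt; apply/negP => h.
have : cbar x < cbar x.
  have [x0 x1] := sx.
  rewrite -{1}[cbar x]mul1r -x1 mulr_suml {2}/cbar; apply: ltr_sum_strict => [k _|].
    by rewrite ler_wpM2l.
  by exists i => //; rewrite ltr_pM2l.
by rewrite ltxx.
Qed.

End nash.

(** * Games with finitely many weighted players *)

Section game.
Context {R : realType} {M N : nat}.
Variables (tau : 'I_N -> 'I_M) (w : 'I_M -> R) (dflt : 'I_M -> 'I_N).
Hypotheses (taud : forall j, tau (dflt j) = j) (w0 : forall j, 0 <= w j).

Definition feasible (y : 'rV[R]_N) :=
  (forall i, 0 <= y ord0 i) /\ forall j, \sum_(i | tau i == j) y ord0 i = w j.

Variable c : 'I_N -> 'rV[R]_N -> R.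
Hypothesis cc : forall i x, feasible x -> forall e, 0 < e -> exists2 d, 0 < d &
  forall y, feasible y -> `|x - y| < d -> `|c i x - c i y| < e.

(** Mixing over whole pure profiles replaces the product of the strategy simplices by a single
    simplex, to which [nash_simplex] applies. A profile is an arbitrary function; [ch] repairs a
    choice outside the strategies of player [j] by [dflt j]. *)
Let prof := {ffun 'I_M -> 'I_N}.
Let ch (s : prof) j : 'I_N := if tau (s j) == j then s j else dflt j.
Let tau_ch s j : tau (ch s j) = j.
Proof. by rewrite /ch; case: ifPn => [/eqP//|_]. Qed.

Let K := #|prof|.-1.
Let KE : K.+1 = #|prof|.
Proof. by rewrite /K prednK//; apply/card_gt0P; exists [ffun j => dflt j]. Qed.

Let pf (k : 'I_K.+1) : prof := enum_val (cast_ord KE k).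
Let kf (s : prof) : 'I_K.+1 := cast_ord (esym KE) (enum_rank s).
Let kfK s : pf (kf s) = s.
Proof. by rewrite /pf /kf cast_ordKV enum_rankK. Qed.

Let mix (x : 'rV[R]_K.+1) : 'rV[R]_N :=
  \row_i \sum_k x ord0 k * \sum_j (w j * (ch (pf k) j == i)%:R).

Let mix_feasible x : simplex x -> feasible (mix x).
Proof.
move=> [x0 x1]; split=> [i|j].
  rewrite mxE sumr_ge0// => k _; rewrite mulr_ge0// sumr_ge0// => j _.
  by rewrite mulr_ge0.
under eq_bigr do rewrite mxE.
have E : w j = \sum_k x ord0 k * w j by rewrite -mulr_suml x1 mul1r.
rewrite exchange_big /= [RHS]E {E}; apply: eq_bigr => k _.
rewrite -mulr_sumr; congr (_ * _); rewrite exchange_big /= (bigD1 j)//=.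
rewrite [X in _ + X]big1 ?addr0 => [|j' jj']; last first.
  rewrite big1// => i /eqP ij; case: eqP => [ei|]; last by rewrite mulr0.
  by move: jj'; rewrite -ij -ei tau_ch eqxx.
rewrite -mulr_sumr (bigD1 (ch (pf k) j))/= ?tau_ch// eqxx.
rewrite [X in _ + X]big1 ?addr0 ?mulr1// => i /andP[_ /negbTE].
by rewrite eq_sym => ->.
Qed.

Let W := \sum_j w j.

Let mix_lip (x y : 'rV[R]_K.+1) : `|mix x - mix y| <= `|x - y| * (K.+1%:R * W).
Proof.
have coord (v : 'rV[R]_K.+1) i : `|v ord0 i| <= `|v|.
  by rewrite [leRHS]mx_normrE; apply: (le_bigmax _ (fun ij => `|v ij.1 ij.2|) (ord0, i)).
have W0 : 0 <= W by rewrite sumr_ge0.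
rewrite [leLHS]mx_normrE; apply: bigmax_le => [|[p i] _ /=].
  by rewrite !mulr_ge0.
rewrite ord1 !mxE -sumrB; apply: le_trans (ler_norm_sum _ _ _) _.
apply: (@le_trans _ _ (\sum_(k < K.+1) (`|x - y| * W))); last first.
  by rewrite sumr_const card_ord -[_ *+ K.+1]mulr_natr -mulrA [_%:R * _]mulrC.
apply: ler_sum => k _; rewrite -mulrBl normrM ler_pM//.
  by have := coord (x - y) k; rewrite !mxE.
rewrite ger0_norm; last by rewrite sumr_ge0// => j _; rewrite mulr_ge0.
by apply: ler_sum => j _; rewrite ler_piMr//; case: eqP.
Qed.

Let C (k : 'I_K.+1) x := \sum_j w j * c (ch (pf k) j) (mix x).

(** The cost of a profile is a sum over the players, so comparing a profile of positive weight with
    the one in which a single player deviates isolates the cost of that player. *)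
Lemma game_equilibrium : exists2 y, feasible y &
  forall i i', tau i = tau i' -> 0 < y ord0 i -> c i y <= c i' y.
Proof.
have [|x sx hx] := @nash_simplex R K C.
  move=> k x sx e e0.
  have W0 : 0 <= W by rewrite sumr_ge0.
  pose e1 := e / (W + 1); have e10 : 0 < e1 by rewrite divr_gt0// ltr_wpDl.
  have /choice[d dP] : forall j, exists d, 0 < d /\
      forall y, feasible y -> `|mix x - y| < d -> `|c (ch (pf k) j) (mix x) - c (ch (pf k) j) y| < e1.
    by move=> j; have [d d0 h] := cc (ch (pf k) j) (mix_feasible sx) e10; exists d.
  pose D := \big[Num.min/1]_j d j.
  have D0 : 0 < D by apply: lt_bigmin => // j0 _; have [] := dP j0.
  have Dd j0 : D <= d j0 by exact: bigmin_le.
  exists (D / (K.+1%:R * W + 1)); first by rewrite divr_gt0// ltr_wpDl// mulr_ge0.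
  move=> y sy xy.
  have mxy : `|mix x - mix y| < D.
    apply: le_lt_trans (mix_lip _ _) _.
    move: xy; rewrite ltr_pdivlMr; last by rewrite ltr_wpDl// mulr_ge0.
    by apply: le_lt_trans; rewrite ler_wpM2l// lerDl.
  rewrite /C -sumrB; apply: le_lt_trans (ler_norm_sum _ _ _) _.
  apply: (@le_lt_trans _ _ (\sum_j w j * e1)).
    apply: ler_sum => j _; rewrite -mulrBr normrM ger0_norm// ler_wpM2l//.
    by apply/ltW/(dP j).2; [exact: mix_feasible|exact: lt_le_trans (Dd j)].
  by rewrite -mulr_suml -/W mulrC -mulrA gtr_pMr// mulrC ltr_pdivrMr ?ltr_wpDl// mul1r ltrDl.
exists (mix x); first exact: mix_feasible.
move=> i i' ii'; rewrite mxE => yi.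
have [k xk [j wj ij]] : exists2 k, 0 < x ord0 k & exists2 j, 0 < w j & ch (pf k) j = i.
  apply: contrapT => hn; move: yi; rewrite ltNge => /negP; apply.
  apply: sumr_le0 => k _; have := (sx.1 k); rewrite le_eqVlt => /orP[/eqP <-|xk].
    by rewrite mul0r.
  rewrite mulr_ge0_le0 ?(ltW xk)//; apply: sumr_le0 => j _.
  have := w0 j; rewrite le_eqVlt => /orP[/eqP <-|wj]; first by rewrite mul0r.
  case: eqP => [ij|]; last by rewrite mulr0.
  by exfalso; apply: hn; exists k => //; exists j.
pose s' : prof := [ffun a => if a == j then i' else ch (pf k) a].
have := hx k (kf s') xk; rewrite /C (bigD1 j)//= [leRHS](bigD1 j)//= ij.
have -> : ch (pf (kf s')) j = i'.
  by rewrite kfK /ch ffunE eqxx -ii' -ij tau_ch eqxx.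
rewrite [X in _ <= _ + X](eq_bigr (fun a => w a * c (ch (pf k) a) (mix x))).
  by rewrite lerD2r ler_pM2l.
by move=> a aj; rewrite kfK {1}/ch ffunE (negbTE aj) tau_ch eqxx.
Qed.

End game.

(** * Helly's selection theorem *)

Section diagonal.
Context {R : realType}.

Lemma increasing_ge (phi : nat -> nat) : (forall k, (phi k < phi k.+1)%N) -> forall k, (k <= phi k)%N.
Proof. by move=> h; elim=> // k IH; apply: leq_ltn_trans IH (h k). Qed.

Lemma cvgn_bound (u : nat -> R) (l : R) (n : nat -> nat) :
  (forall k, `|u k - l| <= (n k).+1%:R^-1) -> (forall k, (k <= n k)%N) -> u @ \oo --> l.
Proof.
move=> h hn; apply/cvgrPdist_le => e e0; exists (Num.bound e^-1) => // k /= kb.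
rewrite distrC; apply: (le_trans (h k)); rewrite -[leRHS]invrK lef_pV2 ?posrE ?invr_gt0//.
apply/ltW/(lt_le_trans (archi_boundP _)); first by rewrite invr_ge0 ltW.
by rewrite ler_nat (leq_trans kb)// (leq_trans (hn k)).
Qed.

(* Cantor diagonal argument, via compactness of a countable product of segments *)
Lemma diagonal_extraction (a : nat -> nat -> R) (M : nat -> R) :
  (forall j k, `|a j k| <= M j) ->
  exists2 phi : nat -> nat, (forall k, (phi k < phi k.+1)%N) &
    forall j, cvgn (fun k => a j (phi k)).
Proof.
move=> aM.
have cA : compact [set f : prod_topology (fun=> R : topologicalType) | forall j : nat, `[- M j, M j]%classic (f j)].
  by apply: (@tychonoff nat (fun=> R) (fun j => `[- M j, M j]%classic)) => j; exact: segment_compact.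
pose X k : prod_topology (fun=> R : topologicalType) := (fun j : nat => a j k).
have [|p [Ap clp]] := cA (X @ \oo) _.
  by exists 0%N => // k _ j; move: (aM j k); rewrite ler_norml => h; rewrite /= in_itv; exact: h.
have near (J : nat) e K : 0 < e -> exists2 k, (K <= k)%N & forall j, (j < J)%N -> `|a j k - p j| < e.
  move=> e0.
  have nb : nbhs p [set f : prod_topology (fun=> R : topologicalType) | forall j, (j < J)%N -> `|f j - p j| < e].
    elim: J => [|J IH]; first by apply: filterE => f j; rewrite ltn0.
    have h1 : nbhs p [set f : prod_topology (fun=> R : topologicalType) | `|f J - p J| < e].
      have := @proj_continuous nat (fun=> R : topologicalType) J p.
      have hb : nbhs (proj J p) (ball (p J) e) by exact: nbhsx_ballx.
      move=> /(_ _ hb).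
      move=> H; have H' : nbhs p (proj J @^-1` ball (p J) e) := H.
      apply: filterS H' => f hf.
      have hf' : ball (p J) e (f J) := hf.
      by move: hf'; rewrite -ball_normE /ball_ /= distrC.
    near=> f; move=> j; rewrite ltnS leq_eqVlt => /orP[/eqP ->|].
      by near: f.
    by move: j; near: f.
  have [|f [[k Kk <-] h]] := clp [set f | exists2 k, (K <= k)%N & X k = f] _ _ nb.
    by exists K => // k /= Kk; exists k.
  by exists k.
have /choice[nx nxP] : forall Jk : nat * nat, exists k, (Jk.2 < k)%N /\
    forall j, (j < Jk.1)%N -> `|a j k - p j| < Jk.1.+1%:R^-1.
  move=> [J K]; have [|k Kk h] := near J (J.+1%:R^-1) K.+1; first by rewrite invr_gt0.
  by exists k.
(* The term of index [k.+1] is close to the cluster point in the coordinates below [k.+1], so each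
   coordinate is controlled from some index on. *)
pose phi := fix phi k := if k is k'.+1 then nx (k'.+1, phi k') else nx (0%N, 0%N).
have phiS k : (phi k < phi k.+1)%N by have [] := nxP (k.+1, phi k).
exists phi => // j; apply/cvg_ex; exists (p j).
rewrite -(cvg_shiftn j.+1).
apply: (@cvgn_bound _ _ (fun k => (k + j.+1)%N)) => k; last exact: leq_addr.
rewrite /= addnS; have [_ /(_ j)] := nxP ((k + j).+1, phi (k + j)%N).
by rewrite /= ltnS leq_addl => /(_ isT) /ltW.
Unshelve. all: by end_near. Qed.

End diagonal.

Section helly.
Context {R : realType}.
Local Notation rr := (@ratr R).

(** Diagonal extraction gives limits [V] at the rationals, and monotonicity squeezes the values at
    every [t] across which [V] does not jump. The bound may depend on [t] and degenerate at the ends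
    of the interval, as it does in the application. *)
Lemma helly (U : nat -> R -> R) :
  (forall k s t, 0 < s -> s <= t -> t < 1 -> U k s <= U k t) ->
  (forall t, 0 < t < 1 -> exists B, forall k, `|U k t| <= B) ->
  exists phi : nat -> nat, [/\ forall k, (phi k < phi k.+1)%N &
    exists2 D : set R, countable D &
      forall t, 0 < t < 1 -> ~ D t -> cvgn (fun k => U (phi k) t)].
Proof.
move=> Um UB.
pose q (j : nat) : R := if (unpickle j : option rat) is Some r then rr r else 0.
pose a j k := if 0 < q j < 1 then U k (q j) else 0.
have /choice[M aM] : forall j, exists B, forall k, `|a j k| <= B.
  move=> j; rewrite /a; case: (0 < q j < 1) (UB (q j)) => [h|_]; first exact: h.
  by exists 0 => k; rewrite normr0.
have [phi phiS phic] := diagonal_extraction aM.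
exists phi; split=> //.
pose V (r : rat) : R := limn (fun k => U (phi k) (rr r)).
have Vc r : 0 < rr r < (1 : R) -> U (phi k) (rr r) @[k --> \oo] --> V r.
  move=> r01; have := phic (pickle r); rewrite /a /q pickleK r01.
  exact.
have Vm r s : 0 < rr r < (1 : R) -> 0 < rr s < (1 : R) -> (r <= s)%R -> V r <= V s.
  move=> r01 s01 rs; apply: (ler_cvg_to (Vc _ r01) (Vc _ s01)); apply: filterE => k.
  by case/andP: r01 => r0 _; case/andP: s01 => _ s1; apply: Um => //; rewrite ler_rat.
pose good (t : R) := forall e, 0 < e -> exists r s, [/\ 0 < rr r, rr r < t, t < rr s, rr s < 1 & V s - V r < e].
pose D := [set t : R | 0 < t < 1 /\ ~ good t].
exists D; last first.
  move=> t t01 nD; have gt : good t by apply: contrapT => h; exact: nD.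
  apply: cauchy_cvg; apply/cauchy_ballP => e e0.
  have [|r [s [r0 rt ts s1 h]]] := gt (e / 4); first by rewrite divr_gt0.
  have r01 : 0 < rr r < (1 : R) by rewrite r0 (lt_trans rt)// (lt_trans ts).
  have s01 : 0 < rr s < (1 : R) by rewrite s1 andbT (lt_trans r0)// (lt_trans rt).
  have e4 : 0 < e / 4 by rewrite divr_gt0.
  have /cvgrPdist_lt/(_ _ e4) Vr := Vc _ r01; have /cvgrPdist_lt/(_ _ e4) Vs := Vc _ s01.
  have N : \forall k \near \oo, `|V r - U (phi k) t| < e / 2.
    near=> k.
    have h1 : `|V r - U (phi k) (rr r)| < e / 4 by near: k.
    have h2 : `|V s - U (phi k) (rr s)| < e / 4 by near: k.
    have h3 : U (phi k) (rr r) <= U (phi k) t by apply: Um => //; [exact: ltW|exact: lt_trans ts s1].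
    have h4 : U (phi k) t <= U (phi k) (rr s) by apply: Um => //; [exact: lt_trans rt|exact: ltW].
    move: h1 h2; rewrite !ltr_norml => /andP[? ?] /andP[? ?]; apply/andP; split; lra.
  exists ([set x | `|V r - x| < e / 2], [set x | `|V r - x| < e / 2]) => //=.
  move=> [x y] [/= hx hy]; rewrite -ball_normE /=.
  by rewrite -(subrKA (V r)) (le_lt_trans (ler_normD _ _))// (splitr e) ltrD// distrC.
(* the bad points carry pairwise disjoint jump intervals *)
have jump t : D t -> exists c : rat, forall r s, 0 < rr r -> rr r < t -> t < rr s -> rr s < (1 : R) ->
    V r < rr c < V s.
  move=> [/andP[t0 t1]] /existsNP[e] /not_implyP[e0 h].
  have h' r s : 0 < rr r -> rr r < t -> t < rr s -> rr s < 1 -> e <= V s - V r.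
    move=> r0 rt ts s1; rewrite leNgt; apply/negP => hlt; apply: h.
    by exists r, s.
  have [r0 /andP[r00 r0t]] : exists r : rat, 0 < rr r < t.
    by have [r] := rat_in_itvoo t0; rewrite in_itv => ?; exists r.
  have [s0 /andP[s0t s01]] : exists s : rat, t < rr s < 1.
    by have [r] := rat_in_itvoo t1; rewrite in_itv => ?; exists r.
  pose S := [set V r | r in [set r : rat | 0 < rr r < t]].
  have Sub : ubound S (V s0).
    move=> _ [r /andP[? ?] <-]; have : e <= V s0 - V r by apply: h'.
    by move: e0; lra.
  have hS : has_sup S by split; [exists (V r0), r0 => //; apply/andP|exists (V s0)].
  (* The values of [V] to the right of [t] are at least [sup S + e], so this rational lies strictly
     inside the jump. *)
  have [c] : exists c : rat, sup S < rr c < sup S + e / 2.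
    have [|c] := @rat_in_itvoo R (sup S) (sup S + e / 2); first by rewrite ltrDl divr_gt0.
    by rewrite in_itv => ?; exists c.
  move=> /andP[c1 c2]; exists c => r s hr0 hrt hts hs1; apply/andP; split.
    by apply: le_lt_trans c1; apply: sup_ubound; [case: hS|exists r => //; apply/andP].
  have : sup S <= V s - e.
    apply: ge_sup; first by case: hS.
    move=> _ [r' /andP[? ?] <-]; have : e <= V s - V r' by apply: h'.
    by lra.
  lra.
pose f t : rat := if pselect (D t) is left Dt then sval (cid (jump t Dt)) else 0.
have fP t : D t -> forall r s, 0 < rr r -> rr r < t -> t < rr s -> rr s < (1 : R) ->
    V r < rr (f t) < V s.
  by move=> Dt; rewrite /f; case: pselect => // Dt'; exact: (svalP (cid (jump t Dt'))).
have finj t t' : D t -> D t' -> t < t' -> rr (f t) < rr (f t').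
  move=> Dt Dt' tt'; have [/andP[t0 t1] _] := Dt; have [/andP[t0' t1'] _] := Dt'.
  have [r] := rat_in_itvoo t0; rewrite in_itv => /andP[/= r0 rt].
  have [s] := rat_in_itvoo tt'; rewrite in_itv => /andP[/= ts st'].
  have [u] := rat_in_itvoo t1'; rewrite in_itv => /andP[/= t'u u1].
  have /andP[_ h1] := fP _ Dt r s r0 rt ts (lt_trans st' t1').
  have /andP[h2 _] := fP _ Dt' s u (lt_trans t0 ts) st' t'u u1.
  exact: lt_trans h2.
apply/pcard_injP; exists (fun t => pickle (f t)) => t t'; rewrite !inE => Dt Dt' /(pcan_inj pickleK) ff.
by have [/(finj _ _ Dt Dt')|/(finj _ _ Dt' Dt)|//] := ltgtP t t'; rewrite ff ltxx.
Unshelve. all: by end_near. Qed.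

End helly.

(** * Absolutely continuous functions *)

Section families.
Context {R : realType}.
Implicit Types (a b T : R) (s : seq (R * R)) (f g : R -> R).

Definition apart (p p' : R * R) := (p.2 <= p'.1) || (p'.2 <= p.1).
Definition inside a b (p : R * R) := [&& a <= p.1, p.1 <= p.2 & p.2 <= b].
Definition family a b s := all (inside a b) s && pairwise apart s.

Lemma apartC p p' : apart p p' = apart p' p.
Proof. by rewrite /apart orbC. Qed.

Lemma allrel_apartC s t : allrel apart s t = allrel apart t s.
Proof.
by rewrite allrelC; congr (allrel _ _ _); apply/funext => p; apply/funext => p'; rewrite apartC.
Qed.

Lemma family_catCA a b s t u : family a b (s ++ t ++ u) = family a b (t ++ s ++ u).
Proof.
rewrite /family !all_cat !pairwise_cat !allrel_catr (allrel_apartC t s).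
move: (all _ s) (all _ t) (all _ u) (allrel _ s t) (allrel _ s u) (allrel _ t u)
  (pairwise _ s) (pairwise _ t) (pairwise _ u).
by do 9 case.
Qed.

Definition ac_scalar T f := forall e, 0 < e -> exists2 d, 0 < d &
  forall s, family 0 T s -> \sum_(p <- s) (p.2 - p.1) < d ->
    \sum_(p <- s) `|f p.2 - f p.1| < e.

Fixpoint pieces a (l : seq R) : seq (R * R) :=
  if l is x :: l' then (a, x) :: pieces x l' else [::].

Lemma pieces_family a b l : path <%R a l -> last a l <= b -> family a b (pieces a l).
Proof.
elim: l a => //= x l IH a /andP[ax xl] lb.
have xb : x <= b.
  apply: le_trans lb; elim: (l) (x) xl {IH ax} => //= y l' IH' z /andP[zy yl].
  by apply: le_trans (IH' _ yl); exact: ltW.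
have /andP[f1 f2] := IH x xl lb.
rewrite /family /= f2 /inside /= lexx (ltW ax) xb /= andbT; apply/andP; split.
  apply: sub_all f1 => p /and3P[h1 h2 h3]; apply/and3P; split=> //.
  by apply: le_trans h1; exact: ltW.
by apply: sub_all f1 => p /and3P[h1 _ _]; rewrite /apart /= h1.
Qed.

Lemma variation_pieces a b f l : itv_partition a b l ->
  variation a b f l = \sum_(p <- pieces a l) `|f p.2 - f p.1|.
Proof.
move=> abl; rewrite variation_zip//; move: abl => [_ _].
by elim: l a => [|x l IH] a /=; rewrite ?big_nil// !big_cons IH.
Qed.

Lemma sum_pieces a l : \sum_(p <- pieces a l) (p.2 - p.1) = last a l - a.
Proof.
elim: l a => [|x l IH] a /=; first by rewrite big_nil subrr.
by rewrite big_cons IH /= addrC subrKA.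
Qed.

Lemma family_refine a b x y s l : family a b ((x, y) :: s) -> itv_partition x y l ->
  family a b (pieces x l ++ s).
Proof.
move=> /andP[/= /andP[/and3P[ax xy yb] h1] /andP[h2 h3]] [pl /eqP ly].
have /andP[g1 g2] : family x y (pieces x l) by apply: pieces_family => //; rewrite ly.
rewrite /family all_cat pairwise_cat h1 h3 g2 !andbT /=; apply/andP; split.
  apply: sub_all g1 => p /and3P[k1 k2 k3]; apply/and3P; split=> //.
    exact: le_trans k1.
  exact: le_trans yb.
apply/allrelP => p p' /(allP g1) /and3P[k1 k2 k3] /(allP h2).
by rewrite /apart /= => /orP[k|k]; apply/orP; [left|right]; [exact: le_trans k|exact: le_trans k1].
Qed.

Local Notation TV := total_variation.

(** Intervals are refined one at a time: those of [s1] are measured by total variation, those of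
    [s2] by increment, and replacing an interval by a partition of it changes neither disjointness
    nor total length. *)
Lemma ac_total_variation T f e d :
  (forall s, family 0 T s -> \sum_(p <- s) (p.2 - p.1) < d ->
    \sum_(p <- s) `|f p.2 - f p.1| <= e) ->
  forall s, family 0 T s -> \sum_(p <- s) (p.2 - p.1) < d ->
    (\sum_(p <- s) TV p.1 p.2 f <= e%:E)%E.
Proof.
move=> h.
suff H s1 s2 : family 0 T (s1 ++ s2) -> \sum_(p <- s1 ++ s2) (p.2 - p.1) < d ->
    (\sum_(p <- s1) TV p.1 p.2 f + (\sum_(p <- s2) `|f p.2 - f p.1|)%:E <= e%:E)%E.
  move=> s fs ls; have := H s [::]; rewrite cats0 big_nil adde0; exact.
elim: s1 s2 => [|[a b] s1 IH] s2 fs ls.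
  by rewrite big_nil add0e lee_fin; apply: h.
rewrite big_cons /=.
have ab : a <= b by move: fs => /andP[/= /andP[/and3P[]]].
set r := (\sum_(p <- s1) TV p.1 p.2 f)%E.
have r0 : (0 <= r)%E.
  rewrite /r big_seq; apply: sume_ge0 => p ps; apply: total_variation_ge0.
  by move: fs => /andP[/= /andP[_ /allP /(_ p)]]; rewrite mem_cat ps => /(_ isT) /and3P[].
have rfin : r \is a fin_num.
  have : (r + (\sum_(p <- [:: (a, b)] ++ s2) `|f p.2 - f p.1|)%:E <= e%:E)%E.
    apply: IH; first by rewrite family_catCA.
    by move: ls; rewrite /= !big_cons !big_cat /= !big_cons addrCA.
  move=> h2; rewrite ge0_fin_numE//; apply: le_lt_trans (ltry e).
  by apply: le_trans h2; rewrite leeDl// lee_fin sumr_ge0.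
set c := \sum_(p <- s2) _.
rewrite -(fineK rfin) -addeA -EFinD -leeBrDr// -EFinB.
apply: ge_ereal_sup => _ [_ [l abl <-] <-].
rewrite lee_fin lerBrDr addrCA -lee_fin EFinD fineK// variation_pieces//.
rewrite /c -big_cat /=; apply: IH.
  by rewrite family_catCA; exact: family_refine fs abl.
rewrite !big_cat /= sum_pieces; case: abl => _ /eqP ->.
by move: ls; rewrite /= big_cons big_cat /= addrCA.
Qed.

End families.

Lemma pairwise_uniq_in {I : eqType} (r : rel I) (s : seq I) : uniq s ->
  (forall x y, x \in s -> y \in s -> x != y -> r x y) -> pairwise r s.
Proof.
elim: s => //= x s IH /andP[xs us] h; apply/andP; split.
  apply/allP => y ys; apply: h; rewrite ?inE ?eqxx ?ys ?orbT//.
  by apply: contra xs => /eqP ->.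
by apply: IH => // y z ys zs; apply: h; rewrite inE ?ys ?zs orbT.
Qed.

Lemma overlap_mid {R : realFieldType} (a b c d : R) : a < b -> c < d -> c < b -> a < d ->
  let z := (Num.max a c + Num.min b d) / 2 in a < z < b /\ c < z < d.
Proof.
move=> ab cd cb ad z; rewrite /z maxEle minEle.
by do 2 case: ifPn; rewrite -?ltNge => ? ?; split; apply/andP; split; lra.
Qed.

(** * The fundamental theorem for absolutely continuous functions *)

Section ac_monotone.
Context {R : realType}.
Implicit Types (a b T : R) (f g : R -> R).
Local Notation TV := total_variation.
Local Notation mu := (@lebesgue_measure R).

Lemma family1 a b x y : a <= x -> x <= y -> y <= b -> family a b [:: (x, y)].
Proof. by move=> ax xy yb; rewrite /family /= /inside /= ax xy yb. Qed.

Lemma ac_bounded_variation T f : 0 <= T -> ac_scalar T f -> TV 0 T f \is a fin_num.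
Proof.
move=> T0 acf; have [d d0 hd] := acf 1 ltr01.
have H := @ac_total_variation R T f 1 d (fun s fs ls => ltW (hd s fs ls)).
have small x y : 0 <= x -> x <= y -> y <= T -> y - x < d -> TV x y f \is a fin_num.
  move=> x0 xy yT l; rewrite ge0_fin_numE ?total_variation_ge0//.
  have := H [:: (x, y)] (family1 x0 xy yT); rewrite !big_seq1 => /(_ l) h.
  by apply: le_lt_trans h _; exact: ltry.
have step k : TV 0 (Num.min (k%:R * (d / 2)) T) f \is a fin_num.
  elim: k => [|k IH].
    by rewrite mul0r min_l// total_variationxx.
  set x := Num.min _ T in IH; set y := Num.min _ T.
  have x0 : 0 <= x by rewrite le_min T0 andbT mulr_ge0// divr_ge0// ltW.
  have xy : x <= y.
    by rewrite le_min !ge_min lexx !orbT andbT ler_pM2r ?divr_gt0// ler_nat leqnSn.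
  have yT : y <= T by rewrite ge_min lexx orbT.
  rewrite (@total_variationD _ _ _ x)// fin_numD IH small//.
  have : y <= x + d / 2.
    rewrite /x /y -addn1 natrD mulrDl mul1r !minEle.
    by do 2 case: ifPn; rewrite -?ltNge => *; move: d0; lra.
  move: d0; lra.
have := step (Num.bound (T / (d / 2))); rewrite min_r//.
rewrite -ler_pdivrMr ?divr_gt0//; apply/ltW/archi_boundP.
by rewrite divr_ge0// divr_ge0// ltW.
Qed.

Definition tv0 f x := fine (TV 0 x f).

Lemma tv0_diff T f x y : 0 <= x -> x <= y -> y <= T -> TV 0 T f \is a fin_num ->
  TV x y f \is a fin_num /\ tv0 f y - tv0 f x = fine (TV x y f).
Proof.
move=> x0 xy yT; rewrite (@total_variationD _ _ _ y)//; last exact: le_trans xy.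
rewrite fin_numD => /andP[+ _]; rewrite /tv0 (@total_variationD _ 0 y x)// fin_numD => /andP[h1 h2].
by split=> //; rewrite fineD// addrAC subrr add0r.
Qed.

(** The Jordan decomposition inside the absolutely continuous functions. It reduces the fundamental
    theorem to nondecreasing functions, where the Radon-Nikodym theorem applies. *)
Lemma ac_tv0 T f : 0 <= T -> ac_scalar T f ->
  [/\ ac_scalar T (tv0 f),
     forall x y, 0 <= x -> x <= y -> y <= T -> `|f y - f x| <= tv0 f y - tv0 f x
     & ac_scalar T (fun x => tv0 f x - f x)].
Proof.
move=> T0 acf; have tvf := ac_bounded_variation T0 acf.
have A : ac_scalar T (tv0 f).
  move=> e e0; have e2 : 0 < e / 2 by rewrite divr_gt0.
  have [d d0 hd] := acf _ e2; exists d => // s fs ls.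
  have := ac_total_variation (fun s fs ls => ltW (hd s fs ls)) fs ls.
  have -> : (\sum_(p <- s) TV p.1 p.2 f = (\sum_(p <- s) `|tv0 f p.2 - tv0 f p.1|)%:E)%E.
    rewrite -sumEFin big_seq [RHS]big_seq; apply: eq_bigr => p ps.
    move: fs => /andP[/allP /(_ _ ps) /and3P[p0 pp pT] _].
    have [h1 ->] := tv0_diff p0 pp pT tvf.
    by rewrite ger0_norm ?fineK// fine_ge0// total_variation_ge0.
  by rewrite lee_fin => h; apply: le_lt_trans h _; move: e0; lra.
have B x y : 0 <= x -> x <= y -> y <= T -> `|f y - f x| <= tv0 f y - tv0 f x.
  move=> x0 xy yT; have [h1 ->] := tv0_diff x0 xy yT tvf.
  by rewrite -lee_fin fineK//; exact: total_variation_ge.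
split=> // e e0; have e2 : 0 < e / 2 by rewrite divr_gt0.
have [d1 d10 h1] := acf _ e2; have [d2 d20 h2] := A _ e2.
exists (Num.min d1 d2); first by rewrite lt_min d10.
move=> s fs; rewrite lt_min => /andP[/(h1 _ fs) k1 /(h2 _ fs) k2].
apply: (@le_lt_trans _ _ (\sum_(p <- s) `|f p.2 - f p.1| + \sum_(p <- s) `|tv0 f p.2 - tv0 f p.1|)).
  rewrite -big_split; apply: ler_sum => p _ /=.
  have -> : tv0 f p.2 - f p.2 - (tv0 f p.1 - f p.1) =
    (tv0 f p.2 - tv0 f p.1) - (f p.2 - f p.1) by ring.
  by rewrite [leRHS]addrC ler_normB.
by rewrite (splitr e) ltrD.
Qed.

Definition clamp T x : R := Num.max 0 (Num.min x T).

Lemma clamp_itv T x : 0 <= T -> 0 <= clamp T x <= T.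
Proof. by move=> T0; rewrite /clamp le_max lexx /= ge_max T0 ge_min lexx orbT. Qed.

Lemma clamp_id T x : 0 <= x <= T -> clamp T x = x.
Proof. by move=> /andP[x0 xT]; rewrite /clamp min_l// max_r. Qed.

Lemma clamp_le T x y : x <= y -> clamp T x <= clamp T y.
Proof.
move=> xy; rewrite /clamp !(maxEle,minEle).
by do 4 case: ifPn; rewrite -?ltNge => *; lra.
Qed.

Lemma clamp_dist T x y : 0 <= T -> x <= y -> clamp T y - clamp T x <= y - x.
Proof.
move=> T0 xy; rewrite /clamp !(maxEle,minEle).
by do 4 case: ifPn; rewrite -?ltNge => *; lra.
Qed.


Lemma ac_continuous T g : ac_scalar T g -> forall e, 0 < e -> exists2 d, 0 < d &
  forall x y, 0 <= x -> x <= y -> y <= T -> y - x < d -> `|g y - g x| < e.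
Proof.
move=> ag e e0; have [d d0 h] := ag _ e0; exists d => // x y x0 xy yT l.
by have := h [:: (x, y)] (family1 x0 xy yT); rewrite !big_seq1; apply.
Qed.

Section cdf.
Variables (T : R) (g : R -> R).
Hypotheses (T0 : 0 < T) (ndg : forall x y, 0 <= x -> x <= y -> y <= T -> g x <= g y)
  (acg : ac_scalar T g).

Let K := g T - g 0 + T.
Let K0 : 0 < K.
Proof. by rewrite ltr_wpDl// subr_ge0; apply: ndg => //; exact: ltW. Qed.

(** Adding the identity makes the total increment [K] positive even when [g] is constant, so that
    dividing by [K] yields a distribution function; [clamp] extends it to the line. *)
Definition cdf x := (g (clamp T x) - g 0 + clamp T x) / K.

Let cdf_nd : {homo cdf : x y / x <= y}.
Proof.
move=> x y xy; rewrite ler_pM2r ?invr_gt0// lerD ?clamp_le// lerD2r.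
have /andP[x0 xT] := clamp_itv x (ltW T0); have /andP[y0 yT] := clamp_itv y (ltW T0).
by apply: ndg => //; exact: clamp_le.
Qed.

Lemma cdf_ac e : 0 < e -> exists2 d, 0 < d & forall s, (forall p, p \in s -> p.1 <= p.2) ->
  pairwise apart s -> \sum_(p <- s) (p.2 - p.1) < d -> \sum_(p <- s) (cdf p.2 - cdf p.1) <= e.
Proof.
move=> e0; have e2 : 0 < e * K / 2 by rewrite divr_gt0// mulr_gt0.
have [d d0 hd] := acg e2; exists (Num.min d (e * K / 2)); first by rewrite lt_min d0.
move=> s s1 s2; rewrite lt_min => /andP[l1 l2].
pose s' := [seq (clamp T p.1, clamp T p.2) | p <- s].
have fs' : family 0 T s'.
  apply/andP; split.
    apply/allP => _ /mapP[p ps ->]; rewrite /inside /=.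
    have /andP[-> _] := clamp_itv p.1 (ltW T0); have /andP[_ ->] := clamp_itv p.2 (ltW T0).
    by rewrite clamp_le// s1.
  rewrite pairwise_map; apply: sub_pairwise s2 => p p' /orP[h|h].
    by apply/orP; left => /=; apply: clamp_le.
  by apply/orP; right => /=; apply: clamp_le.
have ls' : \sum_(p <- s') (p.2 - p.1) <= \sum_(p <- s) (p.2 - p.1).
  by rewrite big_map big_seq [leRHS]big_seq; apply: ler_sum => p ps; apply: clamp_dist (ltW T0) (s1 _ ps).
have -> : \sum_(p <- s) (cdf p.2 - cdf p.1) =
    (\sum_(p <- s') (g p.2 - g p.1) + \sum_(p <- s') (p.2 - p.1)) / K.
  by rewrite !big_map -big_split mulr_suml; apply: eq_bigr => p _; rewrite /cdf /=; field; rewrite gt_eqF.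
rewrite ler_pdivrMr//.
have h1 := hd _ fs' (le_lt_trans ls' l1).
have h2 : \sum_(p <- s') (g p.2 - g p.1) <= \sum_(p <- s') `|g p.2 - g p.1|.
  by apply: ler_sum => p _; exact: ler_norm.
by move: h1 h2 l2 ls'; lra.
Qed.

Let cdf_rc : right_continuous cdf.
Proof.
apply: right_continuousW => x; apply/cvgrPdist_le => e e0.
have [d d0 hd] := cdf_ac e0; near=> y.
have yx : `|x - y| < d by near: y; exact: cvgr_dist_lt.
have [xy|yx'] := leP x y.
  have := hd [:: (x, y)]; rewrite !big_seq1 /= => h.
  rewrite distrC ger0_norm ?subr_ge0 ?cdf_nd//; apply: h => //.
    by move=> p; rewrite inE => /eqP ->.
  by move: yx; rewrite distrC ger0_norm// subr_ge0.
have := hd [:: (y, x)]; rewrite !big_seq1 /= => h.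
rewrite ger0_norm ?subr_ge0 ?cdf_nd ?(ltW yx')//; apply: h => //.
  by move=> p; rewrite inE => /eqP -> /=; exact: ltW.
by move: yx; rewrite ger0_norm// subr_ge0 ltW.
Unshelve. all: by end_near. Qed.

Let cdfNy : cdf @ -oo --> (0 : R).
Proof.
apply: cvg_near_cst; near=> x.
have x0 : x <= 0 by near: x; exact: nbhs_ninfty_le.
by rewrite /cdf /clamp max_l ?subrr ?add0r ?mul0r// ge_min x0.
Unshelve. all: by end_near. Qed.

Let cdfy : cdf @ +oo --> (1 : R).
Proof.
apply: cvg_near_cst; near=> x.
have xT : T <= x by near: x; apply: nbhs_pinfty_ge; rewrite num_real.
by rewrite /cdf /clamp min_r// max_r ?(ltW T0)// divff// gt_eqF.
Unshelve. all: by end_near. Qed.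

HB.instance Definition _ := isCumulative.Build R _ R cdf cdf_nd cdf_rc.
HB.instance Definition _ := isCumulativeBounded.Build R 0 1 cdf cdfNy cdfy.

Let nu : probability _ R := lebesgue_stieltjes_measure cdf.

Lemma nu_oc a b : a <= b -> nu `]a, b]%classic = (cdf b - cdf a)%:E.
Proof.
move=> ab; rewrite /nu /= /lebesgue_stieltjes_measure /measure_extension measurable_mu_extE/=; last exact: is_ocitv.
by rewrite wlength_itv_bnd.
Qed.

(** A null set lies in an open set of measure less than [d]; finitely many components of it form a
    disjoint family of total length less than [d], on which [cdf] increases by at most [e]. *)
Let nu_dom : nu `<< mu.
Proof.
apply/null_content_dominatesP => A mA A0.
apply/eqP; rewrite eq_le measure_ge0 andbT; apply/lee_addgt0Pr => e e0; rewrite add0e.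
have [d d0 hd] := cdf_ac e0.
have Afin : (mu A < +oo)%E by rewrite A0.
have [U [oU AU UA]] := lebesgue_regularity_outer mA Afin d0.
have mU : measurable U by exact: measurable_realfun.open_measurable.
have muU : (mu U < d%:E)%E.
  rewrite -(setUIDK U A); apply: le_lt_trans (measureU2 _ _ _) _; [exact: measurableI|exact: measurableD|].
  have UA0 : mu (U `&` A) = 0%E.
    apply/eqP; rewrite eq_le measure_ge0 andbT -A0; apply: le_measure; rewrite ?inE//.
    exact: measurableI.
  by apply: (le_lt_trans _ UA); rewrite -[leRHS]add0e -UA0; exact: lexx.
apply: (@le_trans _ _ (nu U)); first by apply: le_measure; rewrite ?inE.
have -> : U = \bigcup_i open_disjoint_itv oU i by exact: open_disjoint_itv_bigcup.
set I := open_disjoint_itv oU.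
have tI : trivIset setT I by exact: open_disjoint_itv_trivIset.
have oI i : open (I i) by exact: open_disjoint_itv_open.
have mI i : measurable (I i) by exact: measurable_realfun.open_measurable.
have iI i : is_interval (I i) by exact: open_disjoint_itv_is_interval.
have IU i : I i `<=` U by rewrite [X in _ `<=` X](open_disjoint_itv_bigcup oU); exact: bigcup_sup.
have muI i x y : I i x -> I i y -> y - x < d.
  move=> Ix Iy; rewrite ltNge; apply/negP => h.
  have : (d%:E <= mu `]x, y]%classic)%E.
    by rewrite lebesgue_measure_itv /= lte_fin; case: ltP => [_|]; rewrite -?EFinB ?lee_fin//; move: d0 h; lra.
  apply/negP; rewrite -ltNge; apply: le_lt_trans muU; apply: le_measure; rewrite ?inE//.
  move=> z; rewrite /= in_itv /= => /andP[/ltW xz zy]; apply: (IU i); apply: (iI i x y) => //.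
  by rewrite xz.
have bI i : I i !=set0 -> has_ubound (I i) /\ has_lbound (I i).
  move=> [x Ix]; split; first by exists (x + d) => y Iy; have := muI i x y Ix Iy; lra.
  by exists (x - d) => y Iy; have := muI i y x Iy Ix; lra.
have IE i : I i !=set0 -> I i = `]inf (I i), sup (I i)[%classic.
  move=> I0; have [ub lb] := bI i I0.
  rewrite -[LHS](interior_id _).1//; rewrite interval_bounded_interior//.
have Ine (i : nat) x : I i x -> inf (I i) < x < sup (I i).
  move=> Ix; have := Ix; rewrite {1}IE; last by exists x.
  by rewrite /= in_itv.
rewrite measure_bigcup//=; last by move=> i _; exact: mI.
apply: lime_le; first by apply: is_cvg_nneseries => i _ _; exact: measure_ge0.
near=> N.
(* Empty members of the enumeration of components have no meaningful end points and are dropped. *)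
pose t := [seq i <- iota 0 N | `[< I i !=set0 >]].
pose s := [seq (inf (I i), sup (I i)) | i <- t].
have tI0 i : i \in t -> I i !=set0 by rewrite mem_filter => /andP[/asboolP].
have big_t (m : set R -> \bar R) : m set0 = 0%E ->
    (\sum_(0 <= i < N | i \in [set: nat]) m (I i) = \sum_(i <- t) m (I i))%E.
  move=> m0; rewrite big_filter /index_iota subn0 [RHS]big_mkcond /= [LHS]big_mkcond /=; apply: eq_bigr => i _.
  rewrite in_setT; case: asboolP => // /set0P/negP; rewrite negbK => /eqP ->.
  by rewrite m0.
have nuI i : i \in t -> (nu (I i) <= (cdf (sup (I i)) - cdf (inf (I i)))%:E)%E.
  move=> /tI0[x Ix]; have /andP[h1 h2] := Ine i x Ix.
  rewrite -nu_oc; last by rewrite ltW// (lt_trans h1).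
  apply: le_measure; rewrite ?inE; [exact: mI|exact: measurable_itv|].
  by move=> y /Ine /andP[h3 h4]; rewrite /= in_itv /= h3 ltW.
have len i : i \in t -> (mu (I i) = (sup (I i) - inf (I i))%:E)%E.
  move=> it; have [x Ix] := tI0 i it; have /andP[h1 h2] := Ine i x Ix.
  by rewrite {1}IE; [rewrite lebesgue_measure_itv /= lte_fin (lt_trans h1)|exists x].
rewrite big_t//.
apply: (@le_trans _ _ (\sum_(i <- t) (cdf (sup (I i)) - cdf (inf (I i)))%:E)%E).
  by rewrite big_seq [leRHS]big_seq; apply: lee_sum => i it; exact: nuI.
rewrite sumEFin lee_fin.
have := hd s; rewrite /s !big_map /=; apply.
- move=> _ /mapP[i /tI0[x Ix] ->] /=; have /andP[h1 h2] := Ine i x Ix.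
  by rewrite ltW// (lt_trans h1).
- rewrite pairwise_map; apply: pairwise_uniq_in; first by rewrite filter_uniq// iota_uniq.
  move=> i j it jt ij; rewrite /apart /=; apply/negP => /negP; rewrite negb_or -!ltNge => /andP[h1 h2].
  have [x Ix] := tI0 i it; have /andP[k1 k2] := Ine i x Ix.
  have [y Iy] := tI0 j jt; have /andP[k3 k4] := Ine j y Iy.
  pose z := (Num.max (inf (I i)) (inf (I j)) + Num.min (sup (I i)) (sup (I j))) / 2.
  have z1 : inf (I i) < z < sup (I i) /\ inf (I j) < z < sup (I j).
    apply: overlap_mid => //; [exact: lt_trans k2|exact: lt_trans k4].
  have /trivIsetP /(_ i j Logic.I Logic.I ij) := tI; rewrite -subset0; apply.
  by split; rewrite IE //=; rewrite ?in_itv; [exact: z1.1|exists x|exact: z1.2|exists y].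
- rewrite -lte_fin -sumEFin; apply: le_lt_trans muU.
  rewrite (open_disjoint_itv_bigcup oU) measure_bigcup//= -/I; last by move=> i _; exact: mI.
  apply: (@le_trans _ _ (\sum_(0 <= i < N | i \in [set: nat]) mu (I i))%E); last first.
    exact: nneseries_lim_ge.
  by rewrite big_t// big_seq [leRHS]big_seq; apply: lee_sum => i it; rewrite len.
Unshelve. all: by end_near. Qed.

(** The term [x] stems from the identity added in [cdf]; it cancels when the two parts of the Jordan
    decomposition are subtracted. *)
Lemma ac_nondecreasing_integral : exists2 phi : R -> R,
  mu.-integrable [set: R] (EFin \o phi) &
  forall x, 0 <= x <= T -> g x - g 0 + x = (\int[mu]_(t in `[0, x]) phi t)%R.
Proof.
have [f [f0 ffin fint fE]] := radon_nikodym_sigma_finite nu_dom.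
exists (fun x => K * fine (f x)).
  have := integrableZl measurableT K fint.
  by apply: eq_integrable => // x _ /=; rewrite EFinM fineK.
move=> x x0T; have /andP[x0 xT] := x0T.
have fi : mu.-integrable [set: R] (EFin \o (fine \o f)).
  by apply: eq_integrable fint => // y _ /=; rewrite fineK.
rewrite RintegralZl//; last exact: integrableS fi.
have -> : (\int[mu]_(t in `[0, x]) fine (f t))%R = cdf x - cdf 0.
  rewrite -Rintegral_itv_obnd_cbnd; last exact: integrableS fi.
  rewrite /Rintegral -[RHS]/(fine (cdf x - cdf 0)%:E) -nu_oc// fE//.
  by congr fine; apply: eq_integral => y _; rewrite fineK.
rewrite /cdf !clamp_id ?lexx ?(ltW T0)// -/K.
by field; rewrite gt_eqF.
Qed.

End cdf.

Theorem ac_ftc T f : 0 < T -> ac_scalar T f -> exists2 phi : R -> R,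
  mu.-integrable [set: R] (EFin \o phi) &
  (forall x, 0 <= x <= T -> f x - f 0 = (\int[mu]_(t in `[0, x]) phi t)%R) /\
  {ae mu, forall x, 0 < x < T -> derivable f x 1 /\ derive1 f x = phi x}.
Proof.
move=> T0 acf; have [ac1 maj ac2] := ac_tv0 (ltW T0) acf.
have [|phi1 i1 E1] := @ac_nondecreasing_integral T (tv0 f) T0 _ ac1.
  by move=> x y x0 xy yT; rewrite -subr_ge0; apply: le_trans (maj x y x0 xy yT).
have [|phi2 i2 E2] := @ac_nondecreasing_integral T (fun x => tv0 f x - f x) T0 _ ac2.
  move=> x y x0 xy yT; have := maj x y x0 xy yT; rewrite ler_norml => /andP[_]; lra.
have ip : mu.-integrable [set: R] (EFin \o (fun x => phi1 x - phi2 x)).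
  have := integrableB measurableT i1 i2.
  by apply: eq_integrable => // x _ /=; rewrite EFinB.
have E x : 0 <= x <= T -> f x - f 0 = (\int[mu]_(t in `[0, x]) (phi1 t - phi2 t))%R.
  move=> x0T; rewrite RintegralB//; [|exact: integrableS i1|exact: integrableS i2].
  by rewrite -E1// -E2//; ring.
exists (fun x => phi1 x - phi2 x) => //; split=> //.
have := @FTC1 R (fun x => phi1 x - phi2 x) (BLeft 0).
have ip' y : mu.-integrable `[0, y] (EFin \o (fun x => phi1 x - phi2 x)) by exact: integrableS ip.
move=> /(_ ip').
have lip : locally_integrable [set: R] (fun x => phi1 x - phi2 x).
  by apply: open_integrable_locally => //; exact: openT.
move=> /(_ lip) /=; apply: filterS; first exact: (ae_filter_ringOfSetsType mu).
move=> x + /andP[x0 xT].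
rewrite /= lte_fin => /(_ x0) [].
set F := (fun y => _) => dF F'.
have y0 : \forall y \near x, 0 < y.
  have := @Nlt_nbhsl _ x 0; rewrite oppr_lt0 => /(_ x0).
  by apply: filterS => y; rewrite oppr_lt0.
have FE : \forall y \near x, F y + f 0 = f y.
  near=> y; have y0T : 0 <= y <= T.
    by apply/andP; split; apply: ltW; near: y; [exact: y0|exact: lt_nbhsl].
  by have := E y y0T; rewrite /F => <-; rewrite subrK.
have dFf : is_derive x 1 (fun y => F y + f 0) (phi1 x - phi2 x).
  have F'' : 'D_1 F x = phi1 x - phi2 x by rewrite -derive1E.
  have dd := DeriveDef dF F''.
  have := is_deriveD dd (is_derive_cst (f 0) x 1).
  by rewrite addr0.
have [d1 d2] := near_eq_is_derive FE dFf.
by split; [exact: d1|rewrite derive1E; exact: d2].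
Unshelve. all: by end_near. Qed.
End ac_monotone.

(** * The energy of a curve *)

Section euclid.
Context {R : realType} {n : nat}.
Implicit Types (u v w : 'rV[R]_n) (a b : R).

Lemma dotvC u v : dotv u v = dotv v u.
Proof. by apply: eq_bigr => i _; rewrite mulrC. Qed.

Lemma dotvDl u v w : dotv (u + v) w = dotv u w + dotv v w.
Proof. by rewrite /dotv -big_split; apply: eq_bigr => i _; rewrite mxE mulrDl. Qed.

Lemma dotvZl a u v : dotv (a *: u) v = a * dotv u v.
Proof. by rewrite /dotv mulr_sumr; apply: eq_bigr => i _; rewrite mxE mulrA. Qed.

Lemma dotvDr u v w : dotv u (v + w) = dotv u v + dotv u w.
Proof. by rewrite dotvC dotvDl !(dotvC u). Qed.

Lemma dotvZr a u v : dotv u (a *: v) = a * dotv u v.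
Proof. by rewrite dotvC dotvZl dotvC. Qed.

Lemma dotvNl u v : dotv (- u) v = - dotv u v.
Proof. by rewrite -scaleN1r dotvZl mulN1r. Qed.

Lemma dotvNr u v : dotv u (- v) = - dotv u v.
Proof. by rewrite dotvC dotvNl dotvC. Qed.

Lemma dotv_ge0 u : 0 <= dotv u u.
Proof. by apply: sumr_ge0 => i _; rewrite -expr2 sqr_ge0. Qed.

Lemma enorm_ge0 u : 0 <= enorm u.
Proof. exact: sqrtr_ge0. Qed.

Lemma enorm_sqr u : enorm u ^+ 2 = dotv u u.
Proof. by rewrite sqr_sqrtr// dotv_ge0. Qed.

Lemma enorm_coord u i : `|u ord0 i| <= enorm u.
Proof.
rewrite -(ler_pXn2r (n := 2))// ?nnegrE ?enorm_ge0// enorm_sqr real_normK ?num_real//.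
rewrite /dotv (bigD1 i)//= expr2 lerDl; apply: sumr_ge0 => j _.
by rewrite -expr2 sqr_ge0.
Qed.

Lemma enorm_eq0 u : enorm u = 0 -> u = 0.
Proof.
move=> u0; apply/rowP => i; rewrite mxE; apply/eqP; rewrite -normr_le0.
by rewrite -u0 enorm_coord.
Qed.

Lemma enormZ a u : enorm (a *: u) = `|a| * enorm u.
Proof.
rewrite /enorm dotvZl dotvZr mulrA -expr2 sqrtrM ?sqr_ge0//.
by rewrite sqrtr_sqr.
Qed.

Lemma enorm0 : enorm (0 : 'rV[R]_n) = 0.
Proof. by rewrite -(scale0r 0) enormZ normr0 mul0r. Qed.

Lemma enormN u : enorm (- u) = enorm u.
Proof. by rewrite -scaleN1r enormZ normrN1 mul1r. Qed.

Lemma enorm_distC u v : enorm (u - v) = enorm (v - u).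
Proof. by rewrite -enormN opprB. Qed.

Lemma cauchy_schwarz u v : dotv u v <= enorm u * enorm v.
Proof.
have [u0|un0] := eqVneq (enorm u) 0.
  by rewrite u0 mul0r (enorm_eq0 u0) -(scale0r 0) dotvZl mul0r.
have [v0|vn0] := eqVneq (enorm v) 0.
  by rewrite v0 mulr0 (enorm_eq0 v0) -(scale0r 0) dotvZr mul0r.
have := dotv_ge0 (enorm v *: u - enorm u *: v).
rewrite dotvDl !dotvDr !dotvNl !dotvNr !dotvZl !dotvZr -!enorm_sqr (dotvC v u).
set a := enorm u; set b := enorm v; set d := dotv u v.
have a0 : 0 < a by rewrite lt_def un0 enorm_ge0.
have b0 : 0 < b by rewrite lt_def vn0 enorm_ge0.
move=> h; rewrite -(ler_pM2l (mulr_gt0 a0 b0)).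
move: h; rewrite !expr2; lra.
Qed.

Lemma enormD u v : enorm (u + v) <= enorm u + enorm v.
Proof.
rewrite -(ler_pXn2r (n := 2))// ?nnegrE ?addr_ge0 ?enorm_ge0// enorm_sqr.
rewrite dotvDl !dotvDr (dotvC v u) -!enorm_sqr.
have := cauchy_schwarz u v; rewrite !expr2; lra.
Qed.

Lemma enorm_dist_trans u v w : enorm (u - w) <= enorm (u - v) + enorm (v - w).
Proof. by apply: le_trans (enormD _ _); rewrite addrA subrK. Qed.

Lemma enormB u v : enorm (u - v) <= enorm u + enorm v.
Proof. by apply: le_trans (enormD _ _) _; rewrite enormN. Qed.

Lemma enorm_sum (I : Type) (r : seq I) (P : pred I) (F : I -> 'rV[R]_n) :
  enorm (\sum_(i <- r | P i) F i) <= \sum_(i <- r | P i) enorm (F i).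
Proof.
elim/big_rec2: _ => [|i x y _ h]; first by rewrite enorm0.
by apply: le_trans (enormD _ _) _; rewrite lerD2l.
Qed.

Lemma enorm_le_sum u : enorm u <= \sum_i `|u ord0 i|.
Proof.
rewrite {1}(row_sum_delta u); apply: le_trans (enorm_sum _ _ _) _.
apply: ler_sum => i _; rewrite enormZ -[leRHS]mulr1 ler_wpM2l//.
rewrite /enorm /dotv (bigD1 i)//= big1 => [|j ji]; last first.
  by rewrite mxE (negbTE ji) andbF mul0r.
by rewrite mxE !eqxx mulr1 addr0 sqrtr1.
Qed.

Lemma mxnorm_coord u i : `|u ord0 i| <= `|u|.
Proof. by rewrite [leRHS]mx_normrE; apply: (le_bigmax _ (fun ij => `|u ij.1 ij.2|) (ord0, i)). Qed.

Lemma mxnorm_le_enorm u : `|u| <= enorm u.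
Proof.
rewrite [leLHS]mx_normrE; apply: bigmax_le => [|[p i] _ /=]; first exact: enorm_ge0.
by rewrite ord1 enorm_coord.
Qed.

Lemma enorm_le_mxnorm u : enorm u <= n%:R * `|u|.
Proof.
apply: le_trans (enorm_le_sum u) _.
apply: (@le_trans _ _ (\sum_(i < n) `|u|)); first by apply: ler_sum => i _; exact: mxnorm_coord.
by rewrite sumr_const card_ord mulr_natl.
Qed.

Lemma ler_enorm_dist u v : `|enorm u - enorm v| <= enorm (u - v).
Proof.
rewrite ler_norml; apply/andP; split.
  have := enormD (v - u) u; rewrite subrK enorm_distC; lra.
have := enormD (u - v) v; rewrite subrK; lra.
Qed.

End euclid.

(** * Powers and their perspective *)

Section power.
Context {R : realType}.
Implicit Types (x y a b t q : R).

Lemma powR_convex q t x y : 1 <= q -> 0 <= t <= 1 -> 0 <= x -> 0 <= y ->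
  (t * x + (1 - t) * y) `^ q <= t * x `^ q + (1 - t) * y `^ q.
Proof.
move=> q1 /andP[t0 t1] x0 y0.
by apply: (convex_powR q1 (Itv01 t0 t1)); rewrite ?inE /= in_itv /= ?x0 ?y0.
Qed.

(* [x^q / h^(q-1)], written so as to avoid the exponent [q - 1] *)
Definition pterm q x h := h * (x / h) `^ q.

Lemma pterm_ge0 q x h : 0 <= h -> 0 <= pterm q x h.
Proof. by move=> h0; rewrite mulr_ge0// powR_ge0. Qed.

Lemma pterm0 q h : 0 < q -> pterm q 0 h = 0.
Proof. by move=> q0; rewrite /pterm mul0r powR0 ?gt_eqF// mulr0. Qed.

Lemma pterm_le q x y h : 0 <= q -> 0 <= x -> x <= y -> 0 < h -> pterm q x h <= pterm q y h.
Proof.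
move=> q0 x0 xy h0; rewrite ler_pM2l// ge0_ler_powR ?nnegrE ?divr_ge0 ?(ltW h0)//.
- exact: le_trans xy.
- by rewrite ler_pM2r ?invr_gt0.
Qed.

(** The perspective of a convex function is jointly subadditive: [(x + y) / (u + v)] is the mean of
    [x / u] and [y / v] with weights proportional to [u] and [v]. *)
Lemma pterm_add q x y u v : 1 <= q -> 0 <= x -> 0 <= y -> 0 < u -> 0 < v ->
  pterm q (x + y) (u + v) <= pterm q x u + pterm q y v.
Proof.
move=> q1 x0 y0 u0 v0; have uv : 0 < u + v by rewrite addr_gt0.
have t01 : 0 <= u / (u + v) <= 1.
  by rewrite divr_ge0 ?(ltW u0) ?(ltW uv)//= ler_pdivrMr// mul1r lerDl ltW.
have := powR_convex q1 t01 (divr_ge0 x0 (ltW u0)) (divr_ge0 y0 (ltW v0)).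
have -> : u / (u + v) * (x / u) + (1 - u / (u + v)) * (y / v) = (x + y) / (u + v).
  by field; rewrite !gt_eqF.
move=> h; rewrite /pterm -(ler_pM2l (_ : 0 < (u + v)^-1)) ?invr_gt0//.
rewrite mulKf ?gt_eqF//; apply: (le_trans h); rewrite le_eqVlt; apply/orP; left; apply/eqP.
by field; rewrite gt_eqF.
Qed.

Lemma pterm_antimono q x u h : 1 <= q -> 0 <= x -> 0 < u -> u <= h -> pterm q x h <= pterm q x u.
Proof.
move=> q1 x0 u0; rewrite le_eqVlt => /orP[/eqP ->//|uh].
have := @pterm_add q x 0 u (h - u) q1 x0 (lexx 0) u0.
rewrite subr_gt0 => /(_ uh); rewrite addr0 pterm0 ?addr0 ?(lt_le_trans ltr01)//.
by rewrite addrC subrK.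
Qed.

Lemma ptermM q c x h : 0 <= c -> 0 <= x -> 0 < h -> pterm q (c * x) h = c `^ q * pterm q x h.
Proof.
move=> c0 x0 h0; rewrite /pterm -mulrA powRM ?divr_ge0 ?(ltW h0)//; ring.
Qed.

Lemma pterm_lip q x L h : 0 <= q -> 0 <= x -> 0 < h -> x <= L * h -> pterm q x h <= L `^ q * h.
Proof.
move=> q0 x0 h0 xl; rewrite /pterm mulrC ler_pM2r//.
have xL : x / h <= L by rewrite ler_pdivrMr.
by rewrite ge0_ler_powR ?nnegrE//; [rewrite divr_ge0// ltW|apply: le_trans xL; rewrite divr_ge0// ltW].
Qed.

(* Young's inequality in the form that yields equicontinuity and absolute continuity *)
Lemma pterm_young q k : 1 < q -> 0 < k -> exists2 K, 0 < K &
  forall x h, 0 <= x -> 0 < h -> x <= k * pterm q x h + K * h.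
Proof.
(* The value of [y] at which [k * y^(q - 1) = 1]: below it [K] dominates [y], above it [k * y^q]
   does. *)
move=> q1 k0; pose K := k^-1 `^ (q - 1)^-1.
have q10 : 0 < q - 1 by rewrite subr_gt0.
have K0 : 0 < K by rewrite powR_gt0// invr_gt0.
exists K => // x h x0 h0; rewrite /pterm mulrCA -[leLHS](mulfVK (x := h)) ?gt_eqF//.
set y := x / h; have y0 : 0 <= y by rewrite divr_ge0// ltW.
rewrite [y * h]mulrC [K * h]mulrC -mulrDr ler_pM2l//.
have [yK|Ky] := leP y K; first by rewrite (le_trans yK)// lerDr mulr_ge0 ?powR_ge0// ltW.
apply: (@le_trans _ _ (k * y `^ q)); last by rewrite lerDl ltW.
rewrite -mulr_powRB1//; last exact: lt_trans q1.
rewrite mulrCA -{1}[y]mulr1 ler_wpM2l//.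
have E1 : k * K `^ (q - 1) = 1.
  by rewrite /K -powRrM mulVf ?gt_eqF// powRr1 ?invr_ge0 ?(ltW k0)// divff// gt_eqF.
rewrite -[leLHS]E1 ler_pM2l// ge0_ler_powR ?nnegrE//; exact: ltW.
Qed.

(** This is [t^(1-q)], the weight in [(x + y)^q <= t^(1-q) x^q + (1-t)^(1-q) y^q]. As [t] tends to 1
    the weight of [x] tends to 1, so a small enough [y] hardly perturbs the energy of [x]. *)
Definition wt q t : R := t * t^-1 `^ q.

Lemma pterm_split q t x y h : 1 <= q -> 0 < t < 1 -> 0 <= x -> 0 <= y -> 0 < h ->
  pterm q (x + y) h <= wt q t * pterm q x h + wt q (1 - t) * pterm q y h.
Proof.
move=> q1 /andP[t0 t1] x0 y0 h0; have t1' : 0 < 1 - t by rewrite subr_gt0.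
have := @pterm_add q x y (t * h) ((1 - t) * h) q1 x0 y0 (mulr_gt0 t0 h0) (mulr_gt0 t1' h0).
have -> : t * h + (1 - t) * h = h by ring.
have E s z : 0 < s -> 0 <= z -> pterm q z (s * h) = wt q s * pterm q z h.
  move=> s0 z0; rewrite /pterm /wt.
  have -> : z / (s * h) = s^-1 * (z / h) by field; rewrite !gt_eqF.
  rewrite [(s^-1 * _) `^ q]powRM ?invr_ge0 ?divr_ge0 ?(ltW s0) ?(ltW h0)//.
  by ring.
by rewrite !E.
Qed.

Lemma wt_ge0 q t : 0 <= t -> 0 <= wt q t.
Proof. by move=> t0; rewrite mulr_ge0// powR_ge0. Qed.

Lemma wt_cvg1 q e : 1 <= q -> 0 < e -> exists2 t, 0 < t < 1 & wt q t <= 1 + e.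
Proof.
move=> q1 e0; have c : {for 1, continuous (@powR R ^~ q)}.
  apply: differentiable_continuous; apply/derivable1_diffP.
  by apply: derivable_powR; rewrite in_itv /= andbT ltr01.
have /cvgrPdist_le /(_ _ e0) : (fun x : R => x `^ q) x @[x --> (1 : R)] --> (1 `^ q : R) by exact: c.
move=> [d /= d0 h]; pose x := 1 + d / 2.
have x1 : 1 < x by rewrite ltrDl divr_gt0.
have := h x; rewrite /= powR1 opprD addrA subrr sub0r normrN gtr0_norm ?divr_gt0//.
have d2 : d / 2 < d by rewrite ltr_pdivrMr// ltr_pMr// ltr1n.
move=> /(_ d2); rewrite distrC => hx; exists x^-1.
  by rewrite invr_gt0 (lt_trans ltr01)//= invf_lt1// (lt_trans ltr01).
rewrite /wt invrK; apply: (@le_trans _ _ (1 * x `^ q)).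
  by rewrite ler_wpM2r ?powR_ge0// invf_le1 ?ltW// (lt_trans ltr01).
rewrite mul1r; have := le_trans (ler_norm _) hx; lra.
Qed.

End power.

(** * The energy as a supremum over partitions *)

Section penergy.
Context {R : realType} {n : nat}.
Variable q : R.
Hypothesis q1 : 1 < q.
Implicit Types (f g : R -> 'rV[R]_n) (a b c r : R) (s : seq R).

Let q1' : 1 <= q. Proof. exact: ltW. Qed.
Let q0 : 0 < q. Proof. exact: lt_trans q1. Qed.

Local Notation tm f a b := (pterm q (enorm (f b - f a)) (b - a)).

(* Riesz's partition form of [\int |f'|^q]: as a supremum of finite sums it is lower
   semicontinuous for pointwise convergence. *)
Fixpoint pen f a s : R := if s is b :: s' then tm f a b + pen f b s' else 0.

(** An upper bound is carried instead of the supremum, which may be infinite. Partitions start at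
    [a] but may end before [b], since a further point never decreases the sum. *)
Definition Vle f a b r := forall s, path <%R a s -> last a s <= b -> pen f a s <= r.

Lemma path_last_ge a s : path <%R a s -> a <= last a s.
Proof.
elim: s a => //= x s IH a /andP[ax /IH]; apply: le_trans; exact: ltW.
Qed.

Lemma Vle_ge0 f a b r : a <= b -> Vle f a b r -> 0 <= r.
Proof. by move=> ab /(_ [::]) /=; apply. Qed.

Lemma Vle_mono f a b r r' : r <= r' -> Vle f a b r -> Vle f a b r'.
Proof. by move=> rr h s ps ls; apply: le_trans rr; exact: h. Qed.

Lemma Vle_sub f a b a' b' r : a <= a' -> b' <= b -> Vle f a b r -> Vle f a' b' r.
Proof.
rewrite le_eqVlt => /orP[/eqP <-|aa] bb h s ps ls.
  by apply: h => //; exact: le_trans bb.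
apply: (@le_trans _ _ (pen f a (a' :: s))); last first.
  by apply: h => /=; [rewrite aa|exact: le_trans bb].
by rewrite /= lerDr pterm_ge0// subr_ge0 ltW.
Qed.

Lemma Vle_term f a b r x y : a <= x -> x < y -> y <= b -> Vle f a b r -> tm f x y <= r.
Proof.
move=> ax xy yb /(Vle_sub ax yb) /(_ [:: y]) /=; rewrite xy addr0; exact.
Qed.

Lemma tm_split f a c b : a < c -> c < b -> tm f a b <= tm f a c + tm f c b.
Proof.
move=> ac cb; have -> : b - a = (c - a) + (b - c) by ring.
apply: (@le_trans _ _ (pterm q (enorm (f c - f a) + enorm (f b - f c)) ((c - a) + (b - c)))).
  apply: pterm_le; rewrite ?enorm_ge0 ?(ltW q0)//; last by rewrite addr_gt0// subr_gt0.
  by rewrite [leRHS]addrC enorm_dist_trans.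
by apply: pterm_add; rewrite ?enorm_ge0 ?subr_gt0.
Qed.

(** By [tm_split], inserting [c] into the interval of a partition that straddles it does not
    decrease the sum. *)
Lemma Vle_cat f a c b r1 r2 : a <= c -> c <= b -> Vle f a c r1 -> Vle f c b r2 -> Vle f a b (r1 + r2).
Proof.
move=> ac cb h1 h2 s; elim: s a r1 ac h1 => [|x s IH] a r1 ac h1 /=.
  by rewrite addr_ge0 ?(Vle_ge0 _ h1) ?(Vle_ge0 _ h2).
move=> /andP[ax xs] ls; have [xc|cx] := leP x c.
  have := IH x (r1 - tm f a x) xc _ xs ls.
  rewrite -lerBrDl addrAC; apply=> s' ps' ls'.
  by rewrite lerBrDl; apply: (h1 (x :: s')) => //=; rewrite ax.
have h3 : pen f c (x :: s) <= r2 by apply: h2 => //=; rewrite cx.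
move: ac; rewrite le_eqVlt => /orP[/eqP ac|ac].
  move: h3; rewrite /= -ac; move/le_trans; apply; rewrite lerDr.
  by apply: Vle_ge0 h1; rewrite ac.
have h4 : tm f a c <= r1 by exact: Vle_term h1.
apply: (@le_trans _ _ (tm f a c + tm f c x + pen f x s)).
  by rewrite lerD2r tm_split.
by rewrite -addrA lerD.
Qed.

(* Meaningful only when [Vle f a b r] holds for some [r]. *)
Definition Vn f a b := sup [set x | exists s, [/\ path <%R a s, last a s <= b & x = pen f a s]].

Lemma Vn_le f a b r : a <= b -> Vle f a b r -> Vn f a b <= r.
Proof.
move=> ab h; apply: ge_sup; first by exists 0, [::].
by move=> _ [s [ps ls ->]]; exact: h.
Qed.

Lemma Vle_Vn f a b r : Vle f a b r -> Vle f a b (Vn f a b).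
Proof.
move=> h s ps ls; apply: sup_ubound; last by exists s.
by exists r => _ [s' [ps' ls' ->]]; exact: h.
Qed.

Lemma Vn_ge0 f a b r : a <= b -> Vle f a b r -> 0 <= Vn f a b.
Proof. by move=> ab /Vle_Vn; exact: Vle_ge0. Qed.

Lemma pen_cat f a s t : pen f a (s ++ t) = pen f a s + pen f (last a s) t.
Proof. by elim: s a => [|x s IH] a /=; rewrite ?add0r// IH addrA. Qed.

Lemma pen_widen f a s c : path <%R a s -> last a s <= c ->
  exists s', [/\ path <%R a s', last a s' = c & pen f a s <= pen f a s'].
Proof.
move=> ps; rewrite le_eqVlt => /orP[/eqP <-|lc]; first by exists s.
exists (rcons s c); rewrite rcons_path ps lc last_rcons; split=> //.
by rewrite -cats1 pen_cat lerDl /= addr0 pterm_ge0// subr_ge0 ltW.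
Qed.

Lemma Vn_super f a c b r : a <= c -> c <= b -> Vle f a b r -> Vn f a c + Vn f c b <= Vn f a b.
Proof.
move=> ac cb h; rewrite -lerBrDr; apply: ge_sup; first by exists 0, [::].
move=> _ [s [ps ls ->]]; rewrite lerBrDr -lerBrDl; apply: ge_sup; first by exists 0, [::].
move=> _ [t [pt lt ->]]; rewrite lerBrDl.
have [s' [ps' ls' le']] := pen_widen f ps ls.
apply: (@le_trans _ _ (pen f a (s' ++ t))).
  by rewrite pen_cat ls' lerD2r.
apply: (Vle_Vn h); first by rewrite cat_path ps' ls'.
by rewrite last_cat ls'.
Qed.

Lemma Vn_sub f a c b r : a <= c -> c <= b -> Vle f a b r -> Vn f a b <= Vn f a c + Vn f c b.
Proof.
move=> ac cb h; apply: Vn_le; first exact: le_trans cb.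
apply: (@Vle_cat _ _ c) => //; apply: (@Vle_Vn _ _ _ r); exact: Vle_sub h.
Qed.

Lemma Vle_lip f a b L : (forall x y, a <= x -> x < y -> y <= b -> enorm (f y - f x) <= L * (y - x)) ->
  a <= b -> Vle f a b (L `^ q * (b - a)).
Proof.
move=> h ab s ps ls; apply: (@le_trans _ _ (L `^ q * (last a s - a))); last first.
  by rewrite ler_wpM2l ?powR_ge0// lerD2r.
elim: s a h {ab} ps ls => [|x s IH] a h /=; first by rewrite subrr mulr0.
move=> /andP[ax xs] ls; have xb : x <= b by apply: le_trans (path_last_ge xs) ls.
apply: (@le_trans _ _ (L `^ q * (x - a) + L `^ q * (last x s - x))); last by rewrite le_eqVlt; apply/orP; left; apply/eqP; ring.
apply: lerD; last by apply: IH => // u v xu; apply: h; apply: le_trans xu; exact: ltW.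
by apply: pterm_lip; rewrite ?enorm_ge0 ?subr_gt0 ?(ltW q0)// h.
Qed.

Lemma Vle_dom f g a b r : (forall x y, a <= x -> x < y -> y <= b -> enorm (f y - f x) <= enorm (g y - g x)) ->
  Vle g a b r -> Vle f a b r.
Proof.
move=> h hg s ps ls; apply: le_trans (hg _ ps ls).
elim: s a h {hg} ps ls => //= x s IH a h /andP[ax xs] ls.
have xb : x <= b by apply: le_trans (path_last_ge xs) ls.
apply: lerD; first by apply: pterm_le; rewrite ?enorm_ge0 ?subr_gt0 ?(ltW q0)// h.
by apply: IH => // u v xu; apply: h; apply: le_trans xu; exact: ltW.
Qed.

Lemma Vle_add2 f f1 f2 t a b r1 r2 : 0 < t < 1 ->
  (forall x y, a <= x -> x < y -> y <= b ->
     enorm (f y - f x) <= enorm (f1 y - f1 x) + enorm (f2 y - f2 x)) ->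
  Vle f1 a b r1 -> Vle f2 a b r2 -> Vle f a b (wt q t * r1 + wt q (1 - t) * r2).
Proof.
move=> t01 h h1 h2 s ps ls; have /andP[t0 t1] := t01.
apply: (@le_trans _ _ (wt q t * pen f1 a s + wt q (1 - t) * pen f2 a s)); last first.
  apply: lerD; apply: ler_wpM2l; rewrite ?wt_ge0 ?subr_ge0 ?(ltW t0) ?(ltW t1)//; [exact: h1|exact: h2].
elim: s a h {h1 h2} ps ls => [|x s IH] a h /=; first by rewrite !mulr0 addr0.
move=> /andP[ax xs] ls; have xb : x <= b by apply: le_trans (path_last_ge xs) ls.
rewrite !mulrDr addrACA; apply: lerD; last first.
  by apply: IH => // u v xu; apply: h; apply: le_trans xu; exact: ltW.
apply: le_trans (pterm_split q1' t01 (enorm_ge0 _) (enorm_ge0 _) _); last by rewrite subr_gt0.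
by apply: pterm_le; rewrite ?enorm_ge0 ?subr_gt0 ?(ltW q0)// h.
Qed.

Lemma powR_abs_continuous : continuous (fun x : R => `|x| `^ q).
Proof.
move=> x; have [->|x0] := eqVneq x 0.
  apply/cvgrPdist_le => e e0; rewrite normr0 powR0 ?gt_eqF//.
  exists (e `^ q^-1); first exact: powR_gt0.
  move=> y /=; rewrite !sub0r !normrN => yl; rewrite ger0_norm ?powR_ge0//.
  apply: (@le_trans _ _ ((e `^ q^-1) `^ q)).
    by rewrite ge0_ler_powR ?nnegrE ?powR_ge0 ?(ltW q0)// ltW.
  by rewrite -powRrM mulVf ?gt_eqF// powRr1// ltW.
have c : {for `|x|, continuous (@powR R ^~ q)}.
  apply: differentiable_continuous; apply/derivable1_diffP.
  by apply: derivable_powR; rewrite in_itv /= andbT normr_gt0.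
exact: (@cvg_comp _ _ _ (fun x : R => `|x|) (@powR R ^~ q) _ _ _ (@norm_continuous _ _ x) c).
Qed.

Lemma cvg_enorm {K : Type} {F : set_system K} {FF : Filter F} (u : K -> 'rV[R]_n) l :
  enorm (u k - l) @[k --> F] --> 0 -> enorm (u k) @[k --> F] --> enorm l.
Proof.
move=> h; apply/cvgrPdist_le => e e0; move/cvgrPdist_le/(_ _ e0): h; apply: filterS => k.
rewrite sub0r normrN ger0_norm ?enorm_ge0// => h.
by rewrite distrC; apply: le_trans (ler_enorm_dist _ _) h.
Qed.

Lemma cvg_enormD {K : Type} {F : set_system K} {FF : Filter F} (u v : K -> 'rV[R]_n) l m :
  enorm (u k - l) @[k --> F] --> 0 -> enorm (v k - m) @[k --> F] --> 0 ->
  enorm (u k - v k - (l - m)) @[k --> F] --> 0.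
Proof.
move=> hu hv; apply: (@squeeze_cvgr _ _ _ _ (fun=> 0) (fun k => enorm (u k - l) + enorm (v k - m))).
- apply: nearW => k; rewrite enorm_ge0 /=.
  have -> : u k - v k - (l - m) = (u k - l) - (v k - m).
    by rewrite !opprB [m - l]addrC addrACA [- v k + m]addrC.
  exact: enormB.
- exact: cvg_cst.
- by rewrite -[0 in X in _ --> X]addr0; apply: cvgD.
Qed.

Lemma cvg_pterm {K : Type} {F : set_system K} {FF : Filter F} (x h : K -> R) (x0 h0 : R) :
  (forall k, 0 <= x k) -> 0 <= x0 -> 0 < h0 -> x @ F --> x0 -> h @ F --> h0 ->
  pterm q (x k) (h k) @[k --> F] --> pterm q x0 h0.
Proof.
move=> xp x0p h0p cx ch; rewrite /pterm; apply: cvgM => //.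
have c1 : (x k / h k) @[k --> F] --> x0 / h0 by apply: cvgM => //; apply: cvgV => //; rewrite gt_eqF.
have := @cvg_comp _ _ _ _ _ _ _ _ c1 (@powR_abs_continuous (x0 / h0)).
rewrite ger0_norm ?divr_ge0 ?(ltW h0p)//.
apply: cvg_trans; apply: near_eq_cvg.
move/cvgrPdist_lt/(_ _ h0p): ch; apply: filterS => k hk.
rewrite /= ger0_norm// divr_ge0//; move: hk; rewrite ltr_norml; lra.
Qed.

Lemma cvg_pen {K : Type} {F : set_system K} {FF : Filter F} (f_ : K -> R -> 'rV[R]_n) f a s :
  path <%R a s -> (forall t, t \in a :: s -> enorm (f_ k t - f t) @[k --> F] --> 0) ->
  pen (f_ k) a s @[k --> F] --> pen f a s.
Proof.
elim: s a => /= [|x s IH] a; first by move=> _ _; exact: cvg_cst.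
move=> /andP[ax xs] h; apply: cvgD; last first.
  by apply: IH => // t ts; apply: h; rewrite inE ts orbT.
apply: cvg_pterm; rewrite ?enorm_ge0 ?subr_gt0//; [by move=> k; rewrite enorm_ge0| |exact: cvg_cst].
by apply: cvg_enorm; apply: cvg_enormD; apply: h; rewrite !inE eqxx ?orbT.
Qed.

Lemma Vle_limit {K : Type} {F : set_system K} {FF : ProperFilter F} (f_ : K -> R -> 'rV[R]_n) f a b r :
  (forall t, a <= t <= b -> enorm (f_ k t - f t) @[k --> F] --> 0) ->
  (forall e, 0 < e -> \forall k \near F, Vle (f_ k) a b (r + e)) -> Vle f a b r.
Proof.
move=> h hV s ps ls; apply/ler_addgt0Pr => e e0.
have hc : pen (f_ k) a s @[k --> F] --> pen f a s.
  apply: cvg_pen => // t; rewrite inE => ts; apply: h.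
  have {ts} : a <= t <= last a s.
    elim: s a ps ts {ls hV} => [|x s IH] a /=; first by move=> _; rewrite orbF => /eqP ->; rewrite lexx.
    move=> /andP[ax xs]; rewrite inE => /orP[/eqP ->|ts].
      by rewrite lexx /= (le_trans (ltW ax))// path_last_ge.
    by have /andP[xt ->] := IH x xs ts; rewrite andbT (le_trans (ltW ax)).
  by move=> /andP[-> h2] /=; exact: le_trans ls.
rewrite -(cvg_lim (@Rhausdorff R) hc); apply: limr_le; first by apply/cvg_ex; eexists; exact: hc.
by have := hV e e0; apply: filterS => k; apply.
Qed.

(** The energy does not concentrate at [a]. The starting point of a nearly optimal partition of
    [[a, b]] can be moved to a nearby [t] at small loss, by right continuity; so [[t, b]] carries
    almost all the energy, and superadditivity leaves little for [[a, t]]. *)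
Lemma Vle_start f a b r : a < b -> Vle f a b r ->
  enorm (f t - f a) @[t --> a^'+] --> 0 ->
  forall e, 0 < e -> exists2 d, 0 < d & forall t, a <= t -> t <= a + d -> t <= b -> Vle f a t e.
Proof.
move=> ab hV fa e e0; have V := Vle_Vn hV.
have [s [ps ls] hs] : exists2 s, path <%R a s /\ last a s <= b & Vn f a b - e / 2 < pen f a s.
  have hsup : has_sup [set x | exists s, [/\ path <%R a s, last a s <= b & x = pen f a s]].
    split; first by exists 0, [::]; rewrite /= ltW.
    by exists r => _ [s' [ps' ls' ->]]; exact: hV.
  have [_ [s [ps ls ->]] h] := @sup_adherent _ _ (e / 2) (ltac:(by rewrite divr_gt0)) hsup.
  by exists s.
case: s ps ls hs => [|x s] /= ps ls hs.
  exists 1 => // t _ _ tb; apply: (@Vle_mono _ _ _ (Vn f a b)); last exact: Vle_sub V.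
  by move: e0; lra.
move: ps => /andP[ax xs].
have c : tm f t x @[t --> a^'+] --> tm f a x.
  apply: cvg_pterm; rewrite ?enorm_ge0 ?subr_gt0//; [by move=> k; rewrite enorm_ge0| |].
    apply: cvg_enorm; apply: cvg_enormD => //.
    by rewrite subrr enorm0; exact: cvg_cst.
  by apply: cvgB; [exact: cvg_cst|exact: cvg_within_filter cvg_id].
have e2 : 0 < e / 2 by rewrite divr_gt0.
move/cvgrPdist_lt/(_ _ e2): c => [d /= d0 hd].
exists (Num.min (d / 2) ((x - a) / 2)); first by rewrite lt_min !divr_gt0// subr_gt0.
move=> t at_ + tb; rewrite -lerBlDl le_min => /andP[td tx].
move: at_; rewrite le_eqVlt => /orP[/eqP <-|at_].
  apply: (@Vle_mono _ _ _ 0); first exact: ltW.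
  by move=> [|y l] //= /andP[ay yl] ly; have := le_trans (path_last_ge yl) ly; rewrite leNgt ay.
have {}tx : t < x by move: tx ax; lra.
have ht : ball_ Num.norm a d t by rewrite /= distrC gtr0_norm ?subr_gt0//; move: td d0; lra.
have := hd t ht at_; rewrite ltr_norml => /andP[_ ht2].
have h3 : Vn f a b - e <= Vn f t b.
  apply: (@le_trans _ _ (pen f t (x :: s))).
    by rewrite /=; move: hs ht2; lra.
  by apply: (@Vle_Vn _ _ _ r); [apply: Vle_sub hV => //; exact: ltW| rewrite /= tx|].
have := Vn_super (ltW at_) tb hV => h4.
apply: (@Vle_mono _ _ _ (Vn f a t)); first by lra.
by apply: (@Vle_Vn _ _ _ r); apply: Vle_sub hV.
Qed.

(** A product rule for increments: those of [c g] are at most [C0] times those of [g] plus a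
    Lipschitz term of constant [Lc * G]; the two parts are separated with weights 1/2. *)
Lemma Vle_scale (c : R -> R) g a b C0 Lc G r :
  (forall x, a <= x <= b -> `|c x| <= C0) ->
  (forall x y, a <= x -> x < y -> y <= b -> `|c y - c x| <= Lc * (y - x)) ->
  (forall x, a <= x <= b -> enorm (g x) <= G) -> a <= b -> Vle g a b r ->
  Vle (fun x => c x *: g x) a b
    (wt q 2^-1 * (C0 `^ q * r) + wt q 2^-1 * ((Lc * G) `^ q * (b - a))).
Proof.
move=> hC hL hG ab hg.
have G0 : 0 <= G by apply: le_trans (hG a _); rewrite ?lexx ?enorm_ge0.
have C00 : 0 <= C0 by apply: le_trans (hC a _); rewrite ?lexx.
have h12 : 0 < (2^-1 : R) < 1 by rewrite invr_gt0 ltr0n /= invf_lt1 ?ltr1n.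
have h2 : (1 - 2^-1 : R) = 2^-1 by field.
rewrite -[X in wt q X * (_ * (b - a))]h2.
pose f1 x := C0 *: g x.
pose f2 x : 'rV[R]_n := \row_(i < n) (Lc * G * x).
move=> s ps ls.
have H : pen (fun x => c x *: g x) a s <= wt q 2^-1 * (C0 `^ q * pen g a s) +
   wt q (1 - 2^-1) * ((Lc * G) `^ q * (last a s - a)).
  elim: s a hC hL hG {ab hg} ps ls => [|x s IH] a hC hL hG /=.
    by rewrite subrr !mulr0 addr0.
  move=> /andP[ax xs] ls; have xb : x <= b by apply: le_trans (path_last_ge xs) ls.
  have {}IH := IH x _ _ _ xs ls.
  have -> : wt q 2^-1 * (C0 `^ q * (tm g a x + pen g x s)) +
    wt q (1 - 2^-1) * ((Lc * G) `^ q * (last x s - a)) =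
    (wt q 2^-1 * (C0 `^ q * tm g a x) + wt q (1 - 2^-1) * ((Lc * G) `^ q * (x - a))) +
    (wt q 2^-1 * (C0 `^ q * pen g x s) + wt q (1 - 2^-1) * ((Lc * G) `^ q * (last x s - x))).
    by ring.
  apply: lerD; last first.
    apply: IH => [y /andP[xy yb]|y z xy|y /andP[xy yb]].
    - by apply: hC; rewrite yb andbT (le_trans (ltW ax)).
    - by apply: hL; apply: le_trans xy; exact: ltW.
    - by apply: hG; rewrite yb andbT (le_trans (ltW ax)).
  have xa0 : 0 < x - a by rewrite subr_gt0.
  have axb : a <= x <= b by rewrite (ltW ax).
  have aab : a <= a <= b by rewrite lexx (le_trans (ltW ax)).
  have step : enorm (c x *: g x - c a *: g a) <= C0 * enorm (g x - g a) + Lc * G * (x - a).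
    have -> : c x *: g x - c a *: g a = c x *: (g x - g a) + (c x - c a) *: g a.
      by rewrite scalerBr scalerBl addrA subrK.
    apply: le_trans (enormD _ _) _; rewrite !enormZ lerD//.
      by rewrite ler_wpM2r ?enorm_ge0// hC.
    by rewrite mulrAC ler_pM ?enorm_ge0 ?hG// hL.
  have LcG : 0 <= Lc * G * (x - a).
    by rewrite mulrAC mulr_ge0//; apply: le_trans (hL a x (lexx _) ax xb).
  apply: le_trans (pterm_le (ltW q0) (enorm_ge0 _) step xa0) _.
  apply: le_trans (pterm_split q1' h12 _ LcG xa0) _; first by rewrite mulr_ge0 ?enorm_ge0.
  rewrite lerD ?ler_wpM2l ?wt_ge0 ?h2 ?invr_ge0//; first by rewrite ptermM ?enorm_ge0.
  by apply: pterm_lip => //; exact: ltW.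
apply: le_trans H _; rewrite lerD// ler_wpM2l ?wt_ge0 ?h2 ?invr_ge0//.
  by rewrite ler_wpM2l ?powR_ge0// hg.
by rewrite ler_wpM2l ?powR_ge0// lerD2r.
Qed.

End penergy.

Lemma dist4 {R : realFieldType} (a b c d e f : R) : `|a - c| <= e / 2 -> `|b - d| <= e / 2 ->
  `|a - b| <= f -> `|c - d| <= e + f.
Proof.
rewrite !ler_norml => /andP[? ?] /andP[? ?] /andP[? ?]; apply/andP; split; lra.
Qed.

(** * Measurability of the derivative *)

Section derivative_measurable.
Context {R : realType}.
Local Notation rr := (@ratr R).

Section scalar.
Variable g : R -> R.
Hypothesis cg : continuous g.

Let Q (h x : R) := h^-1 * (g (h + x) - g x).

Let Qc h : continuous (Q h).
Proof.
move=> x; apply: cvgM; first exact: cvg_cst.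
apply: cvgB; last exact: cg.
by apply: (@cvg_comp _ _ _ (fun y => h + y) g); [apply: cvgD; [exact: cvg_cst|exact: cvg_id]|exact: cg].
Qed.

Let Qch x h : h != 0 -> {for h, continuous (Q ^~ x)}.
Proof.
move=> h0; apply: cvgM; first exact: cvgV.
apply: cvgB; last exact: cvg_cst.
by apply: (@cvg_comp _ _ _ (fun y => y + x) g); [apply: cvgD; [exact: cvg_id|exact: cvg_cst]|exact: cg].
Qed.

Let near0 (m : nat) (h : R) := (h != 0) && (`|h| < m.+1%:R^-1).

Let A (k m : nat) := \bigcap_(p in [set: rat * rat])
  [set x | near0 m (rr p.1) && near0 m (rr p.2) -> `|Q (rr p.1) x - Q (rr p.2) x| <= k.+1%:R^-1].

Let bigcap_rat2 (B : rat * rat -> set R) : (forall p, measurable (B p)) ->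
  measurable (\bigcap_(p in [set: rat * rat]) B p).
Proof.
move=> mB; have -> : \bigcap_(p in [set: rat * rat]) B p =
    \bigcap_(k in [set: nat]) (if (unpickle k : option (rat * rat)) is Some p then B p else setT).
  apply/seteqP; split=> x h.
    by move=> k _; case: unpickle => // p; exact: h.
  by move=> p _; have := h (pickle p) Logic.I; rewrite pickleK.
by apply: bigcap_measurable => [|k _]; [exists 0%N|case: unpickle].
Qed.

Let mA k m : measurable (A k m).
Proof.
apply: bigcap_rat2 => p; case: (near0 _ _ && near0 _ _); last first.
  by rewrite (_ : [set _ | _] = setT)//; apply/seteqP.
have -> : [set x | true -> `|Q (rr p.1) x - Q (rr p.2) x| <= k.+1%:R^-1] =
    (fun x => `|Q (rr p.1) x - Q (rr p.2) x|) @^-1` `]-oo, k.+1%:R^-1].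
  by apply/seteqP; split=> x /=; rewrite in_itv /=; [exact|].
rewrite -[X in measurable X]setTI; apply: (continuous_measurable_fun _ _) => //.
move=> x; apply: (@cvg_comp _ _ _ (fun y => Q (rr p.1) y - Q (rr p.2) y) (fun z => `|z|)); last exact: norm_continuous.
by apply: cvgB; exact: Qc.
Qed.

(** Cauchy's criterion for the difference quotients. They are continuous in the increment away from
    0, so rational increments suffice and the set is a countable combination of closed sets. *)
Let derivableE : [set x | derivable g x 1] = \bigcap_(k in [set: nat]) \bigcup_(m in [set: nat]) A k m.
Proof.
have QE x : (fun h : R => h^-1 *: ((g \o shift x) (h *: 1) - g x)) = Q ^~ x.
  by apply/funext => h; rewrite /Q /= /shift /GRing.scale /= mulr1.
apply/seteqP; split=> x /=.
  rewrite /derivable QE => /cvg_ex[l /cvgrPdist_le h] k _.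
  have [|d /= d0 hd] := h (k.+1%:R^-1 / 2); first by rewrite divr_gt0.
  exists (Num.bound d^-1) => // p _ /andP[/andP[p10 p1] /andP[p20 p2]].
  have bd (r : R) : `|r| < (Num.bound d^-1).+1%:R^-1 -> ball_ Num.norm 0 d r.
    move=> hr; rewrite /= sub0r normrN; apply: lt_le_trans hr _.
    rewrite -[leRHS]invrK lef_pV2 ?posrE ?invr_gt0//.
    apply/ltW/(lt_le_trans (archi_boundP _)); first by rewrite invr_ge0 ltW.
    by rewrite ler_nat.
  have := hd _ (bd _ p1) p10; have := hd _ (bd _ p2) p20.
  move=> h2 h1; apply: le_trans (ler_distD l _ _) _.
  by rewrite [leRHS]splitr lerD// distrC.
move=> h; rewrite /derivable QE; apply: cauchy_cvg; apply/cauchy_ballP => e e0.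
have [k ke] : exists k : nat, k.+1%:R^-1 < e :> R.
  exists (Num.bound e^-1); rewrite -[ltRHS]invrK ltf_pV2 ?posrE ?invr_gt0//.
  apply: (lt_le_trans (archi_boundP _)); first by rewrite invr_ge0 ltW.
  by rewrite ler_nat.
have [m _ hm] := h k Logic.I.
have real_h y y' : near0 m y -> near0 m y' -> `|Q y x - Q y' x| <= k.+1%:R^-1.
  move=> ny ny'; apply/ler_addgt0Pl => d d0.
  have d2 : 0 < d / 2 by rewrite divr_gt0.
  have approx z : near0 m z -> exists2 r : rat, near0 m (rr r) & `|Q (rr r) x - Q z x| <= d / 2.
    move=> /andP[z0 zm].
    have N1 : \forall r \near z, `|Q z x - Q r x| <= d / 2.
      by have /cvgrPdist_le/(_ _ d2) := @Qch x z z0.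
    have N2 : \forall r \near z, r != 0 by exact: (open_nbhs_nbhs (conj (@open_neq R 0) z0)) || apply: cvgr_neq0 z0; exact: cvg_id.
    have N3 : \forall r \near z, `|r| < m.+1%:R^-1.
      have c := @norm_continuous R R z; have := cvgr_lt _ c.
      exact.
    have [d' /= d'0 hd'] := filterI N1 (filterI N2 N3).
    have [r] := @rat_in_itvoo R z (z + d') (ltac:(by rewrite ltrDl)).
    rewrite in_itv /= => /andP[zr rz].
    have [h1 [h2 h3]] : `|Q z x - Q (rr r) x| <= d / 2 /\ rr r != 0 /\ `|rr r| < m.+1%:R^-1.
      by apply: hd' => /=; rewrite ltr_norml; apply/andP; split; lra.
    by exists r; [rewrite /near0 h2 h3|rewrite distrC].
  have [r nr hr] := approx y ny; have [r' nr' hr'] := approx y' ny'.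
  have := hm (r, r') Logic.I; rewrite /= nr nr' => /(_ isT).
  by move=> hb; apply: dist4 hr hr' hb.
have nb : \forall y \near (0 : R)^', near0 m y.
  exists m.+1%:R^-1 => //= y /=; rewrite sub0r normrN => yl y0.
  by rewrite /near0 y0 yl.
exists (Q ^~ x @` [set y | near0 m y], Q ^~ x @` [set y | near0 m y]) => /=.
  by split; apply: filterS nb => y ny /=; exists y.
move=> [_ _] [/= [y ny <-] [y' ny' <-]]; rewrite -ball_normE /=.
exact: le_lt_trans (real_h _ _ ny ny') ke.
Qed.

Lemma measurable_derivable : measurable [set x | derivable g x 1].
Proof.
rewrite derivableE; apply: bigcap_measurable => [|k _]; first by exists 0%N.
by apply: bigcup_measurable => m _; exact: mA.
Qed.

Lemma measurable_fun_derive1 : measurable_fun [set x | derivable g x 1] (derive1 g).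
Proof.
apply: (@measurable_fun_cvg _ _ _ _ (fun k => Q k.+1%:R^-1)).
  by move=> k; apply: measurable_funTS; apply: continuous_measurable_fun; exact: Qc.
move=> x dx.
have : Q ^~ x @ 0^' --> derive1 g x.
  have h : (h^-1 *: ((g \o shift x) (h *: 1) - g x)) @[h --> 0^'] --> derive1 g x.
    by rewrite derive1E; exact: dx.
  apply: cvg_trans h; apply: near_eq_cvg; near=> h.
  by rewrite /Q /= /shift /GRing.scale /= mulr1.
move=> /cvgrPdist_le h; apply/cvgrPdist_le => e e0.
have [d /= d0 hd] := h _ e0.
exists (Num.bound d^-1) => // k /= kb; apply: hd => //=.
rewrite sub0r normrN gtr0_norm ?invr_gt0// -[ltRHS]invrK ltf_pV2 ?posrE ?invr_gt0//.
apply: (lt_le_trans (archi_boundP _)); first by rewrite invr_ge0 ltW.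
by rewrite ler_nat ltnW.
Unshelve. all: by end_near. Qed.

End scalar.

Section vector.
Context {n : nat}.
Variable f : R -> 'rV[R]_n.
Hypothesis cf : forall i, continuous (fun x => f x ord0 i).

Lemma measurable_derivable_row : measurable [set x | derivable f x 1].
Proof.
have -> : [set x | derivable f x 1] = \big[setI/setT]_(i < n) [set x | derivable (fun y => f y ord0 i) x 1].
  rewrite -bigcap_seq; apply/seteqP; split=> x /=.
    by move=> /derivable_mxP h i _; exact: h.
  move=> h; apply/derivable_mxP => i j; rewrite ord1.
  by apply: (h j); rewrite /= mem_index_enum.
by apply: bigsetI_measurable => i _; exact: measurable_derivable.
Qed.

Lemma measurable_enorm_derive1 (q : R) : measurable_fun setT (fun x => enorm (derive1 f x) `^ q).
Proof.
pose D := [set x | derivable f x 1].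
have mD : measurable D by exact: measurable_derivable_row.
have -> : [set: R] = D `|` ~` D by rewrite setUv.
apply/measurable_funU => //; first exact: measurableC.
split; last first.
  (* Where [f] is not differentiable, [derive1] is the limit of a divergent filter, that is the
     default point. *)
  apply: (eq_measurable_fun (fun=> enorm (point : 'rV[R]_n) `^ q)) => // x; rewrite inE => nDx.
  by rewrite derive1E /derive dvgP.
apply: (@measurableT_comp _ _ _ _ _ _ (@powR R ^~ q)); first exact: measurable_powR.
rewrite /enorm /dotv.
apply: (@measurableT_comp _ _ _ _ _ _ (@Num.sqrt R)).
  by apply: continuous_measurable_fun; exact: sqrt_continuous.
apply: (eq_measurable_fun (fun x => \sum_(i < n) (derive1 (fun y => f y ord0 i) x * derive1 (fun y => f y ord0 i) x))).
  move=> x; rewrite inE => Dx; apply: eq_bigr => i _.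
  by rewrite [in RHS]derive1E derive_mx// mxE derive1E.
have h i : measurable_fun D (derive1 (fun y => f y ord0 i)).
  apply: (@measurable_funS _ _ _ _ [set x | derivable (fun y => f y ord0 i) x 1]).
  - exact: measurable_derivable.
  - by move=> x /derivable_mxP; exact.
  - exact: measurable_fun_derive1.
by apply: measurable_sum => i; apply: measurable_funM.
Qed.

End vector.
End derivative_measurable.

Lemma Rintegral_sum {R : realType} {d} {X : measurableType d} (m : {measure set X -> \bar R})
    (D : set X) (mD : measurable D) (I : Type) (s : seq I) (h : I -> X -> R) :
  (forall i, m.-integrable D (EFin \o h i)) ->
  (\int[m]_(x in D) (\sum_(i <- s) h i x) = \sum_(i <- s) \int[m]_(x in D) h i x)%R.
Proof.
move=> hi; rewrite /Rintegral.
under eq_integral do rewrite -sumEFin.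
rewrite (@integral_sum _ _ _ m D mD _ (fun i => EFin \o h i))//.
elim: s => [|i s IH]; first by rewrite !big_nil.
rewrite !big_cons fineD ?IH//; first exact: integrable_fin_num.
by rewrite sum_fin_num; elim: s {IH} => //= j s ->; rewrite andbT (integrable_fin_num mD (hi j)).
Qed.

(** * Partition energy and integral energy *)

Section energy_integral.
Context {R : realType} {n : nat}.
Variables (T : R) (f : R -> 'rV[R]_n) (q : R).
Hypotheses (T0 : 0 < T) (q1 : 1 < q) (acf : abs_cont_on T f).
Local Notation mu := (@lebesgue_measure R).
Implicit Types (psi : R -> 'rV[R]_n).

Let q0 : 0 < q. Proof. exact: lt_trans q1. Qed.

Lemma abs_cont_coord i : ac_scalar T (fun s => f s ord0 i).
Proof.
move=> e e0; have [d d0 h] := acf e0; exists d => // s /andP[s1 s2] ls.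
apply: le_lt_trans (h s _ _ ls).
- by apply: ler_sum => p _; have := enorm_coord (f p.2 - f p.1) i; rewrite !mxE.
- by move=> p /(allP s1) /and3P[-> -> ->].
- move=> a b /andP[ab bs]; apply/orP.
  move/(pairwiseP (0, 0)): s2; apply => //; rewrite inE; exact: ltn_trans bs.
Qed.

Lemma coord_clamp_continuous i : continuous (fun s => f (clamp T s) ord0 i).
Proof.
move=> x; apply/cvgrPdist_lt => e e0.
have [d d0 hd] := ac_continuous (abs_cont_coord i) e0.
have /andP[x0 xT] := clamp_itv x (ltW T0).
exists d => // y /=; have /andP[y0 yT] := clamp_itv y (ltW T0).
have [xy|yx] := leP x y.
  rewrite distrC ger0_norm ?subr_ge0// => h; rewrite distrC; apply: hd => //.
    exact: clamp_le.
  exact: le_lt_trans (clamp_dist (ltW T0) xy) h.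
rewrite ger0_norm ?subr_ge0 ?(ltW yx)// => h; apply: hd => //.
  by apply: clamp_le; exact: ltW.
exact: le_lt_trans (clamp_dist (ltW T0) (ltW yx)) h.
Qed.

(** An integrable representative of the derivative on the whole line; the values of [derive1 f] are
    meaningful only at interior points of differentiability. *)
Definition density psi :=
  [/\ forall i, mu.-integrable [set: R] (EFin \o (fun s => psi s ord0 i)),
      forall i x, 0 <= x <= T -> f x ord0 i - f 0 ord0 i = (\int[mu]_(t in `[0, x]) psi t ord0 i)%R &
      {ae mu, forall x, 0 < x < T -> derivable f x 1 /\ derive1 f x = psi x}].

Lemma density_exists : exists psi, density psi.
Proof.
have /choice[phi phiP] : forall i, exists phi : R -> R,
    [/\ mu.-integrable [set: R] (EFin \o phi),
    forall x, 0 <= x <= T -> f x ord0 i - f 0 ord0 i = (\int[mu]_(t in `[0, x]) phi t)%R &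
    {ae mu, forall x, 0 < x < T -> derivable (fun s => f s ord0 i) x 1 /\ derive1 (fun s => f s ord0 i) x = phi x}].
  by move=> i; have [phi h1 [h2 h3]] := ac_ftc T0 (abs_cont_coord i); exists phi.
exists (fun s => \row_i phi i s); split.
- move=> i; have [h _ _] := phiP i; congr (mu.-integrable _ _): h.
  by apply/funext => s /=; rewrite mxE.
- move=> i x x0T; have [_ h _] := phiP i; rewrite h//.
  by apply: eq_Rintegral => s _; rewrite mxE.
- have h i : {ae mu, forall x, 0 < x < T -> derivable (fun s => f s ord0 i) x 1 /\ derive1 (fun s => f s ord0 i) x = phi i x}.
    by have [] := phiP i.
  have FA := ae_filter_ringOfSetsType mu.
  have := @filter_forall _ _ _ _ FA h; apply: filterS => x hx x0T.
  have df : derivable f x 1.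
    by apply/derivable_mxP => i j; rewrite ord1; have [] := hx j x0T.
  split=> //; rewrite derive1E derive_mx//; apply/rowP => j.
  by rewrite !mxE -derive1E; have [] := hx j x0T.
Qed.

(** At 0 and [T] the value of [derive1 f] depends on [f] outside [[0, T]], so the end points are set
    apart; inside, [f] may be replaced by its clamped version, continuous on the line. *)
Lemma measurable_D2 : measurable_fun `[0, T] (fun s => enorm (derive1 f s) `^ q).
Proof.
apply: (@measurable_fun_itv_cc _ 0 T false true).
apply: (eq_measurable_fun (fun s => enorm (derive1 (fun x => f (clamp T x)) s) `^ q)).
  move=> x; rewrite inE /= in_itv /= => /andP[x0 xT].
  suff E : derive1 (fun x1 => f (clamp T x1)) x = derive1 f x by rewrite E.
  rewrite derive1E [RHS]derive1E; apply: near_eq_derive.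
  have y0 : \forall y \near x, 0 < y.
    have := @Nlt_nbhsl _ x 0; rewrite oppr_lt0 => /(_ x0).
    by apply: filterS => y; rewrite oppr_lt0.
  near=> y; rewrite clamp_id//; apply/andP; split; apply: ltW; near: y => //.
  exact: lt_nbhsl.
by apply: measurable_funTS; apply: measurable_enorm_derive1 => i; exact: coord_clamp_continuous.
Unshelve. all: by end_near. Qed.

Section with_density.
Variable psi : R -> 'rV[R]_n.
Hypothesis dpsi : density psi.

Let w s := enorm (psi s) `^ q.

Lemma measurable_density_pow : measurable_fun setT w.
Proof.
have [h _ _] := dpsi.
apply: (@measurableT_comp _ _ _ _ _ _ (@powR R ^~ q)); first exact: measurable_powR.
rewrite /enorm /dotv.
apply: (@measurableT_comp _ _ _ _ _ _ (@Num.sqrt R)).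
  by apply: continuous_measurable_fun; exact: sqrt_continuous.
have h' i : measurable_fun setT (fun s => psi s ord0 i).
  by have /integrableP[/measurable_EFinP] := h i.
by apply: measurable_sum => i; apply: measurable_funM.
Qed.

Lemma integral_D2_density :
  (\int[mu]_(s in I0T T) (enorm (derive1 f s) `^ q)%:E = \int[mu]_(s in I0T T) (w s)%:E)%E.
Proof.
have [_ _ h] := dpsi.
have m1 : measurable_fun `]0, T[ (fun s => enorm (derive1 f s) `^ q).
  by apply: measurable_funS measurable_D2 => //; exact: subset_itvW.
have m2 : measurable_fun `]0, T[ w by apply: measurable_funTS; exact: measurable_density_pow.
rewrite /I0T (integral_itv_bndoo true false); last exact/measurable_EFinP.
rewrite [RHS](integral_itv_bndoo true false); last exact/measurable_EFinP.
apply: ae_eq_integral => //; try exact/measurable_EFinP.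
move: h; apply: filterS; first exact: (ae_filter_ringOfSetsType mu).
move=> x hx /=; rewrite in_itv /= => x0T; have [_ e] := hx x0T.
by rewrite e.
Qed.

Lemma density_increment i a b : 0 <= a -> a <= b -> b <= T ->
  f b ord0 i - f a ord0 i = (\int[mu]_(t in `]a, b]) psi t ord0 i)%R.
Proof.
move=> a0 ab bT; have [h1 h2 _] := dpsi.
rewrite -(@Rintegral_itvB _ _ (BLeft 0) (BRight b) a) ?bnd_simp//; last exact: integrableS (h1 i).
rewrite -!h2 ?a0 ?(le_trans ab)//; first by ring.
by rewrite bT (le_trans a0).
Qed.

(** The graph of [y^q] lies above its tangent at [m]; derived from Young's inequality with the
    conjugate exponents [q] and [q / (q - 1)]. *)
Lemma young_tangent (m y : R) : 0 <= m -> 0 <= y -> q * (m `^ (q - 1) * y) <= y `^ q + (q - 1) * m `^ q.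
Proof.
move=> m0 y0; have q10 : 0 < q - 1 by rewrite subr_gt0.
have := @conjugate_powR R y (m `^ (q - 1)) q (q / (q - 1)) y0 (powR_ge0 _ _) q0 (divr_gt0 q0 q10).
have -> : q^-1 + (q / (q - 1))^-1 = 1 by field; rewrite !gt_eqF.
move=> /(_ erefl); rewrite -powRrM (_ : (q - 1) * (q / (q - 1)) = q); last by field; rewrite gt_eqF.
move=> h; rewrite mulrCA -(ler_pM2l (_ : 0 < q^-1)) ?invr_gt0//.
have -> : q^-1 * (m `^ (q - 1) * (q * y)) = y * m `^ (q - 1) by field; rewrite gt_eqF.
apply: le_trans h _; rewrite le_eqVlt; apply/orP; left; apply/eqP.
by field; rewrite !gt_eqF.
Qed.

(** Jensen's inequality on each interval of a partition, by integrating the supporting affine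
    function that [young_tangent] provides. *)
Lemma Vle_of_integral e : (\int[mu]_(s in I0T T) (w s)%:E <= e%:E)%E -> Vle q f 0 T e.
Proof.
move=> he; have [h1 h2 _] := dpsi.
have mw : measurable_fun `[0, T] (EFin \o w).
  by apply/measurable_EFinP; apply: measurable_funTS; exact: measurable_density_pow.
have wi : mu.-integrable `[0, T] (EFin \o w).
  apply/integrableP; split=> //; apply: le_lt_trans (ltry e).
  apply: le_trans he; rewrite le_eqVlt; apply/orP; left; apply/eqP.
  by apply: eq_integral => s _; rewrite /= ger0_norm// powR_ge0.
pose W x := (\int[mu]_(t in `[0, x]) w t)%R.
have wis a b : 0 <= a -> b <= T -> mu.-integrable `]a, b] (EFin \o w).
  move=> a0 bT; apply: integrableS wi => //.
  by apply: subset_itv; rewrite bnd_simp.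
have WE a b : 0 <= a -> a <= b -> b <= T -> W b - W a = (\int[mu]_(t in `]a, b]) w t)%R.
  move=> a0 ab bT; rewrite /W (@Rintegral_itvB _ _ (BLeft 0) (BRight b) a) ?bnd_simp//.
  by apply: integrableS wi => //; apply: subset_itv; rewrite bnd_simp.
have Wm a b : 0 <= a -> a <= b -> b <= T -> W a <= W b.
  by move=> a0 ab bT; rewrite -subr_ge0 WE// Rintegral_ge0// => s _; rewrite powR_ge0.
have W0 : 0 <= W 0 by rewrite Rintegral_ge0// => s _; rewrite powR_ge0.
have WT : W T <= e.
  rewrite -lee_fin /W /Rintegral fineK//; exact: integrable_fin_num.
have step a b : 0 <= a -> a < b -> b <= T ->
    pterm q (enorm (f b - f a)) (b - a) <= W b - W a.
  move=> a0 ab bT; set h := b - a; have h0 : 0 < h by rewrite subr_gt0.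
  rewrite WE ?(ltW ab)//.
  have [D0|D0] := eqVneq (enorm (f b - f a)) 0.
    by rewrite D0 pterm0// Rintegral_ge0// => s _; rewrite powR_ge0.
  have Dp : 0 < enorm (f b - f a) by rewrite lt_def D0 enorm_ge0.
  set m := enorm (f b - f a) / h; have m0 : 0 <= m by rewrite divr_ge0 ?enorm_ge0// ltW.
  (* The gradient of [|.|^q / q] at the mean slope [(f b - f a) / h], a vector of norm [m]. *)
  pose p : 'rV[R]_n := (m `^ (q - 1) / enorm (f b - f a)) *: (f b - f a).
  have np : enorm p = m `^ (q - 1).
    rewrite enormZ ger0_norm ?divr_ge0 ?powR_ge0 ?enorm_ge0//.
    by rewrite divfK.
  have mab : measurable (`]a, b] : set (measurableTypeR R)) by [].
  have pi i : mu.-integrable `]a, b] (EFin \o (fun s => psi s ord0 i)).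
    exact: integrableS (h1 i).
  have pii i : mu.-integrable `]a, b] (EFin \o (fun s => p ord0 i * psi s ord0 i)).
    by have := integrableZl mab (p ord0 i) (pi i).
  have ip : mu.-integrable `]a, b] (EFin \o (fun s => dotv p (psi s))).
    rewrite /dotv; have := @integrable_sum _ _ _ mu _ mab _ (index_enum 'I_n) predT _ (fun i _ => pii i).
    by apply: eq_integrable => // s _ /=; rewrite sumEFin.
  have ic : mu.-integrable `]a, b] (EFin \o (fun=> (q - 1) * m `^ q)).
    apply: measurable_bounded_integrable => //.
    - by rewrite /= lebesgue_measure_itv /=; case: ifP => _; rewrite -?EFinB ltry.
    - by apply: bounded_cst.
  have E1 : (\int[mu]_(s in `]a, b]) dotv p (psi s))%R = m `^ q * h.
    transitivity (dotv p (f b - f a)).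
      rewrite /dotv (Rintegral_sum mab)//; apply: eq_bigr => i _.
      by rewrite RintegralZl// !mxE -density_increment// ltW.
    rewrite /p dotvZl -enorm_sqr expr2 mulrA divfK// -(mulr_powRB1 m0 q0) mulrC.
    by rewrite [RHS]mulrAC /m divfK// gt_eqF.
  have E2 : (\int[mu]_(s in `]a, b]) ((q - 1) * m `^ q))%R = (q - 1) * m `^ q * h.
    rewrite Rintegral_cst// /= lebesgue_measure_itv /= lte_fin ab.
    by rewrite -EFinB.
  have : (\int[mu]_(s in `]a, b]) (q * dotv p (psi s)) <= \int[mu]_(s in `]a, b]) (w s + (q - 1) * m `^ q))%R.
    apply: le_Rintegral => //.
    - by have := integrableZl mab q ip.
    - by have := integrableD mab (wis a b a0 bT) ic.
    - move=> s _; apply: le_trans (young_tangent m0 (enorm_ge0 (psi s))).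
      by rewrite ler_pM2l// -np cauchy_schwarz.
  rewrite RintegralZl// RintegralD ?E1 ?E2//; last exact: wis.
  rewrite /pterm -/m -/h; lra.
move=> s ps ls; apply: le_trans WT.
suff : pen q f 0 s <= W (last 0 s) - W 0.
  have := Wm (last 0 s) T (path_last_ge ps) ls (lexx T).
  move: W0; lra.
have G : forall s a, 0 <= a -> path <%R a s -> last a s <= T -> pen q f a s <= W (last a s) - W a.
  elim=> [|x s' IH] a a0 /=; first by rewrite subrr.
  move=> /andP[ax xs] lx; have x0 : 0 <= x by apply: le_trans a0 (ltW ax).
  have xT : x <= T by apply: le_trans (path_last_ge xs) lx.
  have := IH x x0 xs lx; have := step a x a0 ax xT; lra.
exact: G.
Qed.

End with_density.

Lemma pen_steps (g : R -> 'rV[R]_n) (t : nat -> R) j m :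
  pen q g (t j) [seq t i.+1 | i <- iota j m] =
  \sum_(i <- iota j m) pterm q (enorm (g (t i.+1) - g (t i))) (t i.+1 - t i).
Proof.
elim: m j => [|m IH] j /=; first by rewrite big_nil.
by rewrite big_cons IH.
Qed.

Lemma steps_path (t : nat -> R) j m : (forall i, t i < t i.+1) ->
  path <%R (t j) [seq t i.+1 | i <- iota j m] /\ last (t j) [seq t i.+1 | i <- iota j m] = t (j + m)%N.
Proof.
move=> ht; elim: m j => [|m IH] j /=; first by rewrite addn0.
by have [h1 h2] := IH j.+1; rewrite ht h1 h2 addSnnS.
Qed.

(** Both end points may move, but since they enclose [s] their first order errors add up to at most
    [e * (b - a)]. Grid intervals containing [s] are of this kind. *)
Lemma straddle_quotient s : derivable f s 1 -> forall e, 0 < e -> exists2 d, 0 < d &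
  forall a b, a < s -> s <= b -> b - a < d -> enorm ((b - a)^-1 *: (f b - f a) - derive1 f s) <= e.
Proof.
move=> df e e0; have [d d0 hd] : exists2 d, 0 < d & forall h, `|h| < d ->
    enorm (f (s + h) - f s - h *: derive1 f s) <= e * `|h|.
  have C0 : 0 < n%:R + 1 :> R by rewrite ltr_wpDl.
  move: df => /cvg_ex[l hl]; have -> : derive1 f s = l.
    by rewrite derive1E; apply: cvg_lim hl.
  move/cvgrPdist_le: hl => /(_ (e / (n%:R + 1)) (divr_gt0 e0 C0)).
  rewrite /= /at_right /within /= => -[d /= d0 hd]; exists d => // h hd'.
  have [->|h0] := eqVneq h 0; first by rewrite addr0 subrr scale0r subrr enorm0 normr0 mulr0.
  have := hd h; rewrite /= sub0r normrN => /(_ hd' h0) hh.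
  have -> : f (s + h) - f s - h *: l = - h *: (l - h^-1 *: (f (h *: 1 + s) - f s)).
    have -> : h *: 1 + s = s + h by rewrite /GRing.scale /= mulr1 addrC.
    by apply/rowP => i; rewrite !mxE; field.
  rewrite enormZ normrN mulrC ler_wpM2r//.
  apply: le_trans (enorm_le_mxnorm _) _.
  apply: (@le_trans _ _ ((n%:R + 1) * (e / (n%:R + 1)))).
    by apply: ler_pM => //; rewrite lerDl.
  by rewrite mulrC divfK// gt_eqF.
exists d => // a b las lsb lab; have ab0 : 0 < b - a by rewrite subr_gt0; apply: lt_le_trans lsb.
have hb : enorm (f b - f s - (b - s) *: derive1 f s) <= e * (b - s).
  have := hd (b - s); rewrite ger0_norm ?subr_ge0// (addrC s) subrK; apply.
  by apply: le_lt_trans lab; rewrite lerD2l lerN2 ltW.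
have ha : enorm (f a - f s - (a - s) *: derive1 f s) <= e * (s - a).
  have := hd (a - s); rewrite ler0_norm ?subr_le0 ?(ltW las)// opprB (_ : s + (a - s) = a); last by ring.
  apply.
  by apply: le_lt_trans lab; rewrite lerD2r.
have -> : (b - a)^-1 *: (f b - f a) - derive1 f s = (b - a)^-1 *:
    ((f b - f s - (b - s) *: derive1 f s) - (f a - f s - (a - s) *: derive1 f s)).
  apply/rowP => i; rewrite !mxE; field; rewrite gt_eqF//.
rewrite enormZ ger0_norm ?invr_ge0 ?(ltW ab0)// ler_pdivrMl//.
by apply: le_trans (enormB _ _) _; move: ha hb; lra.
Qed.

Section step_slopes.
Variable r : R.
Hypothesis V : Vle q f 0 T r.

Let t k i : R := T * i%:R / k.+1%:R.
Let c k i := (enorm (f (t k i.+1) - f (t k i)) / (t k i.+1 - t k i)) `^ q.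
Let u k s := \sum_(i <- iota 0 k.+1) c k i * \1_(`]t k i, t k i.+1]) s.

Let k0 k : 0 < k.+1%:R :> R. Proof. by rewrite ltr0n. Qed.

Let t_step k i : t k i.+1 - t k i = T / k.+1%:R.
Proof. by rewrite /t -[i.+1]addn1 natrD; field; rewrite gt_eqF. Qed.

Let t_lt k i : t k i < t k i.+1.
Proof. by rewrite -subr_gt0 t_step divr_gt0. Qed.

Let t_le k i j : (i <= j)%N -> t k i <= t k j.
Proof. by move=> ij; rewrite /t ler_pM2r ?invr_gt0// ler_pM2l// ler_nat. Qed.

Let u_ge0 k s : 0 <= u k s.
Proof. by apply: sumr_ge0 => i _; rewrite mulr_ge0 ?powR_ge0. Qed.

Let mu_step k i : measurable_fun setT (fun s => c k i * \1_(`]t k i, t k i.+1]) s).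
Proof. by apply: measurable_funM => //; apply: measurable_indic. Qed.

Let u_int k : (\int[mu]_(s in I0T T) (u k s)%:E <= r%:E)%E.
Proof.
have mI : measurable (I0T T : set (measurableTypeR R)) by exact: measurable_itv.
under eq_integral do rewrite /u -sumEFin.
rewrite ge0_integral_sum//; first last.
- by move=> i s _; rewrite lee_fin mulr_ge0 ?powR_ge0.
- by move=> i; apply/measurable_EFinP; apply: measurable_funTS; exact: mu_step.
have [ps ls] := @steps_path (t k) 0 k.+1 (t_lt k).
have t0 : t k 0 = 0 by rewrite /t mulr0 mul0r.
have tk : t k k.+1 = T by rewrite /t mulfK// gt_eqF.
have := V; rewrite /Vle => /(_ [seq t k i.+1 | i <- iota 0 k.+1]).
rewrite -{1 2 3}t0 ps ls add0n tk lexx => /(_ erefl erefl).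
rewrite pen_steps -lee_fin; apply: le_trans.
rewrite -sumEFin; apply: lee_sum => i _.
under eq_integral do rewrite EFinM.
rewrite ge0_integralZl//; last 2 first.
- by apply/measurable_EFinP; apply: measurable_funTS; exact: measurable_indic.
- by rewrite lee_fin powR_ge0.
rewrite integral_indic// /pterm (mulrC (_ - _)) EFinM; apply: lee_pmul => //.
- by rewrite lee_fin powR_ge0.
apply: le_trans (_ : (mu `]t k i, t k i.+1] <= _)%E).
  by apply: le_measure; rewrite ?inE//; exact: measurableI.
by rewrite lebesgue_measure_itv /= lte_fin t_lt.
Qed.

Let u_eq k s : 0 < s <= T -> exists i, [/\ t k i < s, s <= t k i.+1 & u k s = c k i].
Proof.
move=> /andP[s0 sT]; have P : exists i, s <= t k i.
  by exists k.+1; rewrite /t mulfK// gt_eqF.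
case: (ex_minnP P) => -[|i] hi hmin; first by move: hi; rewrite /t mulr0 mul0r leNgt s0.
have ti : t k i < s.
  by rewrite ltNge; apply/negP => /hmin; rewrite ltnn.
exists i; split=> //.
have ik : (i < k.+1)%N.
  by apply: hmin; rewrite /t mulfK// gt_eqF.
rewrite /u (bigD1_seq i) ?mem_iota ?iota_uniq//= big1 ?addr0.
  by rewrite indicE mem_set ?mulr1//= in_itv /= ti hi.
move=> j ji; rewrite indicE memNset ?mulr0//= in_itv /= => /andP[h1 h2].
move: ji; rewrite neq_ltn => /orP[] ji.
- by have := lt_le_trans ti (le_trans h2 (t_le k ji)); rewrite ltxx.
- by have := lt_le_trans h1 (le_trans hi (t_le k ji)); rewrite ltxx.
Qed.

Let u_cvg s : 0 < s <= T -> derivable f s 1 -> u ^~ s @ \oo --> enorm (derive1 f s) `^ q.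
Proof.
move=> s0T df.
apply/cvgrPdist_lt => e e0.
have [d d0 hd] : exists2 d, 0 < d & forall y, `|enorm (derive1 f s) - y| < d ->
    `|enorm (derive1 f s) `^ q - `|y| `^ q| < e.
  have := @powR_abs_continuous R q q1 (enorm (derive1 f s)) => /cvgrPdist_lt/(_ _ e0)[d /= d0 hd].
  by exists d => // y hy; have := hd y hy; rewrite (ger0_norm (enorm_ge0 _)).
have d2 : 0 < d / 2 by rewrite divr_gt0.
have [h h0 hh] := straddle_quotient df d2.
near=> k.
have [i [i1 i2 ->]] := u_eq k s0T; rewrite /c.
have tp : 0 < t k i.+1 - t k i by rewrite subr_gt0.
have NN : 0 <= enorm (f (t k i.+1) - f (t k i)) / (t k i.+1 - t k i).
  by rewrite divr_ge0 ?enorm_ge0// ltW.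
rewrite -[X in `|_ - X `^ q|](ger0_norm NN); apply: hd.
have small : t k i.+1 - t k i < h.
  rewrite t_step ltr_pdivrMr//; near: k; exists (Num.bound (T / h)) => // k /= hk.
  rewrite mulrC -ltr_pdivrMr//; apply: lt_le_trans (archi_boundP _) _; first by rewrite divr_ge0 ?ltW.
  by rewrite ler_nat leqW.
have := hh _ _ i1 i2 small; rewrite distrC.
have -> : enorm (f (t k i.+1) - f (t k i)) / (t k i.+1 - t k i) =
    enorm ((t k i.+1 - t k i)^-1 *: (f (t k i.+1) - f (t k i))).
  by rewrite enormZ ger0_norm ?invr_ge0 ?(ltW tp)// mulrC.
move=> h1; apply: le_lt_trans (ler_enorm_dist _ _) _.
by apply: le_lt_trans h1 _; rewrite ltr_pdivrMr// ltr_pMr// ltr1n.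
Unshelve. all: by end_near. Qed.

(** Fatou's lemma for the slopes on uniform grids: their integrals are bounded by partition sums,
    hence by [r], and they converge almost everywhere to [|f'|^q]. *)
Lemma integral_of_Vle : (\int[mu]_(s in I0T T) (enorm (derive1 f s) `^ q)%:E <= r%:E)%E.
Proof.
have mI : measurable (I0T T : set (measurableTypeR R)) by exact: measurable_itv.
have [psi dpsi] := density_exists; have [_ _ hae] := dpsi.
apply: (@le_trans _ _ (\int[mu]_(s in I0T T) limn_einf (fun k => (u k s)%:E))%E).
  have ml : measurable_fun `]0, T[ (fun s => limn_einf (fun k => (u k s)%:E)).
    apply: measurableT_comp => //; apply: measurable_fun_limn_esup => k.
    apply: measurableT_comp => //; apply/measurable_EFinP; apply: measurable_funTS.
    by apply: measurable_sum => i; exact: mu_step.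
  have m1 : measurable_fun `]0, T[ (fun s => (enorm (derive1 f s) `^ q)%:E).
    by apply/measurable_EFinP; apply: measurable_funS measurable_D2 => //; exact: subset_itvW.
  rewrite /I0T (integral_itv_bndoo true false)// [leRHS](integral_itv_bndoo true false)//.
  rewrite le_eqVlt; apply/orP; left; apply/eqP; apply: ae_eq_integral => //.
  move: hae; apply: filterS; first exact: (ae_filter_ringOfSetsType mu).
  move=> x hx /=; rewrite in_itv /= => x0T; have [dx _] := hx x0T.
  have cu : (fun k => (u k x)%:E) @ \oo --> (enorm (derive1 f x) `^ q)%:E.
    apply: cvg_EFin; first by apply: nearW.
    by apply: u_cvg => //; move: x0T => /andP[-> /ltW ->].
  by rewrite (cvg_limn_einf_sup cu).1.
apply: le_trans; first apply: fatou => //.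
- by move=> k; apply/measurable_EFinP; apply: measurable_funTS; apply: measurable_sum => i; exact: mu_step.
- by move=> k s _; rewrite lee_fin.
rewrite limn_einf_lim; apply: lime_le; first exact: is_cvg_einfs.
near=> k; apply: le_trans (u_int k); apply: ereal_inf_lbound; by exists k => /=.
Unshelve. all: by end_near. Qed.

End step_slopes.

End energy_integral.

Section monotone_family.
Context {R : realType}.
Implicit Types (a b : R) (s : seq (R * R)).

(** All intervals lie to the left of the one with the largest right end [p.2], hence in [[a, p.1]],
    and induction on their number applies. A degenerate interval could sit at [p.2]; such intervals
    contribute nothing and are removed beforehand. *)
Lemma monotone_family_sum (v : R -> R) a b s : a <= b ->
  (forall x y, a <= x -> x <= y -> y <= b -> v x <= v y) -> family a b s ->
  \sum_(p <- s) (v p.2 - v p.1) <= v b - v a.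
Proof.
have maxP (l : seq (R * R)) : l != [::] -> exists l1 p l2, l = l1 ++ [:: p] ++ l2 /\ forall p', p' \in l -> p'.2 <= p.2.
  elim: l => // p l IH _; have [->|/IH[l1 [p' [l2 [-> h]]]]] := eqVneq l [::].
    by exists [::], p, [::]; split=> // p'; rewrite inE => /eqP ->.
  have [pp|pp] := leP p.2 p'.2.
    by exists (p :: l1), p', l2; split=> // y; rewrite inE => /orP[/eqP ->//|/h].
  exists [::], p, (l1 ++ [:: p'] ++ l2); split=> // y; rewrite inE => /orP[/eqP ->//|/h yp].
  exact: le_trans yp (ltW pp).
move=> ab0 vm0 fs0.
have -> : \sum_(p <- s) (v p.2 - v p.1) = \sum_(p <- [seq p <- s | p.1 < p.2]) (v p.2 - v p.1).
  rewrite big_filter [RHS]big_mkcond /=; apply: eq_big_seq => p /=.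
  move: fs0 => /andP[/allP h _] /h /and3P[_ p12 _]; case: ifPn => //.
  by rewrite -leNgt => p21; rewrite (@le_anti _ _ p.1 p.2) ?subrr// p12.
have fs1 : family a b [seq p <- s | p.1 < p.2].
  move: fs0 => /andP[h1 h2]; apply/andP; split.
    by apply/allP => p; rewrite mem_filter => /andP[_ /(allP h1)].
  exact: pairwise_filter.
have : all (fun p => p.1 < p.2) [seq p <- s | p.1 < p.2] by exact: filter_all.
move: [seq p <- s | _] fs1 => {fs0}s fs.
move: {2}(size s) (leqnn (size s)) => m; elim: m s b ab0 vm0 fs => [|m IH] s b ab vm fs sm ps.
  by move: sm; rewrite leqn0 size_eq0 => /eqP ->; rewrite big_nil subr_ge0 vm.
have [->|/maxP[l1 [p [l2 [E hp]]]]] := eqVneq s [::]; first by rewrite big_nil subr_ge0 vm.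
subst s; move: fs; rewrite family_catCA => fs.
have P : perm_eq (l1 ++ [:: p] ++ l2) ([:: p] ++ l1 ++ l2) by rewrite perm_catCA.
rewrite (perm_big _ P) /= big_cons.
move: fs => /andP[/= /andP[/and3P[ap1 p12 p2b] hin] /andP[hp1 hpw]].
have p1b := le_trans p12 p2b.
have := IH (l1 ++ l2) p.1 ap1; have := vm _ _ (le_trans ap1 p12) p2b (lexx b).
move=> v2 /(_ _ _ _ _)-IH'.
suff : \sum_(j <- l1 ++ l2) (v j.2 - v j.1) <= v p.1 - v a by move: v2; lra.
apply: IH'.
- by move=> x y ax xy yp; apply: vm => //; exact: le_trans p1b.
- apply/andP; split=> //; apply/allP => p' p'l.
  have /and3P[q1 q2 q3] := allP hin _ p'l; apply/and3P; split=> //.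
  have p's : p' \in l1 ++ [:: p] ++ l2 by rewrite (perm_mem P) inE p'l orbT.
  have p'p := hp _ p's; have p'lt := allP ps _ p's.
  have /orP[|//] := allP hp1 _ p'l => h.
  by have := lt_le_trans p'lt (le_trans p'p h); rewrite ltxx.
- by move: sm; rewrite (perm_size P) /= ltnS.
- by apply/allP => y yl; apply: (allP ps); rewrite (perm_mem P) inE yl orbT.
Qed.

End monotone_family.

(** Young's inequality bounds each increment by a small multiple of its energy term plus a multiple
    of its length. The energy terms are dominated by the increments of the nondecreasing function
    [v], whose total increment is at most [r]. *)
Lemma Vle_abs_cont {R : realType} {n} (q T : R) (f : R -> 'rV[R]_n) r : 1 < q -> 0 <= T ->
  Vle q f 0 T r -> abs_cont_on T f.
Proof.
move=> q1 T0 V e e0; have r0 := Vle_ge0 T0 V.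
have k0 : 0 < e / (2 * (r + 1)) by rewrite divr_gt0// mulr_gt0// ltr_wpDl.
have [K K0 hK] := pterm_young q1 k0.
exists (e / (2 * K)); first by rewrite divr_gt0// mulr_gt0.
move=> s s1 s2 ls.
have fs : family 0 T s.
  apply/andP; split; first by apply/allP => p /s1 [/andP[h1 h2] h3]; apply/and3P.
  by apply/(pairwiseP (0, 0)) => i j _ js ij; apply/orP; apply: s2; rewrite ij.
pose v t := Vn q f 0 t.
have vstep x y : 0 <= x -> x < y -> y <= T -> pterm q (enorm (f y - f x)) (y - x) <= v y - v x.
  move=> x0 xy yT; have Vy : Vle q f 0 y r by apply: Vle_sub V.
  have := Vn_super x0 (ltW xy) Vy.
  have Vxy : Vle q f x y r by apply: Vle_sub V.
  have := Vle_term (lexx x) xy (lexx y) (Vle_Vn Vxy); rewrite /v; lra.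
have vm x y : 0 <= x -> x <= y -> y <= T -> v x <= v y.
  move=> x0 xy yT; have [->//|xy'] := eqVneq x y.
  have {}xy : x < y by rewrite lt_neqAle xy' xy.
  rewrite -subr_ge0.
  apply: le_trans (vstep _ _ x0 xy yT); apply: pterm_ge0; by rewrite subr_ge0 ltW.
have vT : v T - v 0 <= r.
  have := Vn_le T0 V; have : 0 <= v 0 by apply: (@Vn_ge0 _ _ _ _ _ _ r) => //; apply: Vle_sub V.
  rewrite /v; lra.
apply: (@le_lt_trans _ _ (e / (2 * (r + 1)) * \sum_(p <- s) (v p.2 - v p.1) + K * \sum_(p <- s) (p.2 - p.1))).
  rewrite !mulr_sumr -big_split /=; apply: ler_sum_in => p ps _.
  have [/andP[p1 p12] p2] := s1 _ ps; move: p12; rewrite le_eqVlt => /orP[/eqP->|p12].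
    by rewrite !subrr enorm0 !mulr0 addr0.
  apply: le_trans (hK _ (p.2 - p.1) (enorm_ge0 _) _) _; first by rewrite subr_gt0.
  by rewrite lerD2r ler_pM2l// vstep.
have := monotone_family_sum T0 vm fs => hv.
have h1 : e / (2 * (r + 1)) * \sum_(p <- s) (v p.2 - v p.1) <= e / 2.
  apply: (@le_trans _ _ (e / (2 * (r + 1)) * (r + 1))).
    by rewrite ler_pM2l//; apply: le_trans hv _; move: vT; lra.
  rewrite le_eqVlt; apply/orP; left; apply/eqP; field.
  by rewrite gt_eqF// ltr_wpDl.
have h2 : K * \sum_(p <- s) (p.2 - p.1) < e / 2.
  apply: (@lt_le_trans _ _ (K * (e / (2 * K)))); first by rewrite ltr_pM2l.
  rewrite le_eqVlt; apply/orP; left; apply/eqP; field; by rewrite gt_eqF.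
lra.
Qed.

(** * Spaces of paths *)

Section real_within_derivative.
Context {R : realType}.
Implicit Types (a b c s t : R) (f g : R -> R).

(* [g] is the derivative of [f] on the closed interval, one-sided at its end points. *)
Definition hasd1 a b f g := forall s, a <= s <= b -> forall e, 0 < e -> exists2 d, 0 < d &
  forall t, a <= t <= b -> `|t - s| < d -> `|f t - f s - (t - s) * g s| <= e * `|t - s|.

Lemma hasd1_bound a b f g : hasd1 a b f g -> forall s, a <= s <= b -> exists2 d, 0 < d &
  forall t, a <= t <= b -> `|t - s| < d -> `|f t - f s| <= (`|g s| + 1) * `|t - s|.
Proof.
move=> h s sab; have [d d0 hd] := h s sab 1 ltr01; exists d => // t tab td.
have := hd t tab td; have := ler_normD (f t - f s - (t - s) * g s) ((t - s) * g s).
by rewrite subrK normrM; lra.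
Qed.

Lemma hasd1_cont a b f g : hasd1 a b f g -> forall s, a <= s <= b -> forall e, 0 < e -> exists2 d, 0 < d &
  forall t, a <= t <= b -> `|t - s| < d -> `|f t - f s| <= e.
Proof.
move=> h s sab e e0; have [d d0 hd] := hasd1_bound h sab.
have g0 : 0 < `|g s| + 1 by rewrite ltr_wpDl.
exists (Num.min d (e / (`|g s| + 1))); first by rewrite lt_min d0 divr_gt0.
move=> t tab; rewrite lt_min => /andP[td te]; apply: le_trans (hd t tab td) _.
by rewrite mulrC -ler_pdivlMr// ltW.
Qed.

Lemma hasd1_sub a b a' b' f g : a <= a' -> b' <= b -> hasd1 a b f g -> hasd1 a' b' f g.
Proof.
move=> aa bb h s /andP[s1 s2] e e0; have [|d d0 hd] := h s _ e e0.
  by rewrite (le_trans aa s1) (le_trans s2 bb).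
exists d => // t /andP[t1 t2]; apply: hd.
by rewrite (le_trans aa t1) (le_trans t2 bb).
Qed.

Lemma hasd1_ext a b f g f' g' : (forall t, a <= t <= b -> f t = f' t) -> (forall t, a <= t <= b -> g t = g' t) ->
  hasd1 a b f g -> hasd1 a b f' g'.
Proof.
move=> ff gg h s sab e e0; have [d d0 hd] := h s sab e e0; exists d => // t tab.
by rewrite -!ff// -gg//; exact: hd.
Qed.

Lemma hasd1_cst a b k : hasd1 a b (fun=> k) (fun=> 0).
Proof.
move=> s sab e e0; exists 1 => // t _ _; rewrite subrr mulr0 subrr normr0.
by rewrite mulr_ge0// ltW.
Qed.

Lemma hasd1_id a b : hasd1 a b id (fun=> 1).
Proof.
move=> s sab e e0; exists 1 => // t _ _; rewrite mulr1 subrr normr0.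
by rewrite mulr_ge0// ltW.
Qed.

Lemma hasd1D a b f g f' g' : hasd1 a b f f' -> hasd1 a b g g' -> hasd1 a b (f \+ g) (f' \+ g').
Proof.
move=> hf hg s sab e e0; have e2 : 0 < e / 2 by rewrite divr_gt0.
have [d d0 hd] := hf s sab _ e2; have [d' d'0 hd'] := hg s sab _ e2.
exists (Num.min d d'); first by rewrite lt_min d0.
move=> t tab; rewrite lt_min => /andP[/(hd _ tab) h1 /(hd' _ tab) h2] /=.
have -> : f t + g t - (f s + g s) - (t - s) * (f' s + g' s) =
  (f t - f s - (t - s) * f' s) + (g t - g s - (t - s) * g' s) by ring.
by apply: le_trans (ler_normD _ _) _; move: h1 h2; lra.
Qed.

Lemma hasd1M a b f g f' g' : hasd1 a b f f' -> hasd1 a b g g' ->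
  hasd1 a b (f \* g) (fun t => f' t * g t + f t * g' t).
Proof.
move=> hf hg s sab e e0.
pose K := `|f s| + `|g s| + `|g' s| + 2.
have K0 : 0 < K by rewrite /K ltr_wpDl// !addr_ge0.
have e2 : 0 < e / (3 * K) by rewrite divr_gt0// mulr_gt0.
have [d d0 hd] := hf s sab _ e2; have [d' d'0 hd'] := hg s sab _ e2.
have [c c0 hc] := hasd1_cont hf sab (ltr01 : 0 < 1 :> R).
have [c' c'0 hc'] := hasd1_cont hf sab e2.
exists (Num.min (Num.min d d') (Num.min c c')); first by rewrite !lt_min d0 d'0 c0.
move=> t tab; rewrite !lt_min => /andP[/andP[/(hd _ tab) h1 /(hd' _ tab) h2] /andP[/(hc _ tab) h3 /(hc' _ tab) h4]] /=.
have -> : f t * g t - f s * g s - (t - s) * (f' s * g s + f s * g' s) =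
  f t * (g t - g s - (t - s) * g' s) + g s * (f t - f s - (t - s) * f' s) + (t - s) * g' s * (f t - f s) by ring.
have ft : `|f t| <= K.
  have := ler_normD (f t - f s) (f s); rewrite subrK /K.
  by have := normr_ge0 (g s); have := normr_ge0 (g' s); move: h3; lra.
apply: le_trans (ler_normD _ _) _; apply: le_trans (lerD (ler_normD _ _) (lexx _)) _.
rewrite !normrM.
have gs : `|g s| <= K by rewrite /K; have := normr_ge0 (f s); have := normr_ge0 (g' s); lra.
have gs' : `|g' s| <= K by rewrite /K; have := normr_ge0 (f s); have := normr_ge0 (g s); lra.
have E : e = 3 * (K * (e / (3 * K))) by field; rewrite gt_eqF.
set x := `|t - s| in h1 h2 *; have x0 : 0 <= x by rewrite /x.
have k1 : `|f t| * `|g t - g s - (t - s) * g' s| <= K * (e / (3 * K) * x) by apply: ler_pM.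
have k2 : `|g s| * `|f t - f s - (t - s) * f' s| <= K * (e / (3 * K) * x) by apply: ler_pM.
have k3 : x * `|g' s| * `|f t - f s| <= x * K * (e / (3 * K)) by apply: ler_pM => //; [exact: mulr_ge0|exact: ler_wpM2l].
rewrite [in leRHS]E; move: k1 k2 k3; set y := e / (3 * K); move: (`|f t| * _) (`|g s| * _) (x * _ * `|_|) => *; lra.
Qed.

Lemma hasd1Z a b k f f' : hasd1 a b f f' -> hasd1 a b (fun t => k * f t) (fun t => k * f' t).
Proof.
move=> h; have := hasd1M (@hasd1_cst a b k) h; apply: hasd1_ext => t _ //=.
by rewrite mul0r add0r.
Qed.

Lemma hasd1N a b f f' : hasd1 a b f f' -> hasd1 a b (\- f) (\- f').
Proof. by move/(hasd1Z (-1)); apply: hasd1_ext => t _ /=; rewrite mulN1r. Qed.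

Lemma hasd1_glue a c b f g f' g' : a <= c -> c <= b -> hasd1 a c f f' -> hasd1 c b g g' ->
  f c = g c -> f' c = g' c ->
  hasd1 a b (fun t => if t <= c then f t else g t) (fun t => if t <= c then f' t else g' t).
Proof.
move=> ac cb hf hg fg fg' s /andP[as_ sb] e e0.
have [sc|cs|sc] := ltgtP s c.
- have [|d d0 hd] := hf s _ e e0; first by rewrite as_ ltW.
  exists (Num.min d (c - s)); first by rewrite lt_min d0 subr_gt0.
  move=> t /andP[at_ tb]; rewrite lt_min => /andP[td tc].
  have {}tc : t <= c by have := ler_norm (t - s); move: tc; lra.
  by rewrite tc; apply: hd => //; rewrite at_.
- have [|d d0 hd] := hg s _ e e0; first by rewrite sb ltW.
  exists (Num.min d (s - c)); first by rewrite lt_min d0 subr_gt0.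
  move=> t /andP[at_ tb]; rewrite lt_min => /andP[td tc].
  have {}tc : c < t by have := ler_norm (s - t); rewrite distrC; move: tc; lra.
  rewrite (lt_geF tc); apply: hd => //; rewrite tb ltW//.
- subst s; have [|d d0 hd] := hf c _ e e0; first by rewrite ac lexx.
  have [|d' d'0 hd'] := hg c _ e e0; first by rewrite cb lexx.
  exists (Num.min d d'); first by rewrite lt_min d0.
  move=> t /andP[at_ tb]; rewrite lt_min => /andP[td td'].
  have [tc|ct] := leP t c; first by apply: hd => //; rewrite at_.
  by rewrite fg fg'; apply: hd' => //; rewrite tb ltW.
Qed.

Lemma hasd1_MVT a b f f' : a < b -> hasd1 a b f f' ->
  exists2 c, a < c < b & f b - f a = f' c * (b - a).
Proof.
move=> ab h.
have D x : x \in `]a, b[ -> is_derive x (1 : R) f (f' x).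
  rewrite in_itv /= => /andP[ax xb].
  have C : (fun t : R => t^-1 *: (f (t *: (1 : R) + x) - f x)) @ 0^' --> f' x.
    apply/cvgrPdist_le => e e0; have [|d d0 hd] := h x _ e e0; first by rewrite !ltW.
    exists (Num.min d (Num.min (x - a) (b - x))); first by rewrite /= !lt_min d0 !subr_gt0 ax.
    move=> t /=; rewrite sub0r normrN !lt_min => /andP[td /andP[ta tb]] t0.
    have -> : t *: (1 : R) + x = x + t by rewrite /GRing.scale /= mulr1 addrC.
    have := hd (x + t); rewrite (_ : x + t - x = t); last by ring.
    have h1 := ler_norm t; have h2 := ler_norm (- t); rewrite normrN in h2.
    move=> /(_ _ td) hh; rewrite -(ler_pM2r (_ : 0 < `|t|)) ?normr_gt0//.
    rewrite -normrM.
    rewrite (_ : (_ - _) * t = - (f (x + t) - f x - t * f' x)); last first.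
      by rewrite /GRing.scale /=; field.
    rewrite normrN.
    by apply: hh; move: ta tb; lra.
  apply: DeriveDef; first by apply/cvg_ex; exists (f' x).
  exact: cvg_lim C.
have K : {within `[a, b], continuous f}.
  apply/subspace_continuousP => x /=; rewrite in_itv /= => xab.
  apply/cvgrPdist_le => e e0; have [d d0 hd] := hasd1_cont h xab e0.
  exists d => // t /= td; rewrite in_itv /= => tab; rewrite distrC; apply: hd => //.
  by rewrite distrC.
have [c] := MVT ab D K; rewrite in_itv /= => cab E; by exists c.
Qed.

End real_within_derivative.

(** * Derivatives of vector-valued paths *)

Section path_derivative.
Context {R : realType} {n : nat}.
Implicit Types (a b c s t e M : R) (f g v : R -> 'rV[R]_n).

Definition hasd a b f v := forall i, hasd1 a b (fun t => f t ord0 i) (fun t => v t ord0 i).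

Lemma hasd_enorm a b f v : hasd a b f v -> forall s, a <= s <= b -> forall e, 0 < e -> exists2 d, 0 < d &
  forall t, a <= t <= b -> `|t - s| < d -> enorm (f t - f s - (t - s) *: v s) <= e * `|t - s|.
Proof.
move=> h s sab e e0; have n0 : 0 < n%:R + 1 :> R by rewrite ltr_wpDl.
have /choice[d hd] : forall i, exists d, 0 < d /\ forall t, a <= t <= b -> `|t - s| < d ->
    `|f t ord0 i - f s ord0 i - (t - s) * v s ord0 i| <= (e / (n%:R + 1)) * `|t - s|.
  by move=> i; have [d d0 hd] := h i s sab (e / (n%:R + 1)) (divr_gt0 e0 n0); exists d.
exists (\big[Num.min/1]_i d i).
  by apply/bigmin_gtP; split=> // i _; have [] := hd i.
move=> t tab td; apply: le_trans (enorm_le_sum _) _.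
apply: (@le_trans _ _ (\sum_(i < n) (e / (n%:R + 1) * `|t - s|))).
  apply: ler_sum => i _; rewrite !mxE; have [_] := hd i; apply => //.
  by apply: lt_le_trans td _; exact: bigmin_le.
rewrite sumr_const card_ord -[_ *+ n]mulr_natr -[leLHS]mulrA [`|_| * _]mulrC mulrA ler_wpM2r//.
rewrite mulrAC ler_pdivrMr// ler_pM2l// lerDl//.
Qed.

Lemma hasd_of_enorm a b f v : (forall s, a <= s <= b -> forall e, 0 < e -> exists2 d, 0 < d &
  forall t, a <= t <= b -> `|t - s| < d -> enorm (f t - f s - (t - s) *: v s) <= e * `|t - s|) -> hasd a b f v.
Proof.
move=> h i s sab e e0; have [d d0 hd] := h s sab e e0; exists d => // t tab td.
by apply: le_trans (hd t tab td); have := enorm_coord (f t - f s - (t - s) *: v s) i; rewrite !mxE.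
Qed.

(** The scalar mean value theorem, applied to the projection of [f] on the direction of the error
    [D] itself. *)
Lemma hasd_mean_value a b f v (w : 'rV[R]_n) M : a <= b -> hasd a b f v ->
  (forall c, a < c < b -> enorm (v c - w) <= M) -> enorm (f b - f a - (b - a) *: w) <= M * (b - a).
Proof.
rewrite le_eqVlt => /orP[/eqP -> _ _|ab h hM]; first by rewrite !subrr scale0r subrr enorm0 mulr0.
set D := f b - f a - (b - a) *: w.
have [D0|D0] := eqVneq (enorm D) 0.
  rewrite D0; have ab2 : a < (a + b) / 2 < b by apply/andP; split; lra.
  by rewrite mulr_ge0 ?subr_ge0 ?(ltW ab)// (le_trans (enorm_ge0 _) (hM _ ab2)).
have Dp : 0 < enorm D by rewrite lt_def D0 enorm_ge0.
have h1 : hasd1 a b (fun t => dotv D (f t)) (fun t => dotv D (v t)).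
  rewrite /dotv; elim: (index_enum _) => [|i l IH].
    by have := @hasd1_cst R a b 0; apply: hasd1_ext => t _; rewrite big_nil.
  by have := hasd1D (hasd1Z (D ord0 i) (h i)) IH; apply: hasd1_ext => t _; rewrite /= big_cons.
have [c cab E] := hasd1_MVT ab h1.
have E2 : enorm D ^+ 2 = (b - a) * dotv D (v c - w).
  rewrite enorm_sqr {2}/D !dotvDr !dotvNr dotvZr E; ring.
have := cauchy_schwarz D (v c - w).
rewrite -(ler_pM2l (_ : 0 < b - a)) ?subr_gt0// -E2 expr2 mulrCA ler_pM2l// => h2.
by apply: le_trans h2 _; rewrite mulrC ler_pM2r ?subr_gt0// hM.
Qed.

Lemma hasd_sub a b a' b' f v : a <= a' -> b' <= b -> hasd a b f v -> hasd a' b' f v.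
Proof. by move=> aa bb h i; exact: hasd1_sub (h i). Qed.

Lemma hasd_ext a b f v f' v' : (forall t, a <= t <= b -> f t = f' t) -> (forall t, a <= t <= b -> v t = v' t) ->
  hasd a b f v -> hasd a b f' v'.
Proof. by move=> ff vv h i; apply: hasd1_ext (h i) => t tab; rewrite ?ff ?vv. Qed.

Lemma hasd_cst a b u : hasd a b (fun=> u) (fun=> 0).
Proof. by move=> i; have := @hasd1_cst R a b (u ord0 i); apply: hasd1_ext => t _; rewrite ?mxE. Qed.

Lemma hasdD a b f v f' v' : hasd a b f v -> hasd a b f' v' ->
  hasd a b (fun t => f t + f' t) (fun t => v t + v' t).
Proof. by move=> h h' i; apply: hasd1_ext (hasd1D (h i) (h' i)) => t _; rewrite /= mxE. Qed.

Lemma hasdZ a b (k k' : R -> R) f v : hasd1 a b k k' -> hasd a b f v ->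
  hasd a b (fun t => k t *: f t) (fun t => k' t *: f t + k t *: v t).
Proof. by move=> h h' i; apply: hasd1_ext (hasd1M h (h' i)) => t _; rewrite /= !mxE. Qed.

Lemma hasdN a b f v : hasd a b f v -> hasd a b (fun t => - f t) (fun t => - v t).
Proof. by move=> h i; apply: hasd1_ext (hasd1N (h i)) => t _; rewrite /= !mxE. Qed.

Lemma hasd_glue a c b f g v w : a <= c -> c <= b -> hasd a c f v -> hasd c b g w ->
  f c = g c -> v c = w c ->
  hasd a b (fun t => if t <= c then f t else g t) (fun t => if t <= c then v t else w t).
Proof.
move=> ac cb h1 h2 fg vw i.
apply: hasd1_ext (hasd1_glue ac cb (h1 i) (h2 i) _ _) => [t _|t _||]; rewrite ?fg ?vw//; by case: ifP.
Qed.

Lemma hasd_limit a b f v (f_ v_ : nat -> R -> 'rV[R]_n) : (forall k, hasd a b (f_ k) (v_ k)) ->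
  (forall t, a <= t <= b -> enorm (f_ k t - f t) @[k --> \oo] --> 0) ->
  (forall e, 0 < e -> \forall k \near \oo, forall t, a <= t <= b -> enorm (v_ k t - v t) <= e) ->
  (forall s, a <= s <= b -> forall e, 0 < e -> exists2 d, 0 < d & forall t, a <= t <= b -> `|t - s| < d -> enorm (v t - v s) <= e) ->
  hasd a b f v.
Proof.
move=> h hf hv vc; apply: hasd_of_enorm => s sab e e0.
have e3 : 0 < e / 2 by rewrite divr_gt0.
have [d d0 hd] := vc s sab _ e3; exists d => // t tab td.
have key k : (forall t, a <= t <= b -> enorm (v_ k t - v t) <= e / 2) ->
    enorm (f_ k t - f_ k s - (t - s) *: v s) <= e * `|t - s|.
  move=> hk.
  have hM c : a <= c <= b -> `|c - s| < d -> enorm (v_ k c - v s) <= e.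
    move=> cab cd; apply: le_trans (enorm_dist_trans _ (v c) _) _.
    by have := hk c cab; have := hd c cab cd; lra.
  have [st|ts] := leP s t.
    rewrite ger0_norm ?subr_ge0//; apply: (@hasd_mean_value _ _ _ (v_ k)) => //.
      by apply: hasd_sub (h k); [case/andP: sab|case/andP: tab].
    move=> c /andP[sc ct]; apply: hM.
      by move: sab tab => /andP[? ?] /andP[? ?]; rewrite (le_trans _ (ltW sc))// (le_trans (ltW ct)).
    by apply: le_lt_trans td; rewrite !ger0_norm ?subr_ge0// ?(ltW sc)// lerD2r ltW.
  rewrite -enormN distrC ger0_norm ?subr_ge0 ?(ltW ts)//.
  have -> : - (f_ k t - f_ k s - (t - s) *: v s) = f_ k s - f_ k t - (s - t) *: v s.
    by apply/rowP => i; rewrite !mxE; ring.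
  apply: (@hasd_mean_value _ _ _ (v_ k)); first exact: ltW.
    by apply: hasd_sub (h k); [case/andP: tab|case/andP: sab].
  move=> c /andP[tc cs]; apply: hM.
    by move: sab tab => /andP[? ?] /andP[? ?]; rewrite (le_trans _ (ltW tc))// (le_trans (ltW cs)).
  apply: le_lt_trans td; rewrite distrC [leRHS]distrC !ger0_norm ?subr_ge0 ?(ltW cs) ?(ltW ts)//.
  by rewrite lerD2l lerN2 ltW.
have C : enorm (f_ k t - f_ k s - (t - s) *: v s) @[k --> \oo] --> enorm (f t - f s - (t - s) *: v s).
  apply: cvg_enorm; have := cvg_enormD (hf t tab) (hf s sab).
  have -> : (fun k => enorm (f_ k t - f_ k s - (f t - f s))) =
      (fun k => enorm (f_ k t - f_ k s - (t - s) *: v s - (f t - f s - (t - s) *: v s))).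
    by apply/funext => k; congr enorm; apply/rowP => i; rewrite !mxE; ring.
  exact.
apply: (cvgr_to_le C).
by move: (hv _ e3); apply: filterS => k; exact: key.
Qed.

Variable T : R.
Hypothesis T0 : 0 < T.

Lemma hasd_Dp f v : hasd 0 T f v -> forall s, 0 <= s <= T ->
  (dquot f s @ within [set h | 0 <= s + h <= T] 0^' --> v s) /\ Dp T f s = v s.
Proof.
move=> h s s0T; have C : dquot f s @ within [set h | 0 <= s + h <= T] 0^' --> v s.
  apply/cvgrPdist_le => e e0; have [d d0 hd] := hasd_enorm h s0T e0.
  exists d => // t /=; rewrite sub0r normrN => td t0 stT.
  have := hd (s + t) stT; rewrite (_ : s + t - s = t); last by ring.
  move=> /(_ td) hh; apply: le_trans (mxnorm_le_enorm _) _.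
  rewrite -(ler_pM2r (_ : 0 < `|t|)) ?normr_gt0// mulrC -enormZ.
  apply: le_trans hh; rewrite -enormN le_eqVlt; apply/orP; left; apply/eqP; congr enorm.
  by apply/rowP => i; rewrite !mxE; field.
split=> //; apply: (@cvg_lim _ _ _ _ _ _ _ C) => //.
apply: Build_ProperFilter_ex => A [d /= d0 hd].
(* Uniqueness of the limit requires arbitrarily small increments that stay in [[0, T]]: [h0] from
   the left half, [- h0] from the right half. *)
pose h0 := Num.min (d / 2) (T / 2).
have h00 : 0 < h0 by rewrite lt_min !divr_gt0.
have h0d : h0 < d by rewrite /h0 gt_min; apply/orP; left; lra.
have h0T : h0 <= T / 2 by rewrite ge_min lexx orbT.
have [sT|sT] := leP s (T / 2).
  exists h0; apply: hd; rewrite /= ?sub0r ?normrN ?gtr0_norm// ?gt_eqF//.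
  by move: s0T => /andP[? ?]; apply/andP; split; lra.
exists (- h0); apply: hd; rewrite /= ?sub0r ?opprK ?gtr0_norm// ?oppr_eq0 ?gt_eqF//.
by move: s0T => /andP[? ?]; apply/andP; split; lra.
Qed.

Lemma dquot_hasd f : (forall s, 0 <= s <= T -> dquot f s @ within [set h | 0 <= s + h <= T] 0^' --> Dp T f s) ->
  hasd 0 T f (Dp T f).
Proof.
move=> h; apply: hasd_of_enorm => s s0T e e0.
have n0 : 0 < n%:R + 1 :> R by rewrite ltr_wpDl.
have := h s s0T => /cvgrPdist_le /(_ (e / (n%:R + 1)) (divr_gt0 e0 n0)).
move=> [d /= d0 hd]; exists d => // t t0T td.
have [->|ts] := eqVneq t s; first by rewrite !subrr scale0r subrr enorm0 normr0 mulr0.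
have := hd (t - s); rewrite /= sub0r normrN subr_eq0 => /(_ td ts).
rewrite /dquot (_ : s + (t - s) = t); last by ring.
move=> /(_ t0T) hh.
have -> : f t - f s - (t - s) *: Dp T f s = - (t - s) *: (Dp T f s - (t - s)^-1 *: (f t - f s)).
  by apply/rowP => i; rewrite !mxE; field; rewrite subr_eq0.
rewrite enormZ normrN mulrC ler_wpM2r//; apply: le_trans (enorm_le_mxnorm _) _.
apply: (@le_trans _ _ ((n%:R + 1) * (e / (n%:R + 1)))); last by rewrite mulrC divfK// gt_eqF.
by apply: ler_pM => //; rewrite lerDl.
Qed.

End path_derivative.

Lemma Vle_ext {R : realType} {n} (q : R) (f g : R -> 'rV[R]_n) a b r :
  1 < q -> (forall t, a <= t <= b -> f t = g t) -> Vle q f a b r -> Vle q g a b r.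
Proof.
move=> q1 fg; apply: (Vle_dom q1) => x y ax xy yb.
by rewrite !fg// ?ax ?yb ?(le_trans (ltW xy) yb) ?(le_trans ax (ltW xy)).
Qed.

Lemma cvg_rsum {R : realType} {K : Type} {F : set_system K} {FF : Filter F} (I : Type) (r : seq I)
    (f : I -> K -> R) (l : I -> R) : (forall i, f i @ F --> l i) ->
  \sum_(i <- r) f i k @[k --> F] --> \sum_(i <- r) l i.
Proof.
move=> h; elim: r => [|i r IH].
  by rewrite big_nil; under eq_fun do rewrite big_nil; exact: cvg_cst.
by rewrite big_cons; under eq_fun do rewrite big_cons; exact: cvgD.
Qed.

Lemma cvg_row {R : realType} {n} {K : Type} {F : set_system K} {FF : Filter F} (u : K -> 'rV[R]_n) (l : 'rV[R]_n) :
  (forall i, (fun k => u k ord0 i) @ F --> l ord0 i) -> enorm (u k - l) @[k --> F] --> 0.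
Proof.
move=> h; apply: (@squeeze_cvgr _ _ _ _ (fun=> 0) (fun k => \sum_(i < n) `|u k ord0 i - l ord0 i|)).
- apply: nearW => k; rewrite enorm_ge0 /=; apply: le_trans (enorm_le_sum _) _.
  by apply: ler_sum => i _; rewrite !mxE.
- exact: cvg_cst.
- have := @cvg_rsum R K F FF _ (index_enum 'I_n) (fun i k => `|u k ord0 i - l ord0 i|) (fun=> 0).
  rewrite big1//; apply => i.
  have := cvg_norm (cvgB (h i) (cvg_cst (l ord0 i))); rewrite subrr normr0.
  exact.
Qed.

Lemma closure_enormP {R : realType} {n} (A : set 'rV[R]_n) x :
  closure A x <-> forall e, 0 < e -> exists2 y, A y & enorm (x - y) < e.
Proof.
split=> [cA e e0|h B /nbhs_ballP[e /= e0 eB]].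
  have n0 : 0 < n%:R + 1 :> R by rewrite ltr_wpDl.
  have [y [Ay]] := cA _ (nbhsx_ballx x (e / (n%:R + 1)) (divr_gt0 e0 n0)).
  rewrite -ball_normE /= => xy; exists y => //.
  apply: le_lt_trans (enorm_le_mxnorm _) _.
  apply: (@le_lt_trans _ _ ((n%:R + 1) * `|x - y|)); first by rewrite ler_wpM2r// lerDl.
  by rewrite mulrC -ltr_pdivlMr.
have [y Ay xy] := h e e0; exists y; split=> //; apply: eB; rewrite -ball_normE /=.
exact: le_lt_trans (mxnorm_le_enorm _) xy.
Qed.

Lemma split3 {R : numFieldType} (e : R) : e = e / 3 + (e / 3 + e / 3).
Proof. by field. Qed.

Section relatively_compact.
Context {X : Type} (S : set X) (near : X -> X -> Prop).

(** Without a finite net, points chosen greedily would form a sequence with no near pair. [near] is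
    an arbitrary relation so that a net can control the energy as well as the distance. *)
Lemma finite_net : (forall u : nat -> X, (forall k, S (u k)) -> exists i j, (i < j)%N /\ near (u i) (u j)) ->
  exists l : list X, (forall y, List.In y l -> S y) /\ forall x, S x -> exists2 y, List.In y l & near y x.
Proof.
move=> h; apply: contrapT => /forallNP hn.
have /choice[g hg] : forall l : list X, exists x, (forall y, List.In y l -> S y) -> S x /\ forall y, List.In y l -> ~ near y x.
  move=> l; have [hl|hl] := pselect (forall y, List.In y l -> S y); last first.
    have [[x _]|e] := pselect (exists x : X, True); first by exists x.
    by case: hl => y _; case: e; exists y.
  have := hn l => /not_andP[//|/existsNP[x /not_implyP[Sx hx]]].
  by exists x => _; split=> // y yl yx; apply: hx; exists y.
pose L := fix L k := if k is k'.+1 then g (L k') :: L k' else [::].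
have LS k : forall y, List.In y (L k) -> S y.
  elim: k => //= k IH y [<-|]; last exact: IH.
  by have [] := hg (L k) IH.
have Lin i j : (i < j)%N -> List.In (g (L i)) (L j).
  elim: j => //= j IH; rewrite ltnS leq_eqVlt => /orP[/eqP ->|/IH]; first by left.
  by right.
have [|i [j [ij nij]]] := h (fun k => g (L k)).
  by move=> k; have [] := hg (L k) (LS k).
by have [_ /(_ _ (Lin i j ij))] := hg (L j) (LS j).
Qed.

End relatively_compact.

(** * Compactness of the energy sublevels *)

Section path_space.
Context {R : realType} {n : nat}.
Variables (Om : set 'rV[R]_n) (q T : R).
Hypotheses (q1 : 1 < q) (T0 : 0 < T).
Implicit Types (xi eta : R -> 'rV[R]_n) (c e r : R).

Definition c1le xi eta c := forall s, 0 <= s <= T ->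
  enorm (xi s - eta s) + enorm (Dp T xi s - Dp T eta s) <= c.

Lemma pathballE xi eta e : pathball T xi e eta <-> exists2 c, c < e & c1le xi eta c.
Proof. by split. Qed.

Lemma c1leC xi eta c : c1le xi eta c -> c1le eta xi c.
Proof. by move=> h s sT; rewrite enorm_distC [X in _ + X]enorm_distC; exact: h. Qed.

Lemma c1le_trans xi eta zeta c e : c1le xi eta c -> c1le eta zeta e -> c1le xi zeta (c + e).
Proof.
move=> h h' s sT; apply: le_trans (lerD (h s sT) (h' s sT)).
by rewrite addrACA lerD// enorm_dist_trans.
Qed.

Lemma c1le_le xi eta c e : c <= e -> c1le xi eta c -> c1le xi eta e.
Proof. by move=> ce h s /h /le_trans; apply. Qed.

Lemma c1le_refl xi c : 0 <= c -> c1le xi xi c.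
Proof. by move=> c0 s _; rewrite !subrr enorm0 addr0. Qed.

Lemma abs_cont_unif (f : R -> 'rV[R]_n) : abs_cont_on T f -> forall e, 0 < e -> exists2 d, 0 < d &
  forall s t, 0 <= s <= T -> 0 <= t <= T -> `|t - s| < d -> enorm (f t - f s) <= e.
Proof.
move=> af e e0; have [d d0 hd] := af e e0; exists d => //.
have key s t : 0 <= s -> s <= t -> t <= T -> t - s < d -> enorm (f t - f s) <= e.
  move=> s0 st tT l; have := hd [:: (s, t)]; rewrite !big_seq1 /= => h; apply: ltW; apply: h => //.
    by move=> p; rewrite inE => /eqP -> /=; rewrite s0 st tT.
  by move=> i [|j] /andP[].
move=> s t /andP[s0 sT] /andP[t0 tT]; have [st|ts] := leP s t.
  by rewrite ger0_norm ?subr_ge0//; exact: key.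
by rewrite enorm_distC distrC ger0_norm ?subr_ge0 ?(ltW ts)//; apply: key => //; exact: ltW.
Qed.

Lemma Gam_hasd xi : Gam Om T xi -> hasd 0 T xi (Dp T xi).
Proof. by move=> [h _ _ _]; exact: dquot_hasd. Qed.

Lemma Gam_intro xi v : hasd 0 T xi v -> abs_cont_on T v -> (forall s, 0 <= s <= T -> closure Om (xi s)) ->
  Gam Om T xi /\ forall s, 0 <= s <= T -> Dp T xi s = v s.
Proof.
move=> h av cl; have hD := hasd_Dp T0 h.
have DE s : 0 <= s <= T -> Dp T xi s = v s by move=> /hD[].
have aD : abs_cont_on T (Dp T xi).
  move=> e e0; have [d d0 hd] := av e e0; exists d => // s s1 s2 ls.
  apply: le_lt_trans (hd s s1 s2 ls); apply: ler_sum_in => p /s1[/andP[p0 p12] pT] _.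
  by rewrite !DE// ?p0 ?pT ?(le_trans p12 pT) ?(le_trans p0 p12).
split=> //; split=> //.
  by move=> s sT; rewrite DE//; have [] := hD s sT.
apply/subspace_continuousP => x /=; rewrite in_itv /= => xT.
apply/cvgrPdist_le => e e0; have [d d0 hd] := abs_cont_unif aD e0.
exists d => // t /= td; rewrite in_itv /= => tT.
apply: le_trans (mxnorm_le_enorm _) _; apply: hd => //.
Qed.

Lemma Gam_mean_value xi s t (w : 'rV[R]_n) M : Gam Om T xi -> 0 <= s -> s <= t -> t <= T ->
  (forall c, 0 <= c <= T -> enorm (Dp T xi c - w) <= M) -> enorm (xi t - xi s - (t - s) *: w) <= M * (t - s).
Proof.
move=> G s0 st tT hM; apply: (@hasd_mean_value _ _ _ _ _ (Dp T xi)) => //.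
  by apply: hasd_sub (Gam_hasd G).
by move=> c /andP[sc ct]; apply: hM; rewrite (le_trans s0 (ltW sc)) (le_trans (ltW ct)).
Qed.

Definition energy r := [set xi | Gam Om T xi /\ Vle q (Dp T xi) 0 T r].

Lemma energy_mono r r' : r <= r' -> energy r `<=` energy r'.
Proof. by move=> rr xi [G V]; split=> //; exact: Vle_mono V. Qed.

Lemma energy_intro xi v r : hasd 0 T xi v -> Vle q v 0 T r -> (forall s, 0 <= s <= T -> closure Om (xi s)) ->
  energy r xi /\ forall s, 0 <= s <= T -> Dp T xi s = v s.
Proof.
move=> h V cl; have [G E] := Gam_intro h (Vle_abs_cont q1 (ltW T0) V) cl.
by split=> //; split=> //; apply: (Vle_ext q1 _ V) => t tT; rewrite E.
Qed.

Lemma energy_modulus r e : 0 < e -> exists2 d, 0 < d & forall xi, energy r xi ->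
  forall s t, 0 <= s <= T -> 0 <= t <= T -> `|t - s| < d -> enorm (Dp T xi t - Dp T xi s) <= e.
Proof.
move=> e0; have r1 : 0 < `|r| + 1 by rewrite ltr_wpDl.
have k0 : 0 < e / 2 / (`|r| + 1) by rewrite !divr_gt0.
have [K K0 hK] := pterm_young q1 k0.
exists (e / 2 / K); first by rewrite !divr_gt0.
move=> xi [G V].
have key s t : 0 <= s -> s < t -> t <= T -> t - s < e / 2 / K -> enorm (Dp T xi t - Dp T xi s) <= e.
  move=> s0 st tT l; apply: le_trans (hK _ (t - s) (enorm_ge0 _) _) _; first by rewrite subr_gt0.
  have h1 := Vle_term s0 st tT V.
  have h2 : K * (t - s) <= e / 2 by rewrite mulrC -ler_pdivlMr// ltW.
  have h3 : e / 2 / (`|r| + 1) * pterm q (enorm (Dp T xi t - Dp T xi s)) (t - s) <= e / 2.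
    apply: (@le_trans _ _ (e / 2 / (`|r| + 1) * (`|r| + 1))); last by rewrite divfK// gt_eqF.
    rewrite ler_pM2l//; apply: le_trans h1 _; have := ler_norm r; lra.
  by move: h2 h3; lra.
move=> s t /andP[s0 sT] /andP[t0 tT]; have [st|ts|->] := ltgtP s t.
- by rewrite ger0_norm ?subr_ge0 ?(ltW st)//; exact: key.
- by rewrite enorm_distC distrC ger0_norm ?subr_ge0 ?(ltW ts)//; apply: key.
- by rewrite !subrr enorm0 ltW.
Qed.

Lemma energy_limit r (x_ : nat -> R -> 'rV[R]_n) : (forall k, energy r (x_ k)) ->
  (forall e, 0 < e -> exists N, forall k l, (N <= k)%N -> (N <= l)%N -> c1le (x_ k) (x_ l) e) ->
  exists2 xi, energy r xi & forall e, 0 < e -> exists N, forall k, (N <= k)%N -> c1le (x_ k) xi e.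
Proof.
move=> hx hC.
have cau (g : nat -> R) : (forall e, 0 < e -> exists N, forall k l, (N <= k)%N -> (N <= l)%N -> `|g k - g l| <= e) -> cvgn g.
  move=> h; apply: cauchy_cvg; apply: cauchy_exP => e e0; have [|N hN] := h (e / 2); first by rewrite divr_gt0.
  exists (g N); exists N => // k /= kN; apply: le_lt_trans (hN N k (leqnn N) kN) _.
  by rewrite ltr_pdivrMr// ltr_pMr// ltr1n.
have c1 t i : 0 <= t <= T -> cvgn (fun k => x_ k t ord0 i).
  move=> tT; apply: cau => e /hC[N hN]; exists N => k l kN lN.
  have := hN k l kN lN t tT; have := enorm_coord (x_ k t - x_ l t) i; rewrite !mxE.
  have := enorm_ge0 (Dp T (x_ k) t - Dp T (x_ l) t); lra.
have c2 t i : 0 <= t <= T -> cvgn (fun k => Dp T (x_ k) t ord0 i).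
  move=> tT; apply: cau => e /hC[N hN]; exists N => k l kN lN.
  have := hN k l kN lN t tT; have := enorm_coord (Dp T (x_ k) t - Dp T (x_ l) t) i; rewrite !mxE.
  have := enorm_ge0 (x_ k t - x_ l t); lra.
pose xi t := \row_i limn (fun k => x_ k t ord0 i).
pose v t := \row_i limn (fun k => Dp T (x_ k) t ord0 i).
have cx t : 0 <= t <= T -> enorm (x_ k t - xi t) @[k --> \oo] --> 0.
  by move=> tT; apply: cvg_row => i; rewrite mxE; exact: c1.
have cv t : 0 <= t <= T -> enorm (Dp T (x_ k) t - v t) @[k --> \oo] --> 0.
  by move=> tT; apply: cvg_row => i; rewrite mxE; exact: c2.
have U e : 0 < e -> exists N, forall k, (N <= k)%N -> forall t, 0 <= t <= T ->
    enorm (x_ k t - xi t) + enorm (Dp T (x_ k) t - v t) <= e.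
  move=> e0; have [N hN] := hC e e0; exists N => k kN t tT.
  have C : enorm (x_ k t - x_ l t) + enorm (Dp T (x_ k) t - Dp T (x_ l) t) @[l --> \oo] -->
      enorm (x_ k t - xi t) + enorm (Dp T (x_ k) t - v t).
    apply: cvgD; apply: cvg_enorm.
      rewrite (_ : (fun l => enorm _) = (fun l => enorm (x_ l t - xi t))); first exact: cx.
      by apply/funext => l; rewrite enorm_distC; congr enorm; apply/rowP => i; rewrite !mxE; ring.
    rewrite (_ : (fun l => enorm _) = (fun l => enorm (Dp T (x_ l) t - v t))); first exact: cv.
    by apply/funext => l; rewrite enorm_distC; congr enorm; apply/rowP => i; rewrite !mxE; ring.
  apply: (cvgr_to_le C); exists N => // l /= lN; exact: hN.
have Uv e : 0 < e -> \forall k \near \oo, forall t, 0 <= t <= T -> enorm (Dp T (x_ k) t - v t) <= e.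
  move=> e0; have [N hN] := U e e0; exists N => // k /= kN t tT.
  by have := hN k kN t tT; have := enorm_ge0 (x_ k t - xi t); lra.
have V : Vle q v 0 T r.
  apply: (@Vle_limit _ _ _ q1 _ \oo _ (fun k => Dp T (x_ k))) => // e e0.
  by near=> k; apply: Vle_mono (hx k).2; rewrite lerDl ltW.
have H : hasd 0 T xi v.
  apply: (@hasd_limit _ _ _ _ _ _ x_ (fun k => Dp T (x_ k))) => //.
    by move=> k; exact: Gam_hasd (hx k).1.
  move=> s sT e e0; have [d d0 hd] := abs_cont_unif (Vle_abs_cont q1 (ltW T0) V) e0.
  by exists d => // t tT td; apply: hd.
have [|E DE] := energy_intro H V.
  move=> s sT; apply/closure_enormP => e e0.
  have [|N hN] := U (e / 2); first by rewrite divr_gt0.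
  have [_ _ _ cl] := (hx N).1; have /closure_enormP/(_ (e / 2)) := cl s sT.
  rewrite divr_gt0// => /(_ isT)[y Oy yb]; exists y => //.
  apply: le_lt_trans (enorm_dist_trans _ (x_ N s) _) _.
  have := hN N (leqnn N) s sT; have := enorm_ge0 (Dp T (x_ N) s - v s).
  by rewrite (enorm_distC (xi s)); move: yb; lra.
exists xi => // e /U[N hN]; exists N => k kN t tT; rewrite DE//; exact: hN.
Unshelve. all: by end_near. Qed.


(** Young's inequality bounds the oscillation of the velocity by [B1], so [T] times any velocity
    differs from the displacement [xi T - xi 0] by at most [B1 * T], and the displacement is at most
    [2 * M]. *)
Lemma energy_speed M r : (forall x, closure Om x -> enorm x <= M) -> exists B, forall xi, energy r xi ->
  forall s, 0 <= s <= T -> enorm (Dp T xi s) <= B.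
Proof.
move=> hM; have [K K0 hK] := pterm_young q1 (ltr01 : 0 < 1 :> R).
pose B1 := r + K * T.
exists ((2 * M + B1 * T) / T) => xi [G V].
have inc s t : 0 <= s -> s <= t -> t <= T -> enorm (Dp T xi t - Dp T xi s) <= B1.
  move=> s0 st tT; have r0 := Vle_ge0 (ltW T0) V; have [->|st'] := eqVneq s t.
    by rewrite subrr enorm0 addr_ge0// mulr_ge0 ?ltW.
  have {}st : s < t by rewrite lt_neqAle st'.
  apply: le_trans (hK _ (t - s) (enorm_ge0 _) _) _; first by rewrite subr_gt0.
  rewrite mul1r lerD ?(Vle_term s0 st tT V)// ler_pM2l//; lra.
have {}inc s t : 0 <= s <= T -> 0 <= t <= T -> enorm (Dp T xi t - Dp T xi s) <= B1.
  move=> /andP[s0 sT] /andP[t0 tT]; have [st|ts] := leP s t; first exact: inc.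
  by rewrite enorm_distC; apply: inc => //; exact: ltW.
move=> s sT; have [_ _ _ cl] := G.
have h1 := Gam_mean_value G (lexx 0) (ltW T0) (lexx T) (fun c cT => inc s c sT cT).
rewrite ler_pdivlMr// -[X in _ * X](ger0_norm (ltW T0)) mulrC -enormZ.
rewrite subr0 in h1.
have -> : T *: Dp T xi s = xi T - xi 0 - (xi T - xi 0 - T *: Dp T xi s).
  by apply/rowP => i; rewrite !mxE; ring.
apply: le_trans (enormB _ _) _; apply: lerD => //.
have x0M : enorm (xi 0) <= M by apply: hM; apply: cl; rewrite lexx ltW.
have xTM : enorm (xi T) <= M by apply: hM; apply: cl; rewrite lexx ltW.
by apply: le_trans (enormB _ _) _; rewrite mulr_natl mulr2n lerD.
Qed.

(** Arzela-Ascoli for the velocities, which are equicontinuous and bounded; the positions follow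
    from the velocities and the initial position. *)
Lemma energy_compact M r (x_ : nat -> R -> 'rV[R]_n) : (forall x, closure Om x -> enorm x <= M) ->
  (forall k, energy r (x_ k)) -> exists2 phi : nat -> nat, (forall k, (phi k < phi k.+1)%N) &
  exists2 xi, energy r xi & forall e, 0 < e -> exists N, forall k, (N <= k)%N -> c1le (x_ (phi k)) xi e.
Proof.
move=> hM hx; have [B hB] := energy_speed r hM.
pose grid m i : R := T * i%:R / m.+1%:R.
(* The countable data made to converge: the initial position ([None]) and the velocities at the
   points of all uniform grids ([Some (m, i)]), clamped so that every index yields a time in
   [[0, T]]. *)
pose J : countType := ('I_n * option (nat * nat))%type.
pose val (j : J) k : R := match j.2 with
  | Some (m, i) => Dp T (x_ k) (clamp T (grid m i)) ord0 j.1
  | None => x_ k 0 ord0 j.1 end.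
pose a j k := if unpickle j is Some c then val c k else 0.
have [|phi hphi cphi] := @diagonal_extraction R a (fun=> Num.max 0 (Num.max B M)).
  move=> j k; rewrite /a; case: (unpickle j) => [[i [[m i']|]]|] /=; last by rewrite normr0 le_max lexx.
    rewrite !le_max; apply/orP; right; apply/orP; left.
    by apply: le_trans (enorm_coord _ _) (hB _ (hx k) _ _); rewrite clamp_itv// ltW.
  rewrite !le_max; apply/orP; right; apply/orP; right.
  apply: le_trans (enorm_coord _ _) _; apply: hM; have [[_ _ _ cl] _] := hx k.
  by apply: cl; rewrite lexx ltW.
exists phi => //.
have cJ (c : J) : cvgn (fun k => val c (phi k)).
  by have := cphi (pickle c); rewrite /a pickleK.
pose y_ k := x_ (phi k).
have cau (g : nat -> R) : cvgn g -> forall e, 0 < e -> exists N, forall k l, (N <= k)%N -> (N <= l)%N -> `|g k - g l| <= e.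
  move=> /cvg_ex[l hl] e e0; move/cvgrPdist_le: hl => /(_ (e / 2)).
  rewrite divr_gt0// => /(_ isT) [N _ hN]; exists N => k k' kN kN'.
  have := hN k kN; have := hN k' kN' => /=.
  have := ler_normB (l - g k') (l - g k); rewrite opprB [X in `|X|](_ : _ = g k - g k'); last by ring.
  by lra.
have cauv (val_ : nat -> 'rV[R]_n) : (forall i, cvgn (fun k => val_ k ord0 i)) ->
   forall e, 0 < e -> exists N, forall k l, (N <= k)%N -> (N <= l)%N -> enorm (val_ k - val_ l) <= e.
  move=> h e e0; have n0 : 0 < n%:R + 1 :> R by rewrite ltr_wpDl.
  have /choice[N hN] : forall i, exists N, forall k l, (N <= k)%N -> (N <= l)%N -> `|val_ k ord0 i - val_ l ord0 i| <= e / (n%:R + 1).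
    by move=> i; apply: cau => //; rewrite divr_gt0.
  exists (\max_i N i)%N => k l kN lN; apply: le_trans (enorm_le_sum _) _.
  apply: (@le_trans _ _ (\sum_(i < n) (e / (n%:R + 1)))).
    apply: ler_sum => i _; rewrite !mxE; apply: hN.
      exact: leq_trans (leq_bigmax i) kN.
    exact: leq_trans (leq_bigmax i) lN.
  rewrite sumr_const card_ord -[_ *+ n]mulr_natr mulrAC ler_pdivrMr// ler_pM2l// lerDl//.
have U e : 0 < e -> exists N, forall k l, (N <= k)%N -> (N <= l)%N -> forall t, 0 <= t <= T ->
    enorm (Dp T (y_ k) t - Dp T (y_ l) t) <= e.
  move=> e0; have [|d d0 hd] := @energy_modulus r (e / 3); first by rewrite divr_gt0.
  pose m := Num.bound (T / d).
  have md : T / m.+1%:R < d.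
    rewrite ltr_pdivrMr// mulrC -ltr_pdivrMr//; apply: lt_le_trans (archi_boundP _) _.
      by rewrite divr_ge0 ?ltW.
    by rewrite ler_nat.
  have /choice[N hN] : forall i : 'I_m.+2, exists N, forall k l, (N <= k)%N -> (N <= l)%N ->
      enorm (Dp T (y_ k) (clamp T (grid m i)) - Dp T (y_ l) (clamp T (grid m i))) <= e / 3.
    move=> i; apply: (cauv (fun k => Dp T (y_ k) (clamp T (grid m i)))); last by rewrite divr_gt0.
    by move=> j; exact: (cJ (j, Some (m, i : nat))).
  exists (\max_i N i)%N => k l kN lN t /andP[t0 tT].
  have P : exists i, t <= grid m i by exists m.+1; rewrite /grid mulfK// gt_eqF// ltr0n.
  case: (ex_minnP P) => i hi hmin.
  have im : (i < m.+2)%N by rewrite ltnS; apply: hmin; rewrite /grid mulfK// gt_eqF// ltr0n.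
  have gT : grid m i <= T.
    by rewrite /grid ler_pdivrMr ?ltr0n// ler_pM2l// ler_nat.
  have g0 : 0 <= grid m i by apply: le_trans hi.
  have gd : `|t - grid m i| < d.
    rewrite distrC ger0_norm ?subr_ge0//; apply: le_lt_trans md.
    move: hi hmin g0 {im gT}; case: i => [|i] hi hmin g0.
      by rewrite {1}/grid mulr0 mul0r sub0r; apply: (@le_trans _ _ 0); [rewrite oppr_le0 | rewrite divr_ge0 ?ltW ?ltr0n].
    have ti : grid m i < t by rewrite ltNge; apply/negP => /hmin; rewrite ltnn.
    have -> : T / m.+1%:R = grid m i.+1 - grid m i.
      by rewrite /grid -[i.+1]addn1 natrD; field; rewrite addrC natr1 gt_eqF// ltr0n.
    by rewrite lerD2l lerN2 ltW.
  have gI : 0 <= grid m i <= T by rewrite g0.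
  have tI : 0 <= t <= T by rewrite t0.
  have h1 := hd _ (hx (phi k)) _ _ gI tI gd.
  have h2 := hd _ (hx (phi l)) _ _ gI tI gd.
  have := hN (Ordinal im) k l (leq_trans (leq_bigmax (Ordinal im)) kN) (leq_trans (leq_bigmax (Ordinal im)) lN).
  rewrite /= clamp_id// => h3.
  apply: le_trans (enorm_dist_trans _ (Dp T (y_ k) (grid m i)) _) _.
  apply: le_trans (lerD (lexx _) (enorm_dist_trans _ (Dp T (y_ l) (grid m i)) _)) _.
  rewrite (enorm_distC (Dp T (y_ l) (grid m i))) (_ : e = e / 3 + (e / 3 + e / 3)); last exact: split3.
  exact: lerD h1 (lerD h3 h2).
apply: (energy_limit (x_ := y_)) => [k|e e0]; first exact: hx.
have e30 : 0 < e / 3 by rewrite divr_gt0.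
have [|N1 hN1] := cauv (fun k => y_ k 0) _ (e / 3) e30; first by move=> i; exact: (cJ (i, None)).
have [|N2 hN2] := U (Num.min (e / 3) (e / 3 / T)); first by rewrite lt_min e30 divr_gt0.
exists (maxn N1 N2) => k l; rewrite !geq_max => /andP[k1 k2] /andP[l1 l2] t tT.
have h1 := hN1 k l k1 l1; have h2 := hN2 k l k2 l2.
have h3 : enorm (y_ k t - y_ l t - (y_ k 0 - y_ l 0) - (t - 0) *: 0) <= e / 3 / T * (t - 0).
  have Hd := hasdD (Gam_hasd (hx (phi k)).1) (hasdN (Gam_hasd (hx (phi l)).1)).
  move: tT => /andP[t0 tT].
  have := @hasd_mean_value _ _ 0 t _ _ 0 (e / 3 / T) t0 (hasd_sub (lexx 0) tT Hd).
  apply=> c /andP[c0 ct]; rewrite subr0; apply: le_trans (h2 c _) _.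
    by rewrite ltW// (le_trans (ltW ct)).
  by rewrite ge_min lexx orbT.
rewrite subr0 scaler0 subr0 in h3.
have h4 : e / 3 / T * t <= e / 3.
  apply: (@le_trans _ _ (e / 3 / T * T)); last by rewrite divfK// gt_eqF.
  by rewrite ler_pM2l ?divr_gt0//; case/andP: tT.
have h5 : enorm (Dp T (y_ k) t - Dp T (y_ l) t) <= e / 3.
  by apply: le_trans (h2 t tT) _; rewrite ge_min lexx.
have h6 : enorm (y_ k t - y_ l t) <= e / 3 / T * t + e / 3.
  rewrite -[y_ k t - y_ l t](subrK (y_ k 0 - y_ l 0)).
  by apply: le_trans (enormD _ _) _; apply: lerD.
move: h4 h5 h6; move: (enorm _) (enorm _) (_ * t) => *; lra.
Qed.

End path_space.

(** * Arcs at the boundary of the domain *)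

Section taylor.
Context {R : realType} {n : nat}.
Implicit Types (f : 'rV[R]_n -> R) (x y z u : 'rV[R]_n) (U : set 'rV[R]_n).

Lemma Ck_le k f U : Ck k.+1 U f -> Ck k U f.
Proof.
elim: k f => [|k IH] f /= [h1 h2]; split=> // i.
by have [h3 h4] := h2 i; split=> //; exact: IH.
Qed.

Lemma is_derive_line f z (v : 'rV[R]_n) (s : R) : derivable f (s *: v + z) v ->
  is_derive s (1 : R) (fun t : R => f (t *: v + z)) ('D_v f (s *: v + z)).
Proof.
move=> df; have E : (fun h : R => h^-1 *: (((fun t : R => f (t *: v + z)) \o shift s) (h *: (1 : R)) - f (s *: v + z))) =
   (fun h : R => h^-1 *: ((f \o shift (s *: v + z)) (h *: v) - f (s *: v + z))).
  apply/funext => h /=; congr (_ *: (f _ - _)).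
  by rewrite /shift /= [h *: (1 : R)]mulr1 scalerDl addrA.
by apply: DeriveDef; rewrite /derivable /derive E.
Qed.

Lemma coord_MVT f z i (u : R) :
  (forall s : R, `|s| <= `|u| -> derivable f (s *: unitv i + z) (unitv i)) ->
  exists2 s : R, `|s| <= `|u| & f (u *: unitv i + z) - f z = 'D_(unitv i) f (s *: unitv i + z) * u.
Proof.
move=> df; pose g (t : R) := f (t *: unitv i + z); pose g' (t : R) := 'D_(unitv i) f (t *: unitv i + z).
have gd (t : R) : `|t| <= `|u| -> is_derive t (1 : R) g (g' t) by move/df/is_derive_line.
have gc (t : R) : `|t| <= `|u| -> {for t, continuous g}.
  by move=> /gd[dg _]; apply: differentiable_continuous; apply/derivable1_diffP.
have g0 : f z = g 0 by rewrite /g scale0r add0r.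
rewrite g0 -/(g u).
have [u0|u0|<-] := ltgtP 0 u.
- have [t| |c] := @MVT R g g' 0 u u0.
  + by rewrite in_itv /= => /andP[t0 tu]; apply: gd; rewrite !gtr0_norm ?ltW.
  + apply: continuous_in_subspaceT => t; rewrite inE /= in_itv /= => /andP[t0 tu].
    by apply: gc; rewrite (ger0_norm t0) (ger0_norm (ltW u0)).
  + rewrite in_itv /= subr0 => /andP[c0 cu] E; exists c => //.
    by rewrite !gtr0_norm ?ltW.
- have [t| |c] := @MVT R g g' u 0 u0.
  + by rewrite in_itv /= => /andP[t0 tu]; apply: gd; rewrite !ltr0_norm ?lerN2 ?ltW.
  + apply: continuous_in_subspaceT => t; rewrite inE /= in_itv /= => /andP[t0 tu].
    by apply: gc; rewrite (ler0_norm tu) (ltr0_norm u0) lerN2.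
  + rewrite in_itv /= sub0r mulrN => /andP[c0 cu] E; exists c.
      by rewrite !ltr0_norm ?lerN2 ?ltW.
    by rewrite -opprB E opprK.
- by exists 0; rewrite ?normr0// subrr mulr0.
Qed.

(** Regularity is given through partial derivatives, so the coordinates are changed one at a time
    and each change has its own intermediate point [c i]. *)
Lemma taylor_points f y u :
  (forall z, `|z - y| <= `|u| -> forall i, derivable f z (unitv i)) ->
  exists2 c : 'I_n -> 'rV[R]_n, (forall i, `|c i - y| <= `|u|) &
    f (y + u) - f y = \sum_i 'D_(unitv i) f (c i) * u ord0 i.
Proof.
move=> df; pose Y (m : nat) : 'rV[R]_n := \row_i (y ord0 i + if (i < m)%N then u ord0 i else 0).
have Ystep (i : 'I_n) : Y i.+1 = u ord0 i *: unitv i + Y i.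
  apply/rowP => j; rewrite !mxE eqxx /= ltnS leq_eqVlt.
  have [->|ji] := eqVneq j i; first by rewrite eqxx ltnn /= mulr1 addr0 addrC.
  by rewrite (negbTE ji : (j == i :> nat) = false) /= mulr0 add0r.
have Ydist (i : 'I_n) (s : R) : `|s| <= `|u ord0 i| -> `|s *: unitv i + Y i - y| <= `|u|.
  move=> su; rewrite [leLHS]mx_normrE; apply/bigmax_leP; split=> //= -[k j] _ /=.
  rewrite !ord1 !mxE eqxx /= (addrC (y _ _)) addrA addrK.
  have [->|ji] := eqVneq j i; first by rewrite ltnn addr0 mulr1 (le_trans su)// mxnorm_coord.
  rewrite mulr0 add0r; case: ifP => _; first exact: mxnorm_coord.
  by rewrite normr0.
have /choice[s hs] : forall i : 'I_n, exists s : R, `|s| <= `|u ord0 i| /\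
    f (Y i.+1) - f (Y i) = 'D_(unitv i) f (s *: unitv i + Y i) * u ord0 i.
  move=> i; have [s su|s su E] := @coord_MVT f (Y i) i (u ord0 i); first exact/df/Ydist.
  by exists s; rewrite Ystep.
exists (fun i => s i *: unitv i + Y i) => [i|]; first by apply: Ydist; have [] := hs i.
rewrite -(eq_bigr _ (fun i _ => (hs i).2)).
have := telescope_sumr (fun m => f (Y m)) (leq0n n); rewrite big_mkord => ->.
congr (f _ - f _); apply/rowP => i; rewrite !mxE ?ltn_ord// addr0//.
Qed.

Lemma continuous_near f x e : {for x, continuous f} -> 0 < e -> exists2 d, 0 < d &
  forall z, `|z - x| < d -> `|f z - f x| < e.
Proof.
move=> /cvgrPdist_lt/(_ e) h e0; have /nbhs_ballP[d /= d0 hd] := h e0; exists d => // z zx.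
by rewrite distrC; apply: hd; rewrite -ball_normE /= distrC.
Qed.

Lemma continuous_near_family (I : finType) (F : I -> 'rV[R]_n -> R) x e : (forall i, {for x, continuous (F i)}) ->
  0 < e -> exists2 d, 0 < d & forall i z, `|z - x| < d -> `|F i z - F i x| < e.
Proof.
move=> h e0; have /choice[d hd] : forall i, exists d, 0 < d /\ forall z, `|z - x| < d -> `|F i z - F i x| < e.
  by move=> i; have [d d0 hd] := continuous_near (h i) e0; exists d.
exists (\big[Num.min/1]_i d i); first by apply/bigmin_gtP; split=> // i _; have [] := hd i.
move=> i z zx; have [_] := hd i; apply; apply: lt_le_trans zx _; exact: bigmin_le.
Qed.

Lemma open_near U x : open U -> U x -> exists2 d, 0 < d & forall z, `|z - x| < d -> U z.
Proof.
move=> oU Ux; have /nbhs_ballP[d /= d0 hd] := open_nbhs_nbhs (conj oU Ux).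
by exists d => // z zx; apply: hd; rewrite -ball_normE /= distrC.
Qed.

Lemma Ck1_lipschitz f U x : open U -> U x -> Ck 1 U f -> exists K d, [/\ 0 <= K, 0 < d &
  forall y u, `|y - x| < d -> `|u| < d -> `|f (y + u) - f y| <= K * `|u|].
Proof.
move=> oU Ux [_ h]; have [d1 d10 hd1] := open_near oU Ux.
have [i|d2 d20 hd2] := @continuous_near_family _ (fun i => 'D_(unitv i) f) x 1 _ ltr01.
  by have [_ [hc _]] := h i; exact: hc.
pose K := \sum_i (`|'D_(unitv i) f x| + 1).
have K0 : 0 <= K by apply: sumr_ge0 => i _; rewrite addr_ge0.
exists K, (Num.min d1 d2 / 2); split=> //; first by rewrite divr_gt0// lt_min d10.
move=> y u yx ux.
have near z : `|z - y| <= `|u| -> `|z - x| < Num.min d1 d2.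
  move=> zy; have := ler_normD (z - y) (y - x); rewrite addrA subrK => h1.
  apply: le_lt_trans h1 _; move: yx ux zy; set m := Num.min _ _; lra.
have [z zy i|c hc ->] := @taylor_points f y u.
  by have [hd _] := h i; apply: hd; apply: hd1; apply: lt_le_trans (near z zy) _; rewrite ge_min lexx.
apply: le_trans (ler_norm_sum _ _ _) _; rewrite mulr_suml; apply: ler_sum => i _.
rewrite normrM; apply: ler_pM => //; last exact: mxnorm_coord.
have := hd2 i (c i); have := ler_normD ('D_(unitv i) f (c i) - 'D_(unitv i) f x) ('D_(unitv i) f x).
rewrite subrK => h1 h2; apply: le_trans h1 _; rewrite addrC lerD2l ltW//; apply: h2.
by apply: lt_le_trans (near _ (hc i)) _; rewrite ge_min lexx orbT.
Qed.

Lemma taylor2 f U x : open U -> U x -> Ck 2 U f -> exists C d, [/\ 0 < C, 0 < d,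
  forall z, enorm (z - x) < d -> U z &
  forall y u, enorm (y - x) < d -> enorm u < d ->
    `|f (y + u) - f y - dotv (grad f y) u| <= C * enorm u ^+ 2 /\
    enorm (grad f (y + u) - grad f y) <= C * enorm u].
Proof.
move=> oU Ux [_ h]; have [d1 d10 hd1] := open_near oU Ux.
have /choice[K hK] : forall i, exists K, exists d, [/\ 0 <= K, 0 < d &
  forall y u, `|y - x| < d -> `|u| < d -> `|'D_(unitv i) f (y + u) - 'D_(unitv i) f y| <= K * `|u|].
  by move=> i; have [_ hi] := h i; exact: Ck1_lipschitz hi.
have /choice[d hd] := hK.
pose d2 := \big[Num.min/d1]_i d i.
have d20 : 0 < d2 by apply/bigmin_gtP; split=> // i _; have [] := hd i.
pose C := \sum_i K i + 1.
have K0 i : 0 <= K i by have [] := hd i.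
have C0 : 0 < C by rewrite /C ltr_wpDl// sumr_ge0.
have mE z : `|z| <= enorm z := mxnorm_le_enorm z.
exists C, (d2 / 2); split=> //; first by rewrite divr_gt0.
  move=> z zx; apply: hd1; apply: le_lt_trans (mE _) _; apply: lt_le_trans zx _.
  apply: (@le_trans _ _ d2); last by apply: bigmin_le_id.
  by rewrite ler_pdivrMr// ler_pMr// ler1n.
move=> y u yx ux.
have d22 : d2 / 2 < d2 by rewrite ltr_pdivrMr// ltr_pMr// ltr1n.
have lip i v : `|v| <= `|u| -> `|'D_(unitv i) f (y + v) - 'D_(unitv i) f y| <= K i * enorm u.
  move=> vu; have [_ _ hi] := hd i.
  have dd : d2 <= d i by exact: bigmin_le.
  apply: le_trans (hi y v _ _) _.
  - apply: le_lt_trans (mE _) _; apply: lt_le_trans yx _; exact: le_trans (ltW d22) dd.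
  - apply: le_lt_trans vu _; apply: le_lt_trans (mE _) _; apply: lt_le_trans ux _; exact: le_trans (ltW d22) dd.
  - by apply: ler_wpM2l => //; apply: le_trans vu (mE _).
split.
  have [z zy i|c hc ->] := @taylor_points f y u.
    have [hdi _] := h i; apply: hdi; apply: hd1.
    have := ler_normD (z - y) (y - x); rewrite addrA subrK => h1.
    have d21 : d2 <= d1 by exact: bigmin_le_id.
    apply: le_lt_trans h1 _; have := mE (y - x); have := mE u.
    by move: zy yx ux d21; lra.
  rewrite /dotv -sumrB; apply: le_trans (ler_norm_sum _ _ _) _.
  apply: (@le_trans _ _ (\sum_i (K i * enorm u ^+ 2))).
    apply: ler_sum => i _; rewrite mxE -mulrBl normrM expr2 mulrA.
    apply: ler_pM => //; last exact: enorm_coord.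
    by have := lip i (c i - y) (hc i); rewrite [y + _]addrC subrK.
  by rewrite -mulr_suml ler_wpM2r ?sqr_ge0// /C lerDl.
apply: le_trans (enorm_le_sum _) _; apply: (@le_trans _ _ (\sum_i (K i * enorm u))).
  by apply: ler_sum => i _; rewrite !mxE; apply: lip.
by rewrite -mulr_suml ler_wpM2r ?enorm_ge0// /C lerDl.
Qed.

End taylor.

(** * Arcs bent inwards at a boundary point *)

Section boundary.
Context {R : realType} {n : nat}.
Variable Om : set 'rV[R]_n.
Hypotheses (oO : open Om)
  (bO : forall x0, bdry Om x0 -> exists U rho, local_defining_fun 2 Om x0 U rho).
Implicit Types (x y z u w : 'rV[R]_n) (U : set 'rV[R]_n).

Lemma defining_fun_le0 k x U rho z : local_defining_fun k Om x U rho -> U z -> closure Om z -> rho z <= 0.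
Proof.
move=> [oU _ Crho _ hO] Uz clz; rewrite leNgt; apply/negP => rz.
have cz : {for z, continuous rho} by case: k Crho => [|k] [h _]; exact: h.
have [d1 d10 hd1] := open_near oU Uz; have [d2 d20 hd2] := continuous_near cz rz.
have [|y Oy yz] := (closure_enormP _ _).1 clz (Num.min d1 d2); first by rewrite lt_min d10.
have {}yz : `|y - z| < Num.min d1 d2.
  by apply: le_lt_trans yz; rewrite distrC; exact: mxnorm_le_enorm.
have := hd2 y; have Uy : U y by apply: hd1; apply: lt_le_trans yz _; rewrite ge_min lexx.
have ry := (hO y Uy).1 Oy.
have yz2 : `|y - z| < d2 by apply: lt_le_trans yz _; rewrite ge_min lexx orbT.
move=> /(_ yz2); rewrite ltr0_norm; last by rewrite subr_lt0 (lt_trans ry).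
by rewrite opprB ltrBlDr ltrDl => h; have := lt_trans ry h; rewrite ltxx.
Qed.

Lemma bdry_notin x : bdry Om x -> ~ Om x.
Proof. by move=> [_]; rewrite ((interior_id Om).1 oO). Qed.

Lemma closure_case x : closure Om x -> Om x \/ bdry Om x.
Proof.
by move=> cx; have [Ox|nO] := pselect (Om x); [left|right; split=> //; rewrite ((interior_id Om).1 oO)].
Qed.

Lemma defining_fun_bdry k x U rho : local_defining_fun k Om x U rho -> bdry Om x -> rho x = 0.
Proof.
move=> h bx; have [oU Ux _ _ hO] := h; apply/eqP; rewrite eq_le.
rewrite (defining_fun_le0 h Ux (proj1 bx)) /= leNgt; apply/negP => /(hO x Ux).
exact: bdry_notin bx.
Qed.

Lemma hasd1_comp (f : 'rV[R]_n -> R) x C d a b (xi v : R -> 'rV[R]_n) : 0 < C -> 0 < d ->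
  (forall y u, enorm (y - x) < d -> enorm u < d -> `|f (y + u) - f y - dotv (grad f y) u| <= C * enorm u ^+ 2) ->
  hasd a b xi v -> (forall t, a <= t <= b -> enorm (xi t - x) < d) ->
  hasd1 a b (fun t => f (xi t)) (fun t => dotv (grad f (xi t)) (v t)).
Proof.
move=> C0 d0 ht hxi hb s sab e e0.
set G := enorm (grad f (xi s)); have G0 : 0 <= G := enorm_ge0 _.
set K := enorm (v s) + 1; have K0 : 0 < K by rewrite /K ltr_wpDl ?enorm_ge0.
have e1 : 0 < Num.min 1 (e / (2 * (G + 1))) by rewrite lt_min ltr01 divr_gt0// mulr_gt0// ltr_wpDl.
have [d1 d10 hd1] := hasd_enorm hxi sab e1.
exists (Num.min d1 (Num.min (d / K) (e / (2 * C * K ^+ 2)))).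
  by rewrite !lt_min d10 !divr_gt0// !mulr_gt0// exprn_gt0.
move=> t tab; rewrite !lt_min => /andP[td1 /andP[td2 td3]].
have := hd1 t tab td1; set u := xi t - xi s; set x1 := `|t - s| => h1.
have x10 : 0 <= x1 by rewrite /x1.
have h1a : enorm (u - (t - s) *: v s) <= x1.
  by apply: le_trans h1 _; rewrite -[leRHS]mul1r ler_wpM2r// ge_min lexx.
have h1b : enorm (u - (t - s) *: v s) <= e / (2 * (G + 1)) * x1.
  by apply: le_trans h1 _; rewrite ler_wpM2r// ge_min lexx orbT.
have uK : enorm u <= K * x1.
  rewrite -[u](subrK ((t - s) *: v s)); apply: le_trans (enormD _ _) _.
  by rewrite enormZ -/x1 /K mulrDl mul1r addrC mulrC; apply: lerD.
have ud : enorm u < d.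
  by apply: le_lt_trans uK _; rewrite mulrC -ltr_pdivlMr.
have := ht (xi s) u (hb s sab) ud; rewrite [xi s + u]addrC subrK => h2.
have -> : f (xi t) - f (xi s) - (t - s) * dotv (grad f (xi s)) (v s) =
   (f (xi t) - f (xi s) - dotv (grad f (xi s)) u) + dotv (grad f (xi s)) (u - (t - s) *: v s).
  by rewrite dotvDr dotvNr dotvZr; ring.
apply: le_trans (ler_normD _ _) _.
have h3 : `|dotv (grad f (xi s)) (u - (t - s) *: v s)| <= e / 2 * x1.
  apply: (@le_trans _ _ (G * enorm (u - (t - s) *: v s))).
    rewrite ler_norml cauchy_schwarz andbT lerNl -dotvNl.
    by apply: le_trans (cauchy_schwarz _ _) _; rewrite enormN.
  apply: le_trans (ler_wpM2l G0 h1b) _; rewrite mulrA ler_wpM2r//.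
  rewrite (_ : G * (e / (2 * (G + 1))) = e / 2 * (G / (G + 1))); last by field; rewrite gt_eqF// ltr_wpDl.
  have G1 : G / (G + 1) <= 1 by rewrite ler_pdivrMr ?mul1r ?lerDl// ltr_wpDl.
  by rewrite ler_piMr// divr_ge0// ltW.
have h4 : C * enorm u ^+ 2 <= e / 2 * x1.
  apply: (@le_trans _ _ (C * (K * x1) ^+ 2)).
    by rewrite ler_pM2l// ler_pXn2r ?nnegrE ?enorm_ge0// mulr_ge0// ltW.
  rewrite (_ : C * (K * x1) ^+ 2 = (x1 * (C * K ^+ 2)) * x1); last by ring.
  rewrite ler_wpM2r//; move: td3; rewrite ltr_pdivlMr ?mulr_gt0 ?exprn_gt0// => td3.
  have -> : x1 * (C * K ^+ 2) = x1 * (2 * C * K ^+ 2) / 2 by field.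
  by rewrite ler_pM2r// ltW.
apply: le_trans (lerD (le_trans h2 h4) h3) _; lra.
Qed.

(* Otherwise [sqrt D] would decrease at a rate above 1/2 and vanish before time [tau]. *)
Lemma good_time (D D' : R -> R) tau : hasd1 0 tau D D' -> (forall t, 0 <= t <= tau -> 0 <= D t) ->
  Num.sqrt (D 0) < tau / 2 -> exists2 s, 0 <= s <= tau & - D' s <= Num.sqrt (D s).
Proof.
move=> hD D0 small.
have tau0 : 0 < tau by have := le_lt_trans (sqrtr_ge0 _) small; lra.
pose psi t := Num.sqrt (D t) + t / 2.
have c : {within `[0, tau], continuous psi}.
  apply/subspace_continuousP => x /=; rewrite in_itv /= => xt.
  apply: cvgD; last by apply: cvg_within_filter; apply: cvgMl; exact: cvg_id.
  apply: (@cvg_comp _ _ _ D Num.sqrt _ (nbhs (D x))); last exact: sqrt_continuous.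
  apply/cvgrPdist_le => e e0; have [d d0 hd] := hasd1_cont hD xt e0.
  exists d => // t /= td; rewrite in_itv /= => tt; rewrite distrC; apply: hd => //.
  by rewrite distrC.
have [s] := EVT_min (ltW tau0) c; rewrite in_itv /= => sT hmin.
have st : s < tau.
  rewrite lt_neqAle (andP sT).2 andbT; apply/eqP => E.
  have := hmin 0; rewrite in_itv /= lexx (ltW tau0) => /(_ isT).
  rewrite /psi E mul0r addr0 => h; have := sqrtr_ge0 (D tau); lra.
exists s => //; rewrite leNgt; apply/negP => bad.
set r := Num.sqrt (D s) in bad; have r0 : 0 <= r := sqrtr_ge0 _.
have rr : D s = r ^+ 2 by rewrite sqr_sqrtr// D0.
have k0 : 0 < (- D' s - r) / 2 by lra.
have [d d0 hd] := hD s sT _ k0.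
(* If [r = 0], a small step already makes [D] negative. Otherwise [h <= r] keeps [r - h / 2]
   nonnegative, so that the lower bound on [sqrt D] coming from the minimum can be squared. *)
have [h [h0 hd' ht hr]] : exists h, [/\ 0 < h, h < d, s + h <= tau & r = 0 \/ h <= r].
  have m0 : 0 < Num.min (d / 2) (tau - s) by rewrite lt_min divr_gt0// subr_gt0.
  have md : Num.min (d / 2) (tau - s) < d by rewrite gt_min; apply/orP; left; lra.
  have mt : s + Num.min (d / 2) (tau - s) <= tau by rewrite -lerBrDl ge_min lexx orbT.
  have [r00|rn0] := eqVneq r 0; first by exists (Num.min (d / 2) (tau - s)); split=> //; left.
  exists (Num.min (Num.min (d / 2) (tau - s)) r); split.
  - by rewrite lt_min m0 lt_def rn0.
  - by rewrite gt_min md.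
  - by apply: le_trans mt; rewrite lerD2l ge_min lexx.
  - by right; rewrite ge_min lexx orbT.
have sh : 0 <= s + h <= tau by rewrite ht addr_ge0 ?(andP sT).1 ?ltW.
have := hd (s + h) sh; rewrite (_ : s + h - s = h); last by ring.
rewrite gtr0_norm// => /(_ hd'); rewrite ler_norml => /andP[_ up].
have Dh := D0 _ sh; have := hmin (s + h); rewrite in_itv /= sh => /(_ isT).
rewrite /psi -/r; set p := Num.sqrt (D (s + h)) => low.
have p0 : 0 <= p := sqrtr_ge0 _; have pp : D (s + h) = p ^+ 2 by rewrite sqr_sqrtr.
rewrite pp rr in up.
have up2 : p ^+ 2 <= r ^+ 2 - h * r - (- D' s - r) / 2 * h by move: up; lra.
have kh : 0 < (- D' s - r) / 2 * h by rewrite mulr_gt0.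
case: hr => [r00|hr].
  have := sqr_ge0 p; rewrite r00 mulr0 in up2; rewrite r00 in kh; move: up2 kh.
  by rewrite ?r00 expr0n /=; lra.
have : (r - h / 2) ^+ 2 <= p ^+ 2.
  by rewrite ler_pXn2r ?nnegrE//; lra.
have -> : (r - h / 2) ^+ 2 = r ^+ 2 - h * r + h ^+ 2 / 4 by field.
have := sqr_ge0 h; lra.
Qed.

(* [b] is a large multiple of the inward gradient, so that a second order Taylor expansion gives
   [rho (y + t w + t^2 b) <= rho y + t sqrt (- rho y) - t^2 <= 0]. *)
Lemma inward_arc U rho x W : local_defining_fun 2 Om x U rho -> 0 <= W ->
  exists d t0 b, [/\ 0 < d, 0 < t0, forall z, enorm (z - x) < d -> U z,
   (forall a a' xi v, hasd a a' xi v -> (forall t, a <= t <= a' -> enorm (xi t - x) < d) ->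
      hasd1 a a' (fun t => rho (xi t)) (fun t => dotv (grad rho (xi t)) (v t))) &
   forall y w, enorm (y - x) < d -> closure Om y -> enorm w <= W ->
     dotv (grad rho y) w <= Num.sqrt (- rho y) ->
     forall t, 0 <= t <= t0 -> closure Om (y + t *: w + t ^+ 2 *: b)].
Proof.
move=> hrho W0; have [oU Ux Crho gx hO] := hrho.
have [C [d1 [C0 d10 hU ht]]] := taylor2 oU Ux Crho.
set g := grad rho x; set G := enorm g.
have G0 : 0 < G by rewrite lt_def enorm_ge0 andbT; apply: contraNneq (gx x Ux) => /enorm_eq0 E; apply/eqP.
pose N := - (G ^+ 2)^-1 *: g.
have gN : dotv g N = -1 by rewrite dotvZr -enorm_sqr -/G mulNr mulVf// expf_neq0// gt_eqF.
have nN : enorm N = G^-1.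
  by rewrite enormZ normrN ger0_norm ?invr_ge0 ?sqr_ge0// -/G; field; rewrite gt_eqF.
clearbody N.
(* As [dotv (grad rho y) N <= -1/2] near [x], bending by [M *: N] lowers [rho] by at least
   [M / 2 * t^2 = 2 C W^2 t^2 + 2 t^2]. This pays for the Taylor remainder, at most
   [2 C W^2 t^2 + t^2], and leaves [- t^2]. *)
pose M := 4 * C * W ^+ 2 + 4.
have M0 : 0 < M by rewrite /M ltr_wpDl// !mulr_ge0 ?sqr_ge0// ltW.
pose d := Num.min (d1 / 2) (G / (2 * C)).
have d0 : 0 < d by rewrite lt_min !divr_gt0// mulr_gt0.
(* The second bound keeps the arc where the Taylor estimate holds; the third makes the quadratic
   part of the arc contribute at most [t^2] to the remainder. *)
pose t0 := Num.min 1 (Num.min (d1 / (2 * (W + M / G + 1))) (G / (2 * (C + 1) * M))).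
have P1 : 0 < W + M / G + 1 by rewrite ltr_wpDl// addr_ge0// divr_ge0// ltW.
have C1 : 0 < C + 1 by rewrite addr_gt0.
have t00 : 0 < t0 by rewrite !lt_min ltr01 !divr_gt0// !mulr_gt0.
have dd1 : d < d1 by rewrite /d gt_min; apply/orP; left; lra.
exists d, t0, (M *: N); split=> //.
- by move=> z zx; apply: hU; exact: lt_trans dd1.
- move=> a a' xi v hv hb; apply: (hasd1_comp C0 d10 _ hv) => [y u yx ud|t tab].
    by have [] := ht y u yx ud.
  exact: lt_trans (hb t tab) dd1.
move=> y w yx cy wW aw t /andP[t_ge0 tt0].
have [->|tn0] := eqVneq t 0; first by rewrite scale0r expr0n scale0r !addr0.
have tp : 0 < t by rewrite lt_def tn0.
have /and3P[t1 t2 t3] : [&& t <= 1, t <= d1 / (2 * (W + M / G + 1)) & t <= G / (2 * (C + 1) * M)].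
  by move: tt0; rewrite !le_min => /andP[-> /andP[-> ->]].
set u := t *: w + t ^+ 2 *: (M *: N).
have nu : enorm u <= t * W + t ^+ 2 * (M / G).
  apply: le_trans (enormD _ _) _; rewrite !enormZ nN !ger0_norm ?sqr_ge0 ?(ltW M0)//.
  by rewrite lerD2r ler_wpM2l.
have nu2 : enorm u < d1.
  apply: (@le_lt_trans _ _ (t * (W + M / G))).
    apply: le_trans nu _; rewrite mulrDr lerD2l ler_wpM2r ?divr_ge0 ?(ltW M0) ?(ltW G0)//.
    by rewrite expr2 ler_piMl.
  apply: (@lt_le_trans _ _ (t * (W + M / G + 1))); first by rewrite ltr_pM2l// ltrDl.
  apply: (@le_trans _ _ (d1 / 2)); last lra.
  rewrite -ler_pdivlMr//; apply: le_trans t2 _.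
  by rewrite invfM mulrA.
have yx1 : enorm (y - x) < d1 by exact: lt_trans dd1.
have Uy : U y := hU y yx1.
have ry : rho y <= 0 := defining_fun_le0 hrho Uy cy.
have [h1 _] := ht y u yx1 nu2.
have xx1 : enorm (x - x) < d1 by rewrite subrr enorm0.
have [_] := ht x (y - x) xx1 yx1.
rewrite [x + _]addrC subrK -/g => h2.
have gyN : dotv (grad rho y) N <= - 2^-1.
  rewrite -[grad rho y](subrK g) dotvDl gN.
  have := cauchy_schwarz (grad rho y - g) N; rewrite nN.
  have : enorm (grad rho y - g) / G <= 2^-1.
    rewrite ler_pdivrMr//; apply: le_trans h2 _.
    apply: (@le_trans _ _ (C * (G / (2 * C)))).
      rewrite ler_pM2l//; apply: ltW; apply: lt_le_trans yx _; by rewrite ge_min lexx orbT.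
    by rewrite le_eqVlt; apply/orP; left; apply/eqP; field; rewrite gt_eqF.
  lra.
set r := Num.sqrt (- rho y) in aw; have r0 : 0 <= r := sqrtr_ge0 _.
have rr : rho y = - r ^+ 2 by rewrite sqr_sqrtr ?oppr_ge0// opprK.
have Cu : C * enorm u ^+ 2 <= 2 * C * W ^+ 2 * t ^+ 2 + t ^+ 2.
  apply: (@le_trans _ _ (C * (2 * (t * W) ^+ 2 + 2 * (t ^+ 2 * (M / G)) ^+ 2))).
    rewrite ler_pM2l//; apply: (@le_trans _ _ ((t * W + t ^+ 2 * (M / G)) ^+ 2)).
      by rewrite ler_pXn2r ?nnegrE ?enorm_ge0// (le_trans _ nu)// enorm_ge0.
    have := sqr_ge0 (t * W - t ^+ 2 * (M / G)); move: (t * W) (t ^+ 2 * _) => X Y; lra.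
  rewrite (_ : C * _ = 2 * C * W ^+ 2 * t ^+ 2 + (2 * C * (t * (M / G)) ^+ 2) * t ^+ 2); last by ring.
  rewrite lerD2l ler_piMl ?sqr_ge0//.
  have tM : t * (M / G) <= (2 * (C + 1))^-1.
    rewrite mulrA ler_pdivrMr// -ler_pdivlMr//; apply: le_trans t3 _.
    by rewrite le_eqVlt; apply/orP; left; apply/eqP; field; rewrite !gt_eqF.
  have tM0 : 0 <= t * (M / G) by rewrite mulr_ge0// divr_ge0// ltW.
  apply: (@le_trans _ _ (2 * C * (2 * (C + 1))^-1 ^+ 2)).
    have C20 : 0 <= (2 * (C + 1))^-1 by rewrite invr_ge0 mulr_ge0// ltW.
    rewrite ler_wpM2l ?mulr_ge0 ?(ltW C0)// ler_pXn2r ?nnegrE//.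
  rewrite exprVn ler_pdivrMr ?mul1r ?exprn_gt0 ?mulr_gt0//; nra.
suff : rho (y + u) < 0.
  move=> h; rewrite -addrA; apply: subset_closure; apply/hO => //; apply: hU.
  rewrite addrAC; apply: le_lt_trans (enormD _ _) _.
  have du : enorm u <= d1 / 2.
    apply: (@le_trans _ _ (t * (W + M / G + 1))).
      apply: le_trans nu _; rewrite mulrDr mulrDr -!addrA lerD2l.
      rewrite ler_wpDr ?mulr1// ler_wpM2r ?divr_ge0 ?(ltW M0) ?(ltW G0)//.
      by rewrite expr2 ler_piMl.
    rewrite -ler_pdivlMr//; apply: le_trans t2 _.
    by rewrite invfM mulrA.
  have yd : enorm (y - x) < d1 / 2 by apply: lt_le_trans yx _; rewrite ge_min lexx.
  lra.
move: h1; rewrite ler_norml => /andP[_ h1].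
have gu : dotv (grad rho y) u <= t * r - M / 2 * t ^+ 2.
  rewrite dotvDr !dotvZr; apply: lerD; first by rewrite ler_pM2l.
  rewrite mulrA; apply: (@le_trans _ _ (t ^+ 2 * M * (- 2^-1))).
    by rewrite ler_wpM2l// mulr_ge0 ?sqr_ge0// ltW.
  by rewrite le_eqVlt; apply/orP; left; apply/eqP; field.
have : rho (y + u) <= - r ^+ 2 + t * r - t ^+ 2.
  rewrite rr in h1; move: h1 gu Cu; rewrite /M; set Z := dotv _ u; set Z' := C * enorm u ^+ 2.
  move: (rho (y + u)) => q h1 gu Cu.
  have : q <= - r ^+ 2 + (t * r - (4 * C * W ^+ 2 + 4) / 2 * t ^+ 2) + (2 * C * W ^+ 2 * t ^+ 2 + t ^+ 2).
    by move: h1 gu Cu; rewrite opprK; lra.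
  by move=> /le_trans; apply; rewrite le_eqVlt; apply/orP; left; apply/eqP; field.
have := sqr_ge0 (r - t / 2); have : 0 < t ^+ 2 by rewrite exprn_gt0.
nra.
Qed.

End boundary.

(** * Recovery of competitors *)

Section smoothstep.
Context {R : realType}.
Variables (s h : R).
Hypothesis h0 : 0 < h.
Implicit Types (t x y : R).

(* Smooth cutoff from 1 (at s) to 0 (at s + h) with vanishing end slopes. *)
Definition cutoff t := 1 - (3 * ((t - s) / h) ^+ 2 - 2 * ((t - s) / h) ^+ 3).
Definition dcutoff t := - (6 * ((t - s) / h) - 6 * ((t - s) / h) ^+ 2) / h.

Lemma cutoff_hasd1 a b : hasd1 a b cutoff dcutoff.
Proof.
have Hu : hasd1 a b (fun t => (t - s) / h) (fun=> h^-1).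
  have := hasd1Z h^-1 (hasd1D (@hasd1_id R a b) (@hasd1_cst R a b (- s))).
  by apply: hasd1_ext => t _ /=; ring.
have := hasd1D (@hasd1_cst R a b 1) (hasd1D (hasd1Z (-3) (hasd1M Hu Hu)) (hasd1Z 2 (hasd1M Hu (hasd1M Hu Hu)))).
by apply: hasd1_ext => t _ /=; rewrite /cutoff /dcutoff; ring.
Qed.

Lemma cutoff_unit t : s <= t <= s + h -> 0 <= (t - s) / h <= 1.
Proof.
move=> /andP[st th]; rewrite divr_ge0 ?subr_ge0 ?(ltW h0)//= ler_pdivrMr// mul1r.
by rewrite lerBlDl.
Qed.

Lemma cutoff_ge0 t : s <= t <= s + h -> 0 <= cutoff t <= 1.
Proof.
move=> /cutoff_unit; rewrite /cutoff; set u := (t - s) / h => /andP[u0 u1].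
have : 0 <= (1 - u) ^+ 2 * (1 + 2 * u) by rewrite mulr_ge0 ?sqr_ge0//; lra.
have : 0 <= u ^+ 2 * (3 - 2 * u) by rewrite mulr_ge0 ?sqr_ge0//; lra.
by move=> h1 h2; apply/andP; split; lra.
Qed.

Lemma dcutoff_le t : s <= t <= s + h -> `|dcutoff t| <= 2 / h.
Proof.
move=> /cutoff_unit; rewrite /dcutoff; set u := (t - s) / h => /andP[u0 u1].
rewrite normrM [X in _ * X]ger0_norm ?invr_ge0 ?(ltW h0)// ler_pM2r ?invr_gt0//.
have h1 : 0 <= u * (1 - u) by rewrite mulr_ge0// subr_ge0.
have h2 := sqr_ge0 (u - 2^-1); rewrite ler_norml; apply/andP; split; lra.
Qed.

Lemma cutoff_lip x y : s <= x <= s + h -> s <= y <= s + h -> x < y -> `|cutoff y - cutoff x| <= 2 / h * (y - x).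
Proof.
move=> /cutoff_unit /andP[] + + /cutoff_unit /andP[]; rewrite /cutoff.
have -> : 2 / h * (y - x) = 2 * ((y - s) / h - (x - s) / h) by field; rewrite gt_eqF.
move=> u0 u1 v0 v1 xy.
have : (x - s) / h < (y - s) / h by rewrite ltr_pM2r ?invr_gt0// ltrD2r.
move: (_ / h) u0 u1 (_ / h) v0 v1 => u u0 u1 v v0 v1 uv.
have -> : 1 - (3 * v ^+ 2 - 2 * v ^+ 3) - (1 - (3 * u ^+ 2 - 2 * u ^+ 3)) =
  - ((v - u) * (3 * (u + v) - 2 * (u ^+ 2 + u * v + v ^+ 2))) by ring.
rewrite normrN normrM gtr0_norm ?subr_gt0// mulrC ler_pM2r ?subr_gt0//.
have h1 := sqr_ge0 (u - 2^-1); have h2 := sqr_ge0 (v - 2^-1); have h3 := sqr_ge0 (u + v - 1).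
have h4 : 0 <= u * (1 - u) by rewrite mulr_ge0// subr_ge0.
have h5 : 0 <= v * (1 - v) by rewrite mulr_ge0// subr_ge0.
have h6 : 0 <= u * (1 - v) by rewrite mulr_ge0// subr_ge0.
have h7 : 0 <= v * (1 - u) by rewrite mulr_ge0// subr_ge0.
by rewrite ler_norml; apply/andP; split; lra.
Qed.

Lemma dcutoff_lip x y : s <= x <= s + h -> s <= y <= s + h -> x < y ->
  `|dcutoff y - dcutoff x| <= 6 / h ^+ 2 * (y - x).
Proof.
move=> /cutoff_unit /andP[] + + /cutoff_unit /andP[]; rewrite /dcutoff.
have -> : 6 / h ^+ 2 * (y - x) = 6 * ((y - s) / h - (x - s) / h) / h by field; rewrite gt_eqF.
move=> u0 u1 v0 v1 xy.
have : (x - s) / h < (y - s) / h by rewrite ltr_pM2r ?invr_gt0// ltrD2r.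
move: (_ / h) u0 u1 (_ / h) v0 v1 => u u0 u1 v v0 v1 uv.
have -> : - (6 * v - 6 * v ^+ 2) / h - - (6 * u - 6 * u ^+ 2) / h = - ((v - u) * (6 - 6 * (u + v))) / h by ring.
rewrite normrM normrN normrM gtr0_norm ?subr_gt0// [X in _ * _ * X]ger0_norm ?invr_ge0 ?(ltW h0)//.
rewrite ler_pM2r ?invr_gt0// mulrC ler_pM2r ?subr_gt0//.
by rewrite ler_norml; apply/andP; split; lra.
Qed.

Lemma cutoff_s : cutoff s = 1.
Proof. by rewrite /cutoff subrr mul0r; ring. Qed.

Lemma cutoff_sh : cutoff (s + h) = 0.
Proof. by rewrite /cutoff (addrC s) addrK divff ?gt_eqF//; ring. Qed.

Lemma dcutoff_s : dcutoff s = 0.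
Proof. by rewrite /dcutoff subrr mul0r; ring. Qed.

Lemma dcutoff_sh : dcutoff (s + h) = 0.
Proof. by rewrite /dcutoff (addrC s) addrK divff ?gt_eqF//; ring. Qed.

End smoothstep.

Lemma closure_convex {R : realType} {n} (Om : set 'rV[R]_n) : convex_dom Om -> convex_dom (closure Om).
Proof.
move=> cO x y /closure_enormP cx /closure_enormP cy t t01; apply/closure_enormP => e e0.
have [x' Ox xx] := cx e e0; have [y' Oy yy] := cy e e0.
exists ((1 - t) *: x' + t *: y'); first exact: cO.
have -> : (1 - t) *: x + t *: y - ((1 - t) *: x' + t *: y') = (1 - t) *: (x - x') + t *: (y - y').
  by apply/rowP => i; rewrite !mxE; ring.
apply: le_lt_trans (enormD _ _) _; rewrite !enormZ; move: t01 => /andP[t0 t1].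
rewrite !ger0_norm ?subr_ge0//.
have := enorm_ge0 (x - x'); have := enorm_ge0 (y - y').
have [->|tn] := eqVneq t 0; first by rewrite subr0 mul1r mul0r addr0.
have {}t0 : 0 < t by rewrite lt_def tn.
have : t * enorm (y - y') < t * e by rewrite ltr_pM2l.
have : (1 - t) * enorm (x - x') <= (1 - t) * e by rewrite ler_wpM2l ?subr_ge0// ltW.
lra.
Qed.

(** * Merging an arc into a given path *)

Section blending.
Context {R : realType} {n : nat}.
Variables (Om : set 'rV[R]_n) (q T : R).
Hypotheses (q1 : 1 < q) (T0 : 0 < T) (cO : convex_dom Om).
Implicit Types (xi eta : R -> 'rV[R]_n) (r s h t e : R).

Let q0 : 0 < q. Proof. exact: lt_trans q1. Qed.

Definition arc (y w b : 'rV[R]_n) s t := y + (t - s) *: w + (t - s) ^+ 2 *: b.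
Definition darc (w b : 'rV[R]_n) s t := w + (2 * (t - s)) *: b.

Lemma arc_hasd a c y w b s : hasd a c (arc y w b s) (darc w b s).
Proof.
have Hu : hasd1 a c (fun t => t - s) (fun=> 1).
  have := hasd1D (@hasd1_id R a c) (@hasd1_cst R a c (- s)).
  by apply: hasd1_ext => t _ //=; rewrite addr0.
have := hasdD (hasdD (@hasd_cst _ _ a c y) (hasdZ Hu (@hasd_cst _ _ a c w))) (hasdZ (hasd1M Hu Hu) (@hasd_cst _ _ a c b)).
apply: hasd_ext => t _; rewrite /arc /darc //=; apply/rowP => i; rewrite !mxE; ring.
Qed.

Lemma darc_lip w b s M x y : enorm b <= M -> x < y -> enorm (darc w b s y - darc w b s x) <= 2 * M * (y - x).
Proof.
move=> bM xy; have -> : darc w b s y - darc w b s x = (2 * (y - x)) *: b.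
  by apply/rowP => i; rewrite !mxE; ring.
by rewrite enormZ ger0_norm ?mulr_ge0 ?subr_ge0 ?(ltW xy)// mulrAC ler_wpM2r ?subr_ge0 ?(ltW xy)// ler_wpM2l.
Qed.

(** The velocity correction is a sum of two products, each contributing two parts; separating by
    halves twice gives [wt q 2^-1 ^+ 2]. The numbers 2 and 6 bound the first and second derivatives
    of the cutoff for [h = 1]. *)
Definition blend_const : R := wt q 2^-1 ^+ 2 * (1 + 2 * 2 `^ q + 6 `^ q).

(** The path [eta + c (arc - eta)] stays in the closure by convexity. Only the energy of the
    correction [D] to the velocity of [eta] is estimated, so that each caller chooses the weights
    with which it is added to the energy of [eta]. *)
Lemma blend eta r s h y w b GA GB rB : energy Om q T r eta -> 0 <= s -> 0 < h -> s + h <= T ->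
  (forall t, s <= t <= s + h -> closure Om (arc y w b s t)) ->
  (forall t, s <= t <= s + h -> enorm (arc y w b s t - eta t) <= GA) ->
  (forall t, s <= t <= s + h -> enorm (darc w b s t - Dp T eta t) <= GB) ->
  Vle q (fun t => darc w b s t - Dp T eta t) s (s + h) rB ->
  exists f D, [/\ hasd s T f (fun t => Dp T eta t + D t),
    f s = y /\ Dp T eta s + D s = w,
    forall t, s <= t <= T -> closure Om (f t),
    Vle q D s T (blend_const * (rB + pterm q GB h + pterm q (GA / h) h)) &
    forall t, s <= t <= T -> enorm (f t - eta t) <= GA /\ enorm (D t) <= GB + 2 / h * GA].
Proof.
move=> [G V] s0 h0 shT cz hA hB VB.
have ssh : s <= s + h by rewrite lerDl ltW.
have sI : s <= s <= s + h by rewrite lexx.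
have shI : s <= s + h <= s + h by rewrite lexx andbT.
have GA0 : 0 <= GA by apply: le_trans (hA s sI); exact: enorm_ge0.
have GB0 : 0 <= GB by apply: le_trans (hB s sI); exact: enorm_ge0.
pose A t := arc y w b s t - eta t; pose B t := darc w b s t - Dp T eta t.
pose c := cutoff s h; pose c' := dcutoff s h.
pose D1 t := c t *: B t + c' t *: A t.
exists (fun t => if t <= s + h then eta t + c t *: A t else eta t), (fun t => if t <= s + h then D1 t else 0).
have GD := Gam_hasd G.
have HA : hasd s (s + h) A B.
  exact: hasdD (@arc_hasd _ _ y w b s) (hasdN (hasd_sub s0 shT GD)).
have E1 : c (s + h) = 0 by exact: cutoff_sh.
have E2 : c' (s + h) = 0 by exact: dcutoff_sh.
have E3 : D1 (s + h) = 0 by rewrite /D1 E1 E2 !scale0r addr0.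
have [E4 E5] : c s = 1 /\ c' s = 0 by split; [exact: cutoff_s|exact: dcutoff_s].
split.
- have H1 := hasdD (hasd_sub s0 shT GD) (hasdZ (@cutoff_hasd1 R s h s (s + h)) HA).
  have H2 : hasd (s + h) T eta (Dp T eta) by apply: hasd_sub GD; rewrite ?addr_ge0// ltW.
  have := hasd_glue ssh shT H1 H2.
  rewrite -/c -/c' E1 E2 !scale0r !addr0 => /(_ erefl erefl).
  apply: hasd_ext => // t _; case: ifP => _; last by rewrite addr0.
  by rewrite /D1 [c' t *: _ + _]addrC.
- rewrite ssh E4 scale1r /A addrC subrK /D1 E4 E5 scale1r scale0r addr0 /B addrC subrK.
  by rewrite /arc /darc subrr scale0r mulr0 scale0r expr0n scale0r !addr0.
- move=> t /andP[st tT]; have et : closure Om (eta t).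
    by have [_ _ _ cl] := G; apply: cl; rewrite tT (le_trans s0).
  case: ifP => // tsh; have tI : s <= t <= s + h by rewrite st.
  have -> : eta t + c t *: A t = (1 - c t) *: eta t + c t *: arc y w b s t.
    by apply/rowP => i; rewrite !mxE; ring.
  by apply: closure_convex => //; [exact: cz | exact: cutoff_ge0].
- have hh : s + h - s = h by ring.
  have VA : Vle q A s (s + h) (GB `^ q * h).
    have := @Vle_lip _ _ q q1 A s (s + h) GB; rewrite hh; apply=> // x z sx xz zsh.
    have HA' : hasd x z A B by apply: hasd_sub HA.
    have := hasd_mean_value (w := 0) (ltW xz) HA'; rewrite scaler0 subr0; apply.
    by move=> d /andP[xd dz]; rewrite subr0; apply: hB; rewrite (le_trans sx (ltW xd)) (le_trans (ltW dz)).
  have in_ x z : s <= x -> x < z -> z <= s + h -> (s <= x <= s + h) * (s <= z <= s + h).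
    by move=> sx xz zh; rewrite sx zh (le_trans (ltW xz) zh) (le_trans sx (ltW xz)).
  have V1 : Vle q (fun t => c t *: B t) s (s + h) (wt q 2^-1 * (1 `^ q * rB) + wt q 2^-1 * ((2 / h * GB) `^ q * h)).
    have := @Vle_scale _ _ q q1 c B s (s + h) 1 (2 / h) GB rB; rewrite hh; apply=> //.
    - by move=> x xI; have /andP[c0 c1] := cutoff_ge0 h0 xI; rewrite ger0_norm.
    - by move=> x z sx xz zh; have I := in_ x z sx xz zh; apply: cutoff_lip => //; rewrite I.
  have V2 : Vle q (fun t => c' t *: A t) s (s + h) (wt q 2^-1 * ((2 / h) `^ q * (GB `^ q * h)) + wt q 2^-1 * ((6 / h ^+ 2 * GA) `^ q * h)).
    have := @Vle_scale _ _ q q1 c' A s (s + h) (2 / h) (6 / h ^+ 2) GA (GB `^ q * h); rewrite hh; apply=> //.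
    - by move=> x xI; exact: dcutoff_le.
    - by move=> x z sx xz zh; have I := in_ x z sx xz zh; apply: dcutoff_lip => //; rewrite I.
  have half : 0 < (2^-1 : R) < 1 by rewrite invr_gt0 ltr0Sn invf_lt1// ltr1n.
  have HD x z : s <= x -> x < z -> z <= s + h -> enorm (D1 z - D1 x) <=
      enorm (c z *: B z - c x *: B x) + enorm (c' z *: A z - c' x *: A x).
    by move=> _ _ _; rewrite /D1 opprD addrACA; exact: enormD.
  have VD := Vle_add2 q1 half HD V1 V2.
  have V0 : Vle q (fun t => if t <= s + h then D1 t else 0) (s + h) T (0 `^ q * (T - (s + h))).
    apply: Vle_lip => // x z sx xz zT; rewrite mul0r.
    have -> : (if z <= s + h then D1 z else 0) = 0 by rewrite lt_geF// (le_lt_trans sx).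
    case: ifP => [xs|_]; last by rewrite subrr enorm0.
    by rewrite (@le_anti _ _ x (s + h)) ?E3 ?subrr ?enorm0// xs.
  have ED t : s <= t <= s + h -> D1 t = if t <= s + h then D1 t else 0 by move=> /andP[_ ->].
  have VD' := Vle_ext q1 ED VD.
  apply: (Vle_mono _ (Vle_cat q1 ssh shT VD' V0)).
  rewrite powR0 ?gt_eqF// mul0r addr0 powR1 mul1r.
  have -> : 1 - 2^-1 = 2^-1 :> R by field.
  have r0 : 0 <= rB := Vle_ge0 ssh VB.
  have -> : (2 / h * GB) `^ q * h = 2 `^ q * pterm q GB h.
    have -> : 2 / h * GB = 2 * (GB / h) by ring.
    by rewrite /pterm [(2 * _) `^ q]powRM// ?divr_ge0 ?(ltW h0)//; ring.
  have -> : (2 / h) `^ q * (GB `^ q * h) = 2 `^ q * pterm q GB h.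
    by rewrite /pterm !powRM ?invr_ge0 ?(ltW h0)//; ring.
  have -> : (6 / h ^+ 2 * GA) `^ q * h = 6 `^ q * pterm q (GA / h) h.
    have -> : 6 / h ^+ 2 * GA = 6 * (GA / h / h) by field; rewrite gt_eqF.
    by rewrite /pterm [(6 * _) `^ q]powRM// ?divr_ge0 ?(ltW h0)//; ring.
  rewrite /blend_const.
  have := pterm_ge0 q GB (ltW h0); have := pterm_ge0 q (GA / h) (ltW h0).
  have := powR_ge0 2 q; have := powR_ge0 6 q.
  move: (pterm q GB h) (pterm q _ h) (2 `^ q) (6 `^ q) (wt q 2^-1) => P1 P2 x z k z0 x0 P20 P10.
  rewrite (_ : _ + _ = k ^+ 2 * (rB + 2 * (x * P1) + z * P2)); last by ring.
  rewrite -[leRHS]mulrA ler_wpM2l ?sqr_ge0//.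
  have := mulr_ge0 x0 r0; have := mulr_ge0 z0 r0; have := mulr_ge0 z0 P10.
  have := mulr_ge0 x0 P20; lra.
- move=> t /andP[st tT]; case: ifP => [tsh|_]; last first.
    by rewrite subrr enorm0; split=> //; rewrite addr_ge0// mulr_ge0// divr_ge0// ltW.
  have tI : s <= t <= s + h by rewrite st.
  have /andP[c0 c1] := cutoff_ge0 h0 tI.
  split.
    rewrite (addrC (eta t)) addrK enormZ ger0_norm//; apply: le_trans (hA t tI).
    by rewrite ler_piMl// enorm_ge0.
  apply: le_trans (enormD _ _) _; rewrite !enormZ; apply: lerD.
    rewrite ger0_norm//; apply: le_trans (hB t tI); by rewrite ler_piMl// enorm_ge0.
  by apply: ler_pM => //; [exact: enorm_ge0|exact: dcutoff_le|exact: hA].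
Qed.

End blending.

Lemma pterm_inv {R : realType} (q x y h : R) : 0 < q -> 0 < h -> 0 <= x -> 0 <= y ->
  pterm q x h <= pterm q y h -> x <= y.
Proof.
move=> q0 h0 x0 y0; rewrite /pterm ler_pM2l// => H; rewrite leNgt; apply/negP => yx.
move: H; rewrite leNgt gt0_ltr_powR// ?nnegrE ?divr_ge0 ?(ltW h0)//.
by rewrite ltr_pM2r// invr_gt0.
Qed.

Lemma hasd_bound {R : realType} {n} (a b : R) (f v : R -> 'rV[R]_n) s e : hasd a b f v -> a <= s <= b -> 0 < e ->
  exists2 d, 0 < d & forall t, a <= t <= b -> `|t - s| < d -> enorm (f t - f s) <= e.
Proof.
move=> h sab e0; have [d d0 hd] := hasd_enorm h sab (ltr01 : 0 < 1 :> R).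
have K0 : 0 < enorm (v s) + 1 by rewrite ltr_wpDl ?enorm_ge0.
exists (Num.min d (e / (enorm (v s) + 1))); first by rewrite lt_min d0 divr_gt0.
move=> t tab; rewrite lt_min => /andP[td te].
rewrite -[f t - f s](subrK ((t - s) *: v s)); apply: le_trans (enormD _ _) _.
apply: le_trans (lerD (hd t tab td) (lexx _)) _; rewrite enormZ mul1r.
have -> : `|t - s| + `|t - s| * enorm (v s) = `|t - s| * (enorm (v s) + 1) by ring.
by rewrite -ler_pdivlMr// ltW.
Qed.

Lemma Gam_abs_cont {R : realType} {n} (Om : set 'rV[R]_n) T xi : Gam Om T xi -> abs_cont_on T (Dp T xi).
Proof. by case. Qed.

Lemma Gam_closure {R : realType} {n} (Om : set 'rV[R]_n) T xi s : Gam Om T xi -> 0 <= s <= T -> closure Om (xi s).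
Proof. by move=> [_ _ _]; apply. Qed.

Lemma enorm_le3 {R : realType} {n} (a b c : 'rV[R]_n) x y z : enorm a <= x -> enorm b <= y -> enorm c <= z ->
  enorm (a + b - c) <= x + y + z.
Proof.
move=> ax bY cz; apply: le_trans (enormB _ _) _; apply: lerD => //.
by apply: le_trans (enormD _ _) _; exact: lerD.
Qed.

Lemma le_quarters {R : realFieldType} (d m : R) : 0 < m -> d <= m / 4 -> d + m / 4 + m / 4 <= m.
Proof. lra. Qed.

Lemma ge_min_l {R : realDomainType} (a b : R) : Num.min a b <= a.
Proof. by rewrite ge_min lexx. Qed.

Lemma ge_min_r {R : realDomainType} (a b : R) : Num.min a b <= b.
Proof. by rewrite ge_min lexx orbT. Qed.

Lemma small_sum {R : realFieldType} (m o e : R) : 0 < e -> m <= o -> o <= e / 16 -> 3 * m + (2 * o + 6 * o) <= e.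
Proof. lra. Qed.

Lemma small_sum2 {R : realFieldType} (m o e : R) : 0 < e -> m <= o -> o <= e / 16 -> m + m <= e.
Proof. lra. Qed.

Lemma lt_half {R : realFieldType} (a t : R) : 0 < a -> t <= a / 2 -> t < a.
Proof. lra. Qed.

(** * The recovery construction *)

Section recovery.
Context {R : realType} {n : nat}.
Variables (Om : set 'rV[R]_n) (q T : R).
Hypotheses (q1 : 1 < q) (T0 : 0 < T) (oO : open Om) (cO : convex_dom Om)
  (bO : forall x0, bdry Om x0 -> exists U rho, local_defining_fun 2 Om x0 U rho).
Implicit Types (xi eta : R -> 'rV[R]_n) (x y w b : 'rV[R]_n) (r s h t e : R).

Let q0 : 0 < q. Proof. exact: lt_trans q1. Qed.

(** The duration [t0] and the bound [M] on the bending depend neither on [tau] nor on the path, so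
    the waiting time [tau] can be chosen after the duration of the arc. At a boundary point, [s]
    comes from [good_time] applied to [- rho] along the path; in the interior, [s = 0] and a
    straight segment do. *)
Lemma inward_start x W : closure Om x -> 0 <= W -> exists t0 M, [/\ 0 < t0, 0 <= M &
  forall tau, 0 < tau -> exists2 d, 0 < d & forall xi v, hasd 0 tau xi v ->
    (forall t, 0 <= t <= tau -> closure Om (xi t)) -> (forall t, 0 <= t <= tau -> enorm (v t) <= W) ->
    enorm (xi 0 - x) < d -> exists s b, [/\ 0 <= s <= tau, enorm b <= M &
      forall t, 0 <= t <= t0 -> closure Om (xi s + t *: v s + t ^+ 2 *: b)]].
Proof.
move=> cx W0; have W1 : 0 < W + 1 by rewrite ltr_wpDl.
case: (closure_case oO cx) => [Ox|bx]; last have [U [rho hrho]] := bO bx.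
  have [d d0 hd] := open_near oO Ox.
  exists (d / 2 / (W + 1)), 0; split=> //; first by rewrite !divr_gt0.
  move=> tau tau0; exists (d / 2); first by rewrite divr_gt0.
  move=> xi v _ _ hv x0; exists 0, 0; split; [by rewrite lexx ltW|by rewrite enorm0|].
  move=> t /andP[t_ge0 tt]; rewrite scaler0 addr0; apply: subset_closure; apply: hd.
  apply: le_lt_trans (mxnorm_le_enorm _) _; rewrite addrAC.
  apply: le_lt_trans (enormD _ _) _; rewrite enormZ ger0_norm//.
  have vW : enorm (v 0) <= W + 1 by apply: le_trans (hv 0 _) _; rewrite ?lerDl ?lexx ?ltW.
  have : t * enorm (v 0) <= d / 2 / (W + 1) * (W + 1) by apply: ler_pM => //; exact: enorm_ge0.
  by rewrite divfK ?gt_eqF//; move: x0; lra.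
have [d [t0 [b [d0 t00 hU hc harc]]]] := inward_arc hrho W0.
exists t0, (enorm b); split=> //; first exact: enorm_ge0.
move=> tau tau0; pose tau' := Num.min tau (d / 2 / (W + 1)).
have tau'0 : 0 < tau' by rewrite lt_min tau0 !divr_gt0.
have [tt td] : tau' <= tau /\ tau' <= d / 2 / (W + 1) by rewrite /tau' !ge_min !lexx orbT.
have [oU Ux Crho _ _] := hrho.
have rx := defining_fun_bdry oO hrho bx.
(* [rho] vanishes at [x], so a start close to [x] makes [sqrt (- rho)] less than [tau' / 2], as
   [good_time] requires. *)
have [|d2 d20 hd2] := continuous_near (Crho.1 x Ux) (_ : 0 < (tau' / 2) ^+ 2); first by rewrite exprn_gt0// divr_gt0.
exists (Num.min (d / 2) d2); first by rewrite lt_min divr_gt0.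
move=> xi v hv hcl hW; rewrite lt_min => /andP[x1 x2].
have hv' : hasd 0 tau' xi v by apply: hasd_sub hv.
have near t : 0 <= t <= tau' -> enorm (xi t - x) < d.
  move=> /andP[t_ge0 ttau].
  have := @hasd_mean_value _ _ 0 t xi v 0 (W + 1) t_ge0 (hasd_sub (lexx 0) ttau hv').
  rewrite scaler0 !subr0 => /(_ _)-h.
  have {}h : enorm (xi t - xi 0) <= (W + 1) * t.
    apply: h => c /andP[c0 ct]; rewrite subr0 (le_trans (hW c _)) ?lerDl//.
    by rewrite ltW// (le_trans (ltW ct))// (le_trans ttau).
  have h2 : (W + 1) * t <= d / 2.
    by rewrite mulrC -ler_pdivlMr// (le_trans ttau).
  apply: le_lt_trans (enorm_dist_trans _ (xi 0) _) _; move: h h2 x1; lra.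
have hD := hasd1N (hc 0 tau' xi v hv' near).
have [| |s sI hs] := good_time hD.
- move=> t tI /=; rewrite oppr_ge0; apply: (defining_fun_le0 hrho); first exact/hU/near.
  by apply: hcl; case/andP: tI => -> /le_trans; apply.
- rewrite /= -[X in _ < X](ger0_norm (_ : 0 <= tau' / 2)) ?divr_ge0 ?(ltW tau'0)//.
  rewrite -sqrtr_sqr ltr_sqrt ?exprn_gt0 ?divr_gt0//.
  have := hd2 (xi 0) (le_lt_trans (mxnorm_le_enorm _) x2); rewrite rx subr0.
  by apply: le_lt_trans; rewrite -normrN ler_norm.
have sI' : 0 <= s <= tau by case/andP: sI => -> /le_trans; apply.
exists s, b; split=> //; apply: harc; [exact: near|exact: hcl|exact: hW|].
by move: hs; rewrite /= opprK.
Qed.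

(** The energy [r'] of [xi'] is arbitrary: [eta'] copies [xi'] on [[0, s]], and only the energy on
    [[s, T]] is estimated. The scales are fixed in the order [e1] (energy of the correction), [h]
    (duration of the merging), [o] (velocity error), [m] (position error), [tau] (waiting time) and
    [d], each in terms of the previous ones. *)
Theorem recovery xi eta r e : Gam Om T xi -> energy Om q T r eta ->
  xi 0 = eta 0 -> Dp T xi 0 = Dp T eta 0 -> 0 < e ->
  exists2 d, 0 < d & forall xi' r', energy Om q T r' xi' -> c1le T xi' xi d ->
  exists s eta', [/\ 0 <= s <= e /\ s <= T, exists r'', energy Om q T r'' eta', forall t, 0 <= t <= s -> eta' t = xi' t /\ Dp T eta' t = Dp T xi' t,
    c1le T eta' eta e & Vle q (Dp T eta') s T (r + e)].
Proof.
move=> Gxi Eeta xe ve e0; have [Geta Veta] := Eeta.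
have r0 : 0 <= r := Vle_ge0 (ltW T0) Veta.
have zI : (0 : R) <= 0 <= T by rewrite lexx ltW.
have cx : closure Om (xi 0) by have [_ _ _ cl] := Gxi; exact: cl.
(* A bound of the speed of [xi'] on [[0, tau]]: 1 for the distance from [xi'] to [xi] and 1 for the
   variation of the velocity of [xi]. *)
set W := enorm (Dp T xi 0) + 2.
have W0 : 0 <= W by rewrite addr_ge0// enorm_ge0.
have [t0 [M [t00 M0 hin]]] := inward_start cx W0.
have er0 : 0 < e / (2 * (r + 1)) by rewrite divr_gt0// mulr_gt0// ltr_wpDl.
(* The weight of [eta] is so close to 1 that it adds at most [e / 2]; the weight of the correction,
   possibly large, is compensated by the choice of [e1]. *)
have [th th01 hth] := wt_cvg1 (ltW q1) er0.
have wr : wt q th * r <= r + e / 2.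
  apply: (@le_trans _ _ ((1 + e / (2 * (r + 1))) * r)); first by rewrite ler_wpM2r.
  rewrite mulrDl mul1r lerD2l; apply: (@le_trans _ _ (e / 2 * (r / (r + 1)))).
    by rewrite le_eqVlt; apply/orP; left; apply/eqP; field; rewrite gt_eqF// ltr_wpDl.
  rewrite ler_piMr ?divr_ge0 ?(ltW e0)// ler_pdivrMr ?mul1r ?lerDl//.
  by rewrite ltr_wpDl.
pose K := wt q (1 - th) * (@blend_const R q * (1 + 2 `^ q + 3 `^ q)).
have th1 : 0 <= 1 - th by case/andP: th01 => _ h; rewrite subr_ge0 ltW.
have bc0 : 0 <= @blend_const R q by rewrite mulr_ge0 ?sqr_ge0// !addr_ge0 ?mulr_ge0 ?powR_ge0.
have K0 : 0 <= K by rewrite mulr_ge0 ?wt_ge0// mulr_ge0// !addr_ge0 ?powR_ge0.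
pose e1 := Num.min (e / (2 * (K + 1))) ((e / 16) `^ q).
have e10 : 0 < e1 by rewrite lt_min divr_gt0 ?powR_gt0 ?divr_gt0// mulr_gt0// ltr_wpDl.
have Ke1 : K * e1 <= e / 2.
  apply: (@le_trans _ _ (K * (e / (2 * (K + 1))))); first by rewrite ler_wpM2l// ge_min lexx.
  apply: (@le_trans _ _ (e / 2 * (K / (K + 1)))).
    by rewrite le_eqVlt; apply/orP; left; apply/eqP; field; rewrite gt_eqF// ltr_wpDl.
  rewrite ler_piMr ?divr_ge0 ?(ltW e0)// ler_pdivrMr ?mul1r ?lerDl//.
  by rewrite ltr_wpDl.
have KE : K = wt q (1 - th) * (@blend_const R q * (1 + 2 `^ q + 3 `^ q)) by [].
have e1q : e1 <= (e / 16) `^ q by rewrite ge_min lexx orbT.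
clearbody e1 K.
set k2 := wt q 2^-1; have k20 : 0 <= k2 by rewrite wt_ge0.
have e20 : 0 < e1 / (2 * (k2 + 1)) by rewrite divr_gt0// mulr_gt0// ltr_wpDl.
have [d1 d10 hd1] := abs_cont_unif (Gam_abs_cont Geta) e20.
have hstart : enorm (Dp T eta t - Dp T eta 0) @[t --> 0^'+] --> 0.
  apply/cvgrPdist_le => e' e'0; have [d d0 hd] := abs_cont_unif (Gam_abs_cont Geta) e'0.
  exists (Num.min d T); first by rewrite /= lt_min d0.
  move=> t /=; rewrite sub0r normrN lt_min => /andP[td tT] tp.
  rewrite sub0r normrN ger0_norm ?enorm_ge0//; apply: hd => //; last by rewrite subr0.
  by rewrite (ltW tp) ltW// (le_lt_trans _ tT)// ler_norm.
have [d3 d30 hd3] := Vle_start q1 T0 Veta hstart e20.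
have k2E : k2 = wt q 2^-1 by [].
clearbody k2.
pose Lb := (2 * M) `^ q * (k2 + 1).
have Lb0 : 0 <= Lb by rewrite mulr_ge0 ?powR_ge0// addr_ge0.
have LbE : Lb = (2 * M) `^ q * (k2 + 1) by [].
clearbody Lb.
pose h := Num.min (Num.min 1 t0) (Num.min (Num.min (T / 2) (d3 / 2)) (e1 / (2 * (Lb + 1)))).
have h0 : 0 < h.
  by rewrite !lt_min ltr01 t00 !divr_gt0// mulr_gt0// ltr_wpDl.
have /and5P[h1 ht0 hT hd3' hLb] : [&& h <= 1, h <= t0, h <= T / 2, h <= d3 / 2 & h <= e1 / (2 * (Lb + 1))].
  have := lexx h; rewrite {2}/h !le_min => /andP[/andP[-> ->] /andP[/andP[-> ->] ->]].
  by [].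
clearbody h.
(* The velocity error whose energy over the duration [h] is exactly [e1]. *)
pose o := h * (e1 / h) `^ q^-1.
have o0 : 0 < o by rewrite mulr_gt0// powR_gt0 ?divr_gt0.
have po : pterm q o h = e1.
  rewrite /pterm /o mulrAC divff ?gt_eqF// mul1r -powRrM mulVf ?gt_eqF// powRr1 ?divr_ge0 ?ltW//.
  by rewrite mulrC divfK// gt_eqF.
have oe : o <= e / 16.
  apply: (pterm_inv q0 h0 (ltW o0)); first by rewrite divr_ge0// ltW.
  rewrite po; apply: (@le_trans _ _ (pterm q (e / 16) 1)).
    by rewrite /pterm divr1 mul1r.
  apply: pterm_antimono => //; first exact: ltW.
  by rewrite divr_ge0// ltW.
clearbody o.
(* The position error that weighs as much as [o]: it enters the estimate of [blend] through
   [m / h]. *)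
pose m := h * o.
have m0 : 0 < m by rewrite mulr_gt0.
have mo : m <= o by rewrite ler_piMl// ltW.
have mE : m = h * o by [].
clearbody m.
have m4 : 0 < m / 4 by rewrite divr_gt0.
have [a1 a10 ha1] := hasd_bound (Gam_hasd Gxi) zI m4.
have [a2 a20 ha2] := hasd_bound (Gam_hasd Geta) zI m4.
have m14 : 0 < Num.min 1 (m / 4) by rewrite lt_min ltr01.
have [a3 a30 ha3] := abs_cont_unif (Gam_abs_cont Gxi) m14.
have ha31 s t sT tT st := le_trans (ha3 s t sT tT st) (ge_min_l 1 (m / 4)).
have ha32 s t sT tT st := le_trans (ha3 s t sT tT st) (ge_min_r 1 (m / 4)).
clear ha3.
have [a4 a40 ha4] := abs_cont_unif (Gam_abs_cont Geta) m4.
pose tau := Num.min (Num.min h e) (Num.min (Num.min (a1 / 2) (a2 / 2)) (Num.min (a3 / 2) (a4 / 2))).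
have tau0 : 0 < tau by rewrite !lt_min h0 e0 !divr_gt0.
have [th' te [ta1' ta2'] [ta3' ta4']] : [/\ tau <= h, tau <= e, tau <= a1 / 2 /\ tau <= a2 / 2 & tau <= a3 / 2 /\ tau <= a4 / 2].
  by have := lexx tau; rewrite {2}/tau !le_min => /andP[/andP[-> ->] /andP[/andP[-> ->] /andP[-> ->]]].
clearbody tau.
have ta1 := lt_half a10 ta1'; have ta2 := lt_half a20 ta2'.
have ta3 := lt_half a30 ta3'; have ta4 := lt_half a40 ta4'.
have hTT : h <= T := ltW (lt_half T0 hT).
have tauT : tau <= T := le_trans th' hTT.
have [d4 d40 hd4] := hin tau tau0.
pose d := Num.min (Num.min 1 (m / 4)) (d4 / 2).
have d0 : 0 < d by rewrite !lt_min ltr01 m4 divr_gt0.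
exists d => // xi' r' [Gxi' Vxi'] cxi.
have cxi1 t : 0 <= t <= T -> enorm (xi' t - xi t) <= d.
  by move=> /cxi; apply: le_trans; rewrite lerDl enorm_ge0.
have cxi2 t : 0 <= t <= T -> enorm (Dp T xi' t - Dp T xi t) <= d.
  by move=> /cxi; apply: le_trans; rewrite lerDr enorm_ge0.
have [dm [dl d44]] : d <= m / 4 /\ d <= 1 /\ d <= d4 / 2.
  by have := lexx d; rewrite {2}/d !le_min => /andP[/andP[-> ->] ->].
clearbody d.
have tI t : 0 <= t <= tau -> 0 <= t <= T by case/andP=> -> /le_trans; apply.
have tabs t a : 0 <= t <= tau -> tau < a -> `|t - 0| < a.
  by move=> /andP[t_0 tt] ta; rewrite subr0 ger0_norm// (le_lt_trans tt).
have near1 t : 0 <= t <= tau -> enorm (xi' t - eta t) <= m.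
  move=> tt; have := cxi1 t (tI t tt); have := ha1 t (tI t tt) (tabs t _ tt ta1).
  have := ha2 t (tI t tt) (tabs t _ tt ta2).
  have -> : xi' t - eta t = (xi' t - xi t) + (xi t - xi 0) - (eta t - eta 0).
    by rewrite xe; apply/rowP => i; rewrite !mxE; ring.
  by move=> i1 i2 i3; exact: le_trans (enorm_le3 i3 i2 i1) (le_quarters m0 dm).
have near2 t : 0 <= t <= tau -> enorm (Dp T xi' t - Dp T eta t) <= m.
  move=> tt; have := cxi2 t (tI t tt); have := ha32 0 t zI (tI t tt) (tabs t _ tt ta3).
  have := ha4 0 t zI (tI t tt) (tabs t _ tt ta4).
  have -> : Dp T xi' t - Dp T eta t = (Dp T xi' t - Dp T xi t) + (Dp T xi t - Dp T xi 0) - (Dp T eta t - Dp T eta 0).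
    by rewrite ve; apply/rowP => i; rewrite !mxE; ring.
  by move=> i1 i2 i3; exact: le_trans (enorm_le3 i3 i2 i1) (le_quarters m0 dm).
have [s [b [sI bM hz]]] : exists s b, [/\ 0 <= s <= tau, enorm b <= M &
      forall t, 0 <= t <= t0 -> closure Om (xi' s + t *: Dp T xi' s + t ^+ 2 *: b)].
  apply: hd4.
  - by apply: hasd_sub (Gam_hasd Gxi').
  - by move=> t tt; have [_ _ _ cl] := Gxi'; exact/cl/tI.
  - move=> t tt; rewrite /W -[Dp T xi' t](subrK (Dp T xi t)) -[X in _ + X](subrK (Dp T xi 0)).
    have i1 := cxi2 t (tI t tt); have i2 := ha31 0 t zI (tI t tt) (tabs t _ tt ta3).
    apply: le_trans (enormD _ _) _.
    apply: le_trans (lerD (le_trans i1 dl) (le_trans (enormD _ _) (lerD i2 (lexx _)))) _.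
    by rewrite addrA addrC.
  - exact: le_lt_trans (cxi1 0 zI) (lt_half d40 d44).
have /andP[s0 stau] := sI; have sT := le_trans stau tauT.
have shT : s + h <= T by rewrite [leRHS]splitr; exact: lerD (le_trans stau (le_trans th' hT)) hT.
have szI := tI s sI.
pose B t := darc (Dp T xi' s) b s t - Dp T eta t.
pose A t := arc (xi' s) (Dp T xi' s) b s t - eta t.
have half : 0 < (2^-1 : R) < 1 by rewrite invr_gt0 ltr0Sn invf_lt1// ltr1n.
(* The velocity of the arc is Lipschitz and [h] is small; [eta] has little energy on [[0, s + h]] by
   [Vle_start]. *)
have VB : Vle q B s (s + h) e1.
  have v1 : Vle q (darc (Dp T xi' s) b s) s (s + h) ((2 * M) `^ q * (s + h - s)).
    apply: Vle_lip => //; last by rewrite lerDl ltW.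
    by move=> x y _ xy _; exact: darc_lip.
  have v2 : Vle q (Dp T eta) s (s + h) (e1 / (2 * (k2 + 1))).
    apply: (Vle_sub s0 (lexx _)); apply: (hd3 (s + h) _ _ shT); first exact: addr_ge0 (ltW h0).
    by rewrite add0r [leRHS]splitr; exact: lerD (le_trans stau (le_trans th' hd3')) hd3'.
  have HB (x y : R) : s <= x -> x < y -> y <= s + h -> enorm (B y - B x) <=
     enorm (darc (Dp T xi' s) b s y - darc (Dp T xi' s) b s x) + enorm (Dp T eta y - Dp T eta x).
    move=> _ _ _; rewrite (_ : B y - B x = (darc (Dp T xi' s) b s y - darc (Dp T xi' s) b s x) - (Dp T eta y - Dp T eta x)).
      exact: enormB.
    by apply/rowP => i; rewrite !mxE; ring.
  have := Vle_add2 q1 half HB v1 v2; apply: Vle_mono.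
  have -> : 1 - 2^-1 = 2^-1 :> R by field.
  have -> : s + h - s = h by ring.
  rewrite -k2E; have i1 : k2 * (e1 / (2 * (k2 + 1))) <= e1 / 2.
    apply: (@le_trans _ _ ((k2 + 1) * (e1 / (2 * (k2 + 1))))).
      by rewrite ler_wpM2r ?(ltW e20)// lerDl.
    by rewrite le_eqVlt; apply/orP; left; apply/eqP; field; rewrite gt_eqF// ltr_wpDl.
  have i2 : k2 * ((2 * M) `^ q * h) <= e1 / 2.
    apply: (@le_trans _ _ ((Lb + 1) * h)).
      rewrite mulrA ler_pM2r// LbE mulrDr mulr1 mulrC -addrA lerDl.
      by rewrite addr_ge0// powR_ge0.
    rewrite mulrC -ler_pdivlMr ?ltr_wpDl//; apply: le_trans hLb _.
    by rewrite invfM mulrA.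
  by rewrite [leRHS]splitr lerD.
have osc t : s <= t <= s + h -> enorm (B t - B s) <= o.
  move=> /andP[st ts]; have [->|st'] := eqVneq t s; first by rewrite subrr enorm0 ltW.
  have {}st : s < t by rewrite lt_neqAle eq_sym st'.
  apply: (pterm_inv q0 h0 (enorm_ge0 _) (ltW o0)); rewrite po.
  apply: le_trans (Vle_term (lexx s) st ts VB).
  by apply: pterm_antimono; [exact: ltW|exact: enorm_ge0|rewrite subr_gt0|rewrite lerBlDl].
have Bs : enorm (B s) <= o.
  rewrite /B /darc subrr mulr0 scale0r addr0; apply: le_trans (near2 s sI) mo.
have hB t : s <= t <= s + h -> enorm (B t) <= 2 * o.
  move=> /osc h2; rewrite -[B t](subrK (B s)); by apply: le_trans (enormD _ _) _; rewrite mulr_natl mulr2n lerD.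
have HA : hasd s (s + h) A B.
  exact: hasdD (@arc_hasd _ _ _ _ _ _ _ _) (hasdN (hasd_sub s0 shT (Gam_hasd Geta))).
have As : enorm (A s) <= m.
  rewrite /A /arc subrr scale0r expr0n scale0r !addr0; exact: near1.
have hA t : s <= t <= s + h -> enorm (A t) <= 3 * m.
  move=> /andP[st ts].
  have HA' : hasd s t A B by apply: hasd_sub HA.
  have := hasd_mean_value (w := 0) (M := 2 * o) st HA'; rewrite scaler0 subr0 => hmv.
  have {}hmv : enorm (A t - A s) <= 2 * o * (t - s).
    by apply: hmv => c /andP[sc ct]; rewrite subr0; apply: hB; rewrite (ltW sc) (le_trans (ltW ct)).
  have h2 : 2 * o * (t - s) <= 2 * m.
    rewrite mE mulrA -[2 * h * o]mulrAC ler_wpM2l ?mulr_ge0 ?(ltW o0)// lerBlDl//.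
  rewrite -[A t](subrK (A s)); apply: le_trans (enormD _ _) _.
  rewrite (_ : 3 * m = 2 * m + m); last by ring.
  exact: lerD (le_trans hmv h2) As.
have hz' t : s <= t <= s + h -> closure Om (arc (xi' s) (Dp T xi' s) b s t).
  by move=> /andP[st ts]; apply: hz; rewrite subr_ge0 st (le_trans _ ht0)// lerBlDl.
have [f [D [Hf [fs Ds] clf VD fD]]] := blend q1 cO Eeta s0 h0 shT hz' hA hB VB.
have Hg := hasd_glue s0 sT (hasd_sub (lexx 0) sT (Gam_hasd Gxi')) Hf (esym fs) (esym Ds).
set g := fun t => if t <= s then xi' t else f t in Hg.
set v := fun t => if t <= s then Dp T xi' t else Dp T eta t + D t in Hg.
have vE t : s <= t <= T -> v t = Dp T eta t + D t.
  move=> /andP[st _]; rewrite /v; case: ifP => // ts.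
  by rewrite (@le_anti _ _ t s) ?ts// Ds.
have gE t : s <= t <= T -> g t = f t.
  move=> /andP[st _]; rewrite /g; case: ifP => // ts.
  by rewrite (@le_anti _ _ t s) ?ts// fs.
have VDe : Vle q D s T (@blend_const R q * (1 + 2 `^ q + 3 `^ q) * e1).
  apply: Vle_mono VD; rewrite -[leRHS]mulrA ler_wpM2l//.
  rewrite (_ : 3 * m / h = 3 * o); last by rewrite mE; field; rewrite gt_eqF.
  by rewrite !ptermM ?(ltW o0)// po !mulrDl mul1r.
have Vv : Vle q v s T (r + e).
  have Hv (x y : R) : s <= x -> x < y -> y <= T -> enorm (v y - v x) <=
      enorm (Dp T eta y - Dp T eta x) + enorm (D y - D x).
    move=> sx xy yT; rewrite !vE ?yT ?sx ?(le_trans sx (ltW xy)) ?(le_trans (ltW xy) yT)//.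
    by rewrite opprD addrACA; exact: enormD.
  have Ve' : Vle q (Dp T eta) s T r by apply: Vle_sub Veta.
  apply: Vle_mono (Vle_add2 q1 th01 Hv Ve' VDe).
  rewrite mulrA -KE; apply: le_trans (lerD wr Ke1) _.
  by rewrite -addrA -splitr.
have V0T : Vle q v 0 T (r' + (r + e)).
  apply: (Vle_cat q1 s0 sT) => //.
  have : Vle q (Dp T xi') 0 s r' by apply: Vle_sub Vxi'.
  by apply: Vle_ext => // t /andP[_ ts]; rewrite /v ts.
have [|Eg Dg] := energy_intro q1 T0 Hg V0T (Om := Om).
  move=> t /andP[t_0 tT]; rewrite /g; case: ifP => ts.
    by have [_ _ _ cl] := Gxi'; apply: cl; rewrite t_0.
  by apply: clf; rewrite tT andbT leNgt; apply/negP => /ltW; rewrite ts.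
exists s, g; split.
- by rewrite s0 (le_trans stau).
- by exists (r' + (r + e)).
- move=> t /andP[t_0 ts]; rewrite Dg ?t_0 ?(le_trans ts)//; by rewrite /g /v ts.
- move=> t tT; rewrite Dg//; have [st|ts] := leP s t.
    have tI' : s <= t <= T by rewrite st; case/andP: tT.
    rewrite gE// vE// (addrC (Dp T eta t)) addrK; have [i1 i2] := fD t tI'.
    have i3 : 2 / h * (3 * m) = 6 * o by rewrite mE; field; rewrite gt_eqF.
    by rewrite i3 in i2; exact: le_trans (lerD i1 i2) (small_sum e0 mo oe).
  have tI' : 0 <= t <= tau by case/andP: tT => -> _; rewrite (le_trans (ltW ts)).
  rewrite /g /v (ltW ts); apply: le_trans (lerD (near1 t tI') (near2 t tI')) _.
  exact: small_sum2 e0 mo oe.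
- apply: (Vle_ext q1 _ Vv) => t /andP[st tT]; rewrite Dg// tT (le_trans s0)//.
Qed.

End recovery.

(** * Admissible initial conditions *)

Section affine.
Context {R : realType} {n : nat}.
Implicit Types (U : set 'rV[R]_n) (x v : 'rV[R]_n).

Lemma is_derive_affine (c k : R) i0 x v :
  is_derive x v (fun y : 'rV[R]_n => c * y ord0 i0 + k) (c * v ord0 i0).
Proof.
have C : (fun h : R => h^-1 *: (((fun y : 'rV[R]_n => c * y ord0 i0 + k) \o shift x) (h *: v) - (c * x ord0 i0 + k))) @ 0^' --> c * v ord0 i0.
  apply/cvgrPdist_lt => e e0; exists 1 => //= h _ h0.
  rewrite (_ : h^-1 *: _ = c * v ord0 i0); first by rewrite subrr normr0.
  by rewrite !mxE /GRing.scale /=; field.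
apply: DeriveDef; first by apply/cvg_ex; exists (c * v ord0 i0).
exact: cvg_lim C.
Qed.

Lemma Ck_cst m U (k : R) : Ck m U (fun=> k).
Proof.
elim: m k => [|m IH] k; first by split=> // x _; exact: cst_continuous.
split; first by move=> x _; exact: cst_continuous.
move=> i; split; first by move=> x _; apply: ex_derive.
have -> : (fun x : 'rV[R]_n => 'D_(unitv i) (fun=> k) x) = (fun=> 0 : R).
  by apply/funext => x; rewrite derive_cst.
exact: IH.
Qed.

Lemma Ck_affine m U (c k : R) i0 : Ck m U (fun y => c * y ord0 i0 + k).
Proof.
have cont x : {for x, continuous (fun y : 'rV[R]_n => c * y ord0 i0 + k)}.
  apply: (@continuous_comp _ _ _ (fun y : 'rV[R]_n => y ord0 i0) (fun t : R => c * t + k)).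
    exact: coord_continuous.
  by apply: cvgD; [apply: cvgMr; exact: cvg_id|exact: cvg_cst].
case: m => [|m] /=; split=> // i; split.
  by move=> x _; have [] := is_derive_affine c k i0 x (unitv i).
rewrite (_ : (fun x => _) = fun=> c * unitv i ord0 i0); first exact: Ck_cst.
by apply/funext => x; have [_] := is_derive_affine c k i0 x (unitv i).
Qed.

(** The common ground of the two cases of the theorem; the construction is carried out for such
    domains. *)
Definition good_dom (Om : set 'rV[R]_n) := [/\ open Om, bounded_dom Om, convex_dom Om &
  forall x0, bdry Om x0 -> exists U rho, local_defining_fun 2 Om x0 U rho].

End affine.

Lemma open_coord_lt {R : realType} {n} (c k : R) (i : 'I_n) : open [set x : 'rV[R]_n | c * x ord0 i < k].
Proof.
have cont : continuous (fun y : 'rV[R]_n => c * y ord0 i).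
  move=> x; apply: (@continuous_comp _ _ _ (fun y : 'rV[R]_n => y ord0 i) (fun t : R => c * t)).
    exact: coord_continuous.
  by apply: cvgMr; exact: cvg_id.
exact: (open_comp (fun x _ => cont x) (@open_lt R k)).
Qed.

(** The functions [x - 1] and [- x - 1] define the interval on the half-lines [x > 0] and [x < 0],
    each of which leaves out one end point. *)
Lemma interval_good_dom {R : realType} : good_dom [set x : 'rV[R]_1 | forall i, -1 < x ord0 i < 1].
Proof.
set Om := [set x | _].
have OmE : Om = [set x : 'rV[R]_1 | 1 * x ord0 ord0 < 1] `&` [set x | -1 * x ord0 ord0 < 1].
  apply/seteqP; split=> x /=; rewrite /Om /= mul1r mulN1r.
    by move=> /(_ ord0) /andP[h1 h2]; rewrite ltrNl.
  by move=> [h1 h2] i; have -> : i = ord0 := ord1 i; rewrite h1 andbT ltrNl.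
split.
- by rewrite OmE; apply: openI; exact: open_coord_lt.
- exists 1 => x /(_ ord0) /andP[h1 h2].
  apply: le_trans (enorm_le_sum _) _; rewrite big_ord1; apply: ltW.
  by rewrite ltr_norml h1.
- move=> x y hx hy t /andP[t0 t1] i; rewrite !mxE.
  have /andP[x1 x2] := hx i; have /andP[y1 y2] := hy i.
  have [->|t0'] := eqVneq t 0; first by apply/andP; split; lra.
  have {t0'}tp : 0 < t by rewrite lt_def t0'.
  have a1 : 0 <= (1 - t) * (x ord0 i + 1) by rewrite mulr_ge0 ?subr_ge0//; lra.
  have a2 : 0 <= (1 - t) * (1 - x ord0 i) by rewrite mulr_ge0 ?subr_ge0//; lra.
  have a3 : 0 < t * (y ord0 i + 1) by rewrite mulr_gt0//; lra.
  have a4 : 0 < t * (1 - y ord0 i) by rewrite mulr_gt0//; lra.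
  by apply/andP; split; lra.
have oOm : open Om by rewrite OmE; apply: openI; exact: open_coord_lt.
move=> x0 [_ ni].
have nO : ~ Om x0.
  by move=> Ox; apply: ni; rewrite ((interior_id Om).1 oOm).
have grad1 (c k : R) x : c != 0 -> grad (fun y : 'rV[R]_1 => c * y ord0 ord0 + k) x != 0.
  move=> c0; apply/eqP => /rowP /(_ ord0); rewrite !mxE.
  have [_ ->] := is_derive_affine c k ord0 x (unitv ord0).
  by rewrite mxE !eqxx mulr1 => /eqP; rewrite (negbTE c0).
have [x_ge|x_lt] := leP 0 (x0 ord0 ord0).
  have xp : 0 < x0 ord0 ord0.
    rewrite lt_def x_ge andbT; apply/eqP => x00; apply: nO => i; have -> : i = ord0 := ord1 i; rewrite x00.
    by rewrite ltrN10 ltr01.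
  exists [set x | -1 * x ord0 ord0 < 0], (fun x => 1 * x ord0 ord0 + -1); split=> //.
  - exact: open_coord_lt.
  - by rewrite /= mulN1r oppr_lt0.
  - exact: Ck_affine.
  - by move=> x _; apply: grad1; exact: oner_neq0.
  - move=> x /=; rewrite mulN1r oppr_lt0 => xpos; rewrite mul1r; split.
      by move=> /(_ ord0) /andP[_]; rewrite -subr_lt0.
    move=> h i; have -> : i = ord0 := ord1 i; apply/andP; split; first by apply: lt_trans xpos; rewrite ltrN10.
    by rewrite -subr_lt0.
exists [set x | 1 * x ord0 ord0 < 0], (fun x => -1 * x ord0 ord0 + -1); split=> //.
- exact: open_coord_lt.
- by rewrite /= mul1r.
- exact: Ck_affine.
- by move=> x _; apply: grad1; rewrite oppr_eq0 oner_neq0.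
- move=> x /=; rewrite mul1r => xneg; rewrite mulN1r; split.
    by move=> /(_ ord0) /andP[h _]; lra.
  by move=> h i; have -> : i = ord0 := ord1 i; apply/andP; split; lra.
Qed.

Lemma first_order_arith {R : realFieldType} (S d X m V G a e t : R) : S <= 0 -> - (e * X) <= S - (d + t * a) ->
  - (e * G * t) <= d -> e * X <= e * (m * (V + 1)) * t -> e * (m * (V + 1) + G + 1) * t <= a / 2 * t ->
  0 < a * t -> 0 < e * t -> False.
Proof. lra. Qed.

(** * Initial conditions of paths of finite energy *)

Section start_sets.
Context {R : realType} {n : nat}.
Variables (Om : set 'rV[R]_n) (q T : R).
Hypotheses (q1 : 1 < q) (T0 : 0 < T) (gO : good_dom Om).
Implicit Types (xi eta : R -> 'rV[R]_n) (z : 'rV[R]_n * 'rV[R]_n).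

Let oO : open Om. Proof. by case: gO. Qed.
Let cO : convex_dom Om. Proof. by case: gO. Qed.
Let bO x0 : bdry Om x0 -> exists U rho, local_defining_fun 2 Om x0 U rho.
Proof. by case: gO => _ _ _; apply. Qed.
Let zI : (0 : R) <= 0 <= T. Proof. by rewrite lexx ltW. Qed.

Lemma closure_bounded : exists M, forall x, closure Om x -> enorm x <= M.
Proof.
have [_ [M hM] _ _] := gO; exists (M + 1) => x /closure_enormP/(_ 1 ltr01)[y Oy xy].
rewrite -[x](subrK y) addrC; apply: le_trans (enormD _ _) _; apply: lerD; [exact: hM|exact: ltW].
Qed.

Definition startset r := [set z | exists xi, [/\ energy Om q T r xi, xi 0 = z.1 & Dp T xi 0 = z.2]].

Lemma startset_closed r (z_ : nat -> 'rV[R]_n * 'rV[R]_n) z : (forall k, startset r (z_ k)) ->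
  (forall e, 0 < e -> exists N, forall k, (N <= k)%N -> pdist (z_ k) z <= e) -> startset r z.
Proof.
move=> /choice[x_ hx] hz; have [M hM] := closure_bounded.
have [|phi hphi [xi Exi hxi]] := energy_compact q1 T0 (r := r) (x_ := x_) hM.
  by move=> k; have [] := hx k.
have phik k : (k <= phi k)%N by elim: k => // k IH; exact: leq_ltn_trans IH (hphi k).
have key e : 0 < e -> enorm (xi 0 - z.1) + enorm (Dp T xi 0 - z.2) <= e.
  move=> e0; have e2 : 0 < e / 2 by rewrite divr_gt0.
  have [N1 h1] := hz _ e2; have [N2 h2] := hxi _ e2.
  have := h2 (maxn N1 N2) (leq_maxr _ _) 0 zI; set k := phi _.
  have := h1 k (leq_trans (leq_maxl _ _) (phik _)); have [_ e3 e4] := hx k.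
  rewrite /pdist -e3 -e4 => i1 i2; rewrite (splitr e).
  have j1 := enorm_dist_trans (xi 0) (x_ k 0) z.1; have j2 := enorm_dist_trans (Dp T xi 0) (Dp T (x_ k) 0) z.2.
  apply: le_trans (lerD j1 j2) _; rewrite addrACA (enorm_distC (xi 0)) (enorm_distC (Dp T xi 0)).
  exact: lerD i2 i1.
exists xi; split=> //; apply/eqP; rewrite -subr_eq0; apply/eqP; apply: enorm_eq0; apply: le_anti;
  rewrite enorm_ge0 andbT; apply/ler_addgt0Pr => e /key; rewrite add0r; apply: le_trans.
- by rewrite lerDl enorm_ge0.
- by rewrite lerDr enorm_ge0.
Qed.

(** At a boundary point [rho] vanishes, so the sign condition on the velocity is exactly the slope
    condition of [inward_arc], whose square root is 0 there. *)
Lemma admissible_arc z : Xiad Om z -> exists t0 b, 0 < t0 /\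
  forall t, 0 <= t <= t0 -> closure Om (z.1 + t *: z.2 + t ^+ 2 *: b).
Proof.
move=> [cz hz]; case: (closure_case oO cz) => [Oz|bz].
  have [d d0 hd] := open_near oO Oz; have v1 : 0 < enorm z.2 + 1 by rewrite ltr_wpDl ?enorm_ge0.
  exists (d / 2 / (enorm z.2 + 1)), 0; split; first by rewrite !divr_gt0.
  move=> t /andP[t_ge0 tt]; rewrite scaler0 addr0; apply: subset_closure; apply: hd.
  apply: le_lt_trans (mxnorm_le_enorm _) _; rewrite addrAC subrr add0r enormZ ger0_norm//.
  apply: (@le_lt_trans _ _ (t * (enorm z.2 + 1))); first by rewrite ler_wpM2l// lerDl.
  by apply: lt_half d0 _; rewrite -ler_pdivlMr.
have [U [rho h]] := bO bz.
have [d [t0 [b [d0 t00 _ _ harc]]]] := inward_arc h (enorm_ge0 z.2).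
exists t0, b; split=> //; apply: harc => //; first by rewrite subrr enorm0.
rewrite (defining_fun_bdry oO h bz) oppr0 sqrtr0.
have [oU Uz CU gU hO] := h.
have G0 : 0 < enorm (grad rho z.1).
  by rewrite lt_def enorm_ge0 andbT; apply: contraNneq (gU _ Uz) => /enorm_eq0 ->.
have := hz bz ((enorm (grad rho z.1))^-1 *: grad rho z.1).
rewrite dotvZr dotvC pmulr_rle0 ?invr_gt0//; apply.
by exists U, rho; split=> //; split=> //; exact: Ck_le.
Qed.

(** The inward arc is merged into the constant path at [z.1]. *)
Lemma admissible_finite_energy z : Xiad Om z -> exists r : nat, startset r%:R z.
Proof.
move=> hz; have [t0 [b [t00 hb]]] := admissible_arc hz.
have cz : closure Om z.1 by case: hz.
have V0 : Vle q (fun=> 0 : 'rV[R]_n) 0 T (0 `^ q * (T - 0)).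
  by apply: Vle_lip => //; [move=> x y _ _ _; rewrite subrr enorm0 mul0r|exact: ltW].
have [//|Eeta De] := energy_intro q1 T0 (@hasd_cst _ _ 0 T z.1) V0 (Om := Om).
pose h := Num.min t0 T.
have h0 : 0 < h by rewrite lt_min t00.
have hT : 0 + h <= T by rewrite add0r ge_min lexx orbT.
have ht0 : h <= t0 by rewrite ge_min lexx.
have inI t : 0 <= t <= 0 + h -> 0 <= t <= T by case/andP=> -> /le_trans; apply.
have hz' t : 0 <= t <= 0 + h -> closure Om (arc z.1 z.2 b 0 t).
  by rewrite add0r /arc subr0 => /andP[h1 h2]; apply: hb; rewrite h1 (le_trans h2).
have hA t : 0 <= t <= 0 + h -> enorm (arc z.1 z.2 b 0 t - z.1) <= h * enorm z.2 + h ^+ 2 * enorm b.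
  rewrite add0r /arc subr0 => /andP[h1 h2].
  rewrite (_ : _ - _ = t *: z.2 + t ^+ 2 *: b); last by apply/rowP => i; rewrite !mxE; ring.
  apply: le_trans (enormD _ _) _; rewrite !enormZ !ger0_norm ?sqr_ge0//.
  by apply: lerD; apply: ler_wpM2r; rewrite ?enorm_ge0// ler_pXn2r ?nnegrE// ltW.
have hB t : 0 <= t <= 0 + h -> enorm (darc z.2 b 0 t - Dp T (fun=> z.1) t) <= enorm z.2 + 2 * h * enorm b.
  move=> tI; rewrite De ?inI// /darc subr0 subr0; move: tI; rewrite add0r => /andP[h1 h2].
  apply: le_trans (enormD _ _) _; rewrite lerD2l enormZ ger0_norm ?mulr_ge0//.
  by rewrite ler_wpM2r ?enorm_ge0// ler_wpM2l.
have VB : Vle q (fun t => darc z.2 b 0 t - Dp T (fun=> z.1) t) 0 (0 + h) ((2 * enorm b) `^ q * (0 + h - 0)).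
  apply: (Vle_ext q1 (f := darc z.2 b 0)) => [t tI|]; first by rewrite De ?inI// subr0.
  apply: Vle_lip => //; last by rewrite add0r ltW.
  by move=> x y _ xy _; exact: darc_lip.
have [f [D [Hf [fs Ds] clf VD _]]] := blend q1 cO Eeta (lexx 0) h0 hT hz' hA hB VB.
have half : 0 < (2^-1 : R) < 1 by rewrite invr_gt0 ltr0Sn invf_lt1// ltr1n.
set rD := blend_const q * _ in VD.
have Hv (x y : R) : 0 <= x -> x < y -> y <= T -> enorm (Dp T (fun=> z.1) y + D y - (Dp T (fun=> z.1) x + D x)) <=
    enorm (Dp T (fun=> z.1) y - Dp T (fun=> z.1) x) + enorm (D y - D x).
  by move=> _ _ _; rewrite opprD addrACA; exact: enormD.
have VV := Vle_add2 q1 half Hv Eeta.2 VD.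
have [//|Ef Df] := energy_intro q1 T0 Hf VV (Om := Om).
set rr := _ + _ in VV Ef.
exists (Num.bound `|rr|); exists f; split=> //; last by rewrite Df.
by apply: energy_mono Ef; exact: le_trans (ler_norm _) (ltW (archi_boundP (normr_ge0 rr))).
Qed.

(** Otherwise [rho] would be positive along [xi] at small times, to first order; continuity of the
    partial derivatives absorbs the intermediate points of [taylor_points]. *)
Lemma defining_fun_first_order U rho x (v : 'rV[R]_n) xi : local_defining_fun 1 Om x U rho -> Gam Om T xi -> xi 0 = x -> Dp T xi 0 = v ->
  rho x = 0 -> dotv (grad rho x) v <= 0.
Proof.
move=> h G x0 v0 rx; have [oU Ux [_ CU] gU hO] := h.
rewrite leNgt; apply/negP; set a := dotv _ _ => a0.
pose K := n%:R * (enorm v + 1) + enorm (grad rho x) + 1.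
have K0 : 0 < K by rewrite ltr_wpDl// addr_ge0 ?mulr_ge0 ?addr_ge0 ?enorm_ge0.
pose e := Num.min 1 (a / (2 * K)).
have e0 : 0 < e by rewrite lt_min ltr01 divr_gt0// mulr_gt0.
have e1 : e <= 1 by rewrite ge_min lexx.
have eK : e * K <= a / 2.
  by rewrite -ler_pdivlMr//; apply: le_trans (ge_min_r _ _) _; rewrite invfM mulrA.
have [d1 d10 hd1] := open_near oU Ux.
have [i|d2 d20 hd2] := @continuous_near_family _ _ _ (fun i => 'D_(unitv i) rho) x e _ e0.
  by have [_ [hc _]] := CU i; exact: hc.
have [d3 d30 hd3] := hasd_enorm (Gam_hasd G) zI e0.
have dd : 0 < Num.min d1 d2 by rewrite lt_min d10.
have dd2 : 0 < Num.min d1 d2 / 2 by rewrite divr_gt0.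
have [d4 d40 hd4] := hasd_bound (Gam_hasd G) zI dd2.
pose t := Num.min (Num.min (d3 / 2) (d4 / 2)) T.
have t0 : 0 < t by rewrite !lt_min !divr_gt0.
have [td3 td4 tT] : [/\ t <= d3 / 2, t <= d4 / 2 & t <= T].
  by have := lexx t; rewrite {2}/t !le_min => /andP[/andP[-> ->] ->].
clearbody t.
have tI : 0 <= t <= T by rewrite ltW.
have tn : `|t - 0| = t by rewrite subr0 gtr0_norm.
have := hd3 t tI; rewrite tn subr0 x0 v0 => /(_ (lt_half d30 td3)); set u := xi t - x => hu.
have ud : enorm u < Num.min d1 d2.
  have := hd4 t tI; rewrite tn x0 => /(_ (lt_half d40 td4)); exact: lt_half.
have uv : enorm u <= (enorm v + 1) * t.
  rewrite -[u](subrK (t *: v)); apply: le_trans (enormD _ _) _.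
  rewrite enormZ gtr0_norm// mulrDl mul1r addrC mulrC lerD//.
  by apply: le_trans hu _; rewrite ler_piMl// ltW.
have near (z : 'rV[R]_n) : `|z - x| <= `|u| -> `|z - x| < Num.min d1 d2.
  by move=> zx; apply: le_lt_trans ud; apply: le_trans zx (mxnorm_le_enorm _).
have [z zx i|c hc] := @taylor_points _ _ rho x u.
  have [hd _] := CU i; apply: hd; apply: hd1; apply: lt_le_trans (near z zx) _; exact: ge_min_l.
have xu : x + u = xi t by rewrite /u addrC subrK.
have Uxi : U (xi t).
  apply: hd1; rewrite -/u; apply: lt_le_trans (ge_min_l d1 d2).
  exact: le_lt_trans (mxnorm_le_enorm _) ud.
have := defining_fun_le0 h Uxi (Gam_closure G tI).
rewrite xu rx subr0 => r0 E; rewrite E in r0.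
have i1 : `|\sum_i 'D_(unitv i) rho (c i) * u ord0 i - dotv (grad rho x) u| <= e * (n%:R * enorm u).
  rewrite /dotv -sumrB; apply: le_trans (ler_norm_sum _ _ _) _.
  apply: (@le_trans _ _ (\sum_(i < n) (e * enorm u))).
    apply: ler_sum => i _; rewrite [grad _ _ _ _]mxE -mulrBl normrM; apply: ler_pM => //; last exact: enorm_coord.
    by apply: ltW; apply: hd2; apply: lt_le_trans (near _ (hc i)) (ge_min_r _ _).
  by rewrite sumr_const card_ord -[_ *+ n]mulr_natl mulrCA.
have i2 : `|dotv (grad rho x) (u - t *: v)| <= e * enorm (grad rho x) * t.
  apply: (@le_trans _ _ (enorm (grad rho x) * enorm (u - t *: v))).
    rewrite ler_norml cauchy_schwarz andbT lerNl -dotvNl.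
    by apply: le_trans (cauchy_schwarz _ _) _; rewrite enormN.
  by rewrite (mulrC e) -mulrA ler_wpM2l ?enorm_ge0.
have i3 : e * (n%:R * enorm u) <= e * (n%:R * (enorm v + 1)) * t.
  by rewrite -mulrA ler_pM2l// -mulrA ler_wpM2l.
have E2 : dotv (grad rho x) u = dotv (grad rho x) (u - t *: v) + t * a.
  by rewrite dotvDr dotvNr dotvZr subrK.
have i4 : e * K * t <= a / 2 * t by rewrite ler_pM2r.
have i5 : 0 < a * t by rewrite mulr_gt0.
have i6 : 0 < e * t by rewrite mulr_gt0.
move: i1 i2; rewrite E2 !ler_norml => /andP[i1 _] /andP[i2 _].
exact: first_order_arith r0 i1 i2 i3 i4 i5 i6.
Qed.

Lemma Gam_admissible xi : Gam Om T xi -> Xiad Om (xi 0, Dp T xi 0).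
Proof.
set z := (_, _) => G; have [x0 v0] : xi 0 = z.1 /\ Dp T xi 0 = z.2 by [].
split; first by rewrite -x0; exact: Gam_closure G zI.
move=> bz nu [U [rho [h ->]]]; have rx := defining_fun_bdry oO h bz.
rewrite dotvZr dotvC pmulr_rle0; first exact: defining_fun_first_order h G x0 v0 rx.
have [_ Uz _ gU _] := h; rewrite invr_gt0 lt_def enorm_ge0 andbT.
by apply: contraNneq (gU _ Uz) => /enorm_eq0 ->.
Qed.

Lemma startset_admissible r z : startset r z -> Xiad Om z.
Proof. by move=> [xi [[/Gam_admissible h _] x0 v0]]; rewrite [z]surjective_pairing -x0 -v0. Qed.

(** An exhaustion of the admissible set by closed sets with a controlled energy. It also yields the
    measurability of the admissible set. *)
Lemma XiadE : Xiad Om = \bigcup_(r : nat) startset r%:R.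
Proof.
apply/seteqP; split=> z; first by move=> /admissible_finite_energy[r hr]; exists r.
by move=> [r _ /startset_admissible].
Qed.

End start_sets.

(** * Laws and costs *)

Section open_wrt_sets.
Context {R : realType} {V : pointedType} (B : V -> R -> set V).

Lemma open_wrt_measurable (U : set (g_sigma_algebraType (open_wrt B))) : open_wrt B U -> measurable U.
Proof. exact: sub_sigma_algebra. Qed.

Lemma measurable_fun_open_wrt {d} {X : measurableType d} (D : set X) (f : X -> g_sigma_algebraType (open_wrt B)) :
  (forall U, open_wrt B U -> measurable (D `&` f @^-1` U)) -> measurable_fun D f.
Proof.
move=> h; apply: (@measurability _ _ _ _ D f (open_wrt B)) => //.
by move=> _ [U oU <-]; exact: h.
Qed.

Hypothesis Bsym : forall x e y, B x e y -> B y e x.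
Hypothesis Btri : forall x a y b z, B x a y -> B y b z -> B x (a + b) z.
Hypothesis Bmono : forall x a b, a <= b -> B x a `<=` B x b.

(* Path spaces carry no countable base here, hence the pre-images of all sets are required to be
   measurable; step maps satisfy this. *)
Lemma measurable_fun_limit {d} {X : measurableType d} (D : set X) (f_ : nat -> X -> g_sigma_algebraType (open_wrt B))
    (f : X -> g_sigma_algebraType (open_wrt B)) : measurable D ->
  (forall k A, measurable (f_ k @^-1` A)) ->
  (forall x, D x -> forall e, 0 < e -> exists N, forall k, (N <= k)%N -> B (f x) e (f_ k x)) ->
  measurable_fun D f.
Proof.
move=> mD mf hf; apply: measurable_fun_open_wrt => U oU.
pose Uj (j : nat) : set V := [set v | B v j.+1%:R^-1 `<=` U].
have j0 (j : nat) : 0 < j.+1%:R^-1 :> R by rewrite invr_gt0 ltr0n.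
have -> : D `&` f @^-1` U = D `&` \bigcup_j \bigcup_N \bigcap_(k in [set k | (N <= k)%N]) (f_ k @^-1` Uj j).
  apply/seteqP; split=> x [Dx]; last first.
    move=> [j _ [N _ h]]; split=> //.
    have [N' hN'] := hf x Dx _ (j0 j).
    apply: (h (maxn N N') (leq_maxl _ _)); apply: Bsym; apply: hN'; exact: leq_maxr.
  move=> /oU[e e0 he]; split=> //.
  have e2 : 0 <= 2 / e by rewrite divr_ge0 ?ltW.
  exists (Num.bound (2 / e)) => //; have [N hN] := hf x Dx _ (j0 (Num.bound (2 / e))).
  exists N => // k /= Nk v Bv; apply: he; apply: Bmono (Btri (hN k Nk) Bv).
  have : 2 / e <= (Num.bound (2 / e)).+1%:R.
    by apply: le_trans (ltW (archi_boundP e2)) _; rewrite ler_nat.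
  rewrite ler_pdivrMr// => h; rewrite (_ : _ + _ = 2 / (Num.bound (2 / e)).+1%:R); last by ring.
  by rewrite ler_pdivrMr ?ltr0n// mulrC.
apply: measurableI => //; apply: bigcup_measurable => j _; apply: bigcup_measurable => N _.
by apply: bigcap_measurableType => k _; exact: mf.
Qed.

End open_wrt_sets.

Lemma within_continuous_ball {R : realType} {V : pseudoMetricType R} (A : set V) (f : V -> R) :
  {within A, continuous f} -> forall x, A x -> forall e, 0 < e -> exists2 d, 0 < d &
  forall y, A y -> ball x d y -> `|f x - f y| < e.
Proof.
move=> /subspace_continuousP h x Ax e e0.
have := h x Ax => /cvgrPdist_lt/(_ _ e0) /nbhs_ballP[d /= d0 hd].
by exists d => // y Ay xy; apply: hd.
Qed.

Lemma continuous_within_seq {R : realType} (T : R) (f : R -> R) :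
  (forall (s_ : nat -> R) s, (forall k, 0 <= s_ k <= T) -> 0 <= s <= T -> s_ @ \oo --> s -> f \o s_ @ \oo --> f s) ->
  {within `[0, T], continuous f}.
Proof.
move=> h; apply/subspace_continuousP => s /=; rewrite in_itv /= => sT.
apply/cvgrPdist_lt => e e0; apply: contrapT => nh.
have /choice[u hu] : forall k : nat, exists t, [/\ 0 <= t <= T, `|s - t| < k.+1%:R^-1 & e <= `|f s - f t| ].
  move=> k; apply: contrapT => nk; apply: nh; exists k.+1%:R^-1; first by rewrite /= invr_gt0 ltr0n.
  move=> t /= st; rewrite in_itv /= => tT; rewrite ltNge; apply/negP => ht.
  by apply: nk; exists t.
have us : u @ \oo --> s.
  apply/cvgrPdist_lt => d d0; exists (Num.bound d^-1) => // k /= hk.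
  have [_ h1 _] := hu k; apply: lt_le_trans h1 _.
  have di : 0 <= d^-1 by rewrite invr_ge0 ltW.
  rewrite invf_ple ?posrE ?ltr0n//; apply: le_trans (ltW (archi_boundP di)) _.
  by rewrite ler_nat leqW.
have uT k : 0 <= u k <= T by have [] := hu k.
have /cvgrPdist_lt/(_ _ e0)[N _ hN] := h u s uT sT us.
have := hN N (leqnn N); have [_ _] := hu N => h1 /= h2.
by have := le_lt_trans h1 h2; rewrite ltxx.
Qed.

Section phase_space.
Context {R : realType} {n : nat}.
Variable Om : set 'rV[R]_n.
Notation phase := ('rV[R]_n * 'rV[R]_n)%type.
Implicit Types (z w : phase) (e d : R).

Lemma pdist_ge0 z w : 0 <= pdist z w.
Proof. by rewrite addr_ge0 ?enorm_ge0. Qed.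

Lemma pdistC z w : pdist z w = pdist w z.
Proof. by rewrite /pdist enorm_distC [X in _ + X]enorm_distC. Qed.

Lemma pdist_trans z w y : pdist z y <= pdist z w + pdist w y.
Proof. by rewrite /pdist addrACA lerD// enorm_dist_trans. Qed.

Lemma pdistxx z : pdist z z = 0.
Proof. by rewrite /pdist !subrr enorm0 addr0. Qed.

Lemma open_pball z e : open_wrt pball (pball z e).
Proof.
move=> w; rewrite /pball /= => zw; exists (e - pdist z w); first by rewrite subr_gt0.
move=> y /=; rewrite ltrBrDl; apply: le_lt_trans; exact: pdist_trans.
Qed.

Lemma Xi_measurable : measurable (Xi Om : set (phaseB R n)).
Proof.
rewrite -[Xi Om]setCK; apply: measurableC; apply: open_wrt_measurable => z nz.
have /existsNP[e /not_implyP[e0 he]] : ~ forall e, 0 < e -> exists2 y, Om y & enorm (z.1 - y) < e.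
  by move=> h; apply: nz; apply/closure_enormP.
exists (e / 2); first by rewrite divr_gt0.
move=> w zw cw; apply: he; have /closure_enormP/(_ (e / 2)) := cw.
rewrite divr_gt0// => /(_ isT)[y Oy wy]; exists y => //.
apply: le_lt_trans (enorm_dist_trans _ w.1 _) _; rewrite [ltRHS]splitr; apply: ltrD => //.
by apply: le_lt_trans zw; rewrite /pdist lerDl enorm_ge0.
Qed.

(** Continuity for [pdist], the distance that generates the sigma-algebra of [phaseB]; it links the
    topological continuity of the hypotheses to measurability. *)
Definition pcont (phi : phase -> R) := forall z, Xi Om z -> forall e, 0 < e -> exists2 d, 0 < d &
  forall w, Xi Om w -> pdist z w < d -> `|phi z - phi w| < e.

Lemma within_pcont (phi : phaseB R n -> R) : {within Xi Om, continuous phi} -> pcont phi.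
Proof.
move=> h z Xz e e0; have [d d0 hd] := @within_continuous_ball R (phase : pseudoMetricType R) (Xi Om) phi h z Xz e e0.
exists d => // w Xw zw; apply: hd => //; split; rewrite -ball_normE /=.
  by apply: le_lt_trans (mxnorm_le_enorm _) _; apply: le_lt_trans zw; rewrite /pdist lerDl enorm_ge0.
by apply: le_lt_trans (mxnorm_le_enorm _) _; apply: le_lt_trans zw; rewrite /pdist lerDr enorm_ge0.
Qed.

Lemma pcont_measurable (phi : phaseB R n -> R) : pcont phi -> measurable_fun (Xi Om : set (phaseB R n)) phi.
Proof.
move=> h; apply: (measurability _ (RGenOpens.measurableE R)).
move=> _ [_ [a [b ->] <-]].
pose U := [set w : phaseB R n | exists z d, [/\ 0 < d, Xi Om z, pdist z w < d & forall y, Xi Om y -> pdist z y < d -> a < phi y < b]].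
have -> : Xi Om `&` phi @^-1` `]a, b[ = Xi Om `&` U.
  apply/seteqP; split=> w [Xw].
    rewrite /= in_itv /= => /andP[aw wb]; split=> //.
    have [|d d0 hd] := h w Xw (Num.min (phi w - a) (b - phi w)); first by rewrite lt_min !subr_gt0 aw.
    exists w, d; split=> //; first by rewrite pdistxx.
    move=> y Xy wy; have := hd y Xy wy; rewrite lt_min => /andP[h1 h2].
    have := ler_norm (phi w - phi y); have := ler_norm (- (phi w - phi y)); rewrite normrN.
    by move=> h3 h4; apply/andP; split; lra.
  move=> [z [d [d0 Xz zw hd]]]; split=> //=; rewrite in_itv /=; exact: hd.
apply: measurableI; first exact: Xi_measurable.
apply: open_wrt_measurable => w [z [d [d0 Xz zw hd]]].
exists (d - pdist z w); first by rewrite subr_gt0.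
move=> y; rewrite /pball /= ltrBrDl => wy; exists z, d; split=> //.
apply: le_lt_trans wy; exact: pdist_trans.
Qed.

End phase_space.

Section laws.
Context {R : realType} {n : nat} {dX} {X : measurableType dX}.
Variables (P : probability X R) (Om : set 'rV[R]_n).
Notation phase := ('rV[R]_n * 'rV[R]_n)%type.
Implicit Types (Z : X -> phaseB R n).

(** A bare set function, the form in which measures are passed to [F], [G] and [Jcost]. *)
Definition law {V : Type} (Z : X -> V) : set V -> \bar R := fun A => P (Z @^-1` A).

Lemma law_probability d' (V : measurableType d') (Z : X -> V) : measurable_fun setT Z ->
  exists p : probability V R, (p : set V -> \bar R) = law Z.
Proof.
move=> mZ; pose Z' : {mfun X >-> V} := HB.pack Z (isMeasurableFun.Build _ _ _ _ Z mZ).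
by exists (distribution P Z').
Qed.

Lemma measurable_pcont_comp (phi : phaseB R n -> R) Z : measurable_fun setT Z -> (forall x, Xi Om (Z x)) ->
  pcont Om phi -> measurable_fun setT (phi \o Z).
Proof.
move=> mZ XZ /pcont_measurable mphi.
by apply: (measurable_comp (Xi_measurable Om) _ mphi mZ) => _ [x _ <-].
Qed.

Lemma integral_law (p : probability (phaseB R n) R) (phi : phaseB R n -> R) Z : measurable_fun setT Z -> (forall x, Xi Om (Z x)) ->
  pcont Om phi -> (exists C, forall z, Xi Om z -> `|phi z| <= C) -> (p : set _ -> \bar R) = law Z ->
  (\int[p]_(z in Xi Om) (phi z)%:E = \int[P]_x (phi (Z x))%:E)%E.
Proof.
move=> mZ XZ cphi [C hC] pE.
have mX := Xi_measurable Om.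
pose f := (EFin \o phi) \_ (Xi Om).
have mf : measurable_fun setT f.
  have m1 : measurable_fun (Xi Om : set (phaseB R n)) (EFin \o phi).
    by apply/measurable_EFinP; exact: pcont_measurable.
  exact: (measurable_restrictT _ mX).1 m1.
have -> : (\int[p]_(z in Xi Om) (phi z)%:E = \int[p]_(z in Xi Om) f z)%E.
  by apply: eq_integral => z zX; rewrite /f /patch zX.
have fZ x : f (Z x) = (phi (Z x))%:E by rewrite /f /patch mem_set.
transitivity (\int[pushforward P Z]_(z in Xi Om) f z)%E.
  by apply: eq_measure_integral => A mA _; exact: (congr1 (fun g => g A) pE).
have E : Z @^-1` Xi Om = setT by apply/seteqP; split=> x //= _; exact: XZ.
have E2 : f \o Z = EFin \o (phi \o Z) by apply/funext => x /=; rewrite fZ.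
rewrite integral_pushforward//; last first.
  rewrite E E2; apply: measurable_bounded_integrable => //.
  - by apply: le_lt_trans (probability_le1 P _) _ => //; exact: ltry.
  - exact: measurable_pcont_comp.
  - by exists C; split; [exact: num_real|move=> y Cy x _ /=; exact: le_trans (hC _ (XZ x)) (ltW Cy)].
rewrite E; by apply: eq_integral => x _; rewrite /= fZ.
Qed.

Lemma law_cvg (phi : phaseB R n -> R) (Z_ : nat -> X -> phaseB R n) Z : (forall k, measurable_fun setT (Z_ k)) -> measurable_fun setT Z ->
  (forall k x, Xi Om (Z_ k x)) -> (forall x, Xi Om (Z x)) ->
  {ae P, forall x, forall e, 0 < e -> exists N, forall k, (N <= k)%N -> pdist (Z_ k x) (Z x) < e} ->
  pcont Om phi -> (exists C, forall z, Xi Om z -> `|phi z| <= C) ->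
  (fun k => \int[P]_x (phi (Z_ k x))%:E)%E @ \oo --> (\int[P]_x (phi (Z x))%:E)%E.
Proof.
move=> mZ_ mZ XZ_ XZ hc cphi [C hC].
have [|||||_ _] := @dominated_convergence _ _ _ P setT measurableT (fun k x => (phi (Z_ k x))%:E) (fun x => (phi (Z x))%:E) (fun=> C%:E).
- by move=> k; apply/measurable_EFinP; apply: (measurable_pcont_comp (mZ_ k)).
- by apply/measurable_EFinP; apply: (measurable_pcont_comp mZ).
- apply: filterS hc => x hx _; apply: cvg_EFin; first exact: nearW.
  apply/cvgrPdist_lt => e e0; have [d d0 hd] := cphi (Z x) (XZ x) e e0.
  have [N hN] := hx d d0; exists N => // k /= Nk; apply: hd => //.
  by rewrite pdistC; exact: hN.
- by apply: finite_measure_integrable_cst.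
- by apply: aeW => x k _; rewrite lee_fin hC.
exact.
Qed.

(** Almost sure convergence gives narrow convergence of the laws by dominated convergence. Then [F]
    converges in the sup norm, and continuity of the limit function moves the argument from [z_ k]
    to [z]. *)
Lemma F_cvg (F : (set (phaseB R n) -> \bar R) -> phaseB R n -> R) (Z_ : nat -> X -> phaseB R n) Z (z_ : nat -> phaseB R n) z :
  bounded_continuous_map Om F -> (forall k, measurable_fun setT (Z_ k)) -> measurable_fun setT Z ->
  (forall k x, Xi Om (Z_ k x)) -> (forall x, Xi Om (Z x)) ->
  {ae P, forall x, forall e, 0 < e -> exists N, forall k, (N <= k)%N -> pdist (Z_ k x) (Z x) < e} ->
  (forall k, Xi Om (z_ k)) -> Xi Om z -> (forall e, 0 < e -> exists N, forall k, (N <= k)%N -> pdist (z_ k) z < e) ->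
  (fun k => F (law (Z_ k)) (z_ k)) @ \oo --> F (law Z) z.
Proof.
move=> [_ cF hF] mZ_ mZ XZ_ XZ hc Xz_ Xz hz.
have /choice[ps hps] : forall k, exists p : probability (phaseB R n) R, (p : set _ -> \bar R) = law (Z_ k).
  by move=> k; exact: law_probability.
have [p hp] := law_probability mZ.
have XiC (W : X -> phaseB R n) : (forall x, Xi Om (W x)) -> law W (~` Xi Om) = 0%E.
  move=> XW; rewrite /law (_ : _ @^-1` _ = set0) ?measure0//.
  by apply/seteqP; split=> x //=; apply; exact: XW.
have pX : prob_Xi Om p by rewrite /prob_Xi hp XiC.
have psX k : prob_Xi Om (ps k) by rewrite /prob_Xi hps XiC.
have nc : narrow_cvg Om ps p.
  move=> phi /within_pcont cphi bphi; rewrite (integral_law mZ XZ cphi bphi hp).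
  under eq_fun do rewrite (integral_law (mZ_ _) (XZ_ _) cphi bphi (hps _)).
  exact: law_cvg.
apply/cvgrPdist_lt => e e0; have e2 : 0 < e / 2 by rewrite divr_gt0.
have [d d0 hd] := within_pcont (cF p pX) Xz e2.
have [N1 hN1] := hz d d0; have [N2 _ hN2] := hF ps p psX pX nc _ e2.
exists (maxn N1 N2) => // k /=; rewrite geq_max => /andP[k1 k2].
rewrite -hp -(hps k); have := hd (z_ k) (Xz_ k); rewrite pdistC => /(_ (hN1 k k1)) h1.
have := hN2 k k2 (z_ k) (Xz_ k); rewrite distrC => h2.
rewrite [ltRHS]splitr; apply: le_lt_trans (ltrD h1 h2).
exact: ler_distD.
Qed.

End laws.

Lemma et_measurable {R : realType} {n} (T s : R) : 0 <= s <= T ->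
  measurable_fun setT (et T s : pathB R n T -> phaseB R n).
Proof.
move=> sT; apply: measurable_fun_open_wrt => U oU; rewrite setTI.
apply: open_wrt_measurable => xi /oU[e e0 he]; exists e => // eta [c ce hc].
apply: he; exact: le_lt_trans (hc s sT) ce.
Qed.

(** * Convergence and evaluation of the cost *)

Section costs.
Context {R : realType} {n : nat} {dX} {X : measurableType dX}.
Variables (P : probability X R) (Om : set 'rV[R]_n) (q T : R).
Hypotheses (q1 : 1 < q) (T0 : 0 < T).
Variables (F G : (set (phaseB R n) -> \bar R) -> phaseB R n -> R) (L : 'rV[R]_n -> 'rV[R]_n -> R -> R).
Hypotheses (hF : bounded_continuous_map Om F) (hG : bounded_continuous_map Om G)
  (hLc : {within [set p : (('rV[R]_n * 'rV[R]_n) * R)%type | Xi Om p.1 /\ 0 <= p.2 <= T],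
            continuous (fun p : (('rV[R]_n * 'rV[R]_n) * R)%type => L p.1.1 p.1.2 p.2)})
  (hLb : exists C : R, forall z : ('rV[R]_n * 'rV[R]_n)%type, forall s : R,
            Xi Om z -> 0 <= s <= T -> `|L z.1 z.2 s| <= C).
Local Notation mu := (@lebesgue_measure R).
Implicit Types (xi eta : R -> 'rV[R]_n) (Y : X -> pathB R n T) (s : R).

Let q0 : 0 < q. Proof. exact: lt_trans q1. Qed.
Let zI : (0 : R) <= 0 <= T. Proof. by rewrite lexx ltW. Qed.
Let TI : (0 : R) <= T <= T. Proof. by rewrite lexx ltW. Qed.

Definition random_path Y := measurable_fun setT Y /\ forall x, Gam Om T (Y x).

Definition running Y xi s := F (law P (fun x => et T s (Y x))) (xi s, Dp T xi s) + L (xi s) (Dp T xi s) s.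

(* The cost without its energy term; the latter is [q^-1 * Vn q (Dp T xi) 0 T] by [JcostE]. *)
Definition Jreg Y xi := (\int[mu]_(s in I0T T) running Y xi s)%R + G (law P (fun x => et T T (Y x))) (xi T, Dp T xi T).

Lemma mu_I0T : mu (I0T T) = T%:E.
Proof. by rewrite /I0T lebesgue_measure_itv /= lte_fin T0 -EFinB subr0. Qed.

Lemma random_et Y s : random_path Y -> 0 <= s <= T -> measurable_fun setT (fun x => et T s (Y x)) /\ forall x, Xi Om (et T s (Y x)).
Proof.
move=> [mY GY] sT; split; last by move=> x; exact: Gam_closure (GY x) sT.
by apply: (measurableT_comp _ mY); exact: et_measurable.
Qed.

Lemma Gam_et_cvg xi (s_ : nat -> R) s : Gam Om T xi -> (forall k, 0 <= s_ k <= T) -> 0 <= s <= T -> s_ @ \oo --> s ->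
  forall e, 0 < e -> exists N, forall k, (N <= k)%N -> pdist (et T (s_ k) xi) (et T s xi) < e.
Proof.
move=> Gx s_T sT ss e e0; have e3 : 0 < e / 3 by rewrite divr_gt0.
have [d1 d10 h1] := hasd_bound (Gam_hasd Gx) sT e3.
have [d2 d20 h2] := abs_cont_unif (Gam_abs_cont Gx) e3.
have dd : 0 < Num.min d1 d2 by rewrite lt_min d10.
move/cvgrPdist_lt: ss => /(_ _ dd)[N _ hN]; exists N => k Nk.
have := hN k Nk; rewrite /= distrC lt_min => /andP[k1 k2].
have := h1 _ (s_T k) k1; have := h2 _ _ sT (s_T k) k2; rewrite /pdist /et /=; move: e0.
move: (enorm _) (enorm _) => *; lra.
Qed.

Lemma c1le_pdist xi eta s c : 0 <= s <= T -> c1le T xi eta c -> pdist (et T s xi) (et T s eta) <= c.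
Proof. by move=> sT /(_ s sT). Qed.

Lemma L_cvg (z_ : nat -> ('rV[R]_n * 'rV[R]_n)%type) z (s_ : nat -> R) s : (forall k, Xi Om (z_ k)) -> Xi Om z ->
  (forall k, 0 <= s_ k <= T) -> 0 <= s <= T -> (forall e, 0 < e -> exists N, forall k, (N <= k)%N -> pdist (z_ k) z < e) ->
  s_ @ \oo --> s -> (fun k => L (z_ k).1 (z_ k).2 (s_ k)) @ \oo --> L z.1 z.2 s.
Proof.
move=> Xz_ Xz s_T sT hz hs; apply/cvgrPdist_lt => e e0.
have [d d0 hd] := within_continuous_ball hLc (conj Xz sT : [set p : (('rV[R]_n * 'rV[R]_n) * R)%type | Xi Om p.1 /\ 0 <= p.2 <= T] (z, s)) e0.
have [N1 h1] := hz d d0; move/cvgrPdist_lt: hs => /(_ _ d0)[N2 _ h2].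
exists (maxn N1 N2) => // k /=; rewrite geq_max => /andP[k1 k2].
have Ak : [set p : (('rV[R]_n * 'rV[R]_n) * R)%type | Xi Om p.1 /\ 0 <= p.2 <= T] (z_ k, s_ k) by split; [exact: Xz_|exact: s_T].
apply: (hd (z_ k, s_ k) Ak); have := h1 k k1; rewrite pdistC /pdist => hz'.
split; [split|]; rewrite -ball_normE /=; last exact: h2.
  by apply: le_lt_trans (mxnorm_le_enorm _) _; apply: le_lt_trans hz'; rewrite lerDl enorm_ge0.
by apply: le_lt_trans (mxnorm_le_enorm _) _; apply: le_lt_trans hz'; rewrite lerDr enorm_ge0.
Qed.

Lemma running_cvg (Y_ : nat -> X -> pathB R n T) Y (xi_ : nat -> R -> 'rV[R]_n) xi (s_ : nat -> R) s :
  (forall k, random_path (Y_ k)) -> random_path Y -> (forall k, 0 <= s_ k <= T) -> 0 <= s <= T -> s_ @ \oo --> s ->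
  {ae P, forall x, forall e, 0 < e -> exists N, forall k, (N <= k)%N -> pdist (et T (s_ k) (Y_ k x)) (et T s (Y x)) < e} ->
  (forall k, Gam Om T (xi_ k)) -> Gam Om T xi ->
  (forall e, 0 < e -> exists N, forall k, (N <= k)%N -> pdist (et T (s_ k) (xi_ k)) (et T s xi) < e) ->
  (fun k => running (Y_ k) (xi_ k) (s_ k)) @ \oo --> running Y xi s.
Proof.
move=> hY_ hY s_T sT ss hc Gx_ Gx hx; apply: cvgD.
  apply: (F_cvg hF) => //.
  - by move=> k; have [] := random_et (hY_ k) (s_T k).
  - by have [] := random_et hY sT.
  - by move=> k; have [] := random_et (hY_ k) (s_T k).
  - by have [] := random_et hY sT.
  - by move=> k; exact: Gam_closure (Gx_ k) (s_T k).
  - exact: Gam_closure Gx sT.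
apply: (@L_cvg (fun k => et T (s_ k) (xi_ k)) (et T s xi)) => //.
- by move=> k; exact: Gam_closure (Gx_ k) (s_T k).
- exact: Gam_closure Gx sT.
Qed.

(** The flow of laws is narrowly continuous in time because every path is of class [C^1]; this is
    what makes the running cost measurable. *)
Lemma running_continuous Y xi : random_path Y -> Gam Om T xi -> {within `[0, T], continuous (running Y xi)}.
Proof.
move=> hY Gx; apply: continuous_within_seq => s_ s s_T sT ss.
apply: (@running_cvg (fun=> Y) Y (fun=> xi)) => //; last exact: Gam_et_cvg.
by apply: aeW => x; apply: Gam_et_cvg => //; have [_] := hY; apply.
Qed.

Lemma running_measurable Y xi : random_path Y -> Gam Om T xi -> measurable_fun (I0T T) (running Y xi).
Proof. by move=> hY Gx; apply: (subspace_continuous_measurable_fun (measurable_itv `[0, T])); exact: running_continuous. Qed.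

Lemma bounded_map_law (H : (set (phaseB R n) -> \bar R) -> phaseB R n -> R) : bounded_continuous_map Om H ->
  exists C, forall Y s xi t, random_path Y -> 0 <= s <= T -> Gam Om T xi -> 0 <= t <= T ->
   `|H (law P (fun x => et T s (Y x))) (et T t xi)| <= C.
Proof.
move=> [[C hC] _ _]; exists C => Y s xi t hY sT Gx tT; have [mZ XZ] := random_et hY sT.
have [p hp] := law_probability P mZ; rewrite -hp; apply: hC; last exact: Gam_closure Gx tT.
rewrite /prob_Xi hp /law (_ : _ @^-1` _ = set0) ?measure0//.
by apply/seteqP; split=> x //=; apply; exact: XZ.
Qed.

Lemma running_bounded : exists C, forall Y xi s, random_path Y -> Gam Om T xi -> 0 <= s <= T -> `|running Y xi s| <= C.
Proof.
have [CF hCF] := bounded_map_law hF; have [CL hCL] := hLb.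
exists (CF + CL) => Y xi s hY Gx sT; apply: le_trans (ler_normD _ _) _; apply: lerD.
  exact: (hCF Y s xi s hY sT Gx sT).
exact: (hCL (et T s xi) s (Gam_closure Gx sT) sT).
Qed.

Let mI : measurable (I0T T : set (measurableTypeR R)). Proof. exact: measurable_itv. Qed.

Let finI : (mu (I0T T) < +oo)%E. Proof. by have := ltry T; rewrite -mu_I0T. Qed.

Let cst_integrable (C : R) : mu.-integrable (I0T T) (EFin \o (fun=> C)).
Proof. by apply: (measurable_bounded_integrable mI finI) => //; exact: bounded_cst. Qed.

Lemma running_integrable Y xi : random_path Y -> Gam Om T xi -> mu.-integrable (I0T T) (EFin \o running Y xi).
Proof.
move=> hY Gx; have [C hC] := running_bounded.
apply: (measurable_bounded_integrable mI finI (running_measurable hY Gx)).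
exists C; split; [exact: num_real|move=> y Cy s]; rewrite /I0T /= in_itv /= => sT.
exact: le_trans (hC Y xi s hY Gx sT) (ltW Cy).
Qed.

Lemma Jreg_bounded : exists C, forall Y xi, random_path Y -> Gam Om T xi -> `|Jreg Y xi| <= C.
Proof.
have [CG hCG] := bounded_map_law hG; have [C hC] := running_bounded.
exists (C * T + CG) => Y xi hY Gx.
apply: le_trans (ler_normD _ _) _; apply: lerD; last exact: (hCG Y T xi T hY TI Gx TI).
have i1 := running_integrable hY Gx.
apply: le_trans (le_normr_Rintegral mI i1) _.
have -> : C * T = (\int[mu]_(s in I0T T) C)%R.
  by rewrite Rintegral_cst//; have := mu_I0T => /= ->.
apply: (le_Rintegral mI (integrable_norm i1) (cst_integrable C)) => s.
by rewrite /I0T /= in_itv /= => sT; exact: hC.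
Qed.

Lemma Jreg_cvg (Y_ : nat -> X -> pathB R n T) Y (xi_ : nat -> R -> 'rV[R]_n) xi :
  (forall k, random_path (Y_ k)) -> random_path Y ->
  {ae P, forall x, forall e, 0 < e -> exists N, forall k, (N <= k)%N -> c1le T (Y_ k x) (Y x) e} ->
  (forall k, Gam Om T (xi_ k)) -> Gam Om T xi ->
  (forall e, 0 < e -> exists N, forall k, (N <= k)%N -> c1le T (xi_ k) xi e) ->
  (fun k => Jreg (Y_ k) (xi_ k)) @ \oo --> Jreg Y xi.
Proof.
move=> hY_ hY hc Gx_ Gx hx; have [C hC] := running_bounded.
have c1_et (y_ : nat -> R -> 'rV[R]_n) y s : 0 <= s <= T -> (forall e, 0 < e -> exists N, forall k, (N <= k)%N -> c1le T (y_ k) y e) ->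
    forall e, 0 < e -> exists N, forall k, (N <= k)%N -> pdist (et T s (y_ k)) (et T s y) < e.
  move=> sT h e e0; have e2 : 0 < e / 2 by rewrite divr_gt0.
  have [N hN] := h _ e2; exists N => k Nk; apply: le_lt_trans (c1le_pdist sT (hN k Nk)) _.
  by rewrite ltr_pdivrMr// ltr_pMr// ltr1n.
have hce s : 0 <= s <= T -> {ae P, forall x, forall e, 0 < e -> exists N, forall k, (N <= k)%N -> pdist (et T s (Y_ k x)) (et T s (Y x)) < e}.
  by move=> sT; apply: filterS hc => x hx'; exact: c1_et.
apply: cvgD; last first.
  apply: (F_cvg hG) => //.
  - by move=> k; have [] := random_et (hY_ k) TI.
  - by have [] := random_et hY TI.
  - by move=> k; have [] := random_et (hY_ k) TI.
  - by have [] := random_et hY TI.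
  - exact: hce.
  - by move=> k; exact: Gam_closure (Gx_ k) TI.
  - exact: Gam_closure Gx TI.
  - exact: c1_et.
have [|||||_ _ H] := @dominated_convergence _ _ _ mu (I0T T) mI (fun k s => (running (Y_ k) (xi_ k) s)%:E) (fun s => (running Y xi s)%:E) (fun=> C%:E).
- by move=> k; apply/measurable_EFinP; exact: running_measurable.
- by apply/measurable_EFinP; exact: running_measurable.
- apply: aeW => s; rewrite /I0T /= in_itv /= => sT; apply: cvg_EFin; first exact: nearW.
  apply: (@running_cvg _ _ _ _ (fun=> s)) => //; [exact: cvg_cst|exact: hce|exact: c1_et].
- exact: (cst_integrable C).
- apply: aeW => s k; rewrite /I0T /= in_itv /= => sT; rewrite lee_fin.
  exact: hC.
have fin k : (\int[mu]_(s in I0T T) (running (Y_ k) (xi_ k) s)%:E)%E \is a fin_num.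
  exact: integrable_fin_num (running_integrable (hY_ k) (Gx_ k)).
have fin' : (\int[mu]_(s in I0T T) (running Y xi s)%:E)%E \is a fin_num.
  exact: integrable_fin_num (running_integrable hY Gx).
by apply: fine_cvg; rewrite fineK.
Qed.

Lemma le_fineK (x : \bar R) : x \is a fin_num -> (x <= (fine x)%:E)%E.
Proof. by move=> /fineK ->. Qed.

Lemma ge_fineK (x : \bar R) : x \is a fin_num -> ((fine x)%:E <= x)%E.
Proof. by move=> /fineK ->. Qed.

Lemma Vle_of_D2 xi e : abs_cont_on T (Dp T xi) ->
  (\int[mu]_(s in I0T T) (enorm (D2 T xi s) `^ q)%:E <= e%:E)%E -> Vle q (Dp T xi) 0 T e.
Proof.
move=> ac; have [psi dpsi] := density_exists T0 ac.
move=> h; apply: (Vle_of_integral q1 dpsi); apply: le_trans h.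
rewrite le_eqVlt; apply/orP; left; apply/eqP; exact: esym (integral_D2_density q T0 ac dpsi).
Qed.

(** The two comparisons of partition energy with integral energy meet here: [integral_of_Vle] bounds
    the integral by [Vn], and [Vle_of_D2] bounds [Vn] by the integral. *)
Lemma energy_integral xi r : energy Om q T r xi ->
  W2q q T xi /\ (\int[mu]_(s in I0T T) (enorm (D2 T xi s) `^ q)%:E)%E = (Vn q (Dp T xi) 0 T)%:E.
Proof.
move=> [Gx V]; have ac := Gam_abs_cont Gx.
have up := integral_of_Vle T0 q1 ac (Vle_Vn V).
have ge0 : (0 <= \int[mu]_(s in I0T T) (enorm (D2 T xi s) `^ q)%:E)%E.
  by apply: integral_ge0 => s _; rewrite lee_fin powR_ge0.
have fin : (\int[mu]_(s in I0T T) (enorm (D2 T xi s) `^ q)%:E)%E \is a fin_num.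
  by rewrite ge0_fin_numE//; apply: le_lt_trans up (ltry _).
split; first by split; [exact: measurable_D2|rewrite -ge0_fin_numE].
apply/eqP; rewrite eq_le up /=.
apply: (@le_trans _ _ (fine (\int[mu]_(s in I0T T) (enorm (D2 T xi s) `^ q)%:E)%E)%:E); last first.
  exact: ge_fineK fin.
rewrite lee_fin; apply: Vn_le; first exact: ltW.
exact: Vle_of_D2 ac (le_fineK fin).
Qed.

Lemma W2q_energy xi : Gam Om T xi -> W2q q T xi -> exists r, energy Om q T r xi.
Proof.
move=> Gx [_ lt]; have ac := Gam_abs_cont Gx.
have ge0 : (0 <= \int[mu]_(s in I0T T) (enorm (D2 T xi s) `^ q)%:E)%E.
  by apply: integral_ge0 => s _; rewrite lee_fin powR_ge0.
have fin : (\int[mu]_(s in I0T T) (enorm (D2 T xi s) `^ q)%:E)%E \is a fin_num.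
  by rewrite ge0_fin_numE.
exists (fine (\int[mu]_(s in I0T T) (enorm (D2 T xi s) `^ q)%:E)%E); split=> //.
exact: Vle_of_D2 ac (le_fineK fin).
Qed.

Lemma JcostE (Y : X -> pathB R n T) xi r : random_path Y -> energy Om q T r xi ->
  Jcost q T F G L (law P Y) xi = (Jreg Y xi + q^-1 * Vn q (Dp T xi) 0 T)%:E.
Proof.
move=> hY Ex; have [W E] := energy_integral Ex; have [Gx V] := Ex.
have I : (\int[mu]_(s in I0T T) (F (push T (law P Y) s) (xi s, Dp T xi s) + L (xi s) (Dp T xi s) s
    + q^-1 * enorm (D2 T xi s) `^ q)%:E = ((\int[mu]_(s in I0T T) running Y xi s)%R + q^-1 * Vn q (Dp T xi) 0 T)%:E)%E; last first.
  by rewrite /Jcost asboolT// I -EFinD /Jreg addrAC.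
have mw : measurable_fun (I0T T) (fun s => enorm (D2 T xi s) `^ q) by have [] := W.
have iw : mu.-integrable (I0T T) (EFin \o (fun s => enorm (D2 T xi s) `^ q)).
  apply/integrableP; split; first exact/measurable_EFinP.
  have [_] := W; apply: le_lt_trans; rewrite le_eqVlt; apply/orP; left; apply/eqP.
  by apply: eq_integral => s _; rewrite /= ger0_norm// powR_ge0.
transitivity (\int[mu]_(s in I0T T) ((running Y xi s)%:E + (q^-1)%:E * (enorm (D2 T xi s) `^ q)%:E))%E.
  by apply: eq_integral => s _; rewrite -EFinM -EFinD.
rewrite integralD//; last 2 first.
- exact: running_integrable.
- exact: (integrableZl mI q^-1 iw).
rewrite integralZl// E EFinD EFinM /Rintegral fineK//; last exact:
   (integrable_fin_num mI (running_integrable hY Gx)).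
Qed.

End costs.

(** * Finite games played with step maps *)

Section uniform.
Context {R : realType}.
Local Notation mu := (@lebesgue_measure R).

Definition lam : probability (measurableTypeR R) R := uniform_prob (@ltr01 R).

Lemma lam_oc (a b : R) : 0 <= a -> a <= b -> b <= 1 -> lam `]a, b]%classic = (b - a)%:E.
Proof.
move=> a0 ab b1; transitivity (\int[mu]_(x in `]a, b]) (cst 1%E x : \bar R))%E.
  rewrite /lam /= /uniform_prob; apply: eq_integral => x; rewrite inE /= in_itv /= => /andP[ax xb].
  by rewrite /uniform_pdf (ltW (le_lt_trans a0 ax)) (le_trans xb b1) /= subr0 invr1.
rewrite integral_cst//= mul1e lebesgue_measure_itv /= lte_fin.
have [|ba] := ltP a b; first by rewrite -EFinB.
by rewrite (@le_anti _ _ a b) ?subrr// ab.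
Qed.

Lemma lam_outside : lam (~` `]0, 1]%classic) = 0%E.
Proof.
rewrite probability_setC; last exact: measurable_itv.
by rewrite lam_oc// subr0 subee.
Qed.

Lemma ae_notin (A : set R) : measurable (A : set (measurableTypeR R)) -> lam A = 0%E -> {ae lam, forall t, ~ A t}.
Proof. by move=> mA A0; exists A; split=> // t nA; apply: contrapT. Qed.

Lemma countable_lam (D : set R) : countable D -> {ae lam, forall t, ~ D t}.
Proof.
move=> cD; have mD : measurable (D : set (measurableTypeR R)) by exact: countable_measurable.
apply: ae_notin => //; have /null_content_dominatesP := dominates_uniform_prob (@ltr01 R).
by apply=> //; exact: countable_lebesgue_measure0.
Qed.

Lemma lam_ae (D : set R) (Q : R -> Prop) : countable D -> (forall t, 0 < t < 1 -> ~ D t -> Q t) -> {ae lam, forall t, Q t}.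
Proof.
move=> cD hQ; have h1 := countable_lam cD; have h2 := countable_lam (countable1 (1 : R)).
have h3 := ae_notin (measurableC (measurable_itv `]0%R, 1%R])) lam_outside.
apply: (@filterS3 _ _ (ae_filter_ringOfSetsType lam) _ _ _ _ _ h1 h2 h3) => t nD n1 nO; apply: hQ => //.
have : `]0, 1]%classic t by apply: contrapT.
rewrite /= in_itv /= => /andP[t0 t1]; rewrite t0 lt_neqAle t1 andbT.
by apply/eqP => tt; apply: n1.
Qed.

End uniform.

Lemma finite_integral {R : realType} {d} {X : measurableType d} (P : probability X R) (M : nat)
    (idx : X -> 'I_M) (g : 'I_M -> R) : (forall i, measurable [set x | idx x = i]) ->
  (\int[P]_x (g (idx x))%:E = \sum_(i < M) (g i)%:E * P [set x | idx x = i])%E.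
Proof.
move=> mi.
have E x : (g (idx x))%:E = (\sum_(i < M) (g i * \1_[set x | idx x = i] x)%:E)%E.
  rewrite (bigD1 (idx x))//= big1 ?adde0; first by rewrite indicE mem_set// mulr1.
  by move=> i /eqP ne; rewrite indicE memNset ?mulr0// => /= e; apply: ne.
have ii i : P.-integrable setT (EFin \o (fun x => \1_[set x | idx x = i] x : R)).
  apply: measurable_bounded_integrable => //.
  - by apply: le_lt_trans (probability_le1 P _) _ => //; exact: ltry.
  - exact: measurable_indic.
  - exists (1 : R); split; [exact: num_real|move=> y y1 x _ /=].
    by rewrite ger0_norm// (le_trans _ (ltW y1))// indicE; case: (_ \in _).
under eq_integral do rewrite E.
rewrite (@integral_sum _ _ _ P setT measurableT _ (fun i x => (g i * \1_[set x | idx x = i] x)%:E)); last first.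
  by move=> i; exact: (integrableZl measurableT (g i) (ii i)).
apply: eq_bigr => i _; under eq_integral do rewrite EFinM.
transitivity ((g i)%:E * \int[P]_x (\1_[set x | idx x = i] x)%:E)%E; first exact: (integralZl measurableT (ii i)).
by rewrite integral_indic// setIT.
Qed.

(** * Quantile functions of finite laws *)

Section step_index.
Context {R : realType} {N : nat}.
Implicit Types (y : 'rV[R]_N.+1) (t : R) (i j : nat).

Definition prefix_sum y i : R := \sum_(l < N.+1 | (l < i)%N) y ord0 l.
(** The quantile function of the weights [y]. A failed search returns [N], so the last index takes
    every remaining [t]. *)
Definition step_index y t : nat := find (fun j => t <= prefix_sum y j.+1) (iota 0 N).
Definition step_ord y t : 'I_N.+1 := inord (step_index y t).

Lemma step_index_le y t : (step_index y t <= N)%N.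
Proof. by rewrite /step_index (leq_trans (find_size _ _))// size_iota. Qed.

Lemma step_ordE y t : step_ord y t = step_index y t :> nat.
Proof. by rewrite inordK// ltnS step_index_le. Qed.

Lemma step_index_mono y t t' : t <= t' -> (step_index y t <= step_index y t')%N.
Proof. by move=> tt; apply: sub_find => j /=; exact: le_trans. Qed.

Lemma prefix_sum0 y : prefix_sum y 0 = 0.
Proof. by rewrite /prefix_sum big_pred0. Qed.

Lemma prefix_sumS y (l : 'I_N.+1) : prefix_sum y l.+1 = prefix_sum y l + y ord0 l.
Proof.
rewrite /prefix_sum (bigD1 l) ?leqnn//= addrC; congr (_ + _); apply: eq_bigl => j.
by rewrite ltnS andbC -ltn_neqAle.
Qed.

Lemma prefix_sum_full y : prefix_sum y N.+1 = \sum_l y ord0 l.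
Proof. by rewrite /prefix_sum; apply: eq_bigl => l; rewrite ltn_ord. Qed.

Lemma prefix_sum_le y i j : (forall l, 0 <= y ord0 l) -> (i <= j)%N -> prefix_sum y i <= prefix_sum y j.
Proof.
move=> y0 ij; rewrite /prefix_sum [leRHS](bigID (fun l : 'I_N.+1 => (l < i)%N))/=.
rewrite (eq_bigl (fun l : 'I_N.+1 => (l < j)%N && (l < i)%N)) ?lerDl ?sumr_ge0// => l.
by case: (ltnP l i) => li; rewrite ?andbF// (leq_trans li).
Qed.

Section feasible_y.
Variable y : 'rV[R]_N.+1.
Hypotheses (y0 : forall l, 0 <= y ord0 l) (y1 : \sum_l y ord0 l = 1).

Lemma step_indexP t i : 0 < t <= 1 -> (i <= N)%N ->
  (step_index y t = i) <-> (prefix_sum y i < t /\ t <= prefix_sum y i.+1).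
Proof.
move=> /andP[t0 t1] iN; set a := fun j => t <= prefix_sum y j.+1.
have bef j : (j < step_index y t)%N -> prefix_sum y j.+1 < t.
  move=> js; have := before_find 0%N js; rewrite nth_iota ?add0n => [|]; last first.
    exact: leq_trans js (step_index_le y t).
  by move=> /negbT; rewrite -ltNge.
have at_ : t <= prefix_sum y (step_index y t).+1.
  have := step_index_le y t; rewrite leq_eqVlt => /orP[/eqP ->|sN]; first by rewrite prefix_sum_full y1.
  have h : has a (iota 0 N) by rewrite has_find size_iota.
  by have := nth_find 0%N h; rewrite nth_iota ?add0n.
have lo : prefix_sum y (step_index y t) < t.
  by case: (step_index y t) bef => [|j] bef; [rewrite prefix_sum0|exact: bef].
split=> [<-//|[h1 h2]]; apply/eqP; rewrite eqn_leq; apply/andP; split; rewrite leqNgt; apply/negP => lt.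
- by have := le_lt_trans h2 (bef _ lt); rewrite ltxx.
- have := lt_le_trans h1 (le_trans at_ (prefix_sum_le y0 lt)).
  by rewrite ltxx.
Qed.

Lemma step_index_itv t : 0 < t <= 1 -> prefix_sum y (step_index y t) < t <= prefix_sum y (step_index y t).+1.
Proof. by move=> t01; apply/andP; apply/(step_indexP t01 (step_index_le y t)). Qed.

Lemma step_ord_pos t : 0 < t <= 1 -> 0 < y ord0 (step_ord y t).
Proof.
move=> /step_index_itv; rewrite -step_ordE prefix_sumS => /andP[h1 h2].
by have := lt_le_trans h1 h2; rewrite ltrDl.
Qed.

Lemma prefix_sum01 i : 0 <= prefix_sum y i <= 1.
Proof.
rewrite sumr_ge0//= -y1 /prefix_sum [leRHS](bigID (fun l : 'I_N.+1 => (l < i)%N))/= lerDl.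
exact: sumr_ge0.
Qed.

End feasible_y.

Lemma step_ord_measurable y (i : 'I_N.+1) : (forall l, 0 <= y ord0 l) -> measurable ([set t | step_ord y t = i] : set (measurableTypeR R)).
Proof.
move=> y0.
have ml j : measurable ([set t | (step_index y t <= j)%N] : set (measurableTypeR R)).
  have [jN|Nj] := ltnP j N; last first.
    rewrite (_ : [set t | _] = setT)//; apply/seteqP; split=> t //= _.
    exact: leq_trans (step_index_le y t) Nj.
  rewrite (_ : [set t | _] = `]-oo, prefix_sum y j.+1]%classic)//.
  apply/seteqP; split=> t /=; rewrite in_itv /=.
    move=> sj; have sN := leq_ltn_trans sj jN.
    have h : has (fun j => t <= prefix_sum y j.+1) (iota 0 N) by rewrite has_find size_iota.
    have := nth_find 0%N h; rewrite nth_iota ?add0n// => /le_trans; apply.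
    exact: prefix_sum_le.
  move=> tj; rewrite leqNgt; apply/negP => js.
  have := before_find 0%N js; rewrite nth_iota ?add0n//; by rewrite tj.
have E : [set t | step_ord y t = i] = [set t | (step_index y t <= i)%N] `\` [set t | (step_index y t < i)%N].
  apply/seteqP; split=> t /=.
    by move=> <-; rewrite step_ordE leqnn ltnn.
  move=> [h1 h2]; apply/val_inj; rewrite /= step_ordE; apply/eqP; rewrite eqn_leq h1 /= leqNgt.
  exact/negP.
rewrite E; apply: measurableD; first exact: ml.
case: (i : nat) => [|j]; last exact: ml.
by rewrite (_ : [set t | _] = set0)//; apply/seteqP; split=> t.
Qed.

Lemma lam_step_ord y (i : 'I_N.+1) : (forall l, 0 <= y ord0 l) -> \sum_l y ord0 l = 1 ->
  lam [set t : R | step_ord y t = i] = (y ord0 i)%:E.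
Proof.
move=> y0 y1; have mA := step_ord_measurable i y0.
have mI : measurable (`]0%R, 1%R]%classic : set (measurableTypeR R)) by exact: measurable_itv.
rewrite (measureDI lam mA mI) [X in (X + _)%E](_ : _ = 0%E) ?add0e; last first.
  apply: (subset_measure0 _ (measurableC mI) _ lam_outside); first exact: measurableD.
  by move=> t [].
have /andP[p0 p1] := prefix_sum01 y0 y1 i; have /andP[p2 p3] := prefix_sum01 y0 y1 i.+1.
have pp : prefix_sum y i <= prefix_sum y i.+1 by exact: prefix_sum_le.
rewrite (_ : _ `&` _ = `]prefix_sum y i, prefix_sum y i.+1]%classic).
  transitivity (prefix_sum y i.+1 - prefix_sum y i)%:E; first exact: lam_oc.
  by rewrite prefix_sumS addrC addKr.
have iN : (i <= N)%N by rewrite -ltnS ltn_ord.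
apply/seteqP; split=> t /=; rewrite !in_itv /=.
  by move=> [<- t01]; rewrite step_ordE; exact: step_index_itv.
move=> /andP[h1 h2]; have t01 : 0 < t <= 1 by rewrite (le_lt_trans p0 h1) (le_trans h2 p3).
by split=> //; apply/val_inj; rewrite /= step_ordE; apply/(step_indexP y0 y1 t01 iN).
Qed.

(** Unless [t] is one of the finitely many break points, the quantile at [t] does not change when
    [y] moves slightly. *)
Lemma step_ord_cvg (y_ : nat -> 'rV[R]_N.+1) y t : (forall k l, 0 <= y_ k ord0 l) -> (forall k, \sum_l y_ k ord0 l = 1) ->
  (forall l, 0 <= y ord0 l) -> \sum_l y ord0 l = 1 -> (forall e, 0 < e -> exists K, forall k, (K <= k)%N -> forall l, `|y_ k ord0 l - y ord0 l| <= e) ->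
  0 < t < 1 -> (forall i, (i <= N)%N -> t != prefix_sum y i) -> exists K, forall k, (K <= k)%N -> step_ord (y_ k) t = step_ord y t.
Proof.
move=> y0_ y1_ y0 y1 hy /andP[t0 t1] nt.
have t01 : 0 < t <= 1 by rewrite t0 ltW.
set i := step_index y t; have iN := step_index_le y t.
have /andP[h1 h2] := step_index_itv y0 y1 t01; rewrite -/i in h1 h2 iN.
have h2' : t < prefix_sum y i.+1.
  rewrite lt_neqAle h2 andbT; move: iN; rewrite leq_eqVlt => /orP[/eqP ->|/nt//].
  by rewrite prefix_sum_full y1 lt_eqF.
pose g := Num.min (t - prefix_sum y i) (prefix_sum y i.+1 - t) / 2.
have g0 : 0 < g by rewrite divr_gt0// lt_min !subr_gt0 h1.
have [K hK] := hy (g / N.+1%:R) (divr_gt0 g0 (ltr0Sn _ _)).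
exists K => k Kk; have hp j : `|prefix_sum (y_ k) j - prefix_sum y j| <= g.
  rewrite /prefix_sum -sumrB; apply: le_trans (ler_norm_sum _ _ _) _.
  apply: (@le_trans _ _ (\sum_(l < N.+1) (g / N.+1%:R))).
    rewrite [leRHS](bigID (fun l : 'I_N.+1 => (l < j)%N))/=; apply: ler_wpDr.
      by apply: sumr_ge0 => l _; rewrite divr_ge0// ltW.
    by apply: ler_sum => l _; exact: hK.
  by rewrite sumr_const card_ord -[_ *+ _]mulr_natr divfK// pnatr_eq0.
have gg : 2 * g = Num.min (t - prefix_sum y i) (prefix_sum y i.+1 - t) by rewrite /g; field.
have : 2 * g <= t - prefix_sum y i by rewrite gg ge_min lexx.
have : 2 * g <= prefix_sum y i.+1 - t by rewrite gg ge_min lexx orbT.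
move=> g2 g1; apply/val_inj; rewrite /= !step_ordE -/i.
apply/(step_indexP (y0_ k) (y1_ k) t01 iN).
have := hp i; have := hp i.+1; rewrite !ler_norml => /andP[a1 _] /andP[_ a2].
by clear gg; clearbody g; split; [|apply: ltW]; lra.
Qed.

End step_index.

(** * Equilibria among step maps *)

Section finite_game.
Context {R : realType} {n : nat}.
Variables (Om : set 'rV[R]_n) (q T : R).
Hypotheses (q1 : 1 < q) (T0 : 0 < T).
Variables (F G : (set (phaseB R n) -> \bar R) -> phaseB R n -> R) (L : 'rV[R]_n -> 'rV[R]_n -> R -> R).
Hypotheses (hF : bounded_continuous_map Om F) (hG : bounded_continuous_map Om G)
  (hLc : {within [set p : (('rV[R]_n * 'rV[R]_n) * R)%type | Xi Om p.1 /\ 0 <= p.2 <= T],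
            continuous (fun p : (('rV[R]_n * 'rV[R]_n) * R)%type => L p.1.1 p.1.2 p.2)})
  (hLb : exists C : R, forall z : ('rV[R]_n * 'rV[R]_n)%type, forall s : R,
            Xi Om z -> 0 <= s <= T -> `|L z.1 z.2 s| <= C).
Context {N : nat}.
Variable S : 'I_N.+1 -> R -> 'rV[R]_n.
Hypothesis GS : forall i, Gam Om T (S i).

Definition step_path (y : 'rV[R]_N.+1) (t : R) : R -> 'rV[R]_n := S (step_ord y t).

Lemma step_path_preimage (y : 'rV[R]_N.+1) (A : set (R -> 'rV[R]_n)) : (forall l, 0 <= y ord0 l) ->
  measurable (step_path y @^-1` A : set (measurableTypeR R)).
Proof.
move=> y0; rewrite (_ : _ @^-1` _ = \bigcup_(i in [set i : 'I_N.+1 | A (S i)]) [set t | step_ord y t = i]).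
  by apply: fin_bigcup_measurable => // i _; exact: step_ord_measurable.
apply/seteqP; split=> t /=; first by move=> At; exists (step_ord y t).
by move=> [i Ai ti]; rewrite /step_path ti.
Qed.

Lemma random_step_path (y : 'rV[R]_N.+1) : (forall l, 0 <= y ord0 l) -> random_path (X := measurableTypeR R) Om (T := T) (step_path y).
Proof.
move=> y0; split; last by move=> t; exact: GS.
by move=> _ A mA; rewrite setTI; exact: step_path_preimage.
Qed.

(** The quantile representation turns convergence of the weights into almost sure convergence of the
    step maps, so [Jreg_cvg] gives the continuity that [game_equilibrium] requires. The terms [e i],
    which will carry the energies, do not depend on [y]. *)
Lemma finite_equilibrium (M : nat) (tau : 'I_N.+1 -> 'I_M) (w : 'I_M -> R) (dflt : 'I_M -> 'I_N.+1) (e : 'I_N.+1 -> R) :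
  (forall j, tau (dflt j) = j) -> (forall j, 0 <= w j) -> \sum_j w j = 1 ->
  exists2 y : 'rV[R]_N.+1, (forall i, 0 <= y ord0 i) /\ (\sum_i y ord0 i = 1 /\ forall j, \sum_(i | tau i == j) y ord0 i = w j) &
    forall i i', tau i = tau i' -> 0 < y ord0 i ->
    Jreg lam (T := T) F G L (step_path y) (S i) + e i <= Jreg lam (T := T) F G L (step_path y) (S i') + e i'.
Proof.
move=> taud w0 w1.
have feas1 (y : 'rV[R]_N.+1) : feasible tau w y -> \sum_i y ord0 i = 1.
  by move=> [_ h]; rewrite -w1 (partition_big tau xpredT)//=; apply: eq_bigr => j _; exact: h.
have [|y fy hy] := @game_equilibrium R M N.+1 tau w dflt taud w0 (fun i y => Jreg lam (T := T) F G L (step_path y) (S i) + e i); last first.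
  by exists y => //; have [y0 yw] := fy; split=> //; split=> //; exact: feas1.
move=> i x fx eps eps0; apply: contrapT => nd.
have /choice[y_ hy] : forall k : nat, exists y, [/\ feasible tau w y, `|x - y| < k.+1%:R^-1 &
    eps <= `|Jreg lam (T := T) F G L (step_path x) (S i) + e i - (Jreg lam (T := T) F G L (step_path y) (S i) + e i)| ].
  move=> k; apply: contrapT => nk; apply: nd; exists k.+1%:R^-1; first by rewrite invr_gt0 ltr0n.
  by move=> y fy xy; rewrite ltNge; apply/negP => ge; apply: nk; exists y.
have fy k : feasible tau w (y_ k) by have [] := hy k.
have yc d : 0 < d -> exists K, forall k, (K <= k)%N -> forall l, `|y_ k ord0 l - x ord0 l| <= d.
  move=> d0; exists (Num.bound d^-1) => k Kk l; have [_ h _] := hy k.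
  have := mxnorm_coord (x - y_ k) l; rewrite !mxE distrC => h1; apply: le_trans h1 _; apply: le_trans (ltW h) _.
  have di : 0 <= d^-1 by rewrite invr_ge0 ltW.
  rewrite invf_ple ?posrE ?ltr0n//; apply: le_trans (ltW (archi_boundP di)) _.
  by rewrite ler_nat leqW.
have H1 k : random_path (X := measurableTypeR R) Om (T := T) (step_path (y_ k)) by apply: random_step_path; have [] := fy k.
have H2 : random_path (X := measurableTypeR R) Om (T := T) (step_path x) by apply: random_step_path; have [] := fx.
have H3 : {ae lam, forall t, forall e, 0 < e -> exists K, forall k, (K <= k)%N -> c1le T (step_path (y_ k) t) (step_path x t) e}.
  apply: (@lam_ae _ [set prefix_sum x j | j in setT]); first exact: sub_countable (card_image_le _ _) (countableP _).
  move=> t t01 nt d d0; have [] := @step_ord_cvg _ _ y_ x t _ _ _ _ yc t01.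
  - by move=> k; have [] := fy k.
  - by move=> k; exact: feas1.
  - by have [] := fx.
  - exact: feas1.
  - by move=> j _; apply/eqP => tj; apply: nt; exists j.
  - by move=> K hK; exists K => k /hK E; rewrite /step_path E; apply: c1le_refl; exact: ltW.
have H4 d : 0 < d -> exists K, forall k, (K <= k)%N -> c1le T (S i) (S i) d.
  by move=> d0; exists 0%N => k _; apply: c1le_refl; exact: ltW.
have := Jreg_cvg T0 hF hG hLc hLb H1 H2 H3 (fun=> GS i) (GS i) H4.
move=> /cvgrPdist_lt/(_ _ eps0)[K _ hK]; have := hK K (leqnn K); have [_ _] := hy K.
have E (a b c : R) : a + c - (b + c) = a - b by ring.
by rewrite /= E => h1 h2; move: (le_lt_trans h1 h2); rewrite ltxx.
Qed.

End finite_game.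

(** * Coding paths by real numbers *)

Lemma level_arith {R : realFieldType} (x y a b : R) : 0 <= x -> y <= 1 -> 2 * a + x <= 2 * b + y -> b + 1 <= a -> False.
Proof. lra. Qed.

Lemma level_arith1 {R : realFieldType} (x y a b : R) : 0 <= x -> y <= 1 ->
  2 * a + x - (2 * b + y) < 3^-1 -> b + 1 <= a -> False.
Proof. lra. Qed.

Lemma level_arith2 {R : realFieldType} (x y a b : R) : x <= 1 -> 0 <= y ->
  - 3^-1 < 2 * a + x - (2 * b + y) -> a + 1 <= b -> False.
Proof. lra. Qed.

Section ternary_code.
Context {R : realType}.
Implicit Types (l : seq bool).

(* Ternary expansions with digits in {0, 2}: nearby values share their first digits. *)
Fixpoint cantor_code l : R := if l is b :: l' then ((b : nat)%:R * 2 + cantor_code l') / 3 else 0.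

Lemma cantor_code01 l : 0 <= cantor_code l <= 1.
Proof.
elim: l => [|b l /andP[h0 h1]] /=; first by rewrite lexx ler01.
by case: b => /=; apply/andP; split; lra.
Qed.

Lemma cantor_code_close J l l' : (J < size l)%N -> (J < size l')%N ->
  `|cantor_code l - cantor_code l'| < 3^-1 ^+ J.+1 -> nth false l J = nth false l' J.
Proof.
elim: J l l' => [|J IH] [|b l] [|b' l'] //= sl sl'.
  rewrite expr1; have /andP[x0 x1] := cantor_code01 l; have /andP[y0 y1] := cantor_code01 l'.
  by rewrite ltr_norml => /andP[]; case: b; case: b' => //=; lra.
move=> h; have h3 : (3^-1 : R) ^+ J.+2 <= 3^-1.
  rewrite exprS ler_piMr ?invr_ge0// exprn_ile1 ?invr_ge0//.
  by rewrite invf_le1// ler1n.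
have /andP[x0 x1] := cantor_code01 l; have /andP[y0 y1] := cantor_code01 l'.
have bb : b = b'.
  by move: (lt_le_trans h h3); rewrite ltr_norml => /andP[]; case: b {h}; case: b' => //=; lra.
apply: IH => //; move: h; rewrite -bb (_ : _ - _ = (cantor_code l - cantor_code l') / 3); last by ring.
by rewrite normrM [X in _ * X]gtr0_norm ?invr_gt0// exprSr ltr_pM2r ?invr_gt0.
Qed.

End ternary_code.

Lemma find_measurable {d} {X : measurableType d} {C : Type} (a : X -> C -> bool) (s : seq C) :
  (forall c, measurable [set x | a x c]) -> forall j, measurable [set x | find (a x) s = j].
Proof.
move=> ma; elim: s => [|c s IH] j /=.
  by case: j => [|j]; [rewrite (_ : [set x | _] = setT)|rewrite (_ : [set x | _] = set0)]; rewrite ?predeqE.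
case: j => [|j].
  rewrite (_ : [set x | _] = [set x | a x c])//; apply/seteqP; split=> x /=; first by case: (a x c).
  by move=> ->.
rewrite (_ : [set x | _] = [set x | find (a x) s = j] `\` [set x | a x c]); first exact: measurableD.
apply/seteqP; split=> x /=; first by case: (a x c) => // -[].
by move=> [<- /negP]; case: (a x c).
Qed.

Lemma InP {X : eqType} (x : X) (l : seq X) : reflect (List.In x l) (x \in l).
Proof.
elim: l => [|y l IH]; first exact: ReflectF.
rewrite inE; apply: (iffP orP) => [[/eqP ->|/IH]|[->|/IH]]; by [left|right].
Qed.

(** * Finite nets of paths and the code *)

Section nets.
Context {R : realType} {n : nat}.
Variables (Om : set 'rV[R]_n) (q T : R).
Hypotheses (q1 : 1 < q) (T0 : 0 < T) (gO : good_dom Om).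
Notation phase := ('rV[R]_n * 'rV[R]_n)%type.
Notation path := (R -> 'rV[R]_n).
Implicit Types (xi eta : path) (z : phase) (e r : R).

Let zI : (0 : R) <= 0 <= T. Proof. by rewrite lexx ltW. Qed.

Lemma energy_subsequence r (x_ : nat -> path) : (forall k, energy Om q T r (x_ k)) ->
  exists2 phi : nat -> nat, (forall k, (phi k < phi k.+1)%N) &
  exists2 xi, energy Om q T r xi & forall e, 0 < e -> exists N, forall k, (N <= k)%N -> c1le T (x_ (phi k)) xi e.
Proof. by move=> hx; have [M hM] := closure_bounded gO; exact: energy_compact hM hx. Qed.

(** The energy is only lower semicontinuous for [C^1] convergence, so a net has to approximate the
    energies separately; being bounded, they converge along a further subsequence. *)
Lemma energy_near_pair r (x_ : nat -> path) e : 0 < e -> (forall k, energy Om q T r (x_ k)) ->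
  exists i j, (i < j)%N /\ (c1le T (x_ i) (x_ j) e /\ `|Vn q (Dp T (x_ i)) 0 T - Vn q (Dp T (x_ j)) 0 T| <= e).
Proof.
move=> e0 hx; have [phi hphi [xi _ hxi]] := energy_subsequence hx.
pose v k := Vn q (Dp T (x_ (phi k))) 0 T.
have vB k : `|v k| <= r.
  have [_ V] := hx (phi k); rewrite ger0_norm; first exact: Vn_le (ltW T0) V.
  exact: Vn_ge0 (ltW T0) V.
have [psi hpsi cpsi] := @diagonal_extraction R (fun=> v) (fun=> r) (fun=> vB).
have [l hl] := (cvg_ex _).1 (cpsi 0%N).
have e2 : 0 < e / 2 by rewrite divr_gt0.
have [N1 h1] := hxi _ e2; have /cvgrPdist_le/(_ _ e2)[N2 _ h2] := hl.
have ps k : (k <= psi k)%N by elim: k => // k IH; exact: leq_ltn_trans IH (hpsi k).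
pose k := maxn N1 N2.
exists (phi (psi k)), (phi (psi k.+1)); split.
  have phi_homo : {homo phi : a b / (a < b)%N} by apply: homo_ltn => //; exact: ltn_trans.
  by apply: phi_homo; exact: hpsi.
split.
  rewrite [e]splitr; apply: c1le_trans (h1 _ _) (c1leC (h1 _ _)).
    exact: leq_trans (leq_maxl _ _) (ps k).
  exact: leq_trans (leq_trans (leq_maxl N1 N2) (leqnSn _)) (ps k.+1).
have i1 : `|l - v (psi k)| <= e / 2 := h2 k (leq_maxr _ _).
have i2 : `|l - v (psi k.+1)| <= e / 2 := h2 k.+1 (leq_trans (leq_maxr N1 N2) (leqnSn _)).
change (`|v (psi k) - v (psi k.+1)| <= e).
rewrite [e]splitr; apply: le_trans (ler_distD l _ _) _; rewrite [X in X + _]distrC.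
exact: lerD i1 i2.
Qed.

Lemma energy_net r e (A : set path) : 0 < e -> A `<=` energy Om q T r -> exists l : seq path,
  (forall y, y \in l -> A y) /\ forall x, A x -> exists2 y, y \in l &
    c1le T y x e /\ `|Vn q (Dp T y) 0 T - Vn q (Dp T x) 0 T| <= e.
Proof.
move=> e0 Ar; have [u Au|l [lA hl]] := @finite_net _ A (fun y x => c1le T y x e /\ `|Vn q (Dp T y) 0 T - Vn q (Dp T x) 0 T| <= e).
  by apply: energy_near_pair => // k; exact/Ar/Au.
exists l; split=> [y /InP|x Ax]; first exact: lA.
by have [y /InP yl h] := hl x Ax; exists y.
Qed.

Lemma startset_net r e : 0 < e -> exists l : seq phase, (forall c, c \in l -> startset Om q T r c) /\
  forall z, startset Om q T r z -> exists2 c, c \in l & pdist c z < e.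
Proof.
move=> e0; have e2 : 0 < e / 2 by rewrite divr_gt0.
have [l [lA hl]] := @energy_net r _ (energy Om q T r) e2 (fun x h => h).
exists [seq et T 0 x | x <- l]; split.
  by move=> c /mapP[x /lA Ex ->]; exists x.
move=> z [x [Ex x0 v0]]; have [y yl [c _]] := hl x Ex.
exists (et T 0 y); first exact: map_f.
have := c 0 zI; rewrite x0 v0 /pdist /= => h; apply: le_lt_trans h _.
by rewrite ltr_pdivrMr// ltr_pMr// ltr1n.
Qed.

Lemma startset_measurable r : measurable (startset Om q T r : set (phaseB R n)).
Proof.
rewrite -[startset _ _ _ _]setCK; apply: measurableC; apply: open_wrt_measurable => z nz.
apply: contrapT => nh; apply: nz.
have /choice[u hu] : forall k : nat, exists w, pball z k.+1%:R^-1 w /\ startset Om q T r w.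
  move=> k; apply: contrapT => nk; apply: nh; exists k.+1%:R^-1; first by rewrite invr_gt0 ltr0n.
  by move=> w zw sw; apply: nk; exists w.
apply: (startset_closed q1 T0 gO (z_ := u)) => [k|e e0]; first by have [] := hu k.
exists (Num.bound e^-1) => k Kk; have [h _] := hu k; rewrite pdistC; apply: le_trans (ltW h) _.
have di : 0 <= e^-1 by rewrite invr_ge0 ltW.
rewrite invf_ple ?posrE ?ltr0n//; apply: le_trans (ltW (archi_boundP di)) _.
by rewrite ler_nat leqW.
Qed.

Lemma startset_mono r r' : r <= r' -> startset Om q T r `<=` startset Om q T r'.
Proof. by move=> rr z [xi [Ex x0 v0]]; exists xi; split=> //; exact: energy_mono Ex. Qed.

Definition cell z e (rc : nat * phase) := `[< startset Om q T rc.1%:R z /\ pdist rc.2 z < e >].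

(** The centers are listed by increasing level and each point takes the first cell containing it, so
    a point of level [r] receives a center of level at most [r]: discretising never raises the
    level. *)
Lemma startset_cover k e : 0 < e -> exists cl : seq (nat * phase),
  (forall rc, rc \in cl -> (rc.1 <= k)%N /\ startset Om q T rc.1%:R rc.2) /\
  forall (r : nat) z d, (r <= k)%N -> startset Om q T r%:R z -> has (cell z e) cl /\ ((nth d cl (find (cell z e) cl)).1 <= r)%N.
Proof.
move=> e0; elim: k => [|k [cl [h1 h2]]].
  have [l [lA hl]] := @startset_net 0%:R e e0.
  exists [seq (0%N, c) | c <- l]; split; first by move=> _ /mapP[c /lA cl ->].
  move=> [|//] z d _ hz; have hs : has (cell z e) [seq (0%N, c) | c <- l].
    have [c cl cz] := hl z hz; apply/hasP; exists (0%N, c); first exact: map_f.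
    by apply/asboolP.
  split=> //; have := mem_nth d (_ : (find (cell z e) [seq (0%N, c) | c <- l] < size [seq (0%N, c) | c <- l])%N).
  by rewrite -has_find => /(_ hs) /mapP[c _ ->].
have [l [lA hl]] := @startset_net k.+1%:R e e0.
exists (cl ++ [seq (k.+1, c) | c <- l]); split.
  move=> rc; rewrite mem_cat => /orP[/h1[h sc]|/mapP[c /lA cl' ->]//].
  by split; [exact: leqW|exact: sc].
move=> r z d rk hz; have hs : has (cell z e) (cl ++ [seq (k.+1, c) | c <- l]).
  rewrite has_cat; move: rk; rewrite leq_eqVlt ltnS => /orP[/eqP rE|/h2/(_ hz)-/(_ d)[->//]].
  apply/orP; right; rewrite rE in hz; have [c c_l cz] := hl z hz; apply/hasP; exists (k.+1, c); first exact: map_f.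
  by apply/asboolP.
split=> //; rewrite find_cat; case: (boolP (has (cell z e) cl)) => hcl; rewrite nth_cat.
  rewrite -has_find hcl.
  move: rk; rewrite leq_eqVlt ltnS => /orP[/eqP ->|rk]; last by have [] := h2 r z d rk hz.
  have := mem_nth d (_ : (find (cell z e) cl < size cl)%N); rewrite -has_find => /(_ hcl) /h1[h _].
  exact: leqW.
rewrite ltnNge leq_addr /= addKn.
have rE : r = k.+1.
  move: rk; rewrite leq_eqVlt ltnS => /orP[/eqP //|rk].
  by have [h _] := h2 r z d rk hz; rewrite h in hcl.
have hs' : has (cell z e) [seq (k.+1, c) | c <- l] by move: hs; rewrite has_cat (negbTE hcl).
have := mem_nth d (_ : (find (cell z e) [seq (k.+1, c) | c <- l] < size [seq (k.+1, c) | c <- l])%N).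
by rewrite -has_find => /(_ hs') /mapP[c _ ->]; rewrite rE.
Qed.

Lemma cell_measurable e rc : measurable ([set z | cell z e rc] : set (phaseB R n)).
Proof.
rewrite (_ : [set z | _] = startset Om q T rc.1%:R `&` pball rc.2 e).
  by apply: measurableI; [exact: startset_measurable|apply: open_wrt_measurable; exact: open_pball].
by apply/seteqP; split=> z /=; [move/asboolP|move=> ?; apply/asboolP].
Qed.

(** The least integer bound of the energy; paths of infinite energy get the default 0 of [xget]. *)
Definition energy_level xi : nat := xget 0%N [set r : nat | energy Om q T r%:R xi /\ forall r' : nat, energy Om q T r'%:R xi -> (r <= r')%N].

Lemma energy_levelP (r : nat) xi : energy Om q T r%:R xi -> (energy_level xi <= r)%N /\ energy Om q T (energy_level xi)%:R xi.
Proof.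
move=> Ex; have : exists r : nat, `[< energy Om q T r%:R xi >] by exists r; apply/asboolP.
move=> ex; case: (ex_minnP ex) => m /asboolP Em mmin.
have hm : [set r : nat | energy Om q T r%:R xi /\ forall r' : nat, energy Om q T r'%:R xi -> (r <= r')%N] m.
  by split=> // r' Er'; apply: mmin; apply/asboolP.
by have [h1 h2] := xgetPex 0%N (ex_intro _ m hm); split=> //; exact: h2.
Qed.

Lemma code_net : exists net : nat -> nat -> seq path, forall (r m : nat) x, energy Om q T r%:R x -> exists2 y, y \in net r m & c1le T y x m.+1%:R^-1.
Proof.
have h rm : exists l : seq path, forall x, energy Om q T (rm.1 : nat)%:R x -> exists2 y, y \in l & c1le T y x ((rm.2 : nat).+1%:R)^-1.
  have m0 : 0 < (rm.2 : nat).+1%:R^-1 :> R by rewrite invr_gt0 ltr0n.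
  have [l [_ hl]] := @energy_net rm.1%:R _ _ m0 (fun x h => h).
  by exists l => x Ex; have [y yl [c _]] := hl x Ex; exists y.
have [net hnet] := choice h.
by exists (fun r m : nat => net (r, m)) => r m x Ex; exact: (hnet (r, m) x Ex).
Qed.

Section code.
Variable net : nat -> nat -> seq path.
Hypothesis hnet : forall (r m : nat) x, energy Om q T r%:R x -> exists2 y, y \in net r m & c1le T y x m.+1%:R^-1.

(** One bit for each ball of the nets. Two paths sharing a positive bit of precision [m] are within
    twice its radius of each other, which is how agreement of codes turns into [C^1] closeness. *)
Definition code_bit xi (j : nat) : bool :=
  if (unpickle j : option (nat * nat * nat)) is Some (r, m, p) then `[< c1le T (nth (fun=> 0) (net r m) p) xi m.+1%:R^-1 >] else false.

(* The level counts double, so that the cantor code (in [0, 1]) never confuses two levels. *)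
Definition path_code k xi : R := 2 * (energy_level xi)%:R + cantor_code (mkseq (code_bit xi) k).

Lemma path_code_level k xi eta : path_code k xi <= path_code k eta -> (energy_level xi <= energy_level eta)%N.
Proof.
rewrite /path_code; have /andP[x0 x1] := @cantor_code01 R (mkseq (code_bit xi) k).
have /andP[y0 y1] := @cantor_code01 R (mkseq (code_bit eta) k).
move=> h; rewrite leqNgt; apply/negP => lt.
have : (energy_level eta).+1%:R <= (energy_level xi)%:R :> R by rewrite ler_nat.
by rewrite -natr1; exact: level_arith x0 y1 h.
Qed.

Lemma path_code_close J k l xi eta : (J < k)%N -> (J < l)%N -> `|path_code k xi - path_code l eta| < 3^-1 ^+ J.+1 ->
  energy_level xi = energy_level eta /\ code_bit xi J = code_bit eta J.
Proof.
move=> Jk Jl; rewrite /path_code => h.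
have h3 : (3^-1 : R) ^+ J.+1 <= 3^-1.
  rewrite exprS ler_piMr ?invr_ge0// exprn_ile1 ?invr_ge0//.
  by rewrite invf_le1// ler1n.
have /andP[x0 x1] := @cantor_code01 R (mkseq (code_bit xi) k).
have /andP[y0 y1] := @cantor_code01 R (mkseq (code_bit eta) l).
have lE : energy_level xi = energy_level eta.
  have := lt_le_trans h h3; rewrite ltr_norml => /andP[b1 b2].
  apply/eqP; rewrite eqn_leq; apply/andP; split; rewrite leqNgt; apply/negP => lt.
    have : (energy_level eta).+1%:R <= (energy_level xi)%:R :> R by rewrite ler_nat.
    by rewrite -natr1; exact: level_arith1 x0 y1 b2.
  have : (energy_level xi).+1%:R <= (energy_level eta)%:R :> R by rewrite ler_nat.
  by rewrite -natr1; exact: level_arith2 x1 y0 b1.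
split; first exact: lE.
move: h; rewrite lE.
have E (a b c : R) : a + b - (a + c) = b - c by ring.
rewrite E => h.
have sk : (J < size (mkseq (code_bit xi) k))%N by rewrite size_mkseq.
have sl : (J < size (mkseq (code_bit eta) l))%N by rewrite size_mkseq.
by have := cantor_code_close sk sl h; rewrite (nth_mkseq _ _ Jk) (nth_mkseq _ _ Jl).
Qed.

(** Convergence of the codes stabilises the level and then each single bit. The net of the final
    level [rr] at precision [m] has a center near any late path, and all other late paths share the
    corresponding bit. As [k <= kk k], every fixed bit is eventually part of the code. *)
Lemma code_cauchy (y_ : nat -> path) (kk : nat -> nat) r : (forall k, (k <= kk k)%N) -> (forall k, energy Om q T r (y_ k)) ->
  cvgn (fun k => path_code (kk k) (y_ k)) ->
  forall e, 0 < e -> exists N, forall k l, (N <= k)%N -> (N <= l)%N -> c1le T (y_ k) (y_ l) e.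
Proof.
move=> hkk hy /cvg_ex[c hc] e e0.
have close J : exists N, forall k l, (N <= k)%N -> (N <= l)%N -> `|path_code (kk k) (y_ k) - path_code (kk l) (y_ l)| < 3^-1 ^+ J.+1.
  have p0 : 0 < (3^-1 : R) ^+ J.+1 / 2 by rewrite divr_gt0// exprn_gt0// invr_gt0.
  move/cvgrPdist_lt: hc => /(_ _ p0)[N _ hN]; exists N => k l /hN h1 /hN h2.
  rewrite [ltRHS]splitr; apply: le_lt_trans (ler_distD c _ _) _.
  rewrite [X in X + _]distrC; exact: ltrD h1 h2.
have agree J : exists N, forall k l, (N <= k)%N -> (N <= l)%N -> energy_level (y_ k) = energy_level (y_ l) /\ code_bit (y_ k) J = code_bit (y_ l) J.
  have [N hN] := close J; exists (maxn N J.+1) => k l; rewrite !geq_max => /andP[k1 k2] /andP[l1 l2].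
  apply: path_code_close (hN k l k1 l1); [exact: leq_trans k2 (hkk k)|exact: leq_trans l2 (hkk l)].
have [N0 h0] := agree 0%N.
pose rr := energy_level (y_ N0).
have Err k : (N0 <= k)%N -> energy Om q T rr%:R (y_ k).
  move=> Nk; have [E _] := h0 N0 k (leqnn _) Nk; rewrite /rr E.
  have Ek : energy Om q T (Num.bound `|r|)%:R (y_ k).
    by apply: energy_mono (hy k); exact: le_trans (ler_norm _) (ltW (archi_boundP (normr_ge0 r))).
  by have [] := energy_levelP Ek.
pose m := Num.bound (2 / e).
have me : m.+1%:R^-1 <= e / 2.
  have e2 : 0 <= 2 / e by rewrite divr_ge0 ?ltW.
  rewrite invf_ple ?posrE ?ltr0n ?divr_gt0// invf_div; apply: le_trans (ltW (archi_boundP e2)) _.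
  by rewrite ler_nat.
(* finitely many bits decide which center of the net is near *)
have [N1 h1] : exists N, forall p, (p < size (net rr m))%N -> forall k l, (N <= k)%N -> (N <= l)%N ->
    code_bit (y_ k) (pickle (rr, m, p)) = code_bit (y_ l) (pickle (rr, m, p)).
  have /choice[Nf hNf] : forall p : nat, exists N, forall k l, (N <= k)%N -> (N <= l)%N ->
      code_bit (y_ k) (pickle (rr, m, p)) = code_bit (y_ l) (pickle (rr, m, p)).
    by move=> p; have [N hN] := agree (pickle (rr, m, p)); exists N => k l /hN h /h[].
  exists (\max_(p < size (net rr m)) Nf p)%N => p ps k l pk pl.
  by apply: hNf; [apply: leq_trans pk|apply: leq_trans pl]; exact: (leq_bigmax (Ordinal ps)).
exists (maxn N0 N1) => k l; rewrite !geq_max => /andP[k1 k2] /andP[l1 l2].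
have [y yn cy] := hnet m (Err k k1).
pose p := index y (net rr m).
have ps : (p < size (net rr m))%N by rewrite index_mem.
have bk : code_bit (y_ k) (pickle (rr, m, p)).
  by rewrite /code_bit pickleK; apply/asboolP; rewrite nth_index.
have bl : code_bit (y_ l) (pickle (rr, m, p)) by rewrite -(h1 p ps k l k2 l2).
move: bk bl; rewrite /code_bit pickleK => /asboolP ck /asboolP cl.
by rewrite [e]splitr; apply: c1le_trans (c1leC (c1le_le me ck)) (c1le_le me cl).
Qed.

End code.
End nets.

(** * Approximate equilibria *)

Section arithmetic.
Context {R : realDomainType}.

Lemma perturbed_le (a b u v B : R) : a + u <= b + v -> - B <= a -> b <= B -> u <= v + 2 * B.
Proof. lra. Qed.

Lemma energy_arith (a b c d u r e : R) : a <= b + d -> b - c <= e -> c <= r -> d + 1 <= u -> e <= 1 -> a <= r + u.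
Proof. lra. Qed.

End arithmetic.

Lemma descale_le {R : realFieldType} (q a b B : R) : 0 < q -> q^-1 * a <= q^-1 * b + 2 * B -> a <= b + 2 * q * B.
Proof.
move=> q0; rewrite -(ler_pM2l q0) mulrDr !mulrA divff ?gt_eqF// !mul1r.
by rewrite (mulrC q 2).
Qed.

Section approximate_equilibria.
Context {R : realType} {n : nat}.
Variables (Om : set 'rV[R]_n) (q T : R).
Hypotheses (q1 : 1 < q) (T0 : 0 < T) (gO : good_dom Om).
Variables (F G : (set (phaseB R n) -> \bar R) -> phaseB R n -> R) (L : 'rV[R]_n -> 'rV[R]_n -> R -> R).
Hypotheses (hF : bounded_continuous_map Om F) (hG : bounded_continuous_map Om G)
  (hLc : {within [set p : (('rV[R]_n * 'rV[R]_n) * R)%type | Xi Om p.1 /\ 0 <= p.2 <= T],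
            continuous (fun p : (('rV[R]_n * 'rV[R]_n) * R)%type => L p.1.1 p.1.2 p.2)})
  (hLb : exists C : R, forall z : ('rV[R]_n * 'rV[R]_n)%type, forall s : R,
            Xi Om z -> 0 <= s <= T -> `|L z.1 z.2 s| <= C).
Variable m0 : probability (phaseB R n) R.
Hypotheses (hm0 : prob_Xi Om m0) (hm0ad : m0 (Xi Om `\` Xiad Om) = 0%E).
Notation phase := ('rV[R]_n * 'rV[R]_n)%type.
Notation path := (R -> 'rV[R]_n).
Variable net : nat -> nat -> seq path.
Local Notation energy r := (energy Om q T r%:R).
Local Notation Kr r := (startset Om q T r%:R).
Local Notation J := (Jreg lam (T := T) F G L).
Local Notation Vt := (fun xi : path => Vn q (Dp T xi) 0 T).
Local Notation code := (path_code Om q T net).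
Implicit Types (r k : nat) (z : phase) (xi eta : path) (t : R).

Let zI : (0 : R) <= 0 <= T. Proof. by rewrite lexx ltW. Qed.
Let q0 : 0 < q. Proof. exact: lt_trans q1. Qed.

Lemma startset_exhausts : m0 (~` \bigcup_r Kr r) = 0%E.
Proof.
have E := XiadE q1 T0 gO.
have mA : measurable (\bigcup_r Kr r : set (phaseB R n)).
  by apply: bigcup_measurable => r _; exact: startset_measurable.
have mX := Xi_measurable Om.
apply/eqP; rewrite -measure_le0 -[leRHS]adde0 -{1}hm0 -hm0ad.
apply: le_trans (measureU2 _ _ _); last 2 first.
- exact: measurableC.
- by apply: measurableD => //; rewrite E.
apply: le_measure; rewrite ?inE; first exact: measurableC.
  by apply: measurableU; [exact: measurableC|apply: measurableD => //; rewrite E].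
move=> z nz; have [Xz|nX] := pselect (Xi Om z); last by left.
by right; split=> //; rewrite E.
Qed.

Lemma startset_nonempty : exists r z, Kr r z.
Proof.
apply: contrapT => h; have : m0 setT = 0%E.
  rewrite -startset_exhausts; congr (m0 _); apply/seteqP; split=> z // _ [r _ hz].
  by apply: h; exists r, z.
by rewrite probability_setT => /eqP; rewrite onee_eq0.
Qed.

(* The energy [k + r0 + C1] of an equilibrium path, with room for that of a competitor. *)
Definition max_energy r0 C1 k := (2 * (k + r0) + C1)%N.

(** In order: measurability and a crude energy bound; monotone codes, for Helly's theorem; an energy
    bound at [t] that is uniform in [k]; near optimality, where [eta] is replaced by a strategy
    [eta'] of the game whose energy exceeds that of [eta] by at most [k.+1%:R^-1]; finally the
    initial law, that of [pi] under [m0], with [pi] close to the identity. *)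
Definition approx_solution (r0 C1 k : nat) (Y : R -> path) (pi : phase -> phase) :=
  [/\ (forall A, measurable (Y @^-1` A : set (measurableTypeR R))) /\ (forall t, energy (max_energy r0 C1 k) (Y t)),
   forall t t', t <= t' -> code k (Y t) <= code k (Y t'),
   forall r t, (r <= k)%N -> 0 < t <= 1 -> (t%:E <= m0 (Kr r))%E -> energy (r + C1)%N (Y t),
   forall t, 0 < t <= 1 -> energy (k + r0 + C1)%N (Y t) /\
     forall eta, energy (max_energy r0 C1 k) eta -> eta 0 = Y t 0 -> Dp T eta 0 = Dp T (Y t) 0 ->
     exists eta', [/\ Gam Om T eta', c1le T eta' eta k.+1%:R^-1 &
       J Y (Y t) + q^-1 * Vt (Y t) <= J Y eta' + q^-1 * (Vt eta + k.+1%:R^-1)] &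
   (forall phi : phase -> R, (\int[lam]_t (phi (et T 0 (Y t)))%:E = \int[m0]_z (phi (pi z))%:E)%E) /\
   [/\ measurable_fun setT (pi : phaseB R n -> phaseB R n), forall z, Xi Om (pi z) &
     forall r z, (r <= k)%N -> Kr r z -> pdist (pi z) z < k.+1%:R^-1]].

(** [Jreg] is bounded by some [B], so an equilibrium path has at most the energy of a competitor
    plus [2 * q * B]. This is the origin of [C1], with 1 more for the error of the net. *)
Lemma approx_solution_exists : exists r0 C1, forall k, exists Y pi, approx_solution r0 C1 k Y pi.
Proof.
have [r0 [z0 hz0]] := startset_nonempty.
have [B hB] := Jreg_bounded lam T0 hF hG hLc hLb.
pose C1 := Num.bound `|2 * q * B + 1|.
have hC1 : 2 * q * B + 1 <= C1%:R.
  by apply: le_trans (ler_norm _) (ltW (archi_boundP (normr_ge0 _))).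
exists r0, C1 => k; pose e : R := k.+1%:R^-1.
have e0 : 0 < e by rewrite invr_gt0 ltr0n.
have e1 : e <= 1 by rewrite invf_le1 ?ltr0n// ler1n.
have [cl [cl1 cl2]] := @startset_cover R n Om q T q1 T0 gO k e e0.
(* Points outside all cells get the extra index [M], whose representative is the default [z0]. *)
pose M := size cl; pose d0 := (r0, z0).
pose rep (j : 'I_M.+1) : phase := (nth d0 cl j).2.
pose fnd z := find (cell Om q T z e) cl.
have fndM z : (fnd z < M.+1)%N by rewrite ltnS find_size.
pose idx z : 'I_M.+1 := inord (fnd z).
have idxE z : idx z = fnd z :> nat by rewrite inordK.
have midx j : measurable ([set z | idx z = j] : set (phaseB R n)).
  rewrite (_ : [set z | _] = [set z | fnd z = j]).
    by apply: (find_measurable (X := phaseB R n)) => rc; exact: cell_measurable.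
  by apply/seteqP; split=> z /=; [move=> <-; rewrite idxE|move=> h; apply/val_inj; rewrite /= idxE].
have repK j : Kr (k + r0)%N (rep j).
  rewrite /rep; have [jM|Mj] := ltnP j M; last first.
    by rewrite nth_default//=; apply: startset_mono hz0; rewrite ler_nat leq_addl.
  have [h1 h2] := cl1 _ (mem_nth d0 jM); apply: startset_mono h2.
  by rewrite ler_nat (leq_trans h1)// leq_addr.
have near r z : (r <= k)%N -> Kr r z -> Kr r (rep (idx z)) /\ pdist (rep (idx z)) z < e.
  move=> rk hz; have [hs hr] := cl2 r z d0 rk hz.
  have := nth_find d0 hs => /asboolP[_ pz].
  have fM : (fnd z < M)%N by rewrite -has_find.
  rewrite /rep idxE; split=> //.
  have [_ h2] := cl1 _ (mem_nth d0 fM); apply: startset_mono h2.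
  by rewrite ler_nat.
pose Rk := max_energy r0 C1 k.
have kR : (k + r0 <= Rk)%N by rewrite /Rk /max_energy mul2n -addnn -addnA leq_addr.
pose A j := [set xi | [/\ energy Rk xi, xi 0 = (rep j).1 & Dp T xi 0 = (rep j).2]].
have /choice[l hl] : forall j, exists l : seq path, (forall y, y \in l -> A j y) /\ forall x, A j x -> exists2 y, y \in l &
    c1le T y x e /\ `|Vt y - Vt x| <= e.
  move=> j; have Aj : A j `<=` energy Rk by move=> x [].
  exact: (energy_net q1 T0 gO e0 Aj).
pose s0 := [seq (j, x) | j <- enum 'I_M.+1, x <- l j].
have s0P j x : ((j, x) \in s0) = (x \in l j).
  apply/allpairsPdep/idP => [[j' [x' [_ h [-> ->]]]]//|h].
  by exists j, x; rewrite mem_enum.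
(* The strategies of all atoms are sorted together by code, so that the step map is nondecreasing in
   code. *)
pose le_code (a b : 'I_M.+1 * path) := code k a.2 <= code k b.2.
pose sl := sort le_code s0.
have slP j x : ((j, x) \in sl) = (x \in l j) by rewrite mem_sort s0P.
have sl_sorted : sorted le_code sl by apply: sort_sorted => a b; exact: le_total.
have Aex j : exists x, x \in l j.
  have [x [Ex x0 v0]] := repK j; have [|y yl _] := (hl j).2 x; last by exists y.
  by split=> //; apply: energy_mono Ex; rewrite ler_nat.
have [N slN] : exists N, size sl = N.+1.
  have [x hx] := Aex ord0; have : (ord0, x) \in sl by rewrite slP.
  by case: (sl) => // a s _; exists (size s).
pose dd : 'I_M.+1 * path := (ord0, fun=> 0).
pose S (i : 'I_N.+1) := (nth dd sl i).2; pose tau (i : 'I_N.+1) := (nth dd sl i).1.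
have Sl i : S i \in l (tau i).
  by rewrite -slP -surjective_pairing; apply: mem_nth; rewrite slN.
have SA i : A (tau i) (S i) by exact: (hl (tau i)).1 (Sl i).
have GS i : Gam Om T (S i) by have [[]] := SA i.
have Sx j x : x \in l j -> exists i, tau i = j /\ S i = x.
  rewrite -slP => h; have ix : (index (j, x) sl < N.+1)%N by rewrite -slN index_mem.
  by exists (Ordinal ix); rewrite /tau /S /= nth_index.
have Snet j x : A j x -> exists i, [/\ tau i = j, c1le T (S i) x e & `|Vt (S i) - Vt x| <= e].
  move=> Ax; have [y yl [c1 c2]] := (hl j).2 x Ax; have [i [ti Si]] := Sx j y yl.
  by exists i; rewrite Si.
have Smono (i i' : 'I_N.+1) : (i <= i')%N -> code k (S i) <= code k (S i').
  move=> ii; have := @sorted_leq_nth _ le_code (fun b a c => @le_trans _ _ _ _ _) (fun a => lexx _) dd sl sl_sorted i i'.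
  by rewrite !inE slN !ltn_ord => /(_ isT isT ii).
have /choice[dflt hdflt] : forall j, exists i, tau i = j.
  by move=> j; have [x hx] := Aex j; have [i [ti _]] := Sx j x hx; exists i.
pose w j := fine (m0 [set z | idx z = j]).
have m0fin j : m0 [set z | idx z = j] \is a fin_num by exact: fin_num_measure.
have w0 j : 0 <= w j by rewrite fine_ge0.
have w1 : \sum_j w j = 1.
  have := @finite_integral R _ _ m0 M.+1 idx (fun=> 1) midx.
  rewrite integral_cst//= probability_setT mule1 => h.
  apply: EFin_inj; rewrite [RHS]h -sumEFin; apply: eq_bigr => j _.
  by rewrite mul1e fineK.
have [y [y0 [y1 yw]] hy] := finite_equilibrium T0 hF hG hLc hLb GS (fun i => q^-1 * Vt (S i)) hdflt w0 w1.
pose Y := step_path S y.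
have rY : random_path (X := measurableTypeR R) Om (T := T) Y by exact: random_step_path.
(* A strategy in use is compared with the net point nearest to a path of energy at most [r] starting
   from the same atom. *)
have Ylow i r : 0 < y ord0 i -> (r <= k + r0)%N -> Kr r (rep (tau i)) -> energy (r + C1)%N (S i).
  move=> yi rk [x [Ex x0 v0]].
  have Ax : A (tau i) x by split=> //; apply: energy_mono Ex; rewrite ler_nat (leq_trans rk).
  have [i' [ti' _ hV]] := Snet _ _ Ax.
  have hJ := hy i i' (esym ti') yi.
  have b1 := hB Y (S i) rY (GS i); have b2 := hB Y (S i') rY (GS i').
  have Vx : Vt x <= r%:R by apply: Vn_le Ex.2; exact: ltW.
  have [[_ VS] _ _] := SA i; split; first exact: GS.
  apply: Vle_mono (Vle_Vn VS); rewrite natrD.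
  move: hV b1 b2; rewrite !ler_norml => /andP[_ hV] /andP[b1 _] /andP[_ b2].
  have qq : q^-1 * Vt (S i) <= q^-1 * Vt (S i') + 2 * B.
    exact: (perturbed_le hJ b1 b2).
  have q2 := descale_le q0 qq.
  move: q2 hV Vx hC1 e1.
  move: (Vt (S i)) (Vt (S i')) (Vt x) (2 * q * B) (C1%:R) (r%:R) (e : R); exact: energy_arith.
have posY t : 0 < t <= 1 -> 0 < y ord0 (step_ord y t) by exact: step_ord_pos.
exists Y, (fun z => rep (idx z)); split.
- split; first by move=> D; exact: step_path_preimage.
  by move=> t; have [] := SA (step_ord y t).
- move=> t t' tt; apply: Smono; rewrite !step_ordE; exact: step_index_mono.
- move=> r t rk t01 tm; set i := step_ord y t.
  pose g (j : 'I_M.+1) : R := (`[< Kr r (rep j) >] : nat)%:R.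
  have lvl : (energy_level Om q T (S i) <= r + C1)%N.
    (* If the level at [t] exceeded [r + C1], so would the levels of all later steps, because codes
       order paths by level first. By [Ylow] the atoms lying in [Kr r] would then be played at
       earlier steps only, and [m0 (Kr r)] would be at most [prefix_sum y i < t]. *)
    rewrite leqNgt; apply/negP => lt.
    have key : (m0 (Kr r) <= (prefix_sum y i)%:E)%E.
      apply: (@le_trans _ _ (\int[m0]_z (g (idx z))%:E)%E).
        rewrite -(setIT (Kr r)) -integral_indic//; last exact: startset_measurable.
        apply: ge0_le_integral => //.
        + by apply/measurable_EFinP; apply: measurable_indic; exact: startset_measurable.
        + apply/measurable_EFinP => _ D mD; rewrite setTI.
          rewrite (_ : _ @^-1` _ = \bigcup_(j in [set j : 'I_M.+1 | D (g j)]) [set z | idx z = j]).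
            by apply: fin_bigcup_measurable => // j _; exact: midx.
          apply/seteqP; split=> z /=; first by move=> h; exists (idx z).
          by move=> [j Dj ->].
        + move=> z _; rewrite lee_fin indicE /g; case: (boolP (z \in Kr r)) => // /set_mem hz.
          by rewrite asboolT//; have [] := near r z rk hz.
      rewrite (finite_integral m0 g midx).
      rewrite (_ : (\sum_(j < M.+1) _)%E = (\sum_j g j * w j)%:E); last first.
        by rewrite -sumEFin; apply: eq_bigr => j _; rewrite EFinM fineK.
      rewrite lee_fin (_ : \sum_j g j * w j = \sum_i g (tau i) * y ord0 i); last first.
        rewrite [RHS](partition_big tau xpredT)//=; apply: eq_bigr => j _.
        by rewrite -yw mulr_sumr; apply: eq_bigr => i' /eqP ->.
      rewrite /prefix_sum [leRHS]big_mkcond; apply: ler_sum => i' _.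
      case: ifPn => [_|]; first by apply: ler_piMl (y0 _) _; rewrite /g; case: (`[< _ >]).
      rewrite -leqNgt => ii; have [->|yn] := eqVneq (y ord0 i') 0; first by rewrite mulr0.
      have yi' : 0 < y ord0 i' by rewrite lt_def yn y0.
      rewrite /g; case: asboolP => [hK|_]; last by rewrite mul0r.
      have E' := Ylow i' r yi' (leq_trans rk (leq_addr _ _)) hK.
      have [lv _] := energy_levelP E'.
      have := path_code_level (Smono _ _ ii) => h2.
      by have := leq_ltn_trans (leq_trans h2 lv) lt; rewrite ltnn.
    have /andP[h1 _] := step_index_itv y0 y1 t01.
    have := le_trans tm key; rewrite lee_fin /i step_ordE => h2.
    by have := lt_le_trans h1 h2; rewrite ltxx.
  have Ei : energy Rk (S i) by have [] := SA i.
  have [_ h] := energy_levelP Ei; apply: energy_mono h.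
  by rewrite ler_nat.
- move=> t t01; set i := step_ord y t; have yi := posY t t01.
  split; first exact: Ylow yi (leqnn _) (repK (tau i)).
  move=> eta Eeta h0 h1; have [_ a0 a1] := SA i.
  have [|i' [ti' c1 hV]] := Snet (tau i) eta; first by split=> //; rewrite ?h0 ?h1 -?a0 -?a1.
  exists (S i'); split=> //; apply: le_trans (hy i i' (esym ti') yi) _.
  rewrite lerD2l ler_pM2l ?invr_gt0//.
  by move: hV; rewrite ler_norml => /andP[_]; rewrite lerBlDl.
- split; last split.
  + move=> phi; rewrite (finite_integral m0 (fun j => phi (rep j)) midx).
    have E t : phi (et T 0 (Y t)) = phi (rep (tau (step_ord y t))).
      have [_ a0 a1] := SA (step_ord y t); rewrite /et /Y /step_path a0 a1.
      by rewrite -surjective_pairing.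
    under eq_integral do rewrite E.
    rewrite (@finite_integral R _ (measurableTypeR R) lam _ (step_ord y) (fun i => phi (rep (tau i)))); last first.
      by move=> i; exact: step_ord_measurable.
    rewrite [RHS](_ : _ = (\sum_j phi (rep j) * w j)%:E); last first.
      by rewrite -sumEFin; apply: eq_bigr => j _; rewrite EFinM fineK.
    transitivity ((\sum_i phi (rep (tau i)) * y ord0 i)%:E).
      by rewrite -sumEFin; apply: eq_bigr => i _; rewrite EFinM lam_step_ord.
    congr EFin; rewrite (partition_big tau xpredT)//=; apply: eq_bigr => j _.
    by rewrite -yw mulr_sumr; apply: eq_bigr => i' /eqP ->.
  + move=> _ D mD; rewrite setTI.
    rewrite (_ : _ @^-1` _ = \bigcup_(j in [set j : 'I_M.+1 | D (rep j)]) [set z | idx z = j]).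
      by apply: fin_bigcup_measurable => // j _; exact: midx.
    apply/seteqP; split=> z /=; first by move=> h; exists (idx z).
    by move=> [j Dj ->].
  + by move=> z; have [x [[Gx _] x0 _]] := repK (idx z); rewrite /Xi /= -x0; exact: Gam_closure Gx zI.
  + by move=> r z rk hz; have [] := near r z rk hz.
Qed.

End approximate_equilibria.

(** * Laws determined by integrals *)

Section uniqueness_of_law.
Context {R : realType} {n : nat}.
Variable Om : set 'rV[R]_n.
Notation phase := ('rV[R]_n * 'rV[R]_n)%type.
Implicit Types (z w : phase) (U : set phase).

(* The distance to the complement of [U], cut off at 1 so that [U = setT] is harmless. *)
Definition codist U z : R := inf ([set Num.min 1 (pdist z w) | w in ~` U] `|` [set 1]).

Lemma codist_ge U z c : c <= 1 -> (forall w, ~ U w -> c <= pdist z w) -> c <= codist U z.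
Proof.
move=> c1 h; apply: lb_le_inf; first by exists 1; right.
by move=> _ [[w nw <-]|->//]; rewrite le_min c1 h.
Qed.

Lemma codist_lb U z : has_lbound ([set Num.min 1 (pdist z w) | w in ~` U] `|` [set 1]).
Proof. by exists 0 => _ [[w _ <-]|->//]; rewrite le_min ler01 pdist_ge0. Qed.

Lemma codist_le1 U z : codist U z <= 1.
Proof. by apply: ge_inf; [exact: codist_lb|right]. Qed.

Lemma codist_le U z w : ~ U w -> codist U z <= pdist z w.
Proof.
move=> nw; apply: (@le_trans _ _ (Num.min 1 (pdist z w))); last by rewrite ge_min lexx orbT.
by apply: ge_inf; [exact: codist_lb|left; exists w].
Qed.

Lemma codist_ge0 U z : 0 <= codist U z.
Proof. by apply: codist_ge => // w _; exact: pdist_ge0. Qed.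

Lemma codist_lip U z w : codist U z <= codist U w + pdist z w.
Proof.
rewrite -lerBlDr; apply: codist_ge => [|y ny].
  by rewrite lerBlDr (le_trans (codist_le1 _ _))// lerDl pdist_ge0.
by rewrite lerBlDr addrC (le_trans (codist_le _ ny))// pdist_trans.
Qed.

(** Lipschitz functions converging to the indicator of [U] when [U] is open. *)
Definition bump U (j : nat) z : R := Num.min 1 (j%:R * codist U z).

Lemma bump_ge0 U j z : 0 <= bump U j z.
Proof. by rewrite le_min ler01 mulr_ge0 ?codist_ge0. Qed.

Lemma bump_le1 U j z : bump U j z <= 1.
Proof. by rewrite ge_min lexx. Qed.

Lemma bump_lip U j z w : bump U j z <= bump U j w + j%:R * pdist z w.
Proof.
have jp : 0 <= j%:R * pdist z w by rewrite mulr_ge0// pdist_ge0.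
rewrite /bump /Num.min; case: (ltP 1 (j%:R * codist U w)) => h.
  by apply: (@le_trans _ _ 1); [rewrite -/(Num.min _ _) ge_min lexx|rewrite lerDl].
rewrite -/(Num.min _ _) ge_min; apply/orP; right; rewrite -mulrDr ler_wpM2l//.
exact: codist_lip.
Qed.

Lemma bump_pcont U j : pcont Om (bump U j).
Proof.
move=> z _ e e0; exists (e / j.+1%:R) => [|w _ zw]; first by rewrite divr_gt0.
have jz : j%:R * pdist z w < e.
  apply: le_lt_trans (_ : j.+1%:R * pdist z w < e).
    by rewrite ler_wpM2r ?pdist_ge0// ler_nat.
  by rewrite mulrC -ltr_pdivlMr.
have := bump_lip U j z w; have := bump_lip U j w z; rewrite (pdistC w) => h1 h2.
by rewrite ltr_norml; apply/andP; split; [rewrite ltrNl opprB|]; rewrite ltrBlDl; [apply: le_lt_trans h1 _|apply: le_lt_trans h2 _]; rewrite ltrD2l.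
Qed.

Lemma bump_out U j z : ~ U z -> bump U j z = 0.
Proof.
move=> nz; have : codist U z <= 0 by rewrite -(pdistxx z); exact: codist_le.
rewrite le_eqVlt ltNge codist_ge0 orbF /bump => /eqP ->.
by rewrite mulr0 min_r.
Qed.

Lemma bump_in U z : open_wrt pball U -> U z -> exists N, forall j, (N <= j)%N -> bump U j z = 1.
Proof.
move=> oU /oU[e e0 he]; pose c := Num.min 1 e.
have c0 : 0 < c by rewrite lt_min ltr01.
have cd : c <= codist U z.
  apply: codist_ge => [|w nw]; first by rewrite ge_min lexx.
  by rewrite ge_min; apply/orP; right; rewrite leNgt; apply/negP => zw; apply: nw; exact: he.
have c1 : 0 <= c^-1 by rewrite invr_ge0 ltW.
exists (Num.bound c^-1) => j hj; rewrite /bump min_l//.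
apply: (@le_trans _ _ (j%:R * c)); last by rewrite ler_wpM2l.
rewrite -ler_pdivrMr// mul1r; apply: le_trans (ltW (archi_boundP c1)) _.
by rewrite ler_nat.
Qed.

Lemma bump_law {d} {X : measurableType d} (P : probability X R) (Z : X -> phaseB R n) U :
  measurable_fun setT Z -> (forall x, Xi Om (Z x)) -> open_wrt pball U ->
  (fun j => \int[P]_x (bump U j (Z x))%:E)%E @ \oo --> P (Z @^-1` U).
Proof.
move=> mZ XZ oU.
have mU : measurable (Z @^-1` U).
  by rewrite -[X in measurable X]setTI; apply: mZ => //; exact: open_wrt_measurable.
rewrite -(setIT (Z @^-1` U)) -integral_indic//.
have [|||||_ _] := @dominated_convergence _ _ _ P setT measurableT (fun j x => (bump U j (Z x))%:E)
    (fun x => (\1_(Z @^-1` U) x)%:E) (fun=> 1%E).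
- by move=> j; apply/measurable_EFinP; apply: (measurable_pcont_comp mZ XZ); exact: bump_pcont.
- by apply/measurable_EFinP; exact: measurable_indic.
- apply: aeW => x _; apply: cvg_EFin; first exact: nearW.
  have [Ux|nU] := pselect (U (Z x)).
    have [N hN] := bump_in oU Ux; rewrite indicE mem_set//.
    by apply: cvg_near_cst; exists N => // j /= Nj; exact: hN.
  by rewrite indicE memNset//; apply: cvg_near_cst; apply: nearW => j /=; exact: bump_out.
- exact: finite_measure_integrable_cst.
- by apply: aeW => x j _ /=; rewrite lee_fin ger0_norm ?bump_ge0// bump_le1.
exact.
Qed.

(** The open sets are stable under intersection and generate the sigma-algebra, so it suffices to
    recover their measures, as limits of integrals of [bump]. *)
Lemma law_eq {d d'} {X : measurableType d} {X' : measurableType d'} (P : probability X R) (P' : probability X' R)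
    (Z : X -> phaseB R n) (Z' : X' -> phaseB R n) :
  measurable_fun setT Z -> (forall x, Xi Om (Z x)) -> measurable_fun setT Z' -> (forall x, Xi Om (Z' x)) ->
  (forall phi : phaseB R n -> R, pcont Om phi -> (exists C, forall z, Xi Om z -> `|phi z| <= C) ->
     (\int[P]_x (phi (Z x))%:E = \int[P']_x (phi (Z' x))%:E)%E) ->
  forall A, measurable A -> P (Z @^-1` A) = P' (Z' @^-1` A).
Proof.
move=> mZ XZ mZ' XZ' h A mA.
have [p hp] := law_probability P mZ; have [p' hp'] := law_probability P' mZ'.
rewrite -[LHS]/(law P Z A) -[RHS]/(law P' Z' A) -hp -hp'.
apply: (measure_unique (open_wrt pball : set (set (phaseB R n))) (fun=> setT)) => //.
- move=> B C oB oC z [/oB[e e0 he] /oC[e' e'0 he']]; exists (Num.min e e'); first by rewrite lt_min e0.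
  by move=> w; rewrite /pball /= lt_min => /andP[h1 h2]; split; [exact: he|exact: he'].
- by move=> _ z _; exists 1.
- by rewrite bigcup_const//; exists 0%N.
- move=> U oU; transitivity (law P Z U); first exact: (congr1 (fun m => m U) hp).
  transitivity (law P' Z' U); last exact: (esym (congr1 (fun m => m U) hp')).
  have c1 := @bump_law _ _ P Z U mZ XZ oU; have c2 := @bump_law _ _ P' Z' U mZ' XZ' oU.
  apply: (cvg_unique _ c1); first exact: ereal_hausdorff.
  rewrite (_ : (fun j => _) = (fun j => \int[P']_x (bump U j (Z' x))%:E)%E)//.
  apply/funext => j; apply: h; first exact: bump_pcont.
  by exists 1 => z _; rewrite ger0_norm ?bump_ge0// bump_le1.
- by move=> k; apply: le_lt_trans (probability_le1 p measurableT) _; exact: ltry.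
Qed.

End uniqueness_of_law.

(** * Passage to the limit *)

Lemma Vle_right_limit {R : realType} {n} (q T : R) (f : R -> 'rV[R]_n) B : 1 < q -> 0 < T ->
  (forall e, 0 < e -> exists2 d, 0 < d & forall s t, 0 <= s <= T -> 0 <= t <= T -> `|t - s| < d -> enorm (f t - f s) <= e) ->
  (forall a, 0 < a -> a <= T -> Vle q f a T B) -> Vle q f 0 T B.
Proof.
move=> q1 T0 hf hV.
have zI : (0 : R) <= 0 <= T by rewrite lexx ltW.
apply: (@Vle_limit R n q q1 R (0^'+) _ (fun a t => f (Num.max a t))) => [t /andP[t0 tT]|e e0].
  apply/cvgrPdist_le => e e0; have [d d0 hd] := hf e e0.
  near=> a.
  have a0 : 0 < a by near: a; exact: nbhs_right_gt.
  have ad : a < d by near: a; exact: nbhs_right_lt.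
  have aT : a <= T by near: a; exact: nbhs_right_le.
  rewrite sub0r normrN ger0_norm ?enorm_ge0//; apply: hd; rewrite ?t0 ?tT//.
    by rewrite le_max ge_max t0 orbT aT.
  have [ta|at_] := leP a t; first by rewrite subrr normr0.
  by rewrite ger0_norm ?subr_ge0 ?(ltW at_)// (le_lt_trans _ ad)// gerBl.
near=> a.
have a0 : 0 < a by near: a; exact: nbhs_right_gt.
have aT : a <= T by near: a; exact: nbhs_right_le.
apply: (@Vle_mono _ _ _ _ _ _ (0 + B)); first by rewrite add0r lerDl ltW.
apply: (Vle_cat q1 (ltW a0) aT).
  have := @Vle_lip R n q q1 (fun t => f (Num.max a t)) 0 a 0; rewrite powR0 ?gt_eqF ?(lt_trans _ q1)// mul0r.
  apply; last exact: ltW.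
  by move=> x y x0 xy ya; rewrite mul0r !max_l ?(le_trans (ltW xy))// subrr enorm0.
apply: (Vle_ext q1 _ (hV a a0 aT)) => t /andP[at_ _]; by rewrite max_r.
Unshelve. all: by end_near. Qed.

Lemma open_pathball {R : realType} {n} (T : R) (xi : R -> 'rV[R]_n) (e : R) : open_wrt (pathball T) (pathball T xi e).
Proof.
move=> eta /pathballE[c ce h]; exists (e - c); first by rewrite subr_gt0.
move=> y /pathballE[c' h' hy]; apply/pathballE; exists (c + c'); first by rewrite -ltrBrDl.
exact: c1le_trans h hy.
Qed.

(** [v] is the energy on the initial piece shared by an equilibrium path and its competitor: it
    appears in the bound of [u] and in that of [vx], and drops out. [a] and [b] are regular costs,
    close to their limits [d] and [c]. *)
Lemma cost_gap {R : realType} (q e a b c d u v w vx vs e1 k1 : R) : 0 < q -> 0 < e ->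
  a + q^-1 * vx <= b + q^-1 * (u + k1) -> `|b - c| < e / (8 * q) -> `|a - d| < e / (8 * q) ->
  u <= v + (w + e1) -> v + vs <= vx -> k1 <= e1 -> e1 <= e / 4 -> vs <= q * (c - d) + w + e.
Proof.
move=> q0 e0 h1; rewrite !ltr_norml => /andP[_ h2] /andP[h3 _] h4 h5 h6 h7.
have h : vx <= q * (b - a) + (u + k1).
  have := ler_wpM2l (ltW q0) h1; rewrite !mulrDr !mulrA divff ?gt_eqF// !mul1r mulrN => *; lra.
have h8 : q * (b - a) <= q * (c - d) + e / 4.
  rewrite -lerBlDl -mulrBr -(ler_pM2l (_ : 0 < q^-1)) ?invr_gt0// mulKf ?gt_eqF//.
  have -> : q^-1 * (e / 4) = e / (8 * q) + e / (8 * q) by field; rewrite gt_eqF.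
  lra.
lra.
Qed.

Lemma cost_le {R : realFieldType} (q a b v w : R) : 0 < q -> v <= q * (a - b) + w -> b + q^-1 * v <= a + q^-1 * w.
Proof.
move=> q0 h; have := h; rewrite -(ler_pM2l (_ : 0 < q^-1)) ?invr_gt0// mulrDr mulKf ?gt_eqF//.
lra.
Qed.

Section relaxed_equilibrium.
Context {R : realType} {n : nat}.
Variables (Om : set 'rV[R]_n) (q T : R).
Hypotheses (q1 : 1 < q) (T0 : 0 < T) (gO : good_dom Om).
Variables (F G : (set (phaseB R n) -> \bar R) -> phaseB R n -> R) (L : 'rV[R]_n -> 'rV[R]_n -> R -> R).
Hypotheses (hF : bounded_continuous_map Om F) (hG : bounded_continuous_map Om G)
  (hLc : {within [set p : (('rV[R]_n * 'rV[R]_n) * R)%type | Xi Om p.1 /\ 0 <= p.2 <= T],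
            continuous (fun p : (('rV[R]_n * 'rV[R]_n) * R)%type => L p.1.1 p.1.2 p.2)})
  (hLb : exists C : R, forall z : ('rV[R]_n * 'rV[R]_n)%type, forall s : R,
            Xi Om z -> 0 <= s <= T -> `|L z.1 z.2 s| <= C).
Variable m0 : probability (phaseB R n) R.
Hypotheses (hm0 : prob_Xi Om m0) (hm0ad : m0 (Xi Om `\` Xiad Om) = 0%E).
Notation phase := ('rV[R]_n * 'rV[R]_n)%type.
Notation path := (R -> 'rV[R]_n).
Variable net : nat -> nat -> seq path.
Hypothesis hnet : forall (r m : nat) x, energy Om q T r%:R x -> exists2 y, y \in net r m & c1le T y x m.+1%:R^-1.
Local Notation energyR := (energy Om q T).
Local Notation energy r := (energy Om q T r%:R).
Local Notation Kr r := (startset Om q T r%:R).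
Local Notation J := (Jreg lam (T := T) F G L).
Local Notation Vt := (fun xi : path => Vn q (Dp T xi) 0 T).
Local Notation code := (path_code Om q T net).
Implicit Types (r k : nat) (z : phase) (xi eta : path) (t : R).

Let zI : (0 : R) <= 0 <= T. Proof. by rewrite lexx ltW. Qed.
Let q0 : 0 < q. Proof. exact: lt_trans q1. Qed.

Lemma startset_mass t : t < 1 -> exists r, (t%:E <= m0 (Kr r))%E.
Proof.
move=> t1; apply: contrapT => nh.
have mK r : measurable (Kr r : set (phaseB R n)) by exact: startset_measurable.
have mU : measurable (\bigcup_r Kr r : set (phaseB R n)) by exact: bigcup_measurable.
have := @nondecreasing_cvg_mu _ _ _ m0 (fun r => Kr r : set (phaseB R n)) mK mU.
have : nondecreasing_seq (fun r => Kr r : set (phaseB R n)).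
  by move=> r r' rr; apply/subsetPset => z; apply: startset_mono; rewrite ler_nat.
move=> nd /(_ nd) cv.
have U1 : m0 (\bigcup_r Kr r) = 1%E.
  rewrite -(@probability_setT _ _ _ m0) -(setUv (\bigcup_r Kr r)) measureU ?setICr//; last exact: measurableC.
  by rewrite [X in (_ + X)%E](startset_exhausts q1 T0 gO hm0 hm0ad) adde0.
have : (m0 (\bigcup_r Kr r) <= t%:E)%E.
  apply: (@cvge_le _ _ _ _ _ _ _ _ cv); apply: nearW => r /=.
  by rewrite leNgt; apply/negP => lt; apply: nh; exists r; exact: ltW.
by rewrite U1 lee_fin leNgt t1.
Qed.

Lemma path_code_bound r k xi : energy r xi -> `|code k xi| <= 2 * r%:R + 1.
Proof.
move=> Ex; have [lr _] := energy_levelP Ex; rewrite /path_code.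
have /andP[x0 x1] := @cantor_code01 R (mkseq (code_bit T net xi) k).
rewrite ger0_norm; last by rewrite addr_ge0// mulr_ge0.
by apply: lerD x1; rewrite ler_pM2l// ler_nat.
Qed.

Section limit.
Variables (r0 C1 : nat) (Y_ : nat -> R -> path) (pi_ : nat -> phase -> phase).
Hypothesis hY : forall k, approx_solution Om q T F G L m0 net r0 C1 k (Y_ k) (pi_ k).

Lemma code_bounded t : 0 < t < 1 -> exists B : R, forall k, `|code k (Y_ k t)| <= B.
Proof.
move=> /andP[t0 t1]; have [r hr] := startset_mass t1.
(* The uniform bound is available for [k >= r]; the sum covers the finitely many other indices. *)
exists (2 * (r + C1)%:R + 1 + \sum_(k < r) `|code k (Y_ k t)|) => k.
have s0 : 0 <= \sum_(k < r) `|code k (Y_ k t)| by apply: sumr_ge0.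
have [rk|kr] := leqP r k.
  apply: (@le_trans _ _ (2 * (r + C1)%:R + 1)); last by rewrite lerDl.
  by have [_ _ h _ _] := hY k; apply: path_code_bound; apply: (h r t rk _ hr); rewrite t0 ltW.
rewrite (bigD1 (Ordinal kr))//= addrCA lerDl addr_ge0 ?sumr_ge0//.
Qed.

Lemma limit_exists : exists (phi : nat -> nat) (D : set R) (Y : R -> path),
  [/\ forall k, (k <= phi k)%N, countable D, random_path (X := measurableTypeR R) Om (T := T) Y &
   forall t, 0 < t < 1 -> ~ D t ->
     forall e, 0 < e -> exists N, forall k, (N <= k)%N -> c1le T (Y_ (phi k) t) (Y t) e].
Proof.
have [|phi [phiS [D cD hD]]] := @helly R (fun k t => code k (Y_ k t)) _ code_bounded.
  by move=> k s t s0 st t1; have [_ h _ _ _] := hY k; exact: h.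
have phik := increasing_ge phiS.
pose good := `]0, 1[%classic `\` D.
have lim t : good t -> exists xi, Gam Om T xi /\
    forall e, 0 < e -> exists N, forall k, (N <= k)%N -> c1le T (Y_ (phi k) t) xi e.
  rewrite /good /= in_itv /= => -[t01 nD]; have /andP[t0 t1] := t01.
  have [r hr] := startset_mass t1.
  (* The shift by [r] makes the energy bound at [t] valid for every term. *)
  pose y_ k := Y_ (phi (k + r)%N) t.
  have Ey k : energy (r + C1)%N (y_ k).
    have [_ _ h _ _] := hY (phi (k + r)%N); apply: (h r t _ _ hr); last by rewrite t0 ltW.
    by apply: leq_trans (phik _); exact: leq_addl.
  have Ck := @code_cauchy R n Om q T net hnet y_ (fun k => phi (k + r)%N) (r + C1)%:R.
  have [|xi [Gx _] hxi] := energy_limit q1 T0 Ey.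
    apply: Ck => //; first by move=> k; apply: leq_trans (phik _); exact: leq_addr.
    have /cvg_ex[l hl] := hD t t01 nD; apply/cvg_ex; exists l.
    exact: (cvg_comp _ _ (cvg_addnr r) hl).
  exists xi; split; first exact: Gx.
  move=> e e0; have [N hN] := hxi e e0; exists (N + r)%N => k Nk.
  have rk : (r <= k)%N by apply: leq_trans Nk; exact: leq_addl.
  have := hN (k - r)%N; rewrite /y_ subnK//; apply.
  by rewrite leq_subRL// addnC.
have GY k t : Gam Om T (Y_ k t) by have [[_ /(_ t)[]]] := hY k.
(* Off the good times any fixed path of [Gam] will do; a constant keeps [Y] measurable. *)
have /choice[Y hYl] : forall t, exists xi, Gam Om T xi /\ (good t -> forall e, 0 < e -> exists N, forall k, (N <= k)%N -> c1le T (Y_ (phi k) t) xi e) /\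
    (~ good t -> xi = Y_ 0%N 0).
  move=> t; have [gt|ngt] := pselect (good t).
    by have [xi [Gx hx]] := lim t gt; exists xi.
  by exists (Y_ 0%N 0).
exists phi, D, Y; split; [exact: phik|exact: cD| |]; last first.
  by move=> t t01 nD; apply: (hYl t).2.1; split.
split; last by move=> t; exact: (hYl t).1.
have mg : measurable (good : set (measurableTypeR R)).
  by apply: measurableD; [exact: measurable_itv|exact: countable_measurable].
have -> : [set: R] = good `|` ~` good by rewrite setUv.
apply/measurable_funU => //; first exact: measurableC.
split.
  have Bsym (x : Defs.path R n) e y : pathball T x e y -> pathball T y e x.
    by move=> /pathballE[c ce /c1leC h]; apply/pathballE; exists c.
  have Btri (x : Defs.path R n) a y b (w : Defs.path R n) : pathball T x a y -> pathball T y b w -> pathball T x (a + b) w.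
    move=> /pathballE[c ca h] /pathballE[c' cb h']; apply/pathballE.
    by exists (c + c'); [exact: ltrD|exact: c1le_trans h h'].
  have Bmono (x : Defs.path R n) a b : a <= b -> pathball T x a `<=` pathball T x b.
    by move=> ab y /pathballE[c ca h]; apply/pathballE; exists c => //; exact: lt_le_trans ab.
  have Ym k (A : set (pathB R n T)) : measurable (Y_ (phi k) @^-1` A : set (measurableTypeR R)).
    by have [[h _] _ _ _ _] := hY (phi k); exact: h.
  have Yc t : good t -> forall e, 0 < e -> exists N, forall k, (N <= k)%N -> pathball T (Y t) e (Y_ (phi k) t).
    move=> gt e e0; have e2 : 0 < e / 2 by rewrite divr_gt0.
    have [N hN] := (hYl t).2.1 gt _ e2; exists N => k Nk; apply/pathballE; exists (e / 2).
      by rewrite ltr_pdivrMr// ltr_pMr// ltr1n.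
    by apply: c1leC; exact: hN.
  exact: (measurable_fun_limit Bsym Btri Bmono mg Ym Yc).
have mc : measurable_fun (~` good : set (measurableTypeR R)) (fun _ : measurableTypeR R => Y_ 0%N 0 : pathB R n T).
  exact: measurable_cst.
apply: eq_measurable_fun mc => t /set_mem nt; by rewrite ((hYl t).2.2 nt).
Qed.

Section closure.
Variables (phi : nat -> nat) (D : set R) (Y : R -> path).
Hypotheses (phik : forall k, (k <= phi k)%N) (cD : countable D)
  (rY : random_path (X := measurableTypeR R) Om (T := T) Y)
  (hlim : forall t, 0 < t < 1 -> ~ D t ->
     forall e, 0 < e -> exists N, forall k, (N <= k)%N -> c1le T (Y_ (phi k) t) (Y t) e).

Lemma random_approx k : random_path (X := measurableTypeR R) Om (T := T) (Y_ k).
Proof.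
have [[h hE] _ _ _ _] := hY k; split; last by move=> t; have [] := hE t.
by move=> _ A _; rewrite setTI; exact: h.
Qed.

Lemma approx_limit : {ae lam, forall t, forall e, 0 < e -> exists N, forall k, (N <= k)%N -> c1le T (Y_ (phi k) t) (Y t) e}.
Proof. by apply: (lam_ae cD) => t t01 nD; exact: hlim. Qed.

Lemma initial_law (A : set (phaseB R n)) : measurable A -> lam ((fun t => et T 0 (Y t)) @^-1` A) = m0 A.
Proof.
move=> mA.
have mU : measurable (\bigcup_r Kr r : set (phaseB R n)).
  by apply: bigcup_measurable => r _; exact: startset_measurable.
pose U := \bigcup_r Kr r.
(* The identity outside a null set, modified so that all its values lie in [Xi Om], where the test
   functions are controlled. *)
pose Z z : phase := if z \in U then z else et T 0 (Y 0).
have mZ : measurable_fun setT (Z : phaseB R n -> phaseB R n).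
  apply: (@measurable_fun_ifT _ _ (phaseB R n) (phaseB R n) id (fun=> et T 0 (Y 0)) (fun z => z \in U)) => //.
  by apply: (measurable_fun_bool true); rewrite setTI preimage_mem_true.
have [m0Y XY] := random_et rY zI.
have XZ z : Xi Om (Z z).
  rewrite /Z; case: ifPn => [/set_mem[r _ [x [[Gx _] x0 _]]]|_]; last exact: XY.
  by rewrite /Xi /= -x0; exact: Gam_closure Gx zI.
have U0 : m0 (~` U) = 0%E by exact: startset_exhausts.
have -> : m0 A = m0 (Z @^-1` A).
  have mZA : measurable (Z @^-1` A : set (phaseB R n)) by rewrite -[X in measurable X]setTI; exact: mZ.
  have E : A `&` U = Z @^-1` A `&` U.
    by apply/seteqP; split=> z [Az Uz]; split=> //; move: Az; rewrite /= /Z mem_set.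
  have cut (B : set (phaseB R n)) : measurable B -> m0 B = m0 (B `&` U).
    move=> mB; rewrite -{1}(setIT B) -(setUv U) setIUr measureU//; last 3 first.
    - exact: measurableI.
    - by apply: measurableI => //; exact: measurableC.
    - by rewrite setIACA setICr setI0.
    rewrite [X in (_ + X)%E](_ : _ = 0%E) ?adde0//.
    by apply: (subset_measure0 _ _ (@subIsetr _ _ _) U0) => //; [apply: measurableI => //|]; exact: measurableC.
  by rewrite (cut _ mA) (cut _ mZA) E.
apply: (law_eq m0Y XY mZ XZ _ mA) => f cf bf.
have c1 : (fun k => \int[lam]_t (f (et T 0 (Y_ (phi k) t)))%:E)%E @ \oo --> (\int[lam]_t (f (et T 0 (Y t)))%:E)%E.
  have h k := random_et (random_approx (phi k)) zI.
  apply: (law_cvg (fun k => (h k).1) m0Y (fun k => (h k).2) XY _ cf bf).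
  apply: (@filterS _ _ (ae_filter_ringOfSetsType lam) _ _ _ approx_limit) => t ht e e0; have e2 : 0 < e / 2 by rewrite divr_gt0.
  have [N hN] := ht _ e2; exists N => k Nk; apply: le_lt_trans (c1le_pdist zI (hN k Nk)) _.
  by rewrite ltr_pdivrMr// ltr_pMr// ltr1n.
have c2 : (fun k => \int[m0]_z (f (pi_ (phi k) z))%:E)%E @ \oo --> (\int[m0]_z (f (Z z))%:E)%E.
  have mp k : measurable_fun setT (pi_ (phi k) : phaseB R n -> phaseB R n) by have [_ _ _ _ [_ []]] := hY (phi k).
  have Xp k z : Xi Om (pi_ (phi k) z) by have [_ _ _ _ [_ []]] := hY (phi k).
  apply: (law_cvg mp mZ Xp XZ _ cf bf).
  exists (~` U); split; [exact: measurableC|exact: U0|].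
  apply: subsetC => z [r _ Kz] e e0.
  have ei : 0 <= e^-1 by rewrite invr_ge0 ltW.
  exists (maxn r (Num.bound e^-1)) => k; rewrite geq_max => /andP[rk ek].
  rewrite /Z mem_set; last by exists r.
  have [_ _ _ _ [_ [_ _ h]]] := hY (phi k).
  apply: lt_le_trans (h r z (leq_trans rk (phik k)) Kz) _.
  rewrite invf_ple ?posrE ?ltr0n//; apply: le_trans (ltW (archi_boundP ei)) _.
  by rewrite ler_nat (leq_trans ek)// (leq_trans (phik k)).
apply: (cvg_unique _ c1); first exact: ereal_hausdorff.
rewrite (_ : (fun k => _) = (fun k => \int[m0]_z (f (pi_ (phi k) z))%:E)%E)//.
by apply/funext => k; have [_ _ _ _ [h _]] := hY (phi k); exact: h.
Qed.

(** A version of [Jreg_cvg] uniform over the paths near [eta], as equilibrium paths and competitors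
    are only known to lie in a neighbourhood; a sequence of violations would contradict
    [Jreg_cvg]. *)
Lemma Jreg_near eta e : Gam Om T eta -> 0 < e -> exists d, 0 < d /\ exists N, forall k eta', (N <= k)%N ->
  Gam Om T eta' -> c1le T eta' eta d -> `|J (Y_ (phi k)) eta' - J Y eta| < e.
Proof.
move=> Ge e0; apply: contrapT => nh.
have /choice[f hf] : forall j, exists p : nat * path, [/\ (j <= p.1)%N, Gam Om T p.2, c1le T p.2 eta j.+1%:R^-1 &
    e <= `|J (Y_ (phi p.1)) p.2 - J Y eta| ].
  move=> j; apply: contrapT => nj; apply: nh; exists j.+1%:R^-1; split; first by rewrite invr_gt0 ltr0n.
  exists j => k eta' jk Ge' c; rewrite ltNge; apply/negP => h; apply: nj.
  by exists (k, eta').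
have small (d : R) : 0 < d -> forall j, (Num.bound d^-1 <= j)%N -> j.+1%:R^-1 <= d.
  move=> d0 j bj; have di : 0 <= d^-1 by rewrite invr_ge0 ltW.
  rewrite invf_ple ?posrE ?ltr0n//; apply: le_trans (ltW (archi_boundP di)) _.
  by rewrite ler_nat leqW.
have := @Jreg_cvg R n _ _ lam Om T T0 F G L hF hG hLc hLb (fun j => Y_ (phi (f j).1)) Y (fun j => (f j).2) eta
  (fun j => random_approx _) rY.
have ae : {ae lam, forall t, forall e, 0 < e -> exists N, forall k, (N <= k)%N -> c1le T (Y_ (phi (f k).1) t) (Y t) e}.
  apply: (@filterS _ _ (ae_filter_ringOfSetsType lam) _ _ _ approx_limit) => t ht d d0; have [N hN] := ht d d0; exists N => k Nk.
  by apply: hN; apply: leq_trans Nk _; have [] := hf k.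
have Gf j : Gam Om T (f j).2 by have [] := hf j.
have cf : forall d, 0 < d -> exists N, forall j, (N <= j)%N -> c1le T (f j).2 eta d.
  move=> d d0; exists (Num.bound d^-1) => j bj; have [_ _ h _] := hf j; exact: c1le_le (small d d0 j bj) h.
move=> /(_ ae Gf Ge cf) /cvgrPdist_lt/(_ _ e0)[N _ hN].
have := hN N (leqnn N); rewrite /= distrC => lt; have [_ _ _ h] := hf N.
by have := le_lt_trans h lt; rewrite ltxx.
Qed.

(** Optimality of [xi] against [eta], written as a bound of the energy of [xi], whose finiteness is
    part of the conclusion. The bound is proved on [[a, T]] for every [a > 0], by a recovery whose
    good time is at most [a]. *)
Lemma limit_optimal (kk : nat -> nat) (tt : nat -> R) xi eta :
  (forall m, (m <= kk m)%N /\ 0 < tt m <= 1) -> Gam Om T xi ->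
  (forall e, 0 < e -> exists N, forall m, (N <= m)%N -> c1le T (Y_ (phi (kk m)) (tt m)) xi e) ->
  forall r : R, energyR r eta -> xi 0 = eta 0 -> Dp T xi 0 = Dp T eta 0 ->
  Vle q (Dp T xi) 0 T (q * (J Y eta - J Y xi) + Vt eta).
Proof.
move=> hkt Gx hx r Er x0 v0; set B := q * _ + _.
have [oO bO cO dO] := gO.
have [Ge Ve] := Er; have Ee : energyR (Vt eta) eta by split; [exact: Ge|exact: Vle_Vn Ve].
apply: (Vle_right_limit q1 T0 (abs_cont_unif (Gam_abs_cont Gx))) => a a0 aT.
apply: (@Vle_limit R n q q1 nat \oo _ (fun m => Dp T (Y_ (phi (kk m)) (tt m)))) => [t /andP[at_ tT]|e e0].
  apply/cvgrPdist_le => e e0; have [N hN] := hx e e0; exists N => // m /= Nm.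
  rewrite sub0r normrN ger0_norm ?enorm_ge0//.
  have tI : 0 <= t <= T by rewrite tT (le_trans (ltW a0) at_).
  by apply: le_trans (hN m Nm t tI); rewrite lerDr enorm_ge0.
(* Multiplied by [q], the two errors on the regular costs add up to [e / 4]. *)
pose eps := e / (8 * q).
have eps0 : 0 < eps by rewrite divr_gt0// mulr_gt0.
have [d [d0 [N1 hN1]]] := Jreg_near Ge eps0.
have [d' [d'0 [N2 hN2]]] := Jreg_near Gx eps0.
pose e1 := Num.min (Num.min a 1) (Num.min (d / 2) (e / 4)).
have e10 : 0 < e1 by rewrite !lt_min a0 ltr01 !divr_gt0.
have [e1a e11 e1d e1e] : [/\ e1 <= a, e1 <= 1, e1 <= d / 2 & e1 <= e / 4].
  by rewrite /e1 !ge_min !lexx ?orbT.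
have [d1 d10 hrec] := recovery q1 T0 oO cO dO Gx Ee x0 v0 e10.
have [N3 hN3] := hx _ d10; have [N4 hN4] := hx _ d'0.
pose N5 := Num.bound e1^-1; pose N6 := Num.bound `|Vt eta + 1|.
exists (maxn (maxn (maxn N1 N2) (maxn N3 N4)) (maxn N5 N6)) => // m /=.
rewrite !geq_max => /andP[/andP[/andP[m1 m2] /andP[m3 m4]] /andP[m5 m6]].
have [mk t01] := hkt m; pose K := phi (kk m); pose x := Y_ K (tt m).
have mK : (m <= K)%N := leq_trans mk (phik _).
have [_ _ _ /(_ (tt m) t01)[Ex opt] _] := hY K.
have [s [eta1 [[/andP[s0 se] sT] [r'' [Ge1 Ve1]] same c1 V1]]] := hrec x _ Ex (hN3 m m3).
have [Gxm Vx] := Ex.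
have K1 : K.+1%:R^-1 <= e1.
  have ei : 0 <= e1^-1 by rewrite invr_ge0 ltW.
  rewrite invf_ple ?posrE ?ltr0n//; apply: le_trans (ltW (archi_boundP ei)) _.
  by rewrite ler_nat leqW// (leq_trans m5).
have start : Vn q (Dp T eta1) 0 s <= Vn q (Dp T x) 0 s.
  apply: Vn_le => //; apply: (@Vle_ext _ _ q (Dp T x)) => //; first by move=> t ts; have [] := same t ts.
  by apply: Vle_Vn (Vle_sub _ sT Vx).
have Vbound : Vt eta1 <= Vn q (Dp T x) 0 s + (Vt eta + e1).
  apply: le_trans (Vn_sub q1 s0 sT Ve1) _; apply: lerD start _; exact: Vn_le V1.
have split_x := Vn_super s0 sT Vx.
have sx0 : 0 <= Vn q (Dp T x) s T.
  by apply: (Vn_ge0 sT (Vle_sub s0 (lexx T) Vx)).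
have xK : Vt x <= (K + r0 + C1)%:R by exact: Vn_le (ltW T0) Vx.
(* The recovered path is an allowed competitor: its energy up to [s] is at most [K + r0 + C1], and
   [K + r0] leaves room for the energy of [eta] once [m] is large. *)
have Emax : energy (max_energy r0 C1 K) eta1.
  split; first exact: Ge1.
  apply: Vle_mono (Vle_Vn Ve1); apply: le_trans Vbound _.
  have h6 : Vt eta + 1 <= K%:R.
    apply: le_trans (ler_norm _) _; apply: le_trans (ltW (archi_boundP (normr_ge0 _))) _.
    by rewrite ler_nat (leq_trans m6).
  have -> : (max_energy r0 C1 K)%:R = (K + r0 + C1)%:R + (K + r0)%:R :> R.
    by rewrite -natrD /max_energy mul2n -addnn addnAC.
  apply: lerD; first by apply: le_trans xK; apply: le_trans split_x; rewrite lerDl.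
  by apply: le_trans (_ : Vt eta + 1 <= _); [rewrite lerD2l|apply: le_trans h6 _; rewrite ler_nat leq_addr].
have s00 : 0 <= (0 : R) <= s by rewrite lexx.
have [E0 E1] := same 0 s00.
have [eta2 [Ge2 c2 hJ]] := opt eta1 Emax E0 E1.
have hd2 : c1le T eta2 eta d.
  apply: c1le_le (c1le_trans c2 c1); rewrite [leRHS]splitr; exact: lerD (le_trans K1 e1d) e1d.
have j1 := hN1 (kk m) eta2 (leq_trans m1 mk) Ge2 hd2.
have j2 := hN2 (kk m) x (leq_trans m2 mk) Gxm (hN4 m m4).
apply: (Vle_sub (le_trans se e1a) (lexx T)).
apply: Vle_mono (Vle_Vn (Vle_sub s0 (lexx T) Vx)).
exact: (cost_gap q0 e0 hJ j1 j2 Vbound split_x K1 e1e).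
Qed.

(** The times of convergence have full measure, so each ball around a point of the support is hit by
    [Y] at such a time. These times may tend to 1, so no energy bound comes with the sequence. *)
Lemma supp_path_seq (mu : set (pathB R n T) -> \bar R) xi : mu = law lam Y -> supp_path Om T mu xi ->
  exists (kk : nat -> nat) (tt : nat -> R), (forall m, (m <= kk m)%N /\ 0 < tt m <= 1) /\
    forall e, 0 < e -> exists N, forall m, (N <= m)%N -> c1le T (Y_ (phi (kk m)) (tt m)) xi e.
Proof.
move=> muE [Gx hs].
have hit e : 0 < e -> exists t, [/\ 0 < t < 1, ~ D t & pathball T xi e (Y t)].
  move=> e0; apply: contrapT => nh; have := hs e e0; rewrite muE /law ltNge => /negP; apply.
  have [N [mN N0 hN]] : {ae lam, forall t, ~ pathball T xi e (Y t)}.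
    by apply: (lam_ae cD) => t t01 nD h; apply: nh; exists t.
  have mb : measurable (Y @^-1` pathball T xi e : set (measurableTypeR R)).
    rewrite -[X in measurable X]setTI; apply: rY.1 => //.
    by apply: (@open_wrt_measurable R (Defs.path R n) (pathball T)); exact: open_pathball.
  rewrite -N0; apply: le_measure; rewrite ?inE//.
  by move=> t /= h; apply: hN => /=; apply.
have /choice[f hf] : forall m, exists p : nat * R, [/\ (m <= p.1)%N, 0 < p.2 <= 1 &
    c1le T (Y_ (phi p.1) p.2) xi (m.+1%:R^-1 + m.+1%:R^-1)].
  move=> m; have m0' : 0 < m.+1%:R^-1 :> R by rewrite invr_gt0 ltr0n.
  have [t [t01 nD /pathballE[c cm /c1leC hc]]] := hit _ m0'.
  have [N hN] := hlim t01 nD m0'.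
  exists (maxn m N, t) => /=; split; first exact: leq_maxl.
    by have /andP[-> /ltW ->] := t01.
  by apply: c1le_trans (hN _ (leq_maxr _ _)) _; exact: c1le_le (ltW cm) hc.
exists (fun m => (f m).1), (fun m => (f m).2); split; first by move=> m; have [] := hf m.
move=> e e0; exists (Num.bound (e / 2)^-1) => m Nm; have [_ _ h] := hf m; apply: c1le_le h.
have ei : 0 <= (e / 2)^-1 by rewrite invr_ge0 divr_ge0// ltW.
have h : m.+1%:R^-1 <= e / 2.
  rewrite invf_ple ?posrE ?ltr0n ?divr_gt0//; apply: le_trans (ltW (archi_boundP ei)) _.
  by rewrite ler_nat leqW.
by rewrite [leRHS]splitr; exact: lerD.
Qed.

Lemma supp_initial (mu : set (pathB R n T) -> \bar R) xi : mu = law lam Y -> supp_path Om T mu xi ->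
  supp_phase Om m0 (xi 0, Dp T xi 0).
Proof.
move=> muE [Gx hs]; split; first exact: Gam_closure Gx zI.
move=> e e0; have mb : measurable (pball (xi 0, Dp T xi 0) e : set (phaseB R n)).
  by apply: open_wrt_measurable; exact: open_pball.
rewrite -(initial_law mb); apply: lt_le_trans (hs e e0) _; rewrite muE /law.
apply: le_measure; rewrite ?inE.
- rewrite -[X in measurable X]setTI; apply: rY.1 => //.
  by apply: (@open_wrt_measurable R (Defs.path R n) (pathball T)); exact: open_pathball.
- by rewrite -[X in measurable X]setTI; apply: (random_et rY zI).1.
- by move=> t /pathballE[c ce h] /=; apply: le_lt_trans ce; exact: c1le_pdist zI h.
Qed.

(** A first use of [limit_optimal], against a path of finite energy provided by the admissibility of
    the initial condition, shows that [xi] has finite energy; a second one gives optimality,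
    competitors outside [W2q] having infinite cost. *)
Lemma supp_optimal (mu : set (pathB R n T) -> \bar R) xi : mu = law lam Y -> supp_path Om T mu xi ->
  Gam_opt Om q T F G L mu (xi 0) (Dp T xi 0) xi.
Proof.
move=> muE sx; have Gx := sx.1.
have [kk [tt [hkt hx]]] := supp_path_seq muE sx.
have [r [eta0 [Eeta0 x0 v0]]] := admissible_finite_energy q1 T0 gO (Gam_admissible T0 gO Gx).
have V0 := limit_optimal hkt Gx hx Eeta0 (esym x0) (esym v0).
have Ex : energyR (Vt xi) xi by split; [exact: Gx|exact: Vle_Vn V0].
have [Wx _] := energy_integral q1 T0 Ex.
split; [exact: Gx|reflexivity|reflexivity|exact: Wx|] => eta Ge h0 h1; have [We|nW] := pselect (W2q q T eta); last first.
  have -> : Jcost q T F G L mu eta = +oo%E by rewrite /Jcost (asboolF nW).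
  exact: leey.
have [r' Ee] := W2q_energy q1 T0 Ge We.
rewrite muE (JcostE lam q1 T0 G hF hLc hLb rY Ex) (JcostE lam q1 T0 G hF hLc hLb rY Ee) lee_fin.
exact: (cost_le q0 (Vn_le (ltW T0) (limit_optimal hkt Gx hx Ee (esym h0) (esym h1)))).
Qed.

End closure.

End limit.

Lemma relaxed_equilibrium_exists : exists mu : probability (pathB R n T) R,
  [/\ mu (~` Gam Om T) = 0%E,
      (forall A : set (phaseB R n), measurable A -> mu (et T 0 @^-1` A) = m0 A) &
      supp_path Om T mu `<=` \bigcup_(z in supp_phase Om m0) Gam_opt Om q T F G L mu z.1 z.2].
Proof.
have [r0 [C1 /choice[Y_ /choice[pi_ hY]]]] := approx_solution_exists q1 T0 gO hF hG hLc hLb hm0 hm0ad net.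
have [phi [D [Y [phik cD rY hlim]]]] := limit_exists hY.
have [mu muE] := law_probability lam rY.1; exists mu; split.
- rewrite (_ : mu _ = law lam Y (~` Gam Om T)) -?muE// muE /law (_ : _ @^-1` _ = set0) ?measure0//.
  by apply/seteqP; split=> t //=; apply; exact: rY.2.
- move=> A mA; rewrite -(initial_law hY phik cD rY hlim mA).
  exact: (congr1 (fun m => m (et T 0 @^-1` A)) muE).
- move=> xi sx; exists (xi 0, Dp T xi 0).
    exact: (supp_initial hY phik cD rY hlim muE sx).
  exact: (supp_optimal hY phik cD rY hlim muE sx).
Qed.
End relaxed_equilibrium.

Unset Implicit Arguments.

Theorem theorem5p2 (R : realType) (n : nat) (q T : R) (Om : set 'rV[R]_n)
  (hcase : (n = 1%N /\ 1 < q /\ Om = [set x | forall i, -1 < x ord0 i < 1]) \/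
           [/\ (1 < n)%N, q = 2, bounded_dom Om /\ convex_dom Om, open Om &
               C3_boundary Om])
  (hT : 0 < T)
  (F G : (set (phaseB R n) -> \bar R) -> phaseB R n -> R)
  (hF : bounded_continuous_map Om F) (hG : bounded_continuous_map Om G)
  (L : 'rV[R]_n -> 'rV[R]_n -> R -> R)
  (hLc : {within [set p : phase R n * R | Xi Om p.1 /\ 0 <= p.2 <= T],
            continuous (fun p : phase R n * R => L p.1.1 p.1.2 p.2)})
  (hLb : exists C : R, forall z : phase R n, forall s : R,
            Xi Om z -> 0 <= s <= T -> `|L z.1 z.2 s| <= C)
  (m0 : probability (phaseB R n) R)
  (hm0 : prob_Xi Om m0) (hm0ad : m0 (Xi Om `\` Xiad Om) = 0%E) :
  exists mu : probability (pathB R n T) R,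
    [/\ mu (~` Gam Om T) = 0%E,
        (forall A : set (phaseB R n), measurable A ->
           mu (et T 0 @^-1` A) = m0 A) &
        supp_path Om T mu `<=`
          \bigcup_(z in supp_phase Om m0) Gam_opt Om q T F G L mu z.1 z.2].
Proof.
have [q1 gO] : 1 < q /\ good_dom Om.
  case: hcase => [[n1 [q1 OmE]]|[_ q2 [bO cO] oO dO]].
    by subst n; rewrite OmE; split=> //; exact: interval_good_dom.
  rewrite q2; split; first by rewrite ltr1n.
  split=> // x0 /dO[U [rho [oU Ux CU gU hU]]]; exists U, rho; split=> //.
  exact: Ck_le.
have [net hnet] := code_net q1 hT gO.
exact: (relaxed_equilibrium_exists q1 hT gO hF hG hLc hLb hm0 hm0ad hnet).
Qed.
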